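(* The following special cases of the RelBuechi problem (defined in the context) are solvable in polynomial time: (a) the number of different target sets $|\{T_1,\dots,T_m\}|$ is at most a constant; (b) the target sets $T_1,\dots,T_m$ are all absorbing; (c) probability operators with the same scheduler variable and the same initial state have the same target set, i.e., for all $i,i'$: if $k_i=k_{i'}$ and $s_i=s_{i'}$ then $T_i=T_{i'}$.
   Context: A Markov decision process (MDP) is a triple $\mathcal{M}=(S,\mathit{Act},\mathbf{P})$ with $S$ a non-empty finite set of states, $\mathit{Act}$ a non-empty finite set of actions and $\mathbf{P}:S\times\mathit{Act}\times S\to[0,1]$ such that for every $s$ the set $\mathit{Act}(s)=\{\alpha\mid \sum_{s'}\mathbf{P}(s,\alpha,s')=1\}$ of enabled actions is non-empty and $\sum_{s'}\mathbf{P}(s,\alpha,s')=0$ for $\alpha\notin\mathit{Act}(s)$. A state $s$ is absorbing if $\mathbf{P}(s,\alpha,s)=1$ for all $\alpha\in\mathit{Act}(s)$; a set of states is absorbing if all its states are. A (general) scheduler is a function $\sigma$ from finite paths to distributions over $\mathit{Act}$ supported on actions enabled in the last state. $\Pr^{\sigma}_s$ is the induced probability measure on infinite paths from $s$; $\Pr^\sigma_s(\mathbf{G}\mathbf{F}\,T)$ is the probability of visiting $T$ infinitely often. For reals $r,r'$, $\epsilon\ge0$: $r\approx_\epsilon r'$ iff $|r-r'|\le\epsilon$; $r\not\approx_\epsilon r'$ iff $|r-r'|>\epsilon$. RelBuechi: given an MDP $\mathcal{M}$, natural numbers $m,n$, rationals $q_1,\dots,q_m,q$, states $s_1,\dots,s_m$,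 indices $k_1,\dots,k_m$ with $\{k_1,\dots,k_m\}=\{1,\dots,n\}$, sets $T_1,\dots,T_m\subseteq S$, and $\bowtie\in\{>,\ge,\approx_\epsilon,\not\approx_\epsilon\mid\epsilon\in\mathbb{Q}_{\ge0}\}$, decide whether there exist general schedulers $\sigma_1,\dots,\sigma_n$ with $\sum_{i=1}^m q_i\Pr^{\sigma_{k_i}}_{s_i}(\mathbf{G}\mathbf{F}\,T_i)\bowtie q$. *)

(* Defs.v *)
From HB Require Import structures.
From mathcomp Require Import all_boot all_order all_algebra.
From mathcomp Require Import all_classical all_reals all_analysis.

Set Implicit Arguments.
Unset Strict Implicit.
Unset Printing Implicit Defensive.
Import Order.TTheory GRing.Theory Num.Theory.

Local Open Scope ring_scope.

(* Transition probabilities are rational, since an MDP is (part of) the input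
   of a decision problem. *)
Record mdp := Mdp {
  state : finType;
  action : finType;
  trans : state -> action -> state -> rat;
  state_inh : (0 < #|state|)%N;
  action_inh : (0 < #|action|)%N;
  trans_itv : forall s a s', 0 <= trans s a s' <= 1;
  exists_enabled : forall s, exists a, \sum_s' trans s a s' = 1;
  trans_disabled : forall s a,
    \sum_s' trans s a s' <> 1 -> \sum_s' trans s a s' = 0
}.
Arguments trans {m}.

Definition enabled (M : mdp) (s : state M) : {set action M} :=
  [set a | \sum_s' trans s a s' == 1].

Definition absorbing (M : mdp) (s : state M) : Prop :=
  forall a, a \in enabled s -> trans s a s = 1.

Definition absorbing_set (M : mdp) (T : {set state M}) : Prop :=
  forall s, s \in T -> absorbing s.

(* The finite path s_0 a_0 s_1 a_1 ... a_(n-1) s_n is the pair of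
   [:: (s_0, a_0); ...; (s_(n-1), a_(n-1))] and of its last state s_n. *)
Record scheduler (R : realType) (M : mdp) := Scheduler {
  sched :> seq (state M * action M) -> state M -> action M -> R;
  sched_ge0 : forall h s a, 0 <= sched h s a;
  sched_sum : forall h s, \sum_a sched h s a = 1;
  sched_enabled : forall h s a, sched h s a != 0 -> a \in enabled s
}.

Fixpoint ext_weight (R : realType) (M : mdp) (sigma : scheduler R M)
    (past h : seq (state M * action M)) (t : state M) : R :=
  if h is (u, a) :: h' then
    sigma past u a * ratr (trans u a (head t (unzip1 h')))
      * ext_weight sigma (rcons past (u, a)) h' t
  else 1.

(* For the finite path s_0 a_0 ... s_n this is
   [s_0 = s] * \prod_(i < n) sigma(s_0 a_0 ... s_i)(a_i) * P(s_i, a_i, s_(i+1)) *)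
Definition path_weight (R : realType) (M : mdp) (sigma : scheduler R M)
    (s : state M) (h : seq (state M * action M)) (t : state M) : R :=
  (head t (unzip1 h) == s)%:R * ext_weight sigma [::] h t.

Local Open Scope classical_set_scope.

Definition ipath (M : mdp) := nat -> state M * action M.

Definition step0 (M : mdp) : state M * action M :=
  (enum_val (Ordinal (state_inh M)), enum_val (Ordinal (action_inh M))).

HB.instance Definition _ (M : mdp) := gen_eqMixin (ipath M).
HB.instance Definition _ (M : mdp) := gen_choiceMixin (ipath M).
HB.instance Definition _ (M : mdp) := isPointed.Build (ipath M) (fun=> step0 M).

Definition finite_horizon (M : mdp) (n : nat) (A : set (ipath M)) : Prop :=
  forall w w' : ipath M, (forall i, (i < n)%N -> w i = w' i) -> A w -> A w'.

Definition cylinder_sets (M : mdp) : set (set (ipath M)) :=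
  [set A | exists n, finite_horizon n A].

Definition path_space (M : mdp) := g_sigma_algebraType (@cylinder_sets M).

Definition cylinder (M : mdp) (h : seq (state M * action M)) (t : state M) :
    set (path_space M) :=
  [set w | mkseq w (size h) = h /\ (w (size h)).1 = t].

Section cylinder_algebra.
Variable M : mdp.

Lemma cyl0 : @cylinder_sets M set0.
Proof. by exists 0%N. Qed.

Lemma finite_horizonW (n m : nat) (A : set (ipath M)) : (n <= m)%N ->
  finite_horizon n A -> finite_horizon m A.
Proof.
by move=> nm nA w w' ww'; apply: nA => i ni; apply: ww'; exact: leq_trans nm.
Qed.

Lemma cylC : setC_closed (@cylinder_sets M).
Proof.
move=> A [n nA]; exists n => w w' ww' Aw Aw'; apply: Aw.
by apply: nA Aw' => i ni; rewrite ww'.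
Qed.

Lemma cylU : setU_closed (@cylinder_sets M).
Proof.
move=> A B [n nA] [m mB]; exists (maxn n m) => w w' ww' [Aw|Bw]; [left|right].
  by apply: finite_horizonW nA _ _ ww' Aw; rewrite leq_maxl.
by apply: finite_horizonW mB _ _ ww' Bw; rewrite leq_maxr.
Qed.

End cylinder_algebra.

Fact cyl_display : measure_display. Proof. exact. Qed.

HB.instance Definition _ (M : mdp) := @isAlgebraOfSets.Build cyl_display
  (ipath M) (@cylinder_sets M) (@cyl0 M) (@cylU M) (@cylC M).

Section path_measure.
Variables (R : realType) (M : mdp) (sigma : scheduler R M) (s : state M).
Let X := (state M * action M)%type.
Implicit Types (h : seq X) (A B : set (ipath M)).

Definition word_weight h : R :=
  if rev h is (u, a) :: r then path_weight sigma s (rev r) u * sigma (rev r) u a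
  else 1.

Lemma word_weight_rcons h u a :
  word_weight (rcons h (u, a)) = path_weight sigma s h u * sigma h u a.
Proof. by rewrite /word_weight rev_rcons /= revK. Qed.

Lemma ext_weight_rcons past h v b u :
  ext_weight sigma past (rcons h (v, b)) u =
  ext_weight sigma past h v * sigma (past ++ h) v b * ratr (trans v b u).
Proof.
elim: h past => [|[x a] h ih] past /=; first by rewrite mulr1 mul1r cats0.
rewrite ih cat_rcons !mulrA; congr (_ * _ * _ * _ * _).
by case: h {ih} => [|[]].
Qed.

Lemma path_weight_rcons h v b u :
  path_weight sigma s (rcons h (v, b)) u =
  word_weight (rcons h (v, b)) * ratr (trans v b u).
Proof.
rewrite word_weight_rcons /path_weight ext_weight_rcons !mulrA /=.
by case: h => [|[]].
Qed.

Lemma ext_weight_ge0 past h t : 0 <= ext_weight sigma past h t.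
Proof.
elim: h past => [|[u a] h ih] past //=.
rewrite mulr_ge0// mulr_ge0 ?sched_ge0// ler0q.
by have /andP[] := trans_itv u a (head t (unzip1 h)).
Qed.

Lemma path_weight_ge0 h t : 0 <= path_weight sigma s h t.
Proof. by rewrite mulr_ge0// ext_weight_ge0. Qed.

Lemma word_weight_ge0 h : 0 <= word_weight h.
Proof.
rewrite /word_weight; case: (rev h) => [//|[u a] r].
by rewrite mulr_ge0 ?path_weight_ge0 ?sched_ge0.
Qed.

Lemma sum_path_weight h : \sum_t path_weight sigma s h t = word_weight h.
Proof.
case/lastP: h => [|h [v b]].
  rewrite /word_weight /= (bigD1 s)//= /path_weight /= eqxx mulr1 big1 ?addr0//.
  by move=> t /negbTE ->; rewrite mul0r.
under eq_bigr do rewrite path_weight_rcons.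
rewrite -mulr_sumr -rmorph_sum /=; case: (pselect (\sum_u trans v b u = 1)).
  by move=> ->; rewrite rmorph1 mulr1.
move=> vb; suff -> : word_weight (rcons h (v, b)) = 0 by rewrite mul0r.
rewrite word_weight_rcons; suff -> : sigma h v b = 0 by rewrite mulr0.
by apply/eqP/negPn/negP => /sched_enabled; rewrite inE => /eqP.
Qed.

Lemma sum_word_weight h : \sum_x word_weight (rcons h x) = word_weight h.
Proof.
rewrite -[RHS]sum_path_weight.
under eq_bigr do rewrite [x in rcons h x]surjective_pairing.
rewrite -(pair_bigA _ (fun u a => word_weight (rcons h (u, a)))) /=.
apply: eq_bigr => u _; under eq_bigr do rewrite word_weight_rcons.
by rewrite -mulr_sumr sched_sum mulr1.
Qed.

Definition pad h : ipath M := nth (step0 M) h.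

Fixpoint mass n h A : R :=
  if n is n'.+1 then \sum_x mass n' (rcons h x) A
  else word_weight h * (pad h \in A)%:R.

Lemma mass_ge0 n h A : 0 <= mass n h A.
Proof.
elim: n h => [|n ih] h /=; first by rewrite mulr_ge0 ?word_weight_ge0.
by apply: sumr_ge0.
Qed.

Lemma massS n h A : finite_horizon (size h + n) A -> mass n.+1 h A = mass n h A.
Proof.
elim: n h => [|n ih] h hA.
  rewrite /= -[X in _ = X * _]sum_word_weight mulr_suml; apply: eq_bigr => x _.
  congr (_ * _%:R); congr nat_of_bool; rewrite addn0 in hA.
  by apply/idP/idP; rewrite !in_setE; apply: hA => i ih; rewrite /pad nth_rcons ih.
rewrite [LHS]/= [RHS]/=; apply: eq_bigr => x _.
by apply: ih; rewrite size_rcons addSnnS.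
Qed.

Lemma massE d n m h A : finite_horizon d A ->
  (d <= size h + n)%N -> (d <= size h + m)%N -> mass n h A = mass m h A.
Proof.
move=> dA.
have E k l : (d <= size h + k)%N -> mass (l + k) h A = mass k h A.
  move=> dk; elim: l => // l ih; rewrite -ih addSn massS//.
  by apply: finite_horizonW dA; rewrite (leq_trans dk)// leq_add2l leq_addl.
move=> dn dm; case: (leqP n m) => [nm|/ltnW mn].
  by rewrite -(subnK nm) E.
by rewrite -(subnK mn) E.
Qed.

Definition horizon A : nat := xget 0%N [set n | finite_horizon n A].

Lemma horizonP A : cylinder_sets A -> finite_horizon (horizon A) A.
Proof. by move=> exA; exact: (xgetPex 0%N (P := [set n | finite_horizon n A])). Qed.

Definition cmass h A : R := mass (horizon A) h A.

Lemma cmassE n h A : finite_horizon (size h + n) A -> cmass h A = mass n h A.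
Proof.
move=> hA.
have hzA : finite_horizon (horizon A) A by apply: horizonP; eexists; exact: hA.
rewrite -(@massE _ (maxn (horizon A) n) _ _ _ hA) ?leq_add2l ?leq_maxr//.
apply: (massE hzA); rewrite ?leq_addl//.
by apply: leq_trans (leq_addl _ _); rewrite leq_maxl.
Qed.

Lemma cmass_ge0 h A : 0 <= cmass h A. Proof. exact: mass_ge0. Qed.

Lemma cmass_rcons h A : cylinder_sets A ->
  cmass h A = \sum_x cmass (rcons h x) A.
Proof.
move=> /horizonP hA; rewrite (@cmassE (horizon A).+1); last first.
  by apply: finite_horizonW hA; rewrite addnS ltnW// ltnS leq_addl.
apply: eq_bigr => x _; apply/esym/cmassE.
by apply: finite_horizonW hA; rewrite leq_addl.
Qed.

Lemma massU n h A B : A `&` B = set0 ->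
  mass n h (A `|` B) = mass n h A + mass n h B.
Proof.
move=> AB; elim: n h => [|n ih] h /=; last first.
  by rewrite -big_split; apply: eq_bigr => x _; exact: ih.
rewrite -mulrDr; congr (_ * _); rewrite in_setU.
have : pad h \in A `&` B = false by rewrite AB in_set0.
by rewrite in_setI; do 2!case: (_ \in _); rewrite ?addr0 ?add0r.
Qed.

Lemma mass0 n h : mass n h set0 = 0.
Proof.
by elim: n h => [|n ih] h /=; [rewrite in_set0 mulr0|rewrite big1].
Qed.

Definition premeasure : set (ipath M) -> \bar R := fun A => (cmass [::] A)%:E.

Lemma premeasure_ge0 A : (0 <= premeasure A)%E.
Proof. by rewrite lee_fin cmass_ge0. Qed.

Lemma premeasure_additive : measure_function.semi_additive premeasure.
Proof.
apply/additive2P; first by rewrite /premeasure /cmass mass0.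
move=> A B mA mB AB; have /horizonP mAB := @measurableU _ _ A B mA mB.
have {}mA := horizonP mA; have {}mB := horizonP mB.
pose n := maxn (horizon (A `|` B)) (maxn (horizon A) (horizon B)).
rewrite /premeasure -EFinD; congr (_%:E).
have e := @cmassE n [::]; rewrite add0n in e.
rewrite !e ?massU//.
- by apply: finite_horizonW mB; rewrite !leq_max leqnn !orbT.
- by apply: finite_horizonW mA; rewrite !leq_max leqnn !orbT.
- by apply: finite_horizonW mAB; rewrite !leq_max leqnn.
Qed.

HB.instance Definition _ := isContent.Build _ _ _ premeasure
  premeasure_ge0 premeasure_additive.

Lemma mass_le n h A : mass n h A <= word_weight h.
Proof.
elim: n h => [|n ih] h /=.
  by rewrite ler_piMr ?word_weight_ge0// lern1; case: (_ \in _).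
by rewrite -[leRHS]sum_word_weight; apply: ler_sum => x _; exact: ih.
Qed.

Lemma mass_full n h A : (forall w : ipath M, mkseq w (size h) = h -> A w) ->
  mass n h A = word_weight h.
Proof.
have padh (k : seq X) : mkseq (pad k) (size k) = k by exact: mkseq_nth.
elim: n h => [|n ih] h hA /=.
  suff -> : pad h \in A by rewrite mulr1.
  by rewrite in_setE; apply: hA.
rewrite -[RHS]sum_word_weight; apply: eq_bigr => x _; apply: ih => w.
rewrite size_rcons mkseqS => /eqP; rewrite eqseq_rcons => /andP[/eqP wh _].
exact: hA.
Qed.

Lemma mass_empty n h A : (forall w : ipath M, mkseq w (size h) = h -> ~ A w) ->
  mass n h A = 0.
Proof.
have padh (k : seq X) : mkseq (pad k) (size k) = k by exact: mkseq_nth.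
elim: n h => [|n ih] h hA /=.
  suff -> : pad h \in A = false by rewrite mulr0.
  by apply/negP; rewrite in_setE; apply: hA.
rewrite big1// => x _; apply: ih => w.
rewrite size_rcons mkseqS => /eqP; rewrite eqseq_rcons => /andP[/eqP wh _].
exact: hA.
Qed.

Lemma premeasure_subadditive : measurable_subset_sigma_subadditive premeasure.
Proof.
move=> A F mF mA AF; rewrite leNgt; apply/negP => badA.
pose bad h := (\sum_(0 <= i <oo) (cmass h (F i))%:E < (cmass h A)%:E)%E.
have next h : bad h -> exists x, bad (rcons h x).
  move=> badh; apply: contrapT => /forallNP nbad; move: badh.
  apply/negP; rewrite -leNgt (cmass_rcons _ mA) -sumEFin.
  under eq_eseriesr do rewrite (cmass_rcons _ (mF _)) -sumEFin.
  rewrite nneseries_sum; last by move=> *; rewrite lee_fin cmass_ge0.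
  by apply: lee_sum => x _; rewrite leNgt; apply/negP/nbad.
have /choice[g gP] : forall h, exists x, bad h -> bad (rcons h x).
  move=> h; have [/next[x bx]|nb] := pselect (bad h); first by exists x.
  by exists (step0 M).
pose pre := fix pre n := if n is n'.+1 then rcons (pre n') (g (pre n')) else [::].
pose w : ipath M := fun n => g (pre n).
have preE n : mkseq w n = pre n by elim: n => // n ih; rewrite mkseqS ih.
have badn n : bad (mkseq w n).
  by rewrite preE; elim: n => [//|n ih /=]; exact: gP.
have Aw : A w.
  apply: contrapT => nAw; have := badn (horizon A).
  rewrite /bad /cmass (@mass_empty _ _ A).
    by apply/negP; rewrite -leNgt nneseries_ge0// => *; rewrite lee_fin cmass_ge0.
  move=> w'; rewrite size_mkseq => ww' Aw'; apply: nAw.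
  apply: (horizonP mA) Aw' => i ni.
  have := congr1 (fun r => nth (step0 M) r i) ww'; rewrite !nth_mkseq//.
have [i _ Fiw] := AF _ Aw.
have := badn (horizon (F i)); apply/negP; rewrite -leNgt.
apply: (@le_trans _ _ (cmass (mkseq w (horizon (F i))) (F i))%:E).
  rewrite lee_fin [leRHS]mass_full ?mass_le// => w'.
  rewrite size_mkseq => ww'; apply: (horizonP (mF i)) Fiw => j ji.
  by have := congr1 (fun r => nth (step0 M) r j) ww'; rewrite !nth_mkseq.
apply: le_trans (@nneseries_lim_ge _ _ _ _ i.+1 _); last first.
  by move=> *; rewrite lee_fin cmass_ge0.
rewrite big_nat_recr//= leeDr// sume_ge0// => *.
by rewrite lee_fin cmass_ge0.
Qed.

HB.instance Definition _ := Content_SigmaSubAdditive_isMeasure.Build _ _ _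
  premeasure premeasure_subadditive.

Definition path_measure : set (path_space M) -> \bar R :=
  @measure_extension _ (ipath M) R premeasure.

HB.instance Definition _ := Measure.on path_measure.

Lemma path_measure_cyl A : cylinder_sets A ->
  path_measure A = (cmass [::] A)%:E.
Proof. by move=> mA; rewrite /path_measure /measure_extension measurable_mu_extE. Qed.

Lemma path_measureT : path_measure setT = 1%E.
Proof.
by rewrite path_measure_cyl; [rewrite /cmass mass_full|exists 0%N].
Qed.

HB.instance Definition _ :=
  Measure_isProbability.Build _ _ _ path_measure path_measureT.

(* the probability measure on infinite paths from s induced by sigma *)
Definition Pr : probability (path_space M) R := path_measure.

Lemma cmass_nil h A : cylinder_sets A ->
  (forall w : ipath M, A w -> mkseq w (size h) = h) ->
  cmass [::] A = cmass h A.
Proof.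
move=> mA; elim/last_ind: h => [//|h x ih] hA.
have hA' w : A w -> mkseq w (size h) = h.
  move=> /hA; rewrite size_rcons mkseqS => /eqP.
  by rewrite eqseq_rcons => /andP[/eqP].
rewrite ih// cmass_rcons// (bigD1 x)//= big1 ?addr0// => y yx.
rewrite /cmass mass_empty// => w wy /hA; rewrite !size_rcons in wy *.
rewrite wy => /eqP; rewrite eqseq_rcons => /andP[_ /eqP yx'].
by rewrite yx' eqxx in yx.
Qed.

(* The cylinders of finite paths generate the sigma-algebra of path_space M and,
   with the empty set, are stable under intersection, so this equation
   determines Pr. *)
Lemma Pr_cylinder h t : Pr (cylinder h t) = (path_weight sigma s h t)%:E.
Proof.
have mA : cylinder_sets (cylinder h t).
  exists (size h).+1 => w w' ww' [wh wt]; split; last by rewrite -ww'.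
  rewrite -[RHS]wh; apply/eq_in_map => i; rewrite mem_iota => /andP[_ ih].
  by rewrite ww'// ltnS ltnW.
rewrite /Pr /= path_measure_cyl// (@cmass_nil h)//; last by move=> w [].
rewrite cmass_rcons//; congr (_%:E).
under eq_bigr do rewrite [x in rcons h x]surjective_pairing.
rewrite -(pair_bigA _ (fun u a => cmass (rcons h (u, a)) (cylinder h t))) /=.
have wE (w : ipath M) u a : mkseq w (size (rcons h (u, a))) = rcons h (u, a) ->
    mkseq w (size h) = h /\ w (size h) = (u, a).
  rewrite size_rcons mkseqS => /eqP.
  by rewrite eqseq_rcons => /andP[/eqP ? /eqP].
rewrite (bigD1 t)//= [X in _ + X]big1 ?addr0.
  rewrite -[RHS]mulr1 -(sched_sum sigma h t) mulr_sumr; apply: eq_bigr => a _.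
  rewrite /cmass mass_full ?word_weight_rcons// => w /wE[wh wt].
  by split=> //; rewrite wt.
move=> u ut; rewrite big1// => a _; rewrite /cmass mass_empty// => w /wE[_ wu].
by move=> [_]; rewrite wu /= => ut'; rewrite ut' eqxx in ut.
Qed.

End path_measure.

Definition infinitely_often (M : mdp) (T : {set state M}) : set (path_space M) :=
  [set w | forall N, exists2 n, (N <= n)%N & (w n).1 \in T].

Lemma measurable_infinitely_often (M : mdp) (T : {set state M}) :
  measurable (infinitely_often T).
Proof.
have -> : infinitely_often T =
    \bigcap_N \bigcup_(n in [set n | (N <= n)%N]) [set w | (w n).1 \in T].
  apply/seteqP; split=> w wT N => [_|]; first by have [n] := wT N; exists n.
  by have [n] := wT N I; exists n.
apply: bigcapT_measurable => N; apply: bigcup_measurable => n _.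
apply: sub_sigma_algebra; exists n.+1 => w w' ww' /=.
by rewrite (ww' n (ltnSn n)).
Qed.

Local Close Scope classical_set_scope.

Inductive comparison :=
| Greater
| GreaterEq
| Approx (eps : rat) of 0 <= eps
| NotApprox (eps : rat) of 0 <= eps.

Definition compares (R : realType) (c : comparison) (x y : R) : Prop :=
  match c with
  | Greater => y < x
  | GreaterEq => y <= x
  | Approx eps _ => `|x - y| <= ratr eps
  | NotApprox eps _ => ratr eps < `|x - y|
  end.

Record relbuechi := RelBuechi {
  rb_mdp : mdp;
  rb_m : nat;
  rb_n : nat;
  rb_coef : 'I_rb_m -> rat;
  rb_bound : rat;
  rb_init : 'I_rb_m -> state rb_mdp;
  rb_sched : 'I_rb_m -> 'I_rb_n;
  rb_schedP : forall j, exists i, rb_sched i = j;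
  rb_target : 'I_rb_m -> {set state rb_mdp};
  rb_cmp : comparison
}.

Definition rb_yes (R : realType) (I : relbuechi) : Prop :=
  exists sigma : 'I_(rb_n I) -> scheduler R (rb_mdp I),
    compares (rb_cmp I)
      (\sum_(i < rb_m I) ratr (rb_coef i) *
         fine (Pr (sigma (rb_sched i)) (rb_init i)
                 (infinitely_often (rb_target i))))
      (ratr (rb_bound I)).

Definition at_most_targets (c : nat) (I : relbuechi) : Prop :=
  (#|[set rb_target i | i : 'I_(rb_m I)]%SET| <= c)%N.

Definition absorbing_targets (I : relbuechi) : Prop :=
  forall i : 'I_(rb_m I), absorbing_set (rb_target i).

Definition same_targets (I : relbuechi) : Prop :=
  forall i i' : 'I_(rb_m I),
    rb_sched i = rb_sched i' -> rb_init i = rb_init i' ->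
    rb_target i = rb_target i'.

(* Instances are written over a three-letter alphabet: two bits, and None as an
   end-of-number mark. *)
Definition sym := option bool.

(* binary, least significant bit first *)
Definition enc_nat (n : nat) : seq sym :=
  rcons [seq Some (odd (n %/ 2 ^ i)%N) | i <- iota 0 (trunc_log 2 n).+1] None.

Definition enc_rat (x : rat) : seq sym :=
  Some (x < 0) :: enc_nat `|numq x|%N ++ enc_nat `|denq x|%N.

Definition enc_all (T : finType) (f : T -> seq sym) : seq sym :=
  flatten [seq f x | x <- enum T].

Definition enc_mdp (M : mdp) : seq sym :=
  enc_nat #|state M| ++ enc_nat #|action M| ++
  enc_all (fun s : state M => enc_all (fun a : action M =>
    enc_all (fun s' : state M => enc_rat (trans s a s')))).

Definition enc_comparison (c : comparison) : seq sym :=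
  match c with
  | Greater => [:: Some false; Some false]
  | GreaterEq => [:: Some false; Some true]
  | Approx eps _ => [:: Some true, Some false & enc_rat eps]
  | NotApprox eps _ => [:: Some true, Some true & enc_rat eps]
  end.

Definition enc_relbuechi (I : relbuechi) : seq sym :=
  enc_mdp (rb_mdp I) ++ enc_nat (rb_m I) ++ enc_nat (rb_n I) ++
  enc_all (fun i : 'I_(rb_m I) =>
    enc_rat (rb_coef i) ++ enc_nat (enum_rank (rb_init i)) ++
    enc_nat (rb_sched i) ++
    [seq Some (s \in rb_target i) | s <- enum (state (rb_mdp I))]) ++
  enc_comparison (rb_cmp I) ++ enc_rat (rb_bound I).

(* Deterministic multi-tape Turing machines with two-way infinite tapes: tape 0
   initially holds the input, tm_work.+1 is the number of tapes, tm_sym the set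
   of auxiliary tape symbols, and tm_verdict tells the halting states (with their
   answer) from the other states. *)
Inductive direction := MoveLeft | Stay | MoveRight.

Definition cell (A : Type) := option (sym + A).  (* None is the blank *)

Record turing := Turing {
  tm_work : nat;
  tm_state : finType;
  tm_sym : finType;
  tm_start : tm_state;
  tm_verdict : tm_state -> option bool;
  tm_delta : tm_state -> {ffun 'I_tm_work.+1 -> cell tm_sym} ->
    tm_state * ('I_tm_work.+1 -> cell tm_sym * direction)
}.

(* cells to the left of the head (nearest first), scanned cell, cells to its
   right; all other cells are blank *)
Record tape (A : Type) := Tape {
  left_cells : seq (cell A);
  scanned : cell A;
  right_cells : seq (cell A)
}.

Definition write_move (A : Type) (t : tape A) (wd : cell A * direction) :
    tape A :=
  let: Tape l _ r := t in
  let: (c, d) := wd in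
  match d with
  | MoveLeft => Tape (behead l) (head None l) (c :: r)
  | Stay => Tape l c r
  | MoveRight => Tape (c :: l) (head None r) (behead r)
  end.

Definition config (M : turing) : Type :=
  (tm_state M * ('I_(tm_work M).+1 -> tape (tm_sym M)))%type.

Definition tm_step (M : turing) (c : config M) : config M :=
  if tm_verdict c.1 is Some _ then c
  else let: (q, act) := tm_delta c.1 [ffun k => scanned (c.2 k)] in
       (q, fun k => write_move (c.2 k) (act k)).

Definition tm_init (M : turing) (w : seq sym) : config M :=
  (tm_start M,
   fun k => if k == ord0
            then let w' := [seq Some (inl x) | x <- w] in
                 Tape [::] (head None w') (behead w')
            else Tape [::] None [::]).

Definition answers_within (M : turing) (w : seq sym) (t : nat) (b : bool) : Prop :=
  exists2 k, (k <= t)%N & tm_verdict (iter k (@tm_step M) (tm_init M w)).1 = Some b.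

(* A decision problem restricted to the instances satisfying special: only these
   have to be answered within the time bound. *)
Definition poly_time_solvable (X : Type) (enc : X -> seq sym)
    (special yes : X -> Prop) : Prop :=
  exists (M : turing) (c d : nat), forall x, special x ->
    exists2 b : bool,
      answers_within M (enc x) (c * size (enc x) ^ d + c)%N b & (b <-> yes x).

(* Main.v *)
(** The items with a given scheduler variable and a given initial state form a
    group, and the groups can be optimised independently.  Almost surely the set
    of states that a path visits infinitely often is an end component, and an end
    component can be traversed forever once it is entered; so the optimal value
    of a group is that of an optimal stopping problem in which stopping at a
    state [s] pays the best weight of an end component around [s].  There may be
    exponentially many end components, but in each special case it suffices to
    consider the maximal ones that avoid a union of few targets.  The achievable
    sums form an interval, by mixing schedulers, and its end points are rational
    with a denominator of polynomially many digits (Cramer's rule); comparing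
    them with the bound is thus equivalent to a slightly relaxed strict linear
    feasibility problem.

    Linear feasibility is decided by a perceptron with rescaling: the perceptron
    runs in the column space of the constraint matrix, whose orthogonal
    projection is obtained from the division-free Faddeev-LeVerrier recursion,
    and when it fails a row of the matrix can be doubled.  Polynomial time is
    obtained by programming with functions on binary trees, which are compiled
    to programs over a fixed number of stacks and then to Turing machines. *)

Require Import Defs.
From mathcomp Require Import all_boot all_order all_algebra.
From mathcomp Require Import perm boolp.
From mathcomp Require Import zify ring lra.

Set Implicit Arguments.
Unset Strict Implicit.
Unset Printing Implicit Defensive.

(** * Stack programs and their simulation by Turing machines *)

(** Groups are independent because a history contains its initial state: a single scheduler can
    follow unrelated plans from different initial states. The optimum [vmax] is attained by a
    scheduler, so strict and non-strict bounds are questions about the same number.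

    A linear program serves to certify [vmax <= theta]. The solver handles only strict systems whose
    solution set is not too thin, so every constraint is relaxed by [1 / beta]. This error is
    multiplied at worst by expected stopping times, and [beta] is chosen to keep the total below the
    smallest possible positive value of [vmax - theta]. A non-strict bound becomes a strict one
    after scaling the weights by a bound on the denominator of [vmax].

    The perceptron alone may need exponentially many steps on a thin system. If it fails, some slack
    is at most 1/2 at every solution with slacks in the unit box. Doubling that row keeps the slacks
    in the box, and a slack of at least [2^-L] can be doubled at most [L] times. This potential
    argument bounds the number of rounds. *)

Definition stacks := nat -> seq sym.

Definition upd (st : stacks) r s : stacks := fun k => if k == r then s else st k.

Inductive prog :=
| Skip
| Push of nat & sym
| Pop of nat
| Seq of prog & prog
| IfTop of nat & option sym & prog & prog
| Loop of nat & prog.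

Fixpoint regs p := match p with
  | Skip => 0
  | Push r _ | Pop r => r.+1
  | Seq p q => maxn (regs p) (regs q)
  | IfTop r _ p q => maxn r.+1 (maxn (regs p) (regs q))
  | Loop r p => maxn r.+1 (regs p)
  end.

(** The number is the exact step count of the simulating machine: a push costs two, since the head
    first moves left onto a blank cell and then writes; each test costs one. *)
Inductive exec : prog -> stacks -> nat -> stacks -> Prop :=
| ExSkip st : exec Skip st 1 st
| ExPush r x st : exec (Push r x) st 2 (upd st r (x :: st r))
| ExPop r st : exec (Pop r) st 1 (upd st r (behead (st r)))
| ExSeq p q st t st1 u st2 : exec p st t st1 -> exec q st1 u st2 ->
    exec (Seq p q) st (t + u) st2
| ExIfT r x p q st t st1 : ohead (st r) = x -> exec p st t st1 ->
    exec (IfTop r x p q) st t.+1 st1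
| ExIfF r x p q st t st1 : ohead (st r) <> x -> exec q st t st1 ->
    exec (IfTop r x p q) st t.+1 st1
| ExLoop0 r p st : st r = [::] -> exec (Loop r p) st 1 st
| ExLoopS r p st t st1 u st2 : st r <> [::] -> exec p st t st1 ->
    exec (Loop r p) st1 u st2 -> exec (Loop r p) st (t + u).+1 st2.

(** The extra [None] of [IfTop] and [Loop] is the state in which the test is made; the boolean of
    [Push] tells whether the head has already moved to the fresh cell. *)
Fixpoint ctrl (p : prog) : finType := match p with
  | Skip | Pop _ => unit
  | Push _ _ => bool
  | Seq p q => (ctrl p + ctrl q)%type
  | IfTop _ _ p q => option (ctrl p + ctrl q)%type
  | Loop _ p => option (ctrl p)
  end.

Fixpoint start (p : prog) : ctrl p := match p with
  | Skip | Pop _ => tt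
  | Push _ _ => false
  | Seq p q => inl (start p)
  | IfTop _ _ _ _ | Loop _ _ => None
  end.

Section Simulation.
Variable K : nat.
Notation cells := {ffun 'I_K.+1 -> cell void}.
Notation moves := ('I_K.+1 -> cell void * direction).

Definition stay (f : cells) : moves := fun k => (f k, Stay).
Definition set1 (r : nat) wd (f : cells) : moves :=
  fun k => if val k == r then wd else (f k, Stay).

(** A result [None] means that control leaves the program with this step, whose moves are still
    carried out. *)
Fixpoint delta (p : prog) : ctrl p -> cells -> option (ctrl p) * moves :=
  match p return ctrl p -> cells -> option (ctrl p) * moves with
  | Skip => fun _ f => (None, stay f)
  | Push r x => fun b f =>
      if b then (None, set1 r (Some (inl x), Stay) f)
      else (Some true, set1 r (f (inord r), MoveLeft) f)
  | Pop r => fun _ f => (None, set1 r (None, MoveRight) f)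
  | Seq p q => fun c f => match c with
      | inl c => let: (o, a) := delta c f in
                 (Some (if o is Some c' then inl c' else inr (start q)), a)
      | inr c => let: (o, a) := delta c f in (omap inr o, a)
      end
  | IfTop r x p q => fun c f => match c with
      | None => (Some (Some (if f (inord r) == omap inl x then inl (start p)
                             else inr (start q))), stay f)
      | Some (inl c) => let: (o, a) := delta c f in (omap (Some \o inl) o, a)
      | Some (inr c) => let: (o, a) := delta c f in (omap (Some \o inr) o, a)
      end
  | Loop r p => fun c f => match c with
      | None => ((if f (inord r) == None then None else Some (Some (start p))),
                 stay f)
      | Some c => let: (o, a) := delta c f in (Some o, a)
      end
  end.

Notation tapes := ('I_K.+1 -> tape void).

Definition look (c : tapes) : cells := [ffun k => scanned (c k)].
Definition act (c : tapes) (a : moves) : tapes := fun k => write_move (c k) (a k).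

Inductive mrun (p : prog) : nat -> ctrl p -> tapes -> tapes -> Prop :=
| MExit q c a : delta q (look c) = (None, a) -> mrun 1 q c (act c a)
| MStep q c a q' t c' : delta q (look c) = (Some q', a) ->
    mrun t q' (act c a) c' -> mrun t.+1 q c c'.

(** The top of the stack is under the head. All cells to its left are blank, since a pop erases its
    cell before moving right; [j] and [k] count the blanks that happen to be stored explicitly. *)
Definition trep (tp : tape void) (s : seq sym) : Prop :=
  exists j k, left_cells tp = nseq j None /\
    scanned tp :: right_cells tp = [seq Some (inl x) | x <- s] ++ nseq k None.

Definition reps (c : tapes) (st : stacks) := forall k : 'I_K.+1, trep (c k) (st k).

Lemma trep_scanned tp s : trep tp s -> scanned tp = omap inl (ohead s).
Proof. by case=> j [k [_]]; case: s => [|x s] /=; [case: k => //= k|] => -[]. Qed.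

Lemma act_stay c : act c (stay (look c)) = c.
Proof. by apply/funext => k; rewrite /act /stay /look ffunE; case: (c k). Qed.

Lemma write_stay (tp : tape void) : write_move tp (scanned tp, Stay) = tp.
Proof. by case: tp. Qed.

Lemma reps_set1 c st r wd s : reps c st -> (forall k : 'I_K.+1, val k = r ->
    trep (write_move (c k) wd) s) ->
  reps (act c (set1 r wd (look c))) (upd st r s).
Proof.
move=> cst H k; rewrite /act /set1 /upd; case: eqP => [/H//|_].
by rewrite ffunE write_stay; exact: cst.
Qed.

Lemma trep_pop tp s : trep tp s -> trep (write_move tp (None, MoveRight)) (behead s).
Proof.
case=> j [k [+ +]]; case: tp => l a r /= -> E; exists j.+1.
case: s E => [|x s] /=; last first.
  move=> [_ ->]; case: s => [|y s] /=; last by exists k.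
  by case: k => [|k]; [exists 1|exists k.+1].
case: k => //= k [_ ->]; case: k => [|k]; first by exists 1.
by exists k.+1.
Qed.

Lemma trep_left tp s : trep tp s ->
  exists j k, let tp' := write_move tp (scanned tp, MoveLeft) in
  [/\ left_cells tp' = nseq j None, scanned tp' = None &
    right_cells tp' = [seq Some (inl x) | x <- s] ++ nseq k None].
Proof.
case=> j [k [+ +]]; case: tp => l a r /= -> E.
by case: j => [|j]; [exists 0, k|exists j, k].
Qed.

Lemma mrun_seq p q t c0 c c1 u c2 : @mrun p t c0 c c1 ->
  @mrun q u (start q) c1 c2 -> @mrun (Seq p q) (t + u) (inl c0) c c2.
Proof.
move=> H; elim: H u c2 => {t c0 c c1} [c0 c a E|c0 c a q' t c' E _ IH] u c2 H2.
  rewrite add1n; apply: MStep; first by rewrite /= E.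
  elim: H2 => {u c2} [d e b E2|d e b q' t c' E2 _ IH].
    by apply: MExit; rewrite /= E2.
  by apply: MStep IH; rewrite /= E2.
by rewrite addSn; apply: MStep (IH _ _ H2); rewrite /= E.
Qed.

Lemma mrun_ifT r x p q t o c c1 : @mrun p t o c c1 ->
  @mrun (IfTop r x p q) t (Some (inl o)) c c1.
Proof.
elim=> {t o c c1} [d e a E|d e a q' t c' E _ IH].
  by apply: MExit; rewrite /= E.
by apply: MStep IH; rewrite /= E.
Qed.

Lemma mrun_ifF r x p q t o c c1 : @mrun q t o c c1 ->
  @mrun (IfTop r x p q) t (Some (inr o)) c c1.
Proof.
elim=> {t o c c1} [d e a E|d e a q' t c' E _ IH].
  by apply: MExit; rewrite /= E.
by apply: MStep IH; rewrite /= E.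
Qed.

Lemma mrun_loop r p t c0 c c1 u c2 : @mrun p t c0 c c1 ->
  @mrun (Loop r p) u None c1 c2 -> @mrun (Loop r p) (t + u) (Some c0) c c2.
Proof.
move=> H H2; elim: H H2 => {t c0 c c1} [c0 c a E|c0 c a q' t c' E _ IH] H2.
  by rewrite add1n; apply: MStep H2; rewrite /= E.
by rewrite addSn; apply: MStep (IH H2); rewrite /= E.
Qed.

Lemma look_top c st r : reps c st -> r <= K ->
  look c (inord r) = omap inl (ohead (st r)).
Proof.
by move=> H rK; rewrite ffunE (trep_scanned (H _)) inordK.
Qed.

(** By induction on the execution, step for step. A push may move left because [trep] guarantees a
    blank cell there. *)
Lemma sim p st t st' : exec p st t st' -> regs p <= K.+1 ->
  forall c, reps c st -> exists2 c', mrun t (start p) c c' & reps c' st'.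
Proof.
elim=> {p st t st'}.
- by move=> st _ c H; exists c => //; rewrite -{2}(act_stay c); exact: MExit.
- move=> r x st rK c H; eexists.
    apply: MStep; first by reflexivity.
    by apply: MExit; reflexivity.
  set c1 := act c _; move=> k; rewrite /act /set1 /upd.
  case: eqP => [E|/eqP E]; last first.
    rewrite ffunE write_stay /c1 /act /set1 (negbTE E) ffunE write_stay.
    exact: H.
  have [j [k' [L _ Rr]]] := trep_left (H k).
  have -> : c1 k = write_move (c k) (scanned (c k), MoveLeft).
    rewrite /c1 /act /set1 E eqxx ffunE; congr (write_move _ (scanned (c _), _)).
    by apply/val_inj; rewrite /= inordK // -E.
  rewrite -E; move: L Rr; case: (write_move _ _) => l a r' /= -> ->.
  by exists j, k'.
- move=> r st rK c H; eexists; first by apply: MExit; reflexivity.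
  by apply: reps_set1 => // k <-; exact: trep_pop.
- move=> p q st t st1 u st2 _ IH1 _ IH2 /=; rewrite geq_max => /andP[pK qK] c H.
  have [c1 m1 /IH2 [] // c2 m2 H2] := IH1 pK _ H.
  by exists c2 => //; exact: mrun_seq m1 m2.
- move=> r x p q st t st1 E _ IH /=; rewrite !geq_max => /and3P[rK pK qK] c H.
  have [c1 m1 H1] := IH pK _ H; exists c1 => //.
  apply: MStep; first by rewrite /= (look_top H rK) E eqxx; reflexivity.
  by rewrite act_stay; exact: mrun_ifT.
- move=> r x p q st t st1 E _ IH /=; rewrite !geq_max => /and3P[rK pK qK] c H.
  have [c1 m1 H1] := IH qK _ H; exists c1 => //.
  apply: MStep.
    rewrite /= (look_top H rK) ifF; first by reflexivity.
    by apply/eqP; move: E; case: (ohead _) x => [y|] [z|] //= N [] e; apply: N; rewrite e.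
  by rewrite act_stay; exact: mrun_ifF.
- move=> r p st E /=; rewrite geq_max => /andP[rK pK] c H; exists c => //.
  rewrite -{2}(act_stay c); apply: MExit.
  by rewrite /= (look_top H rK) E.
move=> r p st t st1 u st2 E _ IH1 _ IH2 /=; rewrite geq_max => /andP[rK pK] c H.
have [c1 m1 H1] := IH1 pK _ H.
have [|c2 m2 H2] := IH2 _ _ H1; first by rewrite /= geq_max rK.
exists c2 => //; apply: MStep.
  by rewrite /= (look_top H rK); move: E; case: (st r) => // *; reflexivity.
by rewrite act_stay; apply: (mrun_loop m1); exact: m2.
Qed.

(* The verdict is read off the top of stack 0. *)
Definition machine (p : prog) : turing := @Turing K
  (ctrl p + option bool)%type void (inl (start p))
  (fun q => if q is inr o then o else None)
  (fun q f => match q with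
     | inl c => let: (o, a) := delta c f in
                (if o is Some c' then inl c' else inr None, a)
     | inr _ => (inr (Some (f ord0 == Some (inl (Some true)))), stay f)
     end).

Lemma machine_run p t c0 c c1 : @mrun p t c0 c c1 ->
  iter t (@tm_step (machine p)) (inl c0, c) = (inr None, c1).
Proof.
elim=> {t c0 c c1} [q c a E|q c a q' t c' E _ IH].
  by rewrite /= /tm_step /= -/(look c) E.
by rewrite iterSr /tm_step /= -/(look c) E.
Qed.

(** One step beyond the program turns the symbol scanned on tape 0 into the verdict. *)
Lemma machine_answers p w t st : regs p <= K.+1 ->
  exec p (upd (fun=> [::]) 0 w) t st ->
  answers_within (machine p) w t.+1 (ohead (st 0) == Some (Some true)).
Proof.
move=> pK /sim /(_ pK (tm_init (machine p) w).2)[].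
  move=> k /=; rewrite /upd -(inj_eq val_inj) /=; case: eqP => [_|_].
    exists 0; case: w => [|x w]; first by exists 1.
    by exists 0; split=> //=; rewrite cats0.
  by exists 0, 1.
move=> c m H; exists t.+1 => //.
have E : iter t (@tm_step (machine p)) (tm_init (machine p) w) = (inr None, c).
  exact: machine_run m.
rewrite iterS E /tm_step /= ffunE (trep_scanned (H ord0)) /=.
by case: (ohead _).
Qed.

End Simulation.

(** * Polynomial-time functions on binary trees *)

(** Canonical polynomial bounds. With base [n.+1] they are monotone in [n], [c] and [k], so
    different bounds can be merged. *)
Definition pm c k n := c * n.+1 ^ k.
Definition polyb (t : nat -> nat) := exists c k, forall n, t n <= pm c k n.

Lemma leq_exp2rW m n k : m <= n -> m ^ k <= n ^ k.
Proof. by case: k => // k mn; rewrite leq_exp2r. Qed.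

Lemma pm_mono c k m n : m <= n -> pm c k m <= pm c k n.
Proof. by move=> mn; rewrite /pm leq_mul2l leq_exp2rW ?orbT. Qed.

Lemma pm_leq c c' k k' n : c <= c' -> k <= k' -> pm c k n <= pm c' k' n.
Proof. by move=> cc kk; rewrite /pm leq_mul // leq_pexp2l. Qed.

Lemma polyb_le t u : (forall n, t n <= u n) -> polyb u -> polyb t.
Proof. by move=> tu [c [k H]]; exists c, k => n; exact: leq_trans (tu n) (H n). Qed.

Lemma polyb_pm c k : polyb (pm c k). Proof. by exists c, k. Qed.
Lemma polyb_cst c : polyb (fun=> c).
Proof. by exists c, 0 => n; rewrite /pm expn0 muln1. Qed.
Lemma polyb_id : polyb id.
Proof. by exists 1, 1 => n; rewrite /pm expn1 mul1n. Qed.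

Lemma polyb_add t u : polyb t -> polyb u -> polyb (fun n => t n + u n).
Proof.
move=> [c [k tP]] [d [l uP]]; exists (c + d), (maxn k l) => n.
apply: leq_trans (leq_add (tP n) (uP n)) _; rewrite [leqRHS]mulnDl leq_add //.
  by apply: pm_leq; rewrite ?leq_maxl.
by apply: pm_leq; rewrite ?leq_maxr.
Qed.

Lemma polyb_mul t u : polyb t -> polyb u -> polyb (fun n => t n * u n).
Proof.
move=> [c [k tP]] [d [l uP]]; exists (c * d), (k + l) => n.
apply: leq_trans (leq_mul (tP n) (uP n)) _.
by rewrite /pm expnD mulnACA.
Qed.

Lemma polyb_exp t k : polyb t -> polyb (fun n => t n ^ k).
Proof.
move=> pt; elim: k => [|k IH]; first exact: polyb_cst.
by apply: polyb_le (polyb_mul pt IH) => n; rewrite expnS.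
Qed.

Lemma polyb_comp c k t : polyb t -> polyb (fun n => pm c k (t n)).
Proof.
move=> pt; apply: polyb_mul; first exact: polyb_cst.
by apply: polyb_exp; apply: polyb_le (polyb_add pt (polyb_cst 1)) => n; rewrite addn1.
Qed.

Ltac polyb_tac := repeat lazymatch goal with
  | |- polyb (fun _ => ?c) => exact: (polyb_cst c)
  | |- polyb (fun n => n) => exact: polyb_id
  | |- polyb (fun n => pm _ _ n) => exact: polyb_pm
  | |- polyb (pm _ _) => exact: polyb_pm
  | |- polyb id => exact: polyb_id
  | |- polyb (fun n => pm ?c ?k (@?t n)) => apply: (@polyb_comp c k t)
  | |- polyb (fun n => @?t n + @?u n) => apply: (@polyb_add t u)
  | |- polyb (fun n => @?t n * @?u n) => apply: (@polyb_mul t u)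
  | |- polyb (fun n => @?t n ^ ?k) => apply: (@polyb_exp t k)
  | |- polyb _ => assumption
  end.

(** * Execution within a time bound, and basic stack routines *)

Definition run p st T st' := exists2 t, t <= T & exec p st t st'.

Lemma run_le p st T T' st' : T <= T' -> run p st T st' -> run p st T' st'.
Proof. by move=> TT [t tT e]; exists t => //; exact: leq_trans TT. Qed.

Lemma run_eq p st T T' st' st'' : st' = st'' -> T <= T' -> run p st T st' ->
  run p st T' st''.
Proof. by move=> <-; exact: run_le. Qed.

Lemma run_seq p q st T st1 U st2 : run p st T st1 -> run q st1 U st2 ->
  run (Seq p q) st (T + U) st2.
Proof. by move=> [t tT e] [u uU f]; exists (t + u); [lia|apply: ExSeq e f]. Qed.

Lemma run_skip st : run Skip st 1 st.
Proof. by exists 1 => //; exact: ExSkip. Qed.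

Lemma run_push r x st : run (Push r x) st 2 (upd st r (x :: st r)).
Proof. by exists 2 => //; exact: ExPush. Qed.

Lemma run_pop r st : run (Pop r) st 1 (upd st r (behead (st r))).
Proof. by exists 1 => //; exact: ExPop. Qed.

Lemma run_loop0 r p st : st r = [::] -> run (Loop r p) st 1 st.
Proof. by exists 1 => //; exact: ExLoop0. Qed.

Lemma run_loopS r p st T st1 U st2 : st r <> [::] -> run p st T st1 ->
  run (Loop r p) st1 U st2 -> run (Loop r p) st (T + U).+1 st2.
Proof.
by move=> N [t tT e] [u uU f]; exists (t + u).+1; [lia|apply: ExLoopS N e f].
Qed.

Lemma run_if r x p q st T st1 :
  run (if ohead (st r) == x then p else q) st T st1 ->
  run (IfTop r x p q) st T.+1 st1.
Proof.
by case: eqP => E [t tT e]; exists t.+1 => //; [exact: ExIfT|exact: ExIfF].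
Qed.

Lemma exec_size p st t st' r : exec p st t st' -> size (st' r) <= size (st r) + t.
Proof.
elim=> {p st t st'} //=; rewrite /upd.
- lia.
- by move=> r0 x st; case: eqP => [->|_] /=; lia.
- by move=> r0 st; case: eqP => [->|_]; rewrite ?size_behead; lia.
all: lia.
Qed.

Lemma run_size p st T st' r : run p st T st' -> size (st' r) <= size (st r) + T.
Proof. by move=> [t tT /exec_size e]; have := e r; lia. Qed.

Ltac upd_tac := apply/funext => ?; rewrite /upd; repeat case: eqP => ?; subst; try done; try lia.
Ltac upd_at := rewrite /upd; repeat case: eqP => ? //; try lia.

(** Consumes the top symbol and continues according to it. An empty stack would take the last
    branch; [run_onsym] excludes it. *)
Definition onsym r (f : sym -> prog) :=
  IfTop r (Some (Some true)) (Seq (Pop r) (f (Some true)))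
    (IfTop r (Some (Some false)) (Seq (Pop r) (f (Some false)))
       (Seq (Pop r) (f None))).

Lemma run_onsym r f st x s T st' : st r = x :: s -> run (f x) (upd st r s) T st' ->
  run (onsym r f) st (T + 3) st'.
Proof.
move=> E R; have P : run (Pop r) st 1 (upd st r s).
  by have := run_pop r st; rewrite E.
have S := run_seq P R; rewrite addnC.
case: x E R S => [[]|] E R S; apply: run_if; rewrite E /=; try apply: run_if;
  rewrite ?E /=; first [exact: S | by apply: run_le S; lia].
Qed.

Definition mv r r' := Loop r (onsym r (Push r')).
Definition cp r r1 r2 := Loop r (onsym r (fun x => Seq (Push r1 x) (Push r2 x))).
Definition clr r := Loop r (Pop r).

Lemma run_mv r r' st : r <> r' -> run (mv r r') st (6 * size (st r)).+1
  (upd (upd st r' (catrev (st r) (st r'))) r [::]).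
Proof.
move=> N; move E: (st r) => s; elim: s st E => [|x s IH] st E.
  by apply: run_eq (run_loop0 _ E) => //; upd_tac.
apply: run_eq (run_loopS _ (run_onsym E (run_push _ _ _)) (IH _ _)).
- by upd_tac; rewrite eqxx; case: eqP.
- by move=> /=; lia.
- by rewrite E.
- by upd_at.
Qed.

Lemma run_cp r r1 r2 st : uniq [:: r; r1; r2] ->
  run (cp r r1 r2) st (8 * size (st r)).+1
  (upd (upd (upd st r2 (catrev (st r) (st r2))) r1 (catrev (st r) (st r1))) r [::]).
Proof.
rewrite /= !inE negb_or => /andP[/andP[/eqP N1 /eqP N2] /andP[/eqP N3 _]].
move E: (st r) => s; elim: s st E => [|x s IH] st E.
  by apply: run_eq (run_loop0 _ E) => //; upd_tac.
apply: run_eq (run_loopS _ (run_onsym E (run_seq (run_push _ _ _) (run_push _ _ _)))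
  (IH _ _)).
- by apply/funext => k; rewrite /upd; do ![case: eqP => ? //; subst].
- by move=> /=; lia.
- by rewrite E.
- by rewrite /upd; do ![case: eqP => ? //; subst].
Qed.

Lemma run_clr r st : run (clr r) st (2 * size (st r)).+1 (upd st r [::]).
Proof.
move E: (st r) => s; elim: s st E => [|x s IH] st E.
  by apply: run_eq (run_loop0 _ E) => //; upd_tac.
apply: run_eq (run_loopS _ (run_pop _ _) (IH _ _)).
- by upd_tac.
- by move=> /=; lia.
- by rewrite E.
- by rewrite /upd eqxx E.
Qed.

(** Emptying one stack into another reverses it, so both routines go through the scratch stack [c]
    to restore the order. *)
Definition copy a b c := Seq (mv a c) (cp c a b).
Definition transfer a b c := Seq (mv a c) (mv c b).

Lemma run_copy a b c st : uniq [:: a; b; c] -> st b = [::] -> st c = [::] ->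
  run (copy a b c) st (14 * size (st a) + 2) (upd st b (st a)).
Proof.
rewrite /= !inE negb_or => /andP[/andP[/eqP N1 /eqP N2] /andP[/eqP N3 _]] Eb Ec.
have R1 := @run_mv a c st N2.
have R2 := @run_cp c a b (upd (upd st c (catrev (st a) (st c))) a [::]).
apply: run_eq (run_seq R1 (R2 _)).
- apply/funext => k; rewrite /upd Ec ?eqxx.
  have -> : (c == a) = false by apply/eqP => ?; apply: N2.
  have -> : (b == a) = false by apply/eqP => ?; apply: N1.
  have -> : (b == c) = false by apply/eqP.
  rewrite Eb !catrevE !cats0 revK.
  by do ![case: eqP => ? //; subst].
- rewrite /upd Ec eqxx; have -> : (c == a) = false by apply/eqP => ?; apply: N2.
  by rewrite catrevE cats0 size_rev; lia.
- rewrite /= !inE negb_or; apply/andP; split; last by rewrite andbT; apply/eqP.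
  by apply/andP; split; apply/eqP => ?; [apply: N2|apply: N3].
Qed.

Lemma run_transfer a b c st : uniq [:: a; b; c] -> st c = [::] ->
  run (transfer a b c) st (12 * size (st a) + 2)
    (upd (upd st b (st a ++ st b)) a [::]).
Proof.
rewrite /= !inE negb_or => /andP[/andP[/eqP N1 /eqP N2] /andP[/eqP N3 _]] Ec.
have ca : (c == a) = false by apply/eqP => ?; apply: N2.
have ba : (b == a) = false by apply/eqP => ?; apply: N1.
have bc : (b == c) = false by apply/eqP.
have cb : c <> b by move=> ?; apply: N3.
apply: run_eq (run_seq (@run_mv a c st N2) (run_mv _ cb)).
- apply/funext => k; rewrite /upd Ec ?eqxx ca ba bc !catrevE cats0 revK.
  by do ![case: eqP => ? //; subst].
- by rewrite /upd Ec eqxx ca catrevE cats0 size_rev; lia.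
Qed.

(** * Binary trees as data, and computable functions on them *)

Inductive tree := Nil | Cons of tree & tree.

(** Preorder code with arity bits. It is prefix-free, so one component of a pair can be split off
    without a separator. *)
Fixpoint dcode d : seq sym :=
  if d is Cons a b then Some true :: dcode a ++ dcode b else [:: Some false].
Definition dsz d := size (dcode d).
Definition car d := if d is Cons a _ then a else Nil.
Definition cdr d := if d is Cons _ b then b else Nil.
Definition isCons d := if d is Cons _ _ then true else false.

Lemma dsz_Cons a b : dsz (Cons a b) = (dsz a + dsz b).+1.
Proof. by rewrite /dsz /= size_cat. Qed.
Lemma dcode_top d : ohead (dcode d) = Some (Some (isCons d)).
Proof. by case: d. Qed.

Ltac regs_tac := rewrite /= ?geq_max; repeat (apply/andP; split); lia.

Class Enc (A : Type) := enc : A -> tree.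
Definition esz {A} {eA : Enc A} (x : A) := dsz (enc x).

(** Calling convention: argument and result sit on stack [b], the stacks above [b] are empty scratch
    space before and after, and those below are untouched. Uniformity in [b] lets programs be nested
    by raising the base. *)
Definition computes {A B} {eA : Enc A} {eB : Enc B} (p : nat -> prog) (g : A -> B)
    (t : nat -> nat) :=
  forall b st x, (forall j, b < j -> st j = [::]) -> st b = dcode (enc x) ->
  run (p b) st (t (esz x)) (upd st b (dcode (enc (g x)))).

(** The number [r] of scratch stacks may not depend on the argument, since it becomes the number of
    tapes. *)
Definition P {A B} {eA : Enc A} {eB : Enc B} (g : A -> B) := exists p t,
  [/\ polyb t, exists r, forall b, regs (p b) <= b + r & computes p g t].

Lemma P_pm {A B} {eA : Enc A} {eB : Enc B} (g : A -> B) : P g -> exists p c k r, (forall b, regs (p b) <= b + r) /\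
  computes p g (pm c k).
Proof.
move=> [p [t [[c [k tP]] [r rP] H]]]; exists p, c, k, r; split=> // b st x sb E.
by apply: run_le (H b st x sb E).
Qed.

(** A step lengthens a stack by at most one symbol, so the running time bounds the output. This
    closes the class under composition. *)
Lemma P_size {A B} {eA : Enc A} {eB : Enc B} (g : A -> B) : P g -> exists c k, forall x, esz (g x) <= pm c k (esz x).
Proof.
move=> [p [t [pt [r rP] H]]].
have [c [k cP]] : polyb (fun n => n + t n) by polyb_tac.
exists c, k => x; apply: leq_trans (cP _).
have := run_size 0 (H 0 (upd (fun=> [::]) 0 (dcode (enc x))) x _ _).
by rewrite /upd /=; apply => // -[].
Qed.

Lemma P_cast {A B} {eA : Enc A} {eB : Enc B} (f : A -> B) : (forall x, enc (f x) = enc x) -> P f.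
Proof.
move=> fE; exists (fun=> Skip), (fun=> 1); split; [polyb_tac|by exists 0|].
by move=> b st x _ E; apply: run_eq (run_skip _) => //; rewrite fE; upd_tac.
Qed.

Lemma P_nil {A B} {eA : Enc A} {eB : Enc B} (f : A -> B) : (forall x, enc (f x) = Nil) -> P f.
Proof.
move=> fE.
exists (fun b => Seq (clr b) (Push b (Some false))), (fun n => 2 * n + 3).
split; first polyb_tac; first by exists 1 => b /=; lia.
move=> b st x sb E; apply: run_eq (run_seq (run_clr _ _) (run_push _ _ _)).
- by rewrite fE; upd_tac; rewrite eqxx.
- by rewrite E /esz /dsz; lia.
Qed.

Lemma P_comp {A B C} {eA : Enc A} {eB : Enc B} {eC : Enc C} (f : A -> B) (g : B -> C) :
  P g -> P f -> P (fun x => g (f x)).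
Proof.
move=> Pg Pf; have [c' [k' sf]] := P_size Pf.
move: Pf Pg => /P_pm[p [c [k [r [rP H]]]]] /P_pm[q [d [l [s [sP G]]]]].
exists (fun b => Seq (p b) (q b)), (fun n => pm c k n + pm d l (pm c' k' n)).
split; first polyb_tac.
  exists (maxn r s) => b; rewrite /= geq_max.
  by apply/andP; split; [have := rP b|have := sP b]; lia.
move=> b st x sb E.
apply: run_eq (run_seq (H b st x sb E) (G b _ (f x) _ _)).
- by upd_tac.
- by rewrite leq_add2l pm_mono.
- by move=> j bj; rewrite /upd; case: eqP => [?|_]; [lia|exact: sb].
- by rewrite /upd eqxx.
Qed.

(** The first component is computed on a copy, so that the argument survives for the second. The
    codes are then put back in reverse order, the top of the stack coming last. *)
Lemma P_Cons {A B C F} {eA : Enc A} {eB : Enc B} {eC : Enc C} {eF : Enc F}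
    (f : A -> B) (g : A -> C) (h : A -> F) :
  (forall x, enc (h x) = Cons (enc (f x)) (enc (g x))) -> P f -> P g -> P h.
Proof.
move=> hE Pf Pg; have [c' [k' sf]] := P_size Pf; have [d' [l' sg]] := P_size Pg.
move: Pf Pg => /P_pm[p [c [k [r [rP H]]]]] /P_pm[q [d [l [s [sP G]]]]].
exists (fun b => Seq (copy b b.+1 b.+2) (Seq (p b.+1) (Seq (copy b b.+2 b.+3)
  (Seq (q b.+2) (Seq (clr b) (Seq (transfer b.+2 b b.+3)
  (Seq (transfer b.+1 b b.+3) (Push b (Some true))))))))).
exists (fun n => 14 * n + 2 + (pm c k n + (14 * n + 2 + (pm d l n + (2 * n + 1 +
  (12 * pm d' l' n + 2 + (12 * pm c' k' n + 2 + 2))))))).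
split; first polyb_tac.
  exists (r + s + 4) => b; have := rP b.+1; have := sP b.+2 => *; regs_tac.
move=> b st x sb E.
set s1 := upd st b.+1 (dcode (enc x)).
set s2 := upd st b.+1 (dcode (enc (f x))).
set s3 := upd s2 b.+2 (dcode (enc x)).
set s4 := upd s2 b.+2 (dcode (enc (g x))).
set s5 := upd s4 b [::].
set s6 := upd s2 b (dcode (enc (g x))).
set s7 := upd st b (dcode (enc (f x)) ++ dcode (enc (g x))).
have Hsz : size (dcode (enc x)) = esz x by [].
have R1 : run (copy b b.+1 b.+2) st (14 * esz x + 2) s1.
  rewrite -Hsz -E /s1 -E; apply: run_copy; rewrite /= ?inE; try lia; apply: sb; lia.
have R2 : run (p b.+1) s1 (pm c k (esz x)) s2.
  apply: run_eq (H b.+1 s1 x _ _); [by rewrite /s1 /s2; upd_tac|by []| |].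
    by move=> j bj; rewrite /s1; upd_at; apply: sb; lia.
  by rewrite /s1; upd_at.
have R3 : run (copy b b.+2 b.+3) s2 (14 * esz x + 2) s3.
  have E2 : s2 b = dcode (enc x) by rewrite /s2; upd_at.
  rewrite -Hsz -E2 /s3 -E2; apply: run_copy; rewrite /= ?inE; try lia;
    by rewrite /s2; upd_at; apply: sb; lia.
have R4 : run (q b.+2) s3 (pm d l (esz x)) s4.
  apply: run_eq (G b.+2 s3 x _ _); [by rewrite /s3 /s4; upd_tac|by []| |].
    by move=> j bj; rewrite /s3 /s2; upd_at; apply: sb; lia.
  by rewrite /s3; upd_at.
have R5 : run (clr b) s4 (2 * esz x + 1) s5.
  have -> : esz x = size (s4 b) by rewrite /s4 /s2; upd_at; rewrite E.
  by rewrite addn1; exact: run_clr.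
have R6 : run (transfer b.+2 b b.+3) s5 (12 * pm d' l' (esz x) + 2) s6.
  have E5 : s5 b.+2 = dcode (enc (g x)) by rewrite /s5 /s4; upd_at.
  apply: run_eq (@run_transfer b.+2 b b.+3 s5 _ _).
  - rewrite E5 /s6 /s5 /s4 /s2; apply/funext => j; upd_at; subst.
      by rewrite sb //; lia.
    by rewrite cats0.
  - by rewrite E5 leq_add2r leq_mul2l sg orbT.
  - by rewrite /= !inE; lia.
  - by rewrite /s5 /s4 /s2; upd_at; apply: sb; lia.
have R7 : run (transfer b.+1 b b.+3) s6 (12 * pm c' k' (esz x) + 2) s7.
  have E6 : s6 b.+1 = dcode (enc (f x)) by rewrite /s6 /s2; upd_at.
  apply: run_eq (@run_transfer b.+1 b b.+3 s6 _ _).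
  - rewrite E6 /s7 /s6 /s2; apply/funext => j; upd_at; subst.
    by rewrite sb //; lia.
  - by rewrite E6 leq_add2r leq_mul2l sf orbT.
  - by rewrite /= !inE; lia.
  - by rewrite /s6 /s2; upd_at; apply: sb; lia.
apply: (run_seq R1 (run_seq R2 (run_seq R3 (run_seq R4 (run_seq R5 (run_seq R6
  (run_seq R7 _))))))).
apply: run_eq (run_push _ _ _) => //.
by rewrite hE /s7; upd_tac; rewrite eqxx.
Qed.

(** Stack [b.+2] counts in unary the subtrees still to be read: an inner node adds one, a leaf
    removes one. The loop therefore stops after exactly one complete tree, which ends up reversed on
    [b.+1]. *)
Definition split_sym b x := Seq (Push b.+1 x)
  (if x == Some true then Push b.+2 (Some true) else Pop b.+2).
Definition split_prog b := Loop b.+2 (onsym b (split_sym b)).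

(** Continuation style, with an arbitrary remainder [k] of the counter, lets the induction read the
    left subtree and go on with the right one. *)
Lemma run_split b a st s u k T st' : st b = dcode a ++ s -> st b.+1 = u ->
  st b.+2 = Some true :: k ->
  run (split_prog b) (upd (upd (upd st b s) b.+1 (catrev (dcode a) u)) b.+2 k) T st' ->
  run (split_prog b) st (T + 8 * dsz a) st'.
Proof.
elim: a s u k st T => [|l IHl r IHr] s u k st T Eb E1 E2 R.
  apply: run_eq (run_loopS _ (@run_onsym b (split_sym b) _ _ _ _ _ Eb
    (run_seq (run_push _ _ _) (run_pop _ _))) _)
    => //; last first.
  - have <- : upd (upd (upd st b s) b.+1 (catrev (dcode Nil) u)) b.+2 k =
       upd (upd (upd st b s) b.+1 (Some false :: upd st b s b.+1)) b.+2
         (behead (upd (upd st b s) b.+1 (Some false :: upd st b s b.+1) b.+2)).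
      by apply/funext => j; upd_at; rewrite ?E1 ?E2.
    exact: R.
  - by rewrite E2.
  - rewrite /dsz /=; lia.
have Eb' : st b = Some true :: (dcode l ++ (dcode r ++ s)) by rewrite Eb /= catA.
have R1 := @run_onsym b (split_sym b) _ _ _ _ _ Eb'
  (run_seq (run_push b.+1 (Some true) _) (run_push b.+2 (Some true) _)).
apply: run_eq (run_loopS _ R1 _) => //; last first.
- apply: (IHl (dcode r ++ s) (Some true :: u) (Some true :: k)).
  + by upd_at.
  + by upd_at; rewrite E1.
  + by upd_at; rewrite E2.
  apply: (IHr s (catrev (dcode l) (Some true :: u)) k).
  + by upd_at.
  + by upd_at.
  + by upd_at.
  move: R; congr run; apply/funext => j; upd_at.
  by rewrite /= !catrevE rev_cat catA.
- by rewrite E2.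
- by rewrite dsz_Cons; lia.
Qed.

Definition unpair b := Seq (Pop b) (Seq (Push b.+2 (Some true)) (split_prog b)).

Lemma run_unpair b st x y : (forall j, b < j -> st j = [::]) ->
  st b = dcode (Cons x y) ->
  run (unpair b) st (8 * dsz x + 4) (upd (upd st b (dcode y)) b.+1 (rev (dcode x))).
Proof.
move=> sb E; rewrite /unpair.
have R : run (split_prog b) (upd (upd st b (dcode x ++ dcode y)) b.+2 [:: Some true])
   (1 + 8 * dsz x) (upd (upd st b (dcode y)) b.+1 (rev (dcode x))).
  apply: (@run_split b x _ (dcode y) [::] [::]); rewrite ?/upd ?eqxx.
  - by upd_at.
  - by upd_at; apply: sb.
  - by [].
  apply: run_eq (run_loop0 _ _) => //; last by upd_at.
  by apply/funext => j; upd_at; subst; rewrite sb //; lia.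
apply: run_eq (run_seq (run_pop _ _) (run_seq (run_push _ _ _) _)) => //; last first.
  rewrite E /=; have -> : upd (upd st b (dcode x ++ dcode y)) b.+2 (Some true ::
     upd st b (dcode x ++ dcode y) b.+2) =
     upd (upd st b (dcode x ++ dcode y)) b.+2 [:: Some true].
    by congr upd; upd_at; rewrite sb //; lia.
  exact: R.
lia.
Qed.

Lemma P_car {A B} {eA : Enc A} {eB : Enc B} (f : A -> B) : (forall x, enc (f x) = car (enc x)) -> P f.
Proof.
move=> fE.
exists (fun b => IfTop b (Some (Some true)) (Seq (unpair b) (Seq (clr b) (mv b.+1 b))) Skip).
exists (fun n => 20 * n + 10); split; first polyb_tac.
  by exists 3 => b; regs_tac.
move=> b st z sb; rewrite fE /esz; case: (enc z) => [|x y] E.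
  apply: run_eq (run_if _); last by rewrite E /=; exact: run_skip.
    by apply/funext => j; upd_at; subst.
  lia.
apply: run_le (run_if _); last first.
  rewrite E /=; apply: run_seq (run_unpair sb E) (run_seq (run_clr _ _) _).
  apply: run_eq (run_mv _ _) => //; last lia.
  apply/funext => j; upd_at; subst;
    first [by rewrite catrevE revK cats0 | by rewrite sb //; lia].
rewrite dsz_Cons; upd_at; rewrite size_rev /dsz; lia.
Qed.

Lemma P_cdr {A B} {eA : Enc A} {eB : Enc B} (f : A -> B) : (forall x, enc (f x) = cdr (enc x)) -> P f.
Proof.
move=> fE.
exists (fun b => IfTop b (Some (Some true)) (Seq (unpair b) (clr b.+1)) Skip).
exists (fun n => 20 * n + 10); split; first polyb_tac.
  by exists 3 => b; regs_tac.
move=> b st z sb; rewrite fE /esz; case: (enc z) => [|x y] E.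
  apply: run_eq (run_if _); last by rewrite E /=; exact: run_skip.
    by apply/funext => j; upd_at; subst.
  lia.
apply: run_le (run_if _); last first.
  rewrite E /=; apply: run_seq (run_unpair sb E) _.
  apply: run_eq (run_clr _ _) => //.
  by apply/funext => j; upd_at; subst; rewrite sb //; lia.
rewrite dsz_Cons; upd_at; rewrite size_rev /dsz; lia.
Qed.

Lemma P_ifCons {A B C} {eA : Enc A} {eB : Enc B} {eC : Enc C} (h : A -> C)
    (f g : A -> B) : P h -> P f -> P g ->
  P (fun x => if isCons (enc (h x)) then f x else g x).
Proof.
move=> Ph; have [c' [k' sh]] := P_size Ph.
move: Ph => /P_pm[o [e [m [w [wP O]]]]].
move=> /P_pm[p [c [k [r [rP H]]]]] /P_pm[q [d [l [s [sP G]]]]].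
exists (fun b => Seq (copy b b.+1 b.+2) (Seq (o b.+1) (IfTop b.+1 (Some (Some true))
  (Seq (clr b.+1) (p b)) (Seq (clr b.+1) (q b))))).
exists (fun n => 14 * n + 2 + (pm e m n + (2 * pm c' k' n + 2 + (pm c k n + pm d l n)))).
split; first polyb_tac.
  exists (r + s + w + 3) => b; have := rP b; have := sP b; have := wP b.+1 => *; regs_tac.
move=> b st x sb E.
have R1 : run (copy b b.+1 b.+2) st (14 * esz x + 2) (upd st b.+1 (dcode (enc x))).
  rewrite /esz /dsz -E; apply: run_copy; rewrite /= ?inE; try lia; apply: sb; lia.
have R2 : run (o b.+1) (upd st b.+1 (dcode (enc x))) (pm e m (esz x)) (upd st b.+1 (dcode (enc (h x)))).
  apply: run_eq (O b.+1 _ x _ _) => //; first by upd_tac.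
  - by move=> j bj; upd_at; apply: sb; lia.
  - by upd_at.
have RC : run (clr b.+1) (upd st b.+1 (dcode (enc (h x)))) (2 * pm c' k' (esz x)).+1 st.
  apply: run_eq (run_clr _ _).
    by apply/funext => j; upd_at; subst; rewrite sb.
  by rewrite ltnS leq_mul2l; upd_at; exact: sh.
apply: run_le (run_seq R1 (run_seq R2 (run_if (T := (2 * pm c' k' (esz x)).+1 +
  (pm c k (esz x) + pm d l (esz x))) _))); last first.
  rewrite /upd eqxx dcode_top; case: (isCons _) => /=.
    by apply: run_le (run_seq RC (H b st x sb E)); rewrite leq_add2l; apply: leq_addr.
  apply: run_le (run_seq RC (G b st x sb E)); rewrite leq_add2l; apply: leq_addl.
lia.
Qed.

#[global] Instance enc_prod {A B} {eA : Enc A} {eB : Enc B} : Enc (A * B) :=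
  fun p => Cons (enc p.1) (enc p.2).

(** The only source of iteration: the code of [u x] is the unary counter. A pass is polynomial only
    in the current state, so intermediate states have to be of polynomial size; otherwise repeated
    doubling would be allowed. *)
Lemma P_iter {A S U} {eA : Enc A} {eS : Enc S} {eU : Enc U} (h : S -> S)
    (z : A -> S) (u : A -> U) : P h -> P z -> P u ->
  (exists c k, forall x i, esz (iter i h (z x)) <= pm c k (esz x)) ->
  P (fun x => iter (esz (u x)) h (z x)).
Proof.
move=> Ph Pz Pu [c0 [k0 bd]]; have [c' [k' su]] := P_size Pu.
have Pzu : P (fun x => (z x, u x)) by exact: P_Cons Pz Pu.
move: Ph Pzu => /P_pm[p [c [k [r [rP H]]]]] /P_pm[q [d [l [s [sP G]]]]].
exists (fun b => Seq (q b) (Seq (unpair b) (Seq (mv b.+1 b.+2)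
  (Seq (transfer b.+2 b.+1 b.+3)
  (Seq (Loop b (Seq (Pop b) (p b.+1))) (transfer b.+1 b b.+2)))))).
exists (fun n => pm d l n + (8 * pm c0 k0 n + 4 + (6 * pm c0 k0 n + 1 +
  (12 * pm c0 k0 n + 2 +
  (pm c' k' n * (2 + pm c k (pm c0 k0 n)) + 1 + (12 * pm c0 k0 n + 2)))))).
split; first polyb_tac.
  exists (r + s + 5) => b; have := rP b.+1; have := sP b => *; regs_tac.
move=> b st x sb E; have zs : esz (z x) <= pm c0 k0 (esz x) by exact: (bd x 0).
have R1 := G b st x sb E.
set s1 := upd st b _ in R1.
have R2 : run (unpair b) s1 (8 * pm c0 k0 (esz x) + 4)
    (upd (upd st b (dcode (enc (u x)))) b.+1 (rev (dcode (enc (z x))))).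
  apply: run_eq (@run_unpair b s1 (enc (z x)) (enc (u x)) _ _).
  - by rewrite /s1; upd_tac.
  - by rewrite leq_add2r leq_mul2l zs orbT.
  - by move=> j bj; rewrite /s1; upd_at; apply: sb; lia.
  - by rewrite /s1; upd_at.
set s2 := upd (upd st b _) _ _ in R2.
set s3 := upd (upd st b (dcode (enc (u x)))) b.+2 (dcode (enc (z x))).
have R3 : run (mv b.+1 b.+2) s2 (6 * pm c0 k0 (esz x) + 1) s3.
  apply: run_eq (run_mv _ _); last lia.
    rewrite /s2 /s3; apply/funext => j; upd_at; subst;
      first [by rewrite catrevE revK sb ?cats0 //; lia | by rewrite sb //; lia].
  by rewrite /s2; upd_at; rewrite size_rev addn1 ltnS leq_mul2l zs orbT.
set s4 := upd (upd st b (dcode (enc (u x)))) b.+1 (dcode (enc (z x))).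
have R4 : run (transfer b.+2 b.+1 b.+3) s3 (12 * pm c0 k0 (esz x) + 2) s4.
  apply: run_eq (run_transfer _ _).
  - rewrite /s3 /s4; apply/funext => j; upd_at; subst;
      first [by rewrite sb ?cats0 //; lia | by rewrite sb //; lia].
  - by rewrite /s3; upd_at; rewrite leq_add2r leq_mul2l zs orbT.
  - by rewrite /= !inE; lia.
  - by rewrite /s3; upd_at; apply: sb; lia.
have L w n : run (Loop b (Seq (Pop b) (p b.+1)))
    (upd (upd st b w) b.+1 (dcode (enc (iter n h (z x)))))
    (size w * (2 + pm c k (pm c0 k0 (esz x))) + 1)
    (upd (upd st b [::]) b.+1 (dcode (enc (iter (size w + n) h (z x))))).
  elim: w n => [|a w IH] n.
    by apply: run_eq (run_loop0 _ _) => //; upd_at.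
  apply: run_eq (run_loopS _ (run_seq (run_pop _ _) (H b.+1 _ (iter n h (z x)) _ _)) _);
    last first.
  - have -> : upd (upd (upd (upd st b (a :: w)) b.+1 (dcode (enc (iter n h (z x))))) b
      (behead (upd (upd st b (a :: w)) b.+1 (dcode (enc (iter n h (z x)))) b))) b.+1
      (dcode (enc (h (iter n h (z x))))) =
      upd (upd st b w) b.+1 (dcode (enc (iter n.+1 h (z x)))).
      by apply/funext => j; upd_at.
    exact: IH.
  - by upd_at.
  - by move=> j bj; upd_at; apply: sb; lia.
  - by upd_at.
  - have := pm_mono c k (bd x n); rewrite [size (_ :: _)]/=; lia.
  - by rewrite addnS.
have R5 : run (Loop b (Seq (Pop b) (p b.+1))) s4
    (pm c' k' (esz x) * (2 + pm c k (pm c0 k0 (esz x))) + 1)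
    (upd (upd st b [::]) b.+1 (dcode (enc (iter (esz (u x)) h (z x))))).
  have R6 := L (dcode (@enc U eU (u x))) 0; rewrite [_ + 0]addn0 in R6.
  by apply: run_le R6; rewrite leq_add2r leq_mul2r su orbT.
apply: (run_seq R1 (run_seq R2 (run_seq R3 (run_seq R4 (run_seq R5 _))))).
apply: run_eq (@run_transfer b.+1 b b.+2 _ _ _).
- by apply/funext => j; upd_at; subst; rewrite ?cats0 // sb.
- by upd_at; rewrite leq_add2r leq_mul2l bd orbT.
- by rewrite /= !inE; lia.
- by upd_at; apply: sb; lia.
Qed.

#[global] Instance enc_bool : Enc bool := fun b => if b then Cons Nil Nil else Nil.
#[global] Instance enc_option {A} {eA : Enc A} : Enc (option A) :=
  fun o => if o is Some a then Cons (enc a) Nil else Nil.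
#[global] Instance enc_sym : Enc sym := enc_option.
#[global] Instance enc_seq {A} {eA : Enc A} : Enc (seq A) :=
  fix enc_seq s := if s is a :: s' then Cons (enc a) (enc_seq s') else Nil.

Fixpoint pushl r (s : seq sym) :=
  if s is x :: s' then Seq (pushl r s') (Push r x) else Skip.

Lemma run_pushl r s st : run (pushl r s) st (2 * size s + 1) (upd st r (s ++ st r)).
Proof.
elim: s => [|x s IH] /=.
  by exists 1 => //; rewrite (_ : upd _ _ _ = st); [exact: ExSkip|upd_tac].
apply: run_eq (run_seq IH (run_push _ _ _)); last lia.
by upd_tac; rewrite eqxx.
Qed.

(** Turns the raw input into the code of a list. The input is first reversed, so that the list can
    be built from its end by pushing. *)
Definition load_sym (x : sym) := pushl 0 (Some true :: dcode (enc x)).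
Definition load := Seq (mv 0 1) (Seq (Push 0 (Some false))
  (Loop 1 (onsym 1 load_sym))).

Lemma run_load (w : seq sym) : run load (upd (fun=> [::]) 0 w) (50 * size w + 10)
  (upd (fun=> [::]) 0 (dcode (enc w))).
Proof.
have L (v u : seq sym) : run (Loop 1 (onsym 1 load_sym))
   (upd (upd (fun=> [::]) 1 v) 0 (dcode (enc u))) (30 * size v + 1)
   (upd (fun=> [::]) 0 (dcode (enc (catrev v u)))).
  elim: v u => [|x v IH] u.
    apply: run_eq (run_loop0 _ _) => //.
    by apply/funext => j; upd_at.
  have R : run (load_sym x) (upd (upd (upd (fun=> [::]) 1 (x :: v)) 0
      (dcode (enc u))) 1 v) 16 (upd (upd (fun=> [::]) 1 v) 0
      (dcode (enc (x :: u)))).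
    apply: run_eq (run_pushl _ _ _); last by case: x => [[]|].
    by apply/funext => j; upd_at.
  apply: run_le (run_loopS _ (run_onsym _ R) (IH (x :: u))) => //=.
  by lia.
apply: run_eq (run_seq (run_mv _ _) (run_seq (run_push _ _ _) _)) => //; last first.
  have -> : upd (upd (upd (upd (fun=> [::]) 0 w) 1 (catrev (upd (fun=> [::]) 0 w 0)
      (upd (fun=> [::]) 0 w 1))) 0 [::]) 0 (Some false :: upd (upd (upd (fun=> [::]) 0 w)
      1 (catrev (upd (fun=> [::]) 0 w 0) (upd (fun=> [::]) 0 w 1))) 0 [::] 0) =
    upd (upd (fun=> [::]) 1 (rev w)) 0 (dcode (enc ([::] : seq sym))).
    by apply/funext => j; upd_at.
  by have := L (rev w) [::]; rewrite catrevE revK cats0 size_rev; apply.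
by rewrite /upd /=; lia.
Qed.

Theorem P_decides (f : seq sym -> bool) : P f ->
  exists (M : turing) (c d : nat), forall w,
    answers_within M w (c * size w ^ d + c) (f w).
Proof.
move=> /P_pm[p [c [k [r [rP H]]]]].
have tsz (w : seq sym) : esz w <= 6 * size w + 1.
  elim: w => [//|x w IH]; have -> : esz (x :: w) = (dsz (enc x) + esz w).+1.
    by rewrite /esz -dsz_Cons.
  have : dsz (enc x) <= 5 by case: x => [[]|].
  by rewrite [size (_ :: _)]/=; lia.
have [c' [k' bP]] : polyb (fun n => 50 * n + 10 + pm c k (6 * n + 1) + 1) by polyb_tac.
(* For a nonempty word [n.+1 <= 2 * n], whence the factor [2 ^ k']; the empty word is covered by the
   additive constant. *)
exists (machine (r + 3) (Seq load (p 0))), (c' * 2 ^ k'), k' => w.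
have [] := run_seq (run_load w) (H 0 (upd (fun=> [::]) 0 (dcode (enc w))) w _ _) => //.
  by case.
move=> t tT e.
have := @machine_answers (r + 3) (Seq load (p 0)) w t _ _ e.
rewrite {1}/upd eqxx dcode_top => -[].
  by have := rP 0 => *; regs_tac.
move=> u ut V; exists u; last by rewrite V; case: (f w).
apply: leq_trans ut _; apply: (@leq_trans (pm c' k' (size w))).
  apply: leq_trans (bP _); rewrite addn1 ltnS.
  by apply: leq_trans tT _; rewrite leq_add2l; apply: pm_mono.
rewrite /pm; case: (size w) => [|n].
  rewrite exp1n muln1 -[leqLHS]muln1; apply: leq_trans (leq_addl _ _).
  by rewrite leq_mul2l expn_gt0 orbT.
apply: leq_trans (leq_addr _ _); rewrite -mulnA leq_mul2l -expnMn leq_exp2rW ?orbT //.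
lia.
Qed.

(** * Closure under constants, case distinction and list operations *)

#[global] Instance enc_unit : Enc unit := fun=> Nil.

Lemma P_id {A} {eA : Enc A} : P (fun x : A => x).
Proof. exact: P_cast. Qed.

Lemma P_pair {A B C} {eA : Enc A} {eB : Enc B} {eC : Enc C} (f : A -> B) (g : A -> C) :
  P f -> P g -> P (fun x => (f x, g x)).
Proof. exact: P_Cons. Qed.

Lemma P_fst {A B C} {eA : Enc A} {eB : Enc B} {eC : Enc C} (f : A -> B * C) :
  P f -> P (fun x => (f x).1).
Proof. by apply: P_comp; apply: P_car. Qed.

Lemma P_snd {A B C} {eA : Enc A} {eB : Enc B} {eC : Enc C} (f : A -> B * C) :
  P f -> P (fun x => (f x).2).
Proof. by apply: P_comp; apply: P_cdr. Qed.

#[local] Instance enc_tree : Enc tree := id.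

Lemma P_cst {A B} {eA : Enc A} {eB : Enc B} (y : B) : P (fun _ : A => y).
Proof.
have K (t : tree) : P (fun _ : A => t).
  by elim: t => [|a IHa b IHb]; [exact: P_nil|exact: P_Cons IHa IHb].
case E: (@enc B eB y) => [|a b]; first by apply: P_nil => _.
by apply: (P_Cons _ (K a) (K b)) => _.
Qed.

Lemma P_ext {A B} {eA : Enc A} {eB : Enc B} (f g : A -> B) : f =1 g -> P f -> P g.
Proof. by move=> /funext ->. Qed.

Lemma P_if {A B} {eA : Enc A} {eB : Enc B} (b : A -> bool) (f g : A -> B) :
  P b -> P f -> P g -> P (fun x => if b x then f x else g x).
Proof.
move=> Pb Pf Pg; apply: P_ext (P_ifCons Pb Pf Pg) => x.
by rewrite /enc /enc_bool; case: (b x).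
Qed.

Lemma P_negb {A} {eA : Enc A} (b : A -> bool) : P b -> P (fun x => ~~ b x).
Proof. by move=> Pb; apply: (P_if Pb); apply: P_cst. Qed.

Lemma P_andb {A} {eA : Enc A} (b c : A -> bool) : P b -> P c -> P (fun x => b x && c x).
Proof. by move=> Pb Pc; apply: (P_if Pb Pc); apply: P_cst. Qed.

Lemma P_orb {A} {eA : Enc A} (b c : A -> bool) : P b -> P c -> P (fun x => b x || c x).
Proof. by move=> Pb Pc; apply: (P_if Pb _ Pc); apply: P_cst. Qed.

Lemma P_addb {A} {eA : Enc A} (b c : A -> bool) : P b -> P c -> P (fun x => b x (+) c x).
Proof. by move=> Pb Pc; apply: P_ext (P_if Pb (P_negb Pc) Pc) => x; case: (b x). Qed.

Lemma P_cons {X A} {eX : Enc X} {eA : Enc A} (a : X -> A) (l : X -> seq A) :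
  P a -> P l -> P (fun x => a x :: l x).
Proof. exact: P_Cons. Qed.

(** Computability concerns codes only, so a value may be replaced by one of another type with the
    same code. *)
Lemma P_recast {A B B'} {eA : Enc A} {eB : Enc B} {eB' : Enc B'} (f : A -> B)
    (f' : A -> B') : (forall x, enc (f x) = enc (f' x)) -> P f' -> P f.
Proof.
move=> E [p [t [pt rp H]]]; exists p, t; split=> // b st x sb xb.
by rewrite E; exact: H.
Qed.

Lemma P_behead {X A} {eX : Enc X} {eA : Enc A} (l : X -> seq A) :
  P l -> P (fun x => behead (l x)).
Proof. by apply: P_comp; apply: P_cdr => -[]. Qed.

Lemma P_head {X A} {eX : Enc X} {eA : Enc A} (a : A) (l : X -> seq A) :
  P l -> P (fun x => head a (l x)).
Proof.
move=> Pl; apply: (P_recast (f' := fun x => if isCons (enc (l x))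
  then car (enc (l x)) else enc a)); first by move=> x; case: (l x).
apply: P_ifCons => //; last exact: P_cst.
by apply: (P_comp (g := fun s : seq A => car (enc s)) _ Pl); exact: P_car.
Qed.

Lemma P_isnil {X A} {eX : Enc X} {eA : Enc A} (l : X -> seq A) :
  P l -> P (fun x => nilp (l x)).
Proof.
move=> Pl; apply: P_ext (P_ifCons Pl (P_cst false) (P_cst true)) => x.
by case: (l x).
Qed.

Lemma P_seqcase {X A B} {eX : Enc X} {eA : Enc A} {eB : Enc B} (l : X -> seq A)
    (f : X -> A -> seq A -> B) (g : X -> B) :
  P l -> P (fun p : X * (A * seq A) => f p.1 p.2.1 p.2.2) -> P g ->
  P (fun x => match l x with a :: l' => f x a l' | [::] => g x end).
Proof.
have [[a]|nA] := pselect (inhabited A); last first.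
  by move=> _ _ Pg; apply: P_ext Pg => x; case: (l x) => [//|a ?]; case: nA.
move=> Pl Pf Pg.
apply: P_ext (P_ifCons Pl (P_comp (f := fun x => (x, (head a (l x), behead (l x)))) Pf _) Pg).
  by move=> x; case: (l x).
apply: P_pair P_id (P_pair _ _); first exact: P_head.
exact: P_behead.
Qed.

Lemma P_symcase {X B} {eX : Enc X} {eB : Enc B} (o : X -> sym) (f : X -> bool -> B)
    (g : X -> B) : P o -> P (fun p : X * bool => f p.1 p.2) -> P g ->
  P (fun x => match o x with Some a => f x a | None => g x end).
Proof.
move=> Po Pf Pg; apply: P_ext (P_ifCons Po
  (P_comp (f := fun x => (x, odflt false (o x))) Pf _) Pg).
  by move=> x; case: (o x) => [[]|].
by apply: P_pair P_id _; apply: (P_comp _ Po); apply: P_car => -[[]|].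
Qed.

Lemma esz_pair {A B} {eA : Enc A} {eB : Enc B} (a : A) (b : B) :
  esz (a, b) = (esz a + esz b).+1.
Proof. by rewrite /esz /= dsz_Cons. Qed.
Lemma esz_cons {A} {eA : Enc A} (a : A) l : esz (a :: l) = (esz a + esz l).+1.
Proof. by rewrite /esz /= dsz_Cons. Qed.

Section Sizes.
Context {A B : Type} {eA : Enc A} {eB : Enc B}.
Implicit Types (l : seq A).

Lemma esz_cat l l' : (esz (l ++ l')).+1 = esz l + esz l'.
Proof. by elim: l => [//|a l IH]; rewrite cat_cons !esz_cons; lia. Qed.
Lemma esz_rev l : esz (rev l) = esz l.
Proof.
elim: l => // a l IH; rewrite rev_cons -cats1 esz_cons -IH.
have := esz_cat (rev l) [:: a]; rewrite [esz [:: a]]esz_cons.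
by rewrite (_ : esz [::] = 1) //; lia.
Qed.
Lemma size_le_esz l : size l < esz l.
Proof. by elim: l => [//|a l IH]; rewrite esz_cons /=; lia. Qed.
Lemma esz_take n l : esz (take n l) <= esz l.
Proof.
elim: l n => [//|a l IH] [|n]; rewrite ?take_cons ?take0 ?esz_cons; first by rewrite /esz.
by have := IH n; lia.
Qed.
Lemma esz_drop n l : esz (drop n l) <= esz l.
Proof.
by elim: l n => [//|a l IH] [|n]; rewrite ?drop0 // drop_cons esz_cons; have := IH n; lia.
Qed.
Lemma esz_filter (p : pred A) l : esz (filter p l) <= esz l.
Proof. by elim: l => //= a l IH; case: (p a); rewrite ?esz_cons; lia. Qed.
Lemma esz_map (f : A -> B) N M l : (forall a, esz a <= N -> esz (f a) <= M) ->
  esz l <= N -> esz (map f l) <= size l * M.+1 + 1.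
Proof.
move=> H; elim: l => [//|a l IH]; rewrite map_cons !esz_cons /= => lN.
have := H a; have := IH; nia.
Qed.
Lemma esz_seq_le M l : (forall k (a : A), k < size l -> esz (nth a l k) <= M) ->
  esz l <= size l * M.+1 + 1.
Proof.
elim: l => [//|a l IH] H; rewrite esz_cons /=; have := H 0 a erefl => /= ?.
have := IH (fun k b kl => H k.+1 b kl); nia.
Qed.
End Sizes.

(** Iterates a step that consumes the head of the list. The counter is the size of the code of the
    list, which exceeds its length; the surplus steps are idle. *)
Lemma P_foldl {X A B} {eX : Enc X} {eA : Enc A} {eB : Enc B} (f : X -> B -> A -> B)
    (z : X -> B) (l : X -> seq A) :
  P (fun p : X * (B * A) => f p.1 p.2.1 p.2.2) -> P z -> P l ->
  (exists c k, forall x n, esz (foldl (f x) (z x) (take n (l x))) <= pm c k (esz x)) ->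
  P (fun x => foldl (f x) (z x) (l x)).
Proof.
move=> Pf Pz Pl [c [k bd]]; have [c' [k' sl]] := P_size Pl.
pose h (s : X * (seq A * B)) :=
  match s.2.1 with a :: r => (s.1, (r, f s.1 s.2.2 a)) | [::] => s end.
have Ph : P h.
  apply: (P_seqcase (f := fun (s : X * (seq A * B)) a r => (s.1, (r, f s.1 s.2.2 a)))).
  - exact: P_fst (P_snd P_id).
  - apply: P_pair; first exact: P_fst (P_fst P_id).
    apply: P_pair; first exact: P_snd (P_snd P_id).
    apply: (P_comp (f := fun p : (X * (seq A * B)) * (A * seq A) =>
      (p.1.1, (p.1.2.2, p.2.1))) Pf).
    apply: P_pair; first exact: P_fst (P_fst P_id).
    apply: P_pair; first exact: P_snd (P_snd (P_fst P_id)).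
    exact: P_fst (P_snd P_id).
  - exact: P_id.
have hE x n l0 z0 : iter n h (x, (l0, z0)) =
    (x, (drop n l0, foldl (f x) z0 (take n l0))).
  elim: n l0 z0 => [|n IH] l0 z0; first by rewrite drop0 take0.
  rewrite iterSr /h /=; case: l0 => [|a l0] /=; last by rewrite -IH.
  by have := IH [::] z0; rewrite drop_oversize // take_oversize.
have Pi : P (fun x => iter (esz (l x)) h (x, (l x, z x))).
  apply: (P_iter Ph _ Pl); first exact: P_pair P_id (P_pair Pl Pz).
  have [d [m dP]] : polyb (fun n => n + pm c' k' n + pm c k n + 2) by polyb_tac.
  exists d, m => x i; rewrite hE 2!esz_pair; apply: leq_trans (dP _).
  pose proof (bd x i); pose proof (sl x); pose proof (esz_drop i (l x)); lia.
apply: P_ext (P_snd (P_snd Pi)) => x; rewrite hE /=; congr foldl.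
by rewrite take_oversize //; apply/ltnW/size_le_esz.
Qed.

Lemma foldl_cons_map {A B} (f : A -> B) z l :
  foldl (fun acc a => f a :: acc) z l = catrev (map f l) z.
Proof. by elim: l z => //= a l IH z; rewrite IH. Qed.

Lemma P_catrev {X A} {eX : Enc X} {eA : Enc A} (l m : X -> seq A) :
  P l -> P m -> P (fun x => catrev (l x) (m x)).
Proof.
move=> Pl Pm; have [c [k sl]] := P_size Pl; have [c' [k' sm]] := P_size Pm.
apply: (P_ext (f := fun x => foldl (fun acc a => a :: acc) (m x) (l x))).
  by move=> x; rewrite (foldl_cons_map id) map_id.
apply: (P_foldl (f := fun _ acc a => a :: acc)) => //.
  apply: P_cons; first exact: P_snd (P_snd P_id).
  exact: P_fst (P_snd P_id).
have [d [n dP]] : polyb (fun n => pm c k n + pm c' k' n) by polyb_tac.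
exists d, n => x i; rewrite (foldl_cons_map id) map_id catrevE.
apply: leq_trans (dP _); pose proof (esz_cat (rev (take i (l x))) (m x)) as H.
rewrite esz_rev in H; pose proof (esz_take i (l x)); pose proof (sl x); pose proof (sm x); lia.
Qed.

Lemma P_rev {X A} {eX : Enc X} {eA : Enc A} (l : X -> seq A) :
  P l -> P (fun x => rev (l x)).
Proof. by move=> Pl; apply: P_catrev => //; apply: P_cst. Qed.

Lemma P_cat {X A} {eX : Enc X} {eA : Enc A} (l m : X -> seq A) :
  P l -> P m -> P (fun x => l x ++ m x).
Proof.
move=> Pl Pm; apply: P_ext (P_catrev (P_rev Pl) Pm) => x.
by rewrite catrevE revK.
Qed.

Lemma P_map {X A B} {eX : Enc X} {eA : Enc A} {eB : Enc B} (f : X -> A -> B)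
    (l : X -> seq A) :
  P (fun p : X * A => f p.1 p.2) -> P l -> P (fun x => map (f x) (l x)).
Proof.
move=> Pf Pl; have [c [k sl]] := P_size Pl; have [c' [k' sf]] := P_size Pf.
have Pfo : P (fun x => foldl (fun acc a => f x a :: acc) [::] (l x)).
  apply: (P_foldl (f := fun x acc a => f x a :: acc)) => //; last 1 first.
  - have [d [n dP]] : polyb (fun n => pm c k n * (pm c' k' (n + pm c k n + 1) + 1) + 1).
      by polyb_tac.
    exists d, n => x i; rewrite foldl_cons_map -/(rev _) esz_rev.
    apply: leq_trans (dP _); apply: leq_trans (esz_map (N := pm c k (esz x))
      (M := pm c' k' (esz x + pm c k (esz x) + 1)) _ _) _.
    + move=> a aN; apply: leq_trans (sf (x, a)) _.
      by apply: pm_mono; rewrite esz_pair addn1 ltnS leq_add2l.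
    + exact: leq_trans (esz_take _ _) (sl x).
    + rewrite leq_add2r leq_mul ?addn1 //.
      apply: leq_trans (sl x); apply: leq_trans (ltnW (size_le_esz _)).
      by rewrite size_take_min; lia.
  - apply: P_cons; last exact: P_fst (P_snd P_id).
    apply: (P_comp (f := fun p : X * (seq B * A) => (p.1, p.2.2)) Pf).
    by apply: P_pair; [exact: P_fst P_id|exact: P_snd (P_snd P_id)].
  - exact: P_cst.
by apply: P_ext (P_rev Pfo) => x; rewrite foldl_cons_map revK.
Qed.

Lemma P_filter {X A} {eX : Enc X} {eA : Enc A} (p : X -> A -> bool) (l : X -> seq A) :
  P (fun q : X * A => p q.1 q.2) -> P l -> P (fun x => filter (p x) (l x)).
Proof.
move=> Pp Pl; have [c [k sl]] := P_size Pl.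
have E (q : pred A) s z : foldl (fun acc a => if q a then a :: acc else acc) z s =
    catrev (filter q s) z.
  by elim: s z => //= a s IH z; rewrite IH; case: (q a).
have Pfo : P (fun x => foldl (fun acc a => if p x a then a :: acc else acc) [::] (l x)).
  apply: (P_foldl (f := fun x acc a => if p x a then a :: acc else acc)) => //.
  - apply: P_if; [|apply: P_cons|]; last exact: P_fst (P_snd P_id).
    + apply: (P_comp (f := fun q : X * (seq A * A) => (q.1, q.2.2)) Pp).
      by apply: P_pair; [exact: P_fst P_id|exact: P_snd (P_snd P_id)].
    + exact: P_snd (P_snd P_id).
    + exact: P_fst (P_snd P_id).
  - exact: P_cst.
  exists c, k => x i; rewrite E -/(rev _) esz_rev; apply: leq_trans (sl x).
  exact: leq_trans (esz_filter _ _) (esz_take _ _).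
by apply: P_ext (P_rev Pfo) => x; rewrite E revK.
Qed.

Lemma P_has {X A} {eX : Enc X} {eA : Enc A} (p : X -> A -> bool) (l : X -> seq A) :
  P (fun q : X * A => p q.1 q.2) -> P l -> P (fun x => has (p x) (l x)).
Proof.
move=> Pp Pl; apply: P_ext (P_negb (P_isnil (P_filter Pp Pl))) => x.
by rewrite has_count -size_filter /nilp lt0n.
Qed.

Lemma P_all {X A} {eX : Enc X} {eA : Enc A} (p : X -> A -> bool) (l : X -> seq A) :
  P (fun q : X * A => p q.1 q.2) -> P l -> P (fun x => all (p x) (l x)).
Proof.
move=> Pp Pl; apply: P_ext (P_negb (P_has (p := fun x a => ~~ p x a) (P_negb Pp) Pl)) => x.
by elim: (l x) => //= a s <-; case: (p x a).
Qed.

Lemma P_flatten {X A} {eX : Enc X} {eA : Enc A} (l : X -> seq (seq A)) :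
  P l -> P (fun x => flatten (l x)).
Proof.
move=> Pl; have [c [k sl]] := P_size Pl.
have E (s : seq (seq A)) z : foldl cat z s = z ++ flatten s.
  by elim: s z => [|a s IH] z /=; rewrite ?cats0 // IH catA.
apply: (P_ext (f := fun x => foldl (fun acc a => acc ++ a) [::] (l x))).
  by move=> x; rewrite E.
apply: (P_foldl (f := fun _ acc a => acc ++ a)) => //.
- by apply: P_cat; [exact: P_fst (P_snd P_id)|exact: P_snd (P_snd P_id)].
- exact: P_cst.
exists c, k => x i; rewrite E; apply: leq_trans (sl x); apply: leq_trans (esz_take i _).
rewrite cat0s; elim: (take i (l x)) => [//|a s IH]; rewrite esz_cons /=; pose proof (esz_cat a (flatten s)); lia.
Qed.

Lemma P_foldr {X A B} {eX : Enc X} {eA : Enc A} {eB : Enc B} (f : X -> A -> B -> B)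
    (z : X -> B) (l : X -> seq A) :
  P (fun p : X * (A * B) => f p.1 p.2.1 p.2.2) -> P z -> P l ->
  (exists c k, forall x n, esz (foldr (f x) (z x) (drop n (l x))) <= pm c k (esz x)) ->
  P (fun x => foldr (f x) (z x) (l x)).
Proof.
move=> Pf Pz Pl [c [k bd]].
have E x s : foldr (f x) (z x) s = foldl (fun b a => f x a b) (z x) (rev s).
  by rewrite foldl_rev.
apply: (P_ext (f := fun x => foldl (fun b a => f x a b) (z x) (rev (l x)))).
  by move=> x; rewrite E.
apply: (P_foldl (f := fun x b a => f x a b)) => //; last 2 first.
- exact: P_rev.
- by exists c, k => x n; rewrite take_rev -E.
apply: (P_comp (f := fun p : X * (B * A) => (p.1, (p.2.2, p.2.1))) Pf).
apply: P_pair; first exact: P_fst P_id.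
by apply: P_pair; [exact: P_snd (P_snd P_id)|exact: P_fst (P_snd P_id)].
Qed.

Ltac P_more := fail.
Ltac P_step := lazymatch goal with
  | |- P (fun x => x) => exact: P_id
  | |- P (fun _ => ?c) => exact: (P_cst c)
  | |- P (fun x => (@?f x).1) => apply: (P_fst (f := f))
  | |- P (fun x => (@?f x).2) => apply: (P_snd (f := f))
  | |- P (fun x => (@?f x, @?g x)) => apply: (P_pair (f := f) (g := g))
  | |- P (fun x => @?f x :: @?g x) => apply: (P_cons (a := f) (l := g))
  | |- P (fun x => @?b x && @?c x) => apply: (P_andb (b := b) (c := c))
  | |- P (fun x => @?b x || @?c x) => apply: (P_orb (b := b) (c := c))
  | |- P (fun x => @?b x (+) @?c x) => apply: (P_addb (b := b) (c := c))
  | |- P (fun x => ~~ @?b x) => apply: (P_negb (b := b))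
  | |- P (fun x => @?f x ++ @?g x) => apply: (P_cat (l := f) (m := g))
  | |- P (fun x => rev (@?f x)) => apply: (P_rev (l := f))
  | |- P (fun x => behead (@?f x)) => apply: (P_behead (l := f))
  | |- P (fun x => head ?a (@?f x)) => apply: (P_head a (l := f))
  | |- P (fun x => nilp (@?f x)) => apply: (P_isnil (l := f))
  | |- P (fun x => flatten (@?f x)) => apply: (P_flatten (l := f))
  | |- P (fun x => map (@?f x) (@?l x)) => apply: (P_map (f := f) (l := l)); cbv beta
  | |- P (fun x => filter (@?f x) (@?l x)) => apply: (P_filter (p := f) (l := l)); cbv beta
  | |- P (fun x => has (@?f x) (@?l x)) => apply: (P_has (p := f) (l := l)); cbv beta
  | |- P (fun x => all (@?f x) (@?l x)) => apply: (P_all (p := f) (l := l)); cbv beta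
  | |- P (fun x => if _ then _ else _) => apply: P_if
  | |- P fst => exact: (P_fst P_id)
  | |- P snd => exact: (P_snd P_id)
  | |- _ => P_more
  end.
Ltac P_auto := repeat first [assumption | P_step].

Import Order.TTheory GRing.Theory Num.Theory.

(** * Binary arithmetic *)

Fixpoint bits_rec k n :=
  if k is k'.+1 then if n == 0 then [::] else odd n :: bits_rec k' n./2 else [::].
Definition bits n := bits_rec n n.
Definition bval (s : seq bool) := foldr (fun (b : bool) n => b + n.*2) 0 s.
(** Drops the zeros at the most significant end, which restores the canonical form [bits]. *)
Definition trim (s : seq bool) :=
  foldr (fun b acc => if ~~ b && nilp acc then [::] else b :: acc) [::] s.

Lemma bits_recE k n : n <= k -> bits_rec k n = bits n.
Proof.
rewrite /bits; elim: n {-2}n (leqnn n) k => [|m IH] n nm k nk.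
  by move: nm; rewrite leqn0 => /eqP ->; case: k {nk}.
case: n nm nk => [|n] nm nk; first by case: k {nk}.
case: k nk => // k nk /=; congr (_ :: _).
have h : n.+1./2 <= n by lia.
by rewrite !(IH (uphalf n)) //; lia.
Qed.

Lemma bitsE n : bits n = if n == 0 then [::] else odd n :: bits n./2.
Proof. by case: n => // n; rewrite /bits /=; congr (_ :: _); apply: bits_recE; lia. Qed.

Lemma bitsK : cancel bits bval.
Proof.
move=> n; elim: n {-2}n (leqnn n) => [|m IH] n nm.
  by move: nm; rewrite leqn0 => /eqP ->.
rewrite bitsE; case: eqP => [->//|n0] /=; rewrite IH; last by lia.
exact: odd_double_half.
Qed.

Lemma bits_bval s : bits (bval s) = trim s.
Proof.
elim: s => [//|b s IH] /=; rewrite -IH bitsE.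
have -> : nilp (bits (bval s)) = (bval s == 0) by rewrite bitsE; case: eqP.
have -> : odd (b + (bval s).*2) = b by rewrite oddD odd_double addbF; case: b.
have -> : (b + (bval s).*2)./2 = bval s by rewrite halfD odd_double doubleK; case: b.
by case: b => //=; rewrite double_eq0; case: eqP => //= ->.
Qed.

Lemma bval_lt s : bval s < 2 ^ size s.
Proof. by elim: s => //= b s IH; rewrite expnS; case: b => /=; lia. Qed.

Lemma size_bits n k : n < 2 ^ k -> size (bits n) <= k.
Proof.
elim: k n => [|k IH] n; first by rewrite ltnS leqn0 => /eqP ->.
rewrite expnS => nk; rewrite bitsE; case: eqP => //= _; rewrite ltnS IH //.
by lia.
Qed.

#[global] Instance Enc_nat : Enc nat := fun n => enc (bits n).

Lemma esz_nat n k : n < 2 ^ k -> esz n <= 4 * k + 1.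
Proof.
move=> /size_bits; rewrite /esz /enc /Enc_nat -/(esz (bits n)).
elim: (bits n) k => [|b s IH] k /=; first by move=> _; exact: leq_addl.
case: k => // k /IH; rewrite esz_cons; have : esz b <= 3 by case: b.
lia.
Qed.

Lemma ltn_esz (n : nat) : n < 2 ^ esz n.
Proof.
rewrite -{1}(bitsK n); apply: leq_trans (bval_lt _) _; rewrite leq_exp2l //.
exact: ltnW (size_le_esz _).
Qed.

Lemma P_trim {X} {eX : Enc X} (s : X -> seq bool) : P s -> P (fun x => trim (s x)).
Proof.
move=> Ps; have [c [k bd]] := P_size Ps.
apply: (P_foldr (f := fun _ b acc => if ~~ b && nilp acc then [::] else b :: acc)) => //.
- apply: P_if.
  + apply: P_andb; first exact: P_negb (P_fst (P_snd P_id)).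
    exact: P_isnil (P_snd (P_snd P_id)).
  + exact: P_cst.
  + by apply: P_cons; [exact: P_fst (P_snd P_id)|exact: P_snd (P_snd P_id)].
- exact: P_cst.
exists c, k => x n; apply: leq_trans (bd x); apply: leq_trans (esz_drop n _).
elim: (drop n (s x)) => //= b t IH; rewrite esz_cons.
by case: ifP => _; [|rewrite esz_cons; lia].
Qed.

Lemma P_bits {X} {eX : Enc X} (n : X -> nat) : P n -> P (fun x => bits (n x)).
Proof. by apply: P_comp; exact: P_cast. Qed.

Lemma P_bval {X} {eX : Enc X} (s : X -> seq bool) : P s -> P (fun x => bval (s x)).
Proof.
by move=> /P_trim; apply: P_recast => x; rewrite -bits_bval.
Qed.

Section Adder.
Let S := (bool * (seq bool * (seq bool * seq bool)))%type.
Variable car : bool -> bool -> bool -> bool.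

(** The state holds the carry, the two remaining operands and the output, latest bit first. The
    output bit is the same for sums and differences; only the function [car] differs, so one machine
    does both. *)
Definition bstep (s : S) : S :=
  let x := head false s.2.1 in let y := head false s.2.2.1 in
  (car s.1 x y, (behead s.2.1, (behead s.2.2.1, (x (+) y (+) s.1) :: s.2.2.2))).
Definition brun (a b : seq bool) : S :=
  foldl (fun s (_ : bool) => bstep s) (false, (a, (b, [::]))) (a ++ false :: b).

Lemma foldl_bstep l s : foldl (fun s (_ : bool) => bstep s) s l = iter (size l) bstep s.
Proof. by elim: l s => //= a l IH s; rewrite IH -iterSr. Qed.

Lemma bstep_rest n c a b o : let s := iter n bstep (c, (a, (b, o))) in
  [/\ s.2.1 = drop n a, s.2.2.1 = drop n b & size s.2.2.2 = n + size o].
Proof.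
elim: n => [|n [/= -> -> IH]]; first by rewrite !drop0.
by rewrite -!drop1 !drop_drop !add1n IH addSn.
Qed.

Lemma P_brun {X} {eX : Enc X} (a b : X -> seq bool) :
  P (fun p : bool * (bool * bool) => car p.1 p.2.1 p.2.2) ->
  P a -> P b -> P (fun x => brun (a x) (b x)).
Proof.
move=> Pc Pa Pb; have [c [k sa]] := P_size Pa; have [d [l sb]] := P_size Pb.
apply: (P_foldl (f := fun _ s _ => bstep s)).
- apply: (P_comp (f := fun p : X * (S * bool) => p.2.1)); last exact: P_fst (P_snd P_id).
  rewrite /bstep; apply: P_pair; last by cbv beta; P_auto.
  apply: (P_comp (f := fun s : S => (s.1, (head false s.2.1, head false s.2.2.1))) Pc).
  by P_auto.
- by apply: P_pair (P_cst _) (P_pair Pa (P_pair Pb (P_cst _))).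
- by apply: P_cat Pa (P_cons (P_cst _) Pb).
have [e [m eP]] : polyb (fun n => 10 * (pm c k n + pm d l n + 2)) by polyb_tac.
exists e, m => x n; apply: leq_trans (eP _); rewrite foldl_bstep.
set i := size _; have il : i <= size (a x) + size (b x) + 1.
  by rewrite /i size_take_min size_cat /=; lia.
have := bstep_rest i false (a x) (b x) [::].
case: (iter _ _ _) => c0 [a0 [b0 o0]] /= [-> -> E].
rewrite !esz_pair; pose proof (sa x); pose proof (sb x).
pose proof (esz_drop i (a x)); pose proof (esz_drop i (b x)).
pose proof (size_le_esz (a x)); pose proof (size_le_esz (b x)).
have : esz c0 <= 3 by case: (c0).
have : esz o0 <= 4 * size o0 + 1.
  elim: (o0) => // b1 s IH; rewrite esz_cons /=; have : esz b1 <= 3 by case: (b1).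
  lia.
by rewrite E addn0; lia.
Qed.
End Adder.

Definition maj (c x y : bool) := (x && y) || (c && (x || y)).
(** The borrow of a subtraction, as [maj] is the carry of an addition. *)
Definition bor (c x y : bool) := (~~ x && (y || c)) || (y && c).

Lemma bval_cat s t : bval (s ++ t) = bval s + 2 ^ size s * bval t.
Proof. by elim: s => [|b s IH] /=; rewrite ?mul1n // IH expnS; lia. Qed.

Lemma bval_head s : bval s = head false s + (bval (behead s)).*2.
Proof. by case: s. Qed.

Lemma brun_end car a b : let s := brun car a b in
  [/\ s.2.1 = [::], s.2.2.1 = [::] & size s.2.2.2 = size a + size b + 1].
Proof.
rewrite /brun foldl_bstep; case: (bstep_rest car (size (a ++ false :: b)) false a b [::]).
move=> -> -> ->; rewrite size_cat /= addn0 !drop_oversize //; try lia.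
by split=> //; lia.
Qed.

Lemma addn_brun m n : m + n = bval (rev (brun maj (bits m) (bits n)).2.2.2).
Proof.
set s := brun _ _ _.
have I k : let t := iter k (bstep maj) (false, (bits m, (bits n, [::]))) in
    bval (rev t.2.2.2) + 2 ^ size t.2.2.2 * (t.1 + bval t.2.1 + bval t.2.2.1) = m + n.
  elim: k => [|k IH] /=; first by rewrite !bitsK; lia.
  rewrite -{}IH; case: (iter _ _ _) => c [a [b o]] /=.
  rewrite rev_cons -cats1 bval_cat size_rev expnS /= (bval_head a) (bval_head b).
  by rewrite /maj; case: c (head _ a) (head _ b) => [] [] [] /=; lia.
have [E1 E2 _] := brun_end maj (bits m) (bits n).
have := I (size (bits m ++ false :: bits n)); rewrite -foldl_bstep -/(brun _ _ _) -/s /=.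
rewrite E1 E2 => <-.
(* the last step consumed only zeroes, so no carry remains *)
suff -> : s.1 = false by rewrite muln0 addn0.
have := I (size (bits m) + size (bits n)).
rewrite /s /brun foldl_bstep size_cat /= addnS iterS.
case: (bstep_rest maj (size (bits m) + size (bits n)) false (bits m) (bits n) [::]).
case: (iter _ _ _) => c [a [b o]] /= -> -> _ _.
rewrite !drop_oversize /=; try lia.
by rewrite /maj; case: c.
Qed.

(** A borrow left at the end signals [m < n], where the truncated difference is 0. *)
Lemma subn_brun m n : m - n = let s := brun bor (bits m) (bits n) in
  if s.1 then 0 else bval (rev s.2.2.2).
Proof.
set s := brun _ _ _.
have I k : let t := iter k (bstep bor) (false, (bits m, (bits n, [::]))) in
    bval (rev t.2.2.2) + 2 ^ size t.2.2.2 * bval t.2.1 + n =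
    m + 2 ^ size t.2.2.2 * (t.1 + bval t.2.2.1).
  elim: k => [|k] /=; first by rewrite !bitsK; lia.
  case: (iter _ _ _) => c [a [b o]] /=.
  rewrite rev_cons -cats1 bval_cat size_rev expnS /= (bval_head a) (bval_head b).
  by rewrite /bor; case: c (head _ a) (head _ b) => [] [] [] /=; lia.
have [E1 E2 E3] := brun_end bor (bits m) (bits n).
have := I (size (bits m ++ false :: bits n)); rewrite -foldl_bstep -/(brun _ _ _) -/s /=.
rewrite E1 E2 /=; have := bval_lt (rev s.2.2.2); rewrite size_rev.
by case: (s.1); lia.
Qed.

Lemma P_addn {X} {eX : Enc X} (m n : X -> nat) : P m -> P n -> P (fun x => m x + n x).
Proof.
move=> Pm Pn; apply: (P_ext (fun x => esym (addn_brun (m x) (n x)))).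
apply: P_bval; apply: P_rev; apply: P_snd; apply: P_snd; apply: P_snd.
apply: P_brun; [|exact: P_bits|exact: P_bits].
rewrite /maj; P_auto.
Qed.

Lemma P_subn {X} {eX : Enc X} (m n : X -> nat) : P m -> P n -> P (fun x => m x - n x).
Proof.
move=> Pm Pn; apply: (P_ext (fun x => esym (subn_brun (m x) (n x)))) => /=.
have Pb : P (fun x => brun bor (bits (m x)) (bits (n x))).
  apply: P_brun; [|exact: P_bits|exact: P_bits].
  by rewrite /bor; P_auto.
apply: P_if; [exact: P_fst|exact: P_cst|].
exact: P_bval (P_rev (P_snd (P_snd (P_snd Pb)))).
Qed.

Lemma P_leq {X} {eX : Enc X} (m n : X -> nat) : P m -> P n -> P (fun x => m x <= n x).
Proof.
move=> Pm Pn; apply: P_ext (P_isnil (P_bits (P_subn Pm Pn))) => x.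
by rewrite /leq bitsE; case: eqP.
Qed.

Lemma P_succ {X} {eX : Enc X} (n : X -> nat) : P n -> P (fun x => (n x).+1).
Proof.
by move=> Pn; apply: P_ext (P_addn Pn (P_cst 1)) => x; rewrite addn1.
Qed.

Lemma P_eqn {X} {eX : Enc X} (m n : X -> nat) : P m -> P n -> P (fun x => m x == n x).
Proof.
by move=> Pm Pn; apply: P_ext (P_andb (P_leq Pm Pn) (P_leq Pn Pm)) => x; rewrite eqn_leq.
Qed.

(** Shift and add: the first component is [n] doubled once for each bit of [m] already read. *)
Lemma muln_foldl m n : m * n =
  (foldl (fun (s : nat * nat) (b : bool) => (s.1 + s.1, if b then s.2 + s.1 else s.2))
    (n, 0) (bits m)).2.
Proof.
have I l k a : (foldl (fun (s : nat * nat) (b : bool) =>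
    (s.1 + s.1, if b then s.2 + s.1 else s.2)) (k, a) l).2 = a + bval l * k.
  elim: l k a => [|b l IH] k a /=; first by rewrite addn0.
  by rewrite IH; case: b; lia.
by rewrite I bitsK.
Qed.

Lemma P_muln {X} {eX : Enc X} (m n : X -> nat) : P m -> P n -> P (fun x => m x * n x).
Proof.
move=> Pm Pn; apply: (P_ext (fun x => esym (muln_foldl (m x) (n x)))).
have [c [k sm]] := P_size Pm; have [d [l sn]] := P_size Pn.
apply: P_snd; apply: (P_foldl (f := fun _ (s : nat * nat) (b : bool) =>
  (s.1 + s.1, if b then s.2 + s.1 else s.2))).
- have P1 : P (fun p : X * ((nat * nat) * bool) => p.2.1.1) by exact: P_fst (P_fst (P_snd P_id)).
  have P2 : P (fun p : X * ((nat * nat) * bool) => p.2.1.2) by exact: P_snd (P_fst (P_snd P_id)).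
  apply: P_pair (P_addn P1 P1) (P_if (P_snd (P_snd P_id)) (P_addn P2 P1) P2).
- exact: P_pair Pn (P_cst _).
- exact: P_bits.
have I s i a : let t := foldl (fun (s : nat * nat) (b : bool) =>
    (s.1 + s.1, if b then s.2 + s.1 else s.2)) (i, a) s in
    t.1 = i * 2 ^ size s /\ t.2 + i <= a + i * 2 ^ size s.
  elim: s i a => [|b s IH] i a /=; first by rewrite muln1; lia.
  have := IH (i + i) (if b then a + i else a); rewrite expnS => -[-> H].
  by split; first lia; case: b H => H; lia.
have [e [q eP]] : polyb (fun n => 16 * (pm c k n + pm d l n + 2)) by polyb_tac.
exists e, q => x i; apply: leq_trans (eP _); set s := take i _.
have ss : size s <= pm c k (esz x).
  apply: leq_trans (sm x); rewrite /esz /enc /Enc_nat -/(esz (bits (m x))).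
  apply: leq_trans (ltnW (size_le_esz _)); rewrite size_take_min; lia.
have [] := I s (n x) 0; case: (foldl _ _ _) => t1 t2 /= -> H0.
have H : t2 <= n x * 2 ^ size s by lia.
rewrite esz_pair.
have B : n x * 2 ^ size s < 2 ^ (pm d l (esz x) + pm c k (esz x)).
  apply: (@leq_trans (2 ^ esz (n x) * 2 ^ size s)).
    by rewrite ltn_mul2r expn_gt0 /= ltn_esz.
  by rewrite -expnD leq_exp2l // leq_add // sn.
pose proof (esz_nat B) as B1; pose proof (esz_nat (leq_ltn_trans H B)) as B2.
lia.
Qed.

#[global] Instance Enc_int : Enc int := fun z => enc ((z < 0)%R, `|z|%N).
Definition mkint (b : bool) (n : nat) : int := (if b then - n%:Z else n%:Z)%R.

Lemma P_mkint {X} {eX : Enc X} (b : X -> bool) (n : X -> nat) :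
  P b -> P n -> P (fun x => mkint (b x) (n x)).
Proof.
move=> Pb Pn; have Pp : P (fun x => (b x && (0 < n x), n x)).
  by apply: (P_pair _ Pn); apply: (P_andb Pb); apply: P_leq => //; exact: P_cst.
apply: P_recast Pp => x; rewrite {1}/enc /Enc_int; congr (@enc (bool * nat) _ (_, _)).
  by rewrite /mkint; case: (b x) => /=; lia.
by rewrite /mkint; case: (b x); lia.
Qed.

Lemma P_absz {X} {eX : Enc X} (z : X -> int) : P z -> P (fun x => `|z x|%N).
Proof. by apply: P_comp; apply: P_cdr. Qed.

Lemma P_negz {X} {eX : Enc X} (z : X -> int) : P z -> P (fun x => (z x < 0)%R).
Proof. by apply: (P_comp (g := fun z : int => (z < 0)%R)); apply: P_car. Qed.

Lemma P_Posz {X} {eX : Enc X} (n : X -> nat) : P n -> P (fun x => Posz (n x)).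
Proof. by move=> Pn; apply: P_ext (P_mkint (P_cst false) Pn). Qed.

Lemma P_addz {X} {eX : Enc X} (a b : X -> int) : P a -> P b -> P (fun x => (a x + b x)%R).
Proof.
move=> Pa Pb; have Na := P_negz Pa; have Nb := P_negz Pb.
have Aa := P_absz Pa; have Ab := P_absz Pb.
apply: P_ext (P_if (P_addb Na Nb)
  (P_if (P_leq Aa Ab) (P_mkint Nb (P_subn Ab Aa)) (P_mkint Na (P_subn Aa Ab)))
  (P_mkint Na (P_addn Aa Ab))) => x.
rewrite /mkint; case: ltP => ?; case: ltP => ? /=; try case: leqP => ?; lia.
Qed.

Lemma P_oppz {X} {eX : Enc X} (a : X -> int) : P a -> P (fun x => (- a x)%R).
Proof.
move=> Pa; apply: P_ext (P_mkint (P_negb (P_negz Pa)) (P_absz Pa)) => x.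
by rewrite /mkint; case: ltP => ? /=; lia.
Qed.

Lemma P_mulz {X} {eX : Enc X} (a b : X -> int) : P a -> P b -> P (fun x => (a x * b x)%R).
Proof.
move=> Pa Pb.
apply: P_ext (P_mkint (P_addb (P_negz Pa) (P_negz Pb)) (P_muln (P_absz Pa) (P_absz Pb))) => x.
rewrite /mkint PoszM.
case: (ltP (a x)) => ha; case: (ltP (b x)) => hb /=.
- by rewrite !ltz0_abs // mulrNN.
- by rewrite ltz0_abs // gez0_abs // mulNr opprK.
- by rewrite gez0_abs // ltz0_abs // mulrN opprK.
- by rewrite !gez0_abs.
Qed.

Lemma P_ltz {X} {eX : Enc X} (a b : X -> int) : P a -> P b -> P (fun x => (a x < b x)%R).
Proof.
move=> Pa Pb; apply: P_ext (P_negz (P_addz Pa (P_oppz Pb))) => x.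
by rewrite subr_lt0.
Qed.

Lemma P_lez {X} {eX : Enc X} (a b : X -> int) : P a -> P b -> P (fun x => (a x <= b x)%R).
Proof. by move=> Pa Pb; apply: P_ext (P_negb (P_ltz Pb Pa)) => x; rewrite leNgt. Qed.

Lemma P_eqz {X} {eX : Enc X} (a b : X -> int) : P a -> P b -> P (fun x => a x == b x).
Proof. by move=> Pa Pb; apply: P_ext (P_andb (P_lez Pa Pb) (P_lez Pb Pa)) => x; rewrite eq_le. Qed.

Lemma P_eqb {X} {eX : Enc X} (a b : X -> bool) : P a -> P b -> P (fun x => a x == b x).
Proof. by move=> Pa Pb; apply: P_ext (P_negb (P_addb Pa Pb)) => x; case: (a x) (b x) => [] []. Qed.

Lemma esz_int (z : int) k : `|z| < 2 ^ k -> esz z <= 4 * k + 5.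
Proof.
move=> /esz_nat H; have -> : esz z = esz ((z < 0)%R, `|z|%N) by [].
by rewrite esz_pair; have : esz (z < 0)%R <= 3; [case: (z < 0)%R|lia].
Qed.

Lemma ltz_esz (z : int) : `|z| < 2 ^ esz z.
Proof.
apply: leq_trans (ltn_esz _) _; rewrite leq_exp2l //.
have -> : esz z = esz ((z < 0)%R, `|z|%N) by [].
by rewrite esz_pair; lia.
Qed.

(** Bounds the number and the size of the terms for all suffixes at once, which controls the partial
    sums and products below. *)
Lemma P_foldr_bd {X B} {A : Type} {eX : Enc X} {eA : Enc A} {eB : Enc B}
    (f : X -> A -> B) (l : X -> seq A) : P (fun p : X * A => f p.1 p.2) -> P l ->
  exists c k, forall x n, size (drop n (l x)) <= pm c k (esz x) /\
    forall m, m < size (drop n (l x)) -> forall a, esz (f x (nth a (drop n (l x)) m)) <= pm c k (esz x).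
Proof.
move=> Pf Pl; have [c [k sl]] := P_size Pl; have [d [m sf]] := P_size Pf.
have [e [q eP]] : polyb (fun n => pm c k n + pm d m (n + pm c k n + 1)) by polyb_tac.
exists e, q => x n; split.
  apply: leq_trans (eP _); apply: leq_trans (leq_addr _ _); apply: leq_trans (sl x).
  exact: leq_trans (ltnW (size_le_esz _)) (esz_drop _ _).
move=> i iL a; apply: leq_trans (eP _); apply: leq_trans (leq_addl _ _).
apply: leq_trans (sf (x, _)) _; apply: pm_mono; rewrite esz_pair addn1 ltnS leq_add2l.
apply: leq_trans (sl x); apply: leq_trans (esz_drop n _).
elim: (drop n (l x)) i iL => // b s IH [|i] iL; rewrite esz_cons /=; first lia.
by have := IH i iL; lia.
Qed.

Lemma P_sumz {X A} {eX : Enc X} {eA : Enc A} (f : X -> A -> int) (l : X -> seq A) :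
  P (fun p : X * A => f p.1 p.2) -> P l -> P (fun x => \sum_(a <- l x) f x a)%R.
Proof.
move=> Pf Pl; have [c [k H]] := P_foldr_bd Pf Pl.
have E x s : foldr (fun a z => f x a + z)%R 0%R s = (\sum_(a <- s) f x a)%R.
  by elim: s => [|a s IH]; rewrite ?big_nil ?big_cons //= IH.
apply: (P_ext (fun x => E x (l x))).
apply: (P_foldr (f := fun x a z => f x a + z)%R) => //; last 1 first.
- have [e [q eP]] : polyb (fun n => 4 * (pm c k n + pm c k n) + 5) by polyb_tac.
  exists e, q => x n; apply: leq_trans (eP _); apply: esz_int.
  have [Hs Hn] := H x n; move: Hs Hn; set N := pm c k _; move=> Hs Hn.
  apply: (@leq_ltn_trans (size (drop n (l x)) * 2 ^ N)); last first.
    rewrite expnD ltn_mul2r expn_gt0 /=.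
    by apply: leq_ltn_trans Hs _; apply: ltn_expl.
  elim: (drop n (l x)) Hn => [//|a s IH] Hn /=; rewrite mulSn.
  have := IH (fun m => Hn m.+1); have := Hn 0 erefl a => /= h0.
  have : `|f x a| <= 2 ^ N.
    by apply: ltnW; apply: leq_trans (ltz_esz _) _; rewrite leq_exp2l.
  lia.
- apply: P_addz; last exact: P_snd (P_snd P_id).
  by apply: (P_comp (f := fun p : X * (A * int) => (p.1, p.2.1)) Pf); P_auto.
- exact: P_cst.
Qed.

(** Bit lengths add up under multiplication: polynomially many factors of polynomial length. *)
Lemma P_prodn {X A} {eX : Enc X} {eA : Enc A} (f : X -> A -> nat) (l : X -> seq A) :
  P (fun p : X * A => f p.1 p.2) -> P l -> P (fun x => \prod_(a <- l x) f x a).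
Proof.
move=> Pf Pl; have [c [k H]] := P_foldr_bd Pf Pl.
have E x s : foldr (fun a z => f x a * z) 1 s = (\prod_(a <- s) f x a).
  by elim: s => [|a s IH]; rewrite ?big_nil ?big_cons //= IH.
apply: (P_ext (fun x => E x (l x))).
apply: (P_foldr (f := fun x a z => f x a * z)) => //; last 1 first.
- have [e [q eP]] : polyb (fun n => 4 * (pm c k n * pm c k n + 1) + 1) by polyb_tac.
  exists e, q => x n; apply: leq_trans (eP _); apply: esz_nat.
  have [Hs Hn] := H x n; move: Hs Hn; set N := pm c k _; move=> Hs Hn.
  apply: (@leq_ltn_trans (2 ^ (size (drop n (l x)) * N))); last first.
    by rewrite ltn_exp2l // addn1 ltnS leq_mul2r Hs orbT.
  elim: (drop n (l x)) Hn => [//|a s IH] Hn /=; rewrite mulSn expnD.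
  apply: leq_mul; last exact: (IH (fun m => Hn m.+1)).
  by apply: ltnW; apply: leq_trans (ltn_esz _) _; rewrite leq_exp2l //; exact: (Hn 0 erefl a).
- apply: P_muln; last exact: P_snd (P_snd P_id).
  by apply: (P_comp (f := fun p : X * (A * nat) => (p.1, p.2.1)) Pf); P_auto.
- exact: P_cst.
Qed.

Lemma P_sizen {X A} {eX : Enc X} {eA : Enc A} (l : X -> seq A) :
  P l -> P (fun x => size (l x)).
Proof.
move=> Pl; have [c [k sl]] := P_size Pl.
have E (s : seq A) n : foldl (fun n _ => n.+1) n s = size s + n.
  by elim: s n => //= a s IH n; rewrite IH addnS.
apply: (P_ext (f := fun x => foldl (fun n _ => n.+1) 0 (l x))).
  by move=> x; rewrite E addn0.
apply: (P_foldl (f := fun _ n _ => n.+1)) => //; [|exact: P_cst|].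
  by apply: P_succ; P_auto.
have [e [q eP]] : polyb (fun n => 4 * pm c k n + 1) by polyb_tac.
exists e, q => x n; apply: leq_trans (eP _); apply: esz_nat; rewrite E addn0.
apply: (@leq_ltn_trans (pm c k (esz x))); last exact: ltn_expl.
apply: leq_trans (sl x); apply: leq_trans (ltnW (size_le_esz _)).
by rewrite size_take_min; lia.
Qed.

Lemma P_iota {X A} {eX : Enc X} {eA : Enc A} (l : X -> seq A) :
  P l -> P (fun x => iota 0 (size (l x))).
Proof.
move=> Pl; have [c [k sl]] := P_size Pl.
pose st (s : nat * seq nat) := (s.1.+1, s.1 :: s.2).
have E (s : seq A) n z : foldl (fun t _ => st t) (n, z) s =
    (n + size s, catrev (iota n (size s)) z).
  by elim: s n z => [|a s IH] n z /=; rewrite ?addn0 // /st IH addSnnS.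
have P1 : P (fun x => foldl (fun t _ => st t) (0, [::]) (l x)).
  apply: (P_foldl (f := fun _ t _ => st t)) => //; [|exact: P_cst|].
    by rewrite /st; apply: P_pair; [apply: P_succ|]; P_auto.
  have [e [q eP]] : polyb (fun n => 4 * pm c k n + 1 +
      (pm c k n * (4 * pm c k n + 2) + 1) + 1) by polyb_tac.
  exists e, q => x n; apply: leq_trans (eP _); rewrite E esz_pair add0n.
  set m := size _; have mN : m <= pm c k (esz x).
    apply: leq_trans (sl x); apply: leq_trans (ltnW (size_le_esz _)).
    by rewrite /m size_take_min; lia.
  rewrite -/(rev _) esz_rev addn1 ltnS leq_add //.
    by apply: esz_nat; apply: (leq_ltn_trans mN); exact: ltn_expl.
  apply: leq_trans (esz_seq_le (M := 4 * pm c k (esz x) + 1) _) _.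
    move=> j a; rewrite size_iota => jm; rewrite nth_iota // add0n.
    by apply: esz_nat; apply: (@leq_ltn_trans (pm c k (esz x))); [lia|exact: ltn_expl].
  by rewrite size_iota leq_add2r leq_mul //; lia.
by apply: P_ext (P_rev (P_snd P1)) => x; rewrite E /= -/(rev _) revK.
Qed.

Lemma P_nth {X A} {eX : Enc X} {eA : Enc A} (d : A) (l : X -> seq A) (n : X -> nat) :
  P l -> P n -> P (fun x => nth d (l x) (n x)).
Proof.
move=> Pl Pn; have [c [k sl]] := P_size Pl; have [e [m sn]] := P_size Pn.
(* The counter is one more than the number of elements still to be skipped: 1 selects the current
   element, 0 means that the selection is over. *)
pose st (s : nat * A) a := (s.1 - 1, if s.1 == 1 then a else s.2).
have E s i z : foldl st (i, z) s = (i - size s, if 0 < i <= size s then nth d s i.-1 else z).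
  elim: s i z => [|a s IH] i z /=; first by rewrite subn0; case: i.
  by rewrite /st IH /= subn1; case: i => [|[|i]].
have P1 : P (fun x => foldl st ((n x).+1, d) (l x)).
  apply: (P_foldl (f := fun _ => st)) => //.
  - rewrite /st; apply: P_pair; first by apply: P_subn; P_auto.
    by apply: P_if; [apply: P_eqn| |]; P_auto.
  - by apply: P_pair (P_succ Pn) (P_cst d).
  have [f [q fP]] : polyb (fun n => 4 * (pm e m n + 1) + 1 + (pm c k n + esz d) + 1) by polyb_tac.
  exists f, q => x i; apply: leq_trans (fP _); rewrite E esz_pair.
  have B1 : esz ((n x).+1 - size (take i (l x))) <= 4 * (pm e m (esz x) + 1) + 1.
    apply: esz_nat; apply: leq_ltn_trans (leq_subr _ _) _.
    apply: (@leq_trans (2 ^ (esz (n x) + 1))); last by rewrite leq_exp2l // leq_add2r.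
    have := ltn_esz (n x); rewrite addn1 expnS; lia.
  have B2 : esz (if 0 < (n x).+1 <= size (take i (l x)) then nth d (take i (l x)) (n x).+1.-1
      else d) <= pm c k (esz x) + esz d.
    case: ifP => [/andP[_ h]|_]; last exact: leq_addl.
    apply: leq_trans (leq_addr _ _); apply: leq_trans (sl x).
    apply: leq_trans (esz_take i _); move: h; rewrite /=.
    elim: (take i (l x)) (n x) => // b s IH [|j] h; rewrite esz_cons /=; first lia.
    by have := IH j h; lia.
  lia.
apply: P_ext (P_snd P1) => x; rewrite E /=.
by case: ltnP => // h; rewrite nth_default.
Qed.

Lemma P_drop {X A} {eX : Enc X} {eA : Enc A} (l : X -> seq A) (n : X -> nat) :
  P l -> P n -> P (fun x => drop (n x) (l x)).
Proof.
move=> Pl Pn; have [c [k sl]] := P_size Pl; have [e [m sn]] := P_size Pn.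
pose st (s : nat * seq A) (a : A) := if s.1 == 0 then s else (s.1 - 1, behead s.2).
have E (s : seq A) i t : foldl st (i, t) s = (i - size s, drop (minn i (size s)) t).
  elim: s i t => [|a s IH] i t; first by rewrite /= subn0 minn0 drop0.
  rewrite [foldl _ _ _]/= /st /=; case: i => [|i] /=; first by rewrite IH sub0n !min0n drop0.
  by rewrite IH subn1 /= subSS minnSS -drop1 drop_drop addn1.
have P1 : P (fun x => foldl st (n x, l x) (l x)).
  apply: (P_foldl (f := fun _ => st)) => //.
  - rewrite /st; apply: P_if; first by apply: P_eqn; P_auto.
      by P_auto.
    by apply: P_pair; [apply: P_subn|]; P_auto.
  - by apply: P_pair.
  have [f [q fP]] : polyb (fun n => 4 * pm e m n + 1 + pm c k n + 1) by polyb_tac.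
  exists f, q => x i; apply: leq_trans (fP _); rewrite E esz_pair.
  have B1 : esz (n x - size (take i (l x))) <= 4 * pm e m (esz x) + 1.
    apply: esz_nat; apply: leq_ltn_trans (leq_subr _ _) _.
    by apply: leq_trans (ltn_esz _) _; rewrite leq_exp2l.
  pose proof (esz_drop (minn (n x) (size (take i (l x)))) (l x)); have := sl x; lia.
apply: P_ext (P_snd P1) => x; rewrite E /=; case: (leqP (n x) (size (l x))) => // h.
by rewrite !drop_oversize //; lia.
Qed.

Ltac P_more ::= lazymatch goal with
  | |- P (fun x => @?f x + @?g x) => apply: (P_addn (m := f) (n := g))
  | |- P (fun x => @?f x - @?g x) => apply: (P_subn (m := f) (n := g))
  | |- P (fun x => @?f x * @?g x) => apply: (P_muln (m := f) (n := g))
  | |- P (fun x => S (@?f x)) => apply: (P_succ (n := f))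
  | |- P (fun x => @?f x <= @?g x) => apply: (P_leq (m := f) (n := g))
  | |- P (fun x => (@?f x + @?g x)%R) => apply: (P_addz (a := f) (b := g))
  | |- P (fun x => (@?f x * @?g x)%R) => apply: (P_mulz (a := f) (b := g))
  | |- P (fun x => (- @?f x)%R) => apply: (P_oppz (a := f))
  | |- P (fun x => (@?f x <= @?g x)%R) => apply: (P_lez (a := f) (b := g))
  | |- P (fun x => (@?f x < @?g x)%R) => apply: (P_ltz (a := f) (b := g))
  | |- P (fun x => @?f x == @?g x) => first [apply: (P_eqn (m := f) (n := g))
       | apply: (P_eqz (a := f) (b := g)) | apply: (P_eqb (a := f) (b := g))]
  | |- P (fun x => Posz (@?f x)) => apply: (P_Posz (n := f))
  | |- P (fun x => size (@?f x)) => apply: (P_sizen (l := f))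
  | |- P (fun x => iota 0 (size (@?f x))) => apply: (P_iota (l := f))
  | |- P (fun x => nth ?d (@?l x) (@?n x)) => apply: (P_nth d (l := l) (n := n))
  | |- P (fun x => drop (@?n x) (@?l x)) => apply: (P_drop (l := l) (n := n))
  | |- P (fun x => bval (@?l x)) => apply: (P_bval (s := l))
  | |- P (fun x => mkint (@?b x) (@?n x)) => apply: (P_mkint (b := b) (n := n))
  | |- P (fun x => (\sum_(i <- @?l x) @?f x i)%R) =>
      apply: (P_sumz (f := f) (l := l)); cbv beta
  | |- P (fun x => \prod_(i <- @?l x) @?f x i) =>
      apply: (P_prodn (f := f) (l := l)); cbv beta
  end.

Local Open Scope ring_scope.

(** * The Faddeev-LeVerrier algorithm *)

Section FaddeevLeVerrier.
Variable R : comNzRingType.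

Lemma deriv_prod n (F : 'I_n -> {poly R}) :
  (\prod_i F i)^`() = \sum_i \prod_j (if j == i then (F j)^`() else F j).
Proof.
elim: n F => [|n IH] F; first by rewrite !big_ord0 derivC.
rewrite big_ord_recl derivM IH big_ord_recl big_ord_recl eqxx; congr (_ * _ + _).
rewrite mulr_sumr; apply: eq_bigr => i _; rewrite big_ord_recl (negbTE (neq_lift _ _)).
by congr (_ * _); apply: eq_bigr => j _; rewrite (inj_eq (@lift_inj _ _)).
Qed.

(** Jacobi's formula. The entrywise derivative of [xI - N] is the identity, so deriving row [i] of
    the determinant leaves the [i]-th principal cofactor. *)
Lemma deriv_char_poly n (N : 'M[R]_n) : (char_poly N)^`() = \tr (\adj (char_poly_mx N)).
Proof.
set A := char_poly_mx N.
pose B i := \matrix_(k, j) (if k == i then (i == j)%:R else A k j).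
transitivity (\sum_i \det (B i)).
  rewrite /char_poly /determinant raddf_sum exchange_big; apply: eq_bigr => s _ /=.
  rewrite -mulr_sumr -signr_odd; case: (odd _); rewrite ?expr1 ?expr0 ?mul1r ?mulN1r.
    rewrite derivN deriv_prod; congr (- _); apply: eq_bigr => i _.
    apply: eq_bigr => j _; rewrite !mxE; case: eqP => // ->.
    by rewrite derivB derivC subr0 derivMn derivX.
  rewrite deriv_prod; apply: eq_bigr => i _; apply: eq_bigr => j _.
  rewrite !mxE; case: eqP => // ->.
  by rewrite derivB derivC subr0 derivMn derivX.
apply: eq_bigr => i _; rewrite (expand_det_row _ i) (bigD1 i) //= big1 ?addr0.
  rewrite !mxE !eqxx mul1r /cofactor; congr (_ * \det _).
  by apply/matrixP => k l; rewrite !mxE eq_sym (negbTE (neq_lift _ _)).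
by move=> j ji; rewrite !mxE eqxx eq_sym (negbTE ji) mul0r.
Qed.

Variables (n' : nat) (N : 'M[R]_n'.+1).
Let n := n'.+1.
Let c := char_poly N.
(** The adjugate of [xI - N] read as a polynomial in [x] with matrix coefficients. *)
Definition adjc j := map_mx (fun p : {poly R} => p`_j) (\adj (char_poly_mx N)).

Lemma char_mx_adj i j k : ((char_poly_mx N *m \adj (char_poly_mx N)) i j)`_k =
  (if k is k'.+1 then adjc k' i j else 0) - (N *m adjc k) i j.
Proof.
rewrite /char_poly_mx mulmxBl mul_scalar_mx !mxE coefB coefXM; congr (_ - _).
  by case: k => [|k] //=; rewrite /adjc !mxE.
by rewrite coef_sum; apply: eq_bigr => l _; rewrite !mxE coefCM.
Qed.

(** The coefficient of [x^k] in the identity that [xI - N] times its adjugate is the characteristic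
    polynomial times the identity. *)
Lemma adjc_rec k : (if k is k'.+1 then adjc k' else 0) = N *m adjc k + (c`_k)%:M.
Proof.
apply/matrixP => i j; have := char_mx_adj i j k.
rewrite mul_mx_adj -/(char_poly N) -/c mxE coefMn => E.
rewrite [RHS]mxE [_%:M i j]mxE E addrC.
by case: k {E} => [|k]; rewrite ?mxE subrK.
Qed.

(** Jacobi's formula coefficient by coefficient. It recovers a coefficient of the characteristic
    polynomial from a trace. *)
Lemma tr_adjc k : \tr (adjc k) = c`_k.+1 *+ k.+1.
Proof.
rewrite -coef_deriv deriv_char_poly coef_sum; apply: eq_bigr => i _.
by rewrite mxE.
Qed.

Lemma size_adj i j : (size (\adj (char_poly_mx N) i j) <= n)%N.
Proof.
rewrite mxE /cofactor -signr_odd.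
have S : (size (\det (row' j (col' i (char_poly_mx N)))) <= n)%N.
  rewrite /determinant; apply: (leq_trans (size_sum _ _ _)).
  apply/bigmax_leqP => s _; rewrite -signr_odd.
  have D : (size (\prod_i0 row' j (col' i (char_poly_mx N)) i0 (s i0))%R <= n)%N.
    apply: (leq_trans (size_prod_leq _ _)).
    rewrite card_ord /=; apply: (@leq_trans ((\sum_(k < n') 2).+1 - n')%N); last first.
      by rewrite sum_nat_const card_ord; lia.
    apply: leq_sub2r; rewrite ltnS; apply: leq_sum => k _; rewrite !mxE.
    apply: (leq_trans (size_polyD _ _)); rewrite geq_max size_polyN.
    apply/andP; split; last by apply: (leq_trans (size_polyC_leq1 _)).
    by case: (_ == _); rewrite ?size_polyX ?size_poly0.
  by case: (odd _); rewrite ?mul1r // expr1 mulN1r size_polyN.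
by case: (odd _); rewrite ?mul1r // expr1 mulN1r size_polyN.
Qed.

Lemma adjc_top : adjc n' = 1%:M.
Proof.
have E : adjc n = 0.
  by apply/matrixP => i j; rewrite /adjc [LHS]mxE [RHS]mxE nth_default //; exact: size_adj.
have := adjc_rec n; rewrite {1}/n /= E mulmx0 add0r => ->.
have := char_poly_monic N; rewrite monicE lead_coefE size_char_poly /= => /eqP.
by rewrite -/c => ->.
Qed.

(** The usual recursion divides a trace by [k] in step [k]. Here the [k]-th matrix carries an extra
    factor [k!] instead, so integer matrices stay integral. *)
Fixpoint fl k : 'M[R]_n :=
  if k is k'.+1 then k'.+1%:R *: (N *m fl k') - (\tr (N *m fl k'))%:M else 1%:M.

Lemma flE k : (k <= n')%N -> fl k = (k`!)%:R *: adjc (n' - k).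
Proof.
elim: k => [|k IH] kn; first by rewrite subn0 adjc_top scale1r.
rewrite /= IH; last exact: ltnW.
have -> : (n' - k = (n' - k.+1).+1)%N by lia.
set j := (n' - k.+1)%N.
have := adjc_rec j.+1; have := tr_adjc j; set B := adjc j.+1.
move=> trE rec; rewrite rec.
have trNB : \tr (N *m B) = - (c`_j.+1 *+ k.+1).
  have := congr1 mxtrace rec; rewrite mxtraceD mxtrace_scalar trE => E.
  have -> : (\tr (N *m B) = c`_j.+1 *+ j.+1 - c`_j.+1 *+ n) by rewrite E addrK.
  have -> : (n = j.+1 + k.+1)%N by rewrite /n /j; lia.
  by rewrite mulrnDr opprD addrA subrr add0r.
rewrite -!scalemxAr mxtraceZ trNB factS natrM scalerA scalerDr -scalerA; congr (_ + _).
apply/matrixP => i l; rewrite !mxE; case: (i == l); rewrite ?mulr1n ?mulr0n.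
  by rewrite -mulr_natl; ring.
by rewrite oppr0 mulr0.
Qed.

(** The last iterate inverts [N] up to a scalar which, by [char_poly0], is the determinant up to
    sign and a factorial. *)
Lemma fl_inverse : N *m fl n' = (- (n'`!)%:R * c`_0)%:M.
Proof.
rewrite flE // subnn -scalemxAr.
have := adjc_rec 0 => /esym /eqP; rewrite addr_eq0 => /eqP ->.
by apply/matrixP => i j; rewrite !mxE; case: (i == j); rewrite ?mulr1n ?mulr0n; ring.
Qed.

Lemma char_poly0 : c`_0 = (-1) ^+ n * \det N.
Proof. by rewrite /c char_poly_det. Qed.

End FaddeevLeVerrier.

(** * Perceptron steps and row rescaling *)

Lemma cauchy_schwarz (F : realFieldType) (I : finType) (a b : I -> F) :
  (\sum_i a i * b i) ^+ 2 <= (\sum_i a i ^+ 2) * (\sum_i b i ^+ 2).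
Proof.
set A := \sum_i a i ^+ 2; set B := \sum_i b i ^+ 2; set C := \sum_i a i * b i.
have A0 : 0 <= A by apply: sumr_ge0 => i _; exact: sqr_ge0.
have H t : 0 <= A * t ^+ 2 - 2%:R * C * t + B.
  have -> : A * t ^+ 2 - 2%:R * C * t + B = \sum_i (a i * t - b i) ^+ 2.
    rewrite /A /B /C mulr_suml -[2%:R * _ * t]mulrA mulr_suml mulr_sumr -sumrB -big_split /=.
    by apply: eq_bigr => i _; ring.
  by apply: sumr_ge0 => i _; exact: sqr_ge0.
have [A0'|/eqP An0] := eqVneq A 0.
  have /psumr_eq0P a0 : A = 0 by [].
  have -> : C = 0.
    apply: big1 => i _; have := a0 (fun i _ => sqr_ge0 _) i isT => /eqP.
    by rewrite sqrf_eq0 => /eqP ->; rewrite mul0r.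
  by rewrite expr0n /= A0' mul0r.
have Ap : 0 < A by rewrite lt_def A0 andbT; apply/eqP.
(* [C / A] minimises the quadratic polynomial. *)
have := H (C / A); have -> : A * (C / A) ^+ 2 - 2%:R * C * (C / A) + B = B - C ^+ 2 / A.
  by field; apply/eqP.
by rewrite subr_ge0 ler_pdivrMr // mulrC.
Qed.

Section Projection.
Variables (F : realFieldType) (m n : nat) (H : 'M[F]_(m, n)) (A : 'M[F]_n) (c : F).
Hypothesis NA : H^T *m H *m A = c%:M.
Hypothesis c0 : c != 0.

(** The orthogonal projection onto the column space of [H]: [A / c] is the inverse of the Gram
    matrix. *)
Definition proj := c^-1 *: (H *m A *m H^T).

Lemma A_sym : A^T = A.
Proof.
have E : A^T *m (H^T *m H) = c%:M.
  by have := congr1 trmx NA; rewrite tr_scalar_mx !trmx_mul trmxK.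
have : A^T *m (H^T *m H) *m A = c *: A by rewrite E mul_scalar_mx.
rewrite -mulmxA NA mul_mx_scalar => /(congr1 (fun M => c^-1 *: M)).
by rewrite !scalerA mulVf // !scale1r.
Qed.

Lemma AN : A *m (H^T *m H) = c%:M.
Proof.
have := congr1 trmx NA; rewrite tr_scalar_mx !trmx_mul trmxK A_sym.
by rewrite mulmxA.
Qed.

Lemma proj_sym : proj^T = proj.
Proof. by rewrite /proj linearZ /= !trmx_mul trmxK A_sym mulmxA. Qed.

Lemma proj_idem : proj *m proj = proj.
Proof.
rewrite /proj -scalemxAl -scalemxAr scalerA.
have -> : H *m A *m H^T *m (H *m A *m H^T) = c *: (H *m A *m H^T).
  rewrite -!mulmxA (mulmxA H^T) (mulmxA (H^T *m H)) NA.
  by rewrite mul_scalar_mx -!scalemxAr.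
by rewrite scalerA -mulrA mulVf // mulr1.
Qed.

Lemma projH (v : 'cV[F]_n) : proj *m (H *m v) = H *m v.
Proof.
rewrite /proj -scalemxAl -!mulmxA (mulmxA H^T) (mulmxA A) AN mul_scalar_mx.
by rewrite -scalemxAr scalerA mulVf // scale1r.
Qed.

Definition sqn (y : 'cV[F]_m) := \sum_i (proj *m y) i 0 ^+ 2.

Lemma sqnE y : sqn y = (y^T *m proj *m y) 0 0.
Proof.
transitivity (((proj *m y)^T *m (proj *m y)) 0 0).
  by rewrite [RHS]mxE; apply: eq_bigr => i _; rewrite [(_)^T _ _]mxE expr2.
by rewrite trmx_mul proj_sym -!mulmxA (mulmxA proj) proj_idem.
Qed.

(** For a symmetric idempotent a diagonal entry is the sum of the squares of its row, its own square
    included. *)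
Lemma proj_diag k : proj k k <= 1.
Proof.
have E : proj k k = \sum_j proj k j ^+ 2.
  rewrite -{1}proj_idem mxE; apply: eq_bigr => j _.
  by rewrite expr2; congr (_ * _); rewrite -{1}proj_sym mxE.
rewrite leNgt; apply/negP => h.
have : proj k k ^+ 2 <= proj k k.
  by rewrite {2}E (bigD1 k) //= lerDl; apply: sumr_ge0 => j _; exact: sqr_ge0.
by rewrite expr2; nra.
Qed.

(** Adding the unit vector [e_k] changes the squared norm by twice the coordinate [k] of the
    projection, which is at most 0, plus [proj k k], which is at most 1. *)
Lemma sqn_step y k : (proj *m y) k 0 <= 0 -> sqn (y + delta_mx k 0) <= sqn y + 1.
Proof.
move=> yk; rewrite !sqnE; set e := delta_mx k 0 : 'cV_m.
have -> : (y + e)^T *m proj *m (y + e) = y^T *m proj *m y + y^T *m proj *m e +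
    (e^T *m proj *m y + e^T *m proj *m e).
  have -> : (y + e)^T = y^T + e^T by apply/matrixP => i j; rewrite !mxE.
  by rewrite !mulmxDl !mulmxDr.
have E1 : (e^T *m proj *m y) 0 0 = (proj *m y) k 0.
  by rewrite -mulmxA trmx_delta -rowE mxE.
have E2 : (y^T *m proj *m e) 0 0 = (proj *m y) k 0.
  rewrite -E1 -[in LHS]proj_sym -[y^T *m _]trmx_mul -[e]trmxK -trmx_mul mxE.
  by rewrite trmxK mulmxA.
have E3 : (e^T *m proj *m e) 0 0 = proj k k.
  by rewrite trmx_delta -rowE -colE !mxE.
rewrite mxE [X in X + _]mxE [X in _ + X]mxE E1 E2 E3; have := proj_diag k; lra.
Qed.

(* A coordinate on which the perceptron spent many steps is small in every
   solution of the unit box. *)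
Lemma sqn_bound (y : 'cV[F]_m) (v : 'cV[F]_n) t k : sqn y <= t -> (forall i, 0 <= y i 0) ->
  (forall i, 0 <= (H *m v) i 0 <= 1) -> (y k 0 * (H *m v) k 0) ^+ 2 <= t * m%:R.
Proof.
move=> yt y0 x01; set x := H *m v.
have yx : y k 0 * x k 0 <= \sum_i y i 0 * x i 0.
  rewrite (bigD1 k) //= lerDl; apply: sumr_ge0 => i _.
  by rewrite mulr_ge0 //; case/andP: (x01 i).
have E : \sum_i y i 0 * x i 0 = \sum_i (proj *m y) i 0 * x i 0.
  have -> : \sum_i y i 0 * x i 0 = (y^T *m x) 0 0.
    by rewrite [RHS]mxE; apply: eq_bigr => i _; rewrite [y^T _ _]mxE.
  have Ex : proj *m x = x by exact: projH.
  have Ey : y^T *m proj = (proj *m y)^T by rewrite trmx_mul proj_sym.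
  rewrite -{1}Ex mulmxA Ey [LHS]mxE.
  by apply: eq_bigr => i _; rewrite [(_)^T _ _]mxE.
have p0 : 0 <= y k 0 * x k 0 by rewrite mulr_ge0 //; case/andP: (x01 k).
apply: (@le_trans _ _ ((\sum_i (proj *m y) i 0 * x i 0) ^+ 2)).
  by rewrite -E ler_pXn2r // nnegrE // (le_trans p0).
apply: le_trans (cauchy_schwarz _ _) _; apply: ler_pM.
- by apply: sumr_ge0 => i _; exact: sqr_ge0.
- by apply: sumr_ge0 => i _; exact: sqr_ge0.
- exact: yt.
have -> : m%:R = \sum_(i < m) 1 :> F by rewrite sumr_const card_ord.
by apply: ler_sum => i _; case/andP: (x01 i) => a b; rewrite exprn_ile1.
Qed.

End Projection.

(** A kernel vector [u] of the Gram matrix makes the squared norm of [H u^T] vanish. *)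
Lemma gram_unit (F : realFieldType) m n (H : 'M[F]_(m, n)) :
  (forall v : 'cV_n, H *m v = 0 -> v = 0) -> \det (H^T *m H) != 0.
Proof.
move=> inj; rewrite -unitfE -unitmxE -row_free_unit -kermx_eq0.
apply/rowV0P => u /sub_kermxP uN.
have : H *m u^T = 0.
  apply/matrixP => i j; rewrite ord1 [RHS]mxE.
  have : (u *m (H^T *m H) *m u^T) 0 0 = 0 by rewrite uN mul0mx mxE.
  have -> : u *m (H^T *m H) *m u^T = (H *m u^T)^T *m (H *m u^T).
    by rewrite trmx_mul trmxK !mulmxA.
  rewrite mxE; under eq_bigr do rewrite mxE -expr2.
  move=> /psumr_eq0P H0; have /eqP := H0 (fun i _ => sqr_ge0 _) i isT.
  by rewrite sqrf_eq0 => /eqP.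
by move=> /inj /(congr1 trmx); rewrite trmxK trmx0.
Qed.

(** * Strict linear feasibility in polynomial time *)

Notation imat := (seq (seq int)).
Definition ent (M : imat) i j : int := nth 0 (nth [::] M i) j.
Definition mkM (I J : seq nat) (f : nat -> nat -> int) : imat :=
  [seq [seq f i j | j <- J] | i <- I].
Notation rI H := (iota 0 (size H)).
Notation cI H := (iota 0 (size (head [::] H))).

Definition gram (H : imat) := mkM (cI H) (cI H)
  (fun i j => \sum_(k <- rI H) ent H k i * ent H k j).
Definition fl_step (N : imat) (M : imat) (k : nat) := mkM (rI N) (rI N) (fun i j =>
  Posz k.+1 * (\sum_(l <- rI N) ent N i l * ent M l j) -
  (if i == j then \sum_(p <- rI N) \sum_(l <- rI N) ent N p l * ent M l p else 0)).
Definition flm (N : imat) := foldl (fl_step N)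
  (mkM (rI N) (rI N) (fun i j => if i == j then 1 else 0)) (iota 0 (size (behead N))).

(** When [A] is [flm N] the product [N A] is scalar, and one entry gives the scalar. *)
Definition lp_scale (N A : imat) := \sum_(l <- rI N) ent N 0 l * ent A l 0.
Definition lp_vec (H A : imat) (y : seq int) :=
  [seq \sum_(j <- cI H) ent A i j * (\sum_(k <- rI H) ent H k j * nth 0 y k) | i <- cI H].
(** With [D] the scalar of [lp_scale], the extra factor [D] yields [D^2] times the projection of
    [y]: the signs are those of the projection even if [D] is negative. *)
Definition slack (H A : imat) (D : int) (y : seq int) :=
  [seq D * (\sum_(j <- cI H) ent H k j * nth 0 (lp_vec H A y) j) | k <- rI H].
Definition first_le (s : seq int) (t : int) (k : nat) :=
  (nth 0 s k <= t) && all (fun j => (k <= j)%N || (t < nth 0 s j)) (rI s).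
Definition bump (H A : imat) (D : int) (y : seq int) :=
  [seq nth 0 y k + (if first_le (slack H A D y) 0 k then 1 else 0) | k <- rI H].
Definition cube (T : Type) (l : seq T) :=
  flatten [seq flatten [seq [seq tt | c <- l] | b <- l] | a <- l].
(** A unary counter of length [4 m^3]. After that many additions some coordinate is at least
    [4 m^2], just enough for [sqn_bound] to give the bound 1/2. *)
Definition steps (H : imat) := cube H ++ (cube H ++ (cube H ++ cube H)).
Definition percep (H A : imat) (D : int) :=
  foldl (fun y _ => bump H A D y) [seq 0 | k <- rI H] (steps H).
(** Negating [y] turns the search for the first coordinate that is at least [4 m^2] into an instance
    of [first_le]. *)
Definition double_row (H : imat) (y : seq int) := mkM (rI H) (cI H) (fun k j =>
  (if first_le [seq - z | z <- y] (- Posz (4 * size H * size H)) k then 2 else 1) *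
  ent H k j).
(** A round is cut into stages that receive intermediate results as arguments, so that its
    computability is a chain of compositions. *)
Definition round1 (H A : imat) (D : int) (y : seq int) : bool * imat :=
  if all (fun z => 0 < z) (slack H A D y) then (true, H) else (false, double_row H y).
Definition round2 (H A : imat) (D : int) := round1 H A D (percep H A D).
Definition round3 (H N A : imat) := round2 H A (lp_scale N A).
Definition round4 (H N : imat) := round3 H N (flm N).
Definition round (H : imat) := round4 H (gram H).
Definition lp_solve (G : imat) (U : seq unit) : bool :=
  (foldl (fun (st : bool * imat) _ => if st.1 then st else round st.2) (false, G) U).1.

(** * Sizes and running time of the solver *)

Section Bounds.

Lemma esz_imat_le (M : imat) r c b : (size M <= r)%N ->
  (forall i, (i < size M)%N -> (size (nth [::] M i) <= c)%N) ->
  (forall i j, (`|ent M i j| < 2 ^ b)%N) ->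
  (esz M <= r * (c * (4 * b + 6) + 2) + 1)%N.
Proof.
move=> Mr Mc Mb; apply: leq_trans (esz_seq_le (M := (c * (4 * b + 6) + 1)%N) _) _.
  move=> i a iM; rewrite (set_nth_default [::]) //.
  apply: leq_trans (esz_seq_le (M := (4 * b + 5)%N) _) _.
    by move=> j a' jM; rewrite (set_nth_default 0) //; apply: esz_int; exact: Mb.
  by rewrite -addnS leq_add2r leq_mul //; exact: Mc.
by rewrite leq_add2r -addnS leq_mul.
Qed.

Lemma esz_row_le (y : seq int) c b : (size y <= c)%N ->
  (forall j, (`|nth 0%R y j| < 2 ^ b)%N) -> (esz y <= c * (4 * b + 6) + 1)%N.
Proof.
move=> yc yb; apply: leq_trans (esz_seq_le (M := (4 * b + 5)%N) _) _.
  by move=> j a jM; rewrite (set_nth_default 0) //; apply: esz_int.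
by rewrite -addnS leq_add2r leq_mul.
Qed.

Lemma size_mkM I J f : size (mkM I J f) = size I.
Proof. by rewrite size_map. Qed.

Lemma ent_mkM m n f i j : ent (mkM (iota 0 m) (iota 0 n) f) i j =
  if (i < m)%N && (j < n)%N then f i j else 0.
Proof.
rewrite /ent /mkM; case: ltnP => im /=; last by rewrite [nth [::] _ _]nth_default ?size_map ?size_iota // nth_nil.
rewrite (nth_map 0%N) ?size_iota // nth_iota // add0n.
case: ltnP => jn; last by rewrite nth_default ?size_map ?size_iota.
by rewrite (nth_map 0%N) ?size_iota // nth_iota.
Qed.

Lemma ent_mkMT m n f i j : (i < m)%N -> (j < n)%N ->
  ent (mkM (iota 0 m) (iota 0 n) f) i j = f i j.
Proof. by move=> im jn; rewrite ent_mkM im jn. Qed.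

Lemma ent_esz (M : imat) i j : (`|ent M i j| < 2 ^ esz M)%N.
Proof.
rewrite /ent; case: (ltnP i (size M)) => iM; last by rewrite [nth [::] M i]nth_default // nth_nil expn_gt0.
have E1 : (esz (nth [::] M i) <= esz M)%N.
  elim: M i iM => // r M IH [|i] iM; rewrite esz_cons /=; first lia.
  by have := IH i iM; lia.
case: (ltnP j (size (nth [::] M i))) => jM; last by rewrite nth_default // expn_gt0.
apply: leq_trans (ltz_esz _) _; rewrite leq_exp2l //; apply: leq_trans E1.
elim: (nth [::] M i) j jM => // z r IH [|j] jM; rewrite esz_cons /=; first lia.
by apply: leq_trans (IH j jM) _; lia.
Qed.

Lemma abs_sum_le (T : Type) (l : seq T) (f : T -> int) b :
  (forall a, (`|f a| <= b)%N) -> (`|(\sum_(a <- l) f a)%R| <= size l * b)%N.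
Proof.
move=> fb; elim: l => [|a l IH]; first by rewrite big_nil.
move: IH (fb a); rewrite big_cons [size _]/= mulSn.
by move: (\sum_(_ <- l) _)%R (size l * b)%N => z w; lia.
Qed.

(** A step multiplies the largest entry by at most [2 n^2 2^e <= 2^(3e+1)], and there are fewer than
    [n <= e] steps, so entries keep a number of bits quadratic in the input size [e]. *)
Lemma P_flm : P flm.
Proof.
apply: (P_foldl (f := fl_step) (z := fun N => _) (l := fun N => iota 0 (size (behead N)))).
- by rewrite /fl_step /mkM /ent; P_auto.
- by rewrite /mkM; P_auto.
- by P_auto.
have [c [k cP]] : polyb (fun e => e * (e * (4 * (e * (3 * e + 1) + 1) + 6) + 2) + 1)%N.
  by polyb_tac.
exists c, k => N i; apply: leq_trans (cP _); set e := esz N.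
have ne : (size N <= e)%N by exact: ltnW (size_le_esz N).
set M0 := mkM _ _ _.
have I t : (t <= (size N).-1)%N -> let M := foldl (fl_step N) M0 (iota 0 t) in
    (exists f, M = mkM (rI N) (rI N) f) /\
    forall i j, (`|ent M i j| <= 2 ^ (t * (3 * e + 1)))%N.
  elim: t => [|t IH] tN.
    split; first by eexists; reflexivity.
    by move=> a b; rewrite ent_mkM; case: ifP => // _; case: eqP.
  rewrite -addn1 iotaD add0n foldl_cat /=.
  have [_] := IH (ltnW tN); set M := foldl _ _ _; move=> Mb; split; first by eexists; reflexivity.
  move=> a b; rewrite ent_mkM; case: ifP => // _.
  set q := (2 ^ (t * (3 * e + 1)))%N in Mb.
  have S1 p s : (`|(\sum_(l <- rI N) ent N p l * ent M l s)%R| <= size N * (2 ^ e * q))%N.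
    apply: leq_trans (abs_sum_le (b := (2 ^ e * q)%N) _ _) _; last by rewrite size_iota.
    by move=> l; rewrite abszM leq_mul // ltnW // ent_esz.
  have S2 : (`|(\sum_(p <- rI N) \sum_(l <- rI N) ent N p l * ent M l p)%R| <=
      size N * (size N * (2 ^ e * q)))%N.
    apply: leq_trans (abs_sum_le (b := (size N * (2 ^ e * q))%N) _ _) _.
      by move=> p; exact: S1.
    by rewrite size_iota.
  have S3 : (`|(if a == b then \sum_(p <- rI N) \sum_(l <- rI N) ent N p l * ent M l p
      else 0)%R| <= size N * (size N * (2 ^ e * q)))%N by case: eqP => // _; rewrite absz0.
  apply: (@leq_trans (2 * (size N * size N) * (2 ^ e * q))%N).
    have T1 : (`|(Posz t.+1 * (\sum_(l <- rI N) ent N a l * ent M l b))%R| <=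
       size N * (size N * (2 ^ e * q)))%N by rewrite abszM leq_mul //; lia.
    move: T1 S3; move: (Posz t.+1 * _)%R (if _ then _ else _)%R => z1 z2.
    by move: (2 ^ e * q)%N => w; lia.
  have Nn : (size N * size N <= 2 ^ e * 2 ^ e)%N.
    by apply: leq_mul; apply: leq_trans ne _; apply: ltnW; exact: ltn_expl.
  rewrite mulnDl mul1n expnD -/q; apply: (@leq_trans (2 * (2 ^ e * 2 ^ e) * (2 ^ e * q))%N).
    by rewrite leq_mul2r leq_mul2l Nn !orbT.
  rewrite (_ : (3 * e + 1 = e + e + e + 1)%N); last by lia.
  have aux u w : (2 * (u * u) * (u * w) <= w * (u * u * u * 2))%N by lia.
  by rewrite !expnD expn1; exact: aux.
have -> : take i (iota 0 (size (behead N))) = iota 0 (minn i (size (behead N))).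
  by rewrite take_iota.
set t := minn _ _; have tN : (t <= (size N).-1)%N by rewrite /t size_behead; lia.
have [[f E] Mb] := I t tN.
apply: leq_trans (esz_imat_le (r := e) (c := e) (b := (e * (3 * e + 1) + 1)%N) _ _ _) _ => //.
- by rewrite E size_mkM size_iota.
- move=> a; rewrite E size_mkM size_iota => aN.
  by rewrite /mkM (nth_map 0%N) ?size_iota // size_map size_iota.
move=> a b; apply: leq_ltn_trans (Mb a b) _; rewrite ltn_exp2l //.
by rewrite [ltnRHS]addn1 ltnS leq_mul //; lia.
Qed.

Lemma size_cube (T : Type) (l : seq T) : size (cube l) = (size l * (size l * size l))%N.
Proof.
rewrite /cube size_flatten /shape -map_comp /= sumnE big_map /=.
under eq_bigr do rewrite size_flatten /shape -map_comp /= sumnE big_map /=.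
under eq_bigr do under eq_bigr do rewrite size_map.
by rewrite !big_const_seq !count_predT !iter_addn_0; lia.
Qed.

Lemma size_steps H : size (steps H) = (4 * (size H * (size H * size H)))%N.
Proof. by rewrite /steps !size_cat !size_cube; lia. Qed.

Lemma P_cube {X A} {eX : Enc X} {eA : Enc A} (l : X -> seq A) : P l -> P (fun x => cube (l x)).
Proof. by move=> Pl; apply: (P_comp (g := @cube A) _ Pl); rewrite /cube; P_auto. Qed.

Lemma percep_le H A D (l : seq unit) k :
  let y := foldl (fun y _ => bump H A D y) [seq 0 | k <- rI H] l in
  size y = size H /\ 0 <= nth 0 y k <= Posz (size l).
Proof.
elim/last_ind: l => [|l a IH] /=.
  rewrite size_map size_iota; split=> //; case: (ltnP k (size H)) => kH.
    by rewrite (nth_map 0%N) ?size_iota.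
  by rewrite nth_default // size_map size_iota.
rewrite foldl_rcons size_rcons; set y := foldl _ _ _ in IH *.
rewrite {1}/bump size_map size_iota; split=> //; case: (ltnP k (size H)) => kH.
  rewrite /bump (nth_map 0%N) ?size_iota // nth_iota // add0n.
  by case: IH => _; case: ifP => _; lia.
by rewrite nth_default // size_map size_iota.
Qed.

Lemma P_slack : P (fun p : imat * (imat * (int * seq int)) => slack p.1 p.2.1 p.2.2.1 p.2.2.2).
Proof. by rewrite /slack /lp_vec /ent; P_auto. Qed.

Lemma P_percep : P (fun p : imat * (imat * int) => percep p.1 p.2.1 p.2.2).
Proof.
apply: (P_foldl (f := fun p y _ => bump p.1 p.2.1 p.2.2 y)
  (z := fun p => [seq 0 | k <- rI p.1]) (l := fun p => steps p.1)).
- rewrite /bump; apply: P_map; last by P_auto.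
  apply: P_addz; first by P_auto.
  apply: P_if; [|by P_auto|by P_auto].
  apply: (P_comp (f := fun p : (imat * (imat * int) * (seq int * unit)) * nat =>
    (slack p.1.1.1 p.1.1.2.1 p.1.1.2.2 p.1.2.1, p.2))
    (g := fun q => first_le q.1 0 q.2)).
    by rewrite /first_le; P_auto.
  apply: P_pair; last by P_auto.
  apply: (P_comp (f := fun p : (imat * (imat * int) * (seq int * unit)) * nat =>
    (p.1.1.1, (p.1.1.2.1, (p.1.1.2.2, p.1.2.1)))) P_slack).
  by P_auto.
- by P_auto.
- by rewrite /steps; P_auto; apply: P_cube; P_auto.
have [c [k cP]] : polyb (fun e => e * (4 * (4 * (e * (e * e)) + 1) + 6) + 1)%N by polyb_tac.
exists c, k => -[H [A D]] i; apply: leq_trans (cP _).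
set e := esz (H, (A, D)); have He : (size H <= e)%N.
  by rewrite /e esz_pair; pose proof (size_le_esz H); lia.
have Hi := percep_le H A D (take i (steps H)).
apply: esz_row_le; first by case: (Hi 0%N) => ->.
move=> j; case: (Hi j) => _; rewrite size_take_min size_steps => /andP[h0 h1].
apply: (@leq_ltn_trans (4 * (e * (e * e)))%N); last first.
  apply: (@leq_trans (2 ^ (4 * (e * (e * e))))%N); first exact: ltn_expl.
  by rewrite leq_exp2l //; lia.
have : (size H * (size H * size H) <= e * (e * e))%N by rewrite !leq_mul.
have aux (z : int) a b : 0 <= z -> z <= Posz (minn i a) -> (a <= b)%N -> (`|z| <= b)%N.
  by lia.
by move=> h; apply: aux h0 h1 _; rewrite leq_mul2l h orbT.
Qed.

Lemma P_round : P round.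
Proof.
rewrite /round; apply: (P_comp (f := fun H => (H, gram H)) (g := fun p => round4 p.1 p.2)); last first.
  by rewrite /gram /mkM /ent; P_auto.
rewrite /round4; apply: (P_comp (f := fun p => (p.1, (p.2, flm p.2)))
  (g := fun p => round3 p.1 p.2.1 p.2.2)); last first.
  by P_auto; apply: (P_comp P_flm); P_auto.
rewrite /round3; apply: (P_comp (f := fun p => (p.1, (p.2.2, lp_scale p.2.1 p.2.2)))
  (g := fun p => round2 p.1 p.2.1 p.2.2)); last first.
  by rewrite /lp_scale /ent; P_auto.
rewrite /round2; apply: (P_comp (f := fun p => (p.1, (p.2.1, (p.2.2, percep p.1 p.2.1 p.2.2))))
  (g := fun p => round1 p.1 p.2.1 p.2.2.1 p.2.2.2)); last first.
  by P_auto; exact: P_percep.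
rewrite /round1; apply: P_if.
- by apply: P_all; [P_auto|exact: P_slack].
- by P_auto.
- by rewrite /double_row /mkM /first_le /ent; P_auto.
Qed.

Definition wf m n (H : imat) := size H = m /\ forall i, (i < m)%N -> size (nth [::] H i) = n.

Lemma wf_head m n H : (0 < m)%N -> wf m n H -> size (head [::] H) = n.
Proof. by move=> m0 [sH rH]; rewrite -nth0 rH. Qed.

Lemma size_row_esz (M : imat) i : (size (nth [::] M i) <= esz M)%N.
Proof.
elim: M i => [|r M IH] [|i]; rewrite ?nth_nil ?esz_cons //=.
  by pose proof (size_le_esz r); lia.
by have := IH i; lia.
Qed.

(** A round at most doubles an entry, so bit lengths grow by at most one per unit of fuel. *)
Lemma P_lp_solve : P (fun p : imat * seq unit => lp_solve p.1 p.2).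
Proof.
apply: P_fst; apply: (P_foldl (f := fun _ (st : bool * imat) _ => if st.1 then st else round st.2)
  (z := fun p : imat * seq unit => (false, p.1)) (l := fun p => p.2)).
- by apply: P_if; [P_auto|P_auto|apply: (P_comp P_round); P_auto].
- by P_auto.
- by P_auto.
have [c [k cP]] : polyb (fun e => 3 + (e + (e * (e * (4 * (e + e) + 6) + 2) + 1)) + 1)%N by polyb_tac.
exists c, k => -[G U] i; apply: leq_trans (cP _); set e := esz (G, U).
have Ge : (esz G <= e)%N by rewrite /e esz_pair; lia.
have Ue : (size U <= e)%N by rewrite /e esz_pair; pose proof (size_le_esz U); lia.
rewrite [z in foldl _ z]/= [(G, U).2]/=.
have I (l : seq unit) : let st := foldl (fun (st : bool * imat) _ => if st.1 then st else round st.2)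
   (false, G) l in (st.2 = G) \/ [/\ (size st.2 <= e)%N,
   forall i, (size (nth [::] st.2 i) <= e)%N &
   forall i j, (`|ent st.2 i j| < 2 ^ (esz G + size l))%N].
  elim/last_ind: l => [|l a]; first by left.
  rewrite foldl_rcons size_rcons; case: (foldl _ _ _) => -[] H /= IH.
    case: IH => [->|[h1 h2 h3]]; [by left|right]; split=> // p q.
    by apply: leq_trans (h3 p q) _; rewrite leq_exp2l //; lia.
  have {}IH : [/\ (size H <= e)%N, forall i, (size (nth [::] H i) <= e)%N &
     forall i j, (`|ent H i j| < 2 ^ (esz G + size l))%N].
    case: IH => [->|//]; split=> [|p|p q].
    - exact: leq_trans (ltnW (size_le_esz _)) Ge.
    - exact: leq_trans (size_row_esz _ _) Ge.
    - by apply: leq_trans (ent_esz _ _ _) _; rewrite leq_exp2l //; lia.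
  right; case: IH => h1 h2 h3.
  rewrite /round /round4 /round3 /round2 /round1; case: ifP => _ /=.
    split=> // p q; apply: leq_trans (h3 p q) _; rewrite leq_exp2l //; lia.
  split; first by rewrite size_mkM size_iota.
    move=> p; rewrite /mkM; case: (ltnP p (size H)) => pH; last first.
      by rewrite nth_default // size_map size_iota.
    by rewrite (nth_map 0%N) ?size_iota // size_map size_iota -nth0.
  move=> p q; rewrite ent_mkM; case: ifP => [_|_]; last by rewrite expn_gt0.
  rewrite abszM addnS expnS; have := h3 p q; case: ifP => _ /=; lia.
have := I (take i U); case: (foldl _ _ _) => b H /= IH; rewrite esz_pair.
have b3 : (esz b <= 3)%N by case: (b).
rewrite addn1 ltnS; apply: leq_add => //.
case: IH => [->|[h1 h2 h3]]; first by apply: leq_trans Ge _; lia.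
apply: leq_trans (leq_addl _ _); apply: esz_imat_le => // p q.
apply: leq_trans (h3 p q) _; rewrite leq_exp2l //; apply: leq_add => //.
by rewrite size_take_min; lia.
Qed.

End Bounds.

Lemma sum_iota (V : nmodType) n (f : nat -> V) :
  \sum_(k <- iota 0 n) f k = \sum_(k < n) f k.
Proof. by rewrite -(big_mkord xpredT f) /index_iota subn0. Qed.

Lemma first_leP (s : seq int) t : (exists2 k, (k < size s)%N & nth 0 s k <= t) ->
  exists2 k, (k < size s)%N & nth 0 s k <= t /\
    forall j, (j < size s)%N -> first_le s t j = (j == k).
Proof.
move=> [k0 k0s k0t].
have ex : exists k, (k < size s)%N && (nth 0 s k <= t) by exists k0; rewrite k0s.
case: (ex_minnP ex) => k /andP[ks kt] kmin; exists k => //; split=> // j js.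
rewrite /first_le; apply/idP/eqP => [/andP[jt /allP H]|->].
  apply/eqP; rewrite eqn_leq kmin ?js // andbT.
  have := H k; rewrite mem_iota add0n ks => /(_ isT).
  by rewrite ltNge kt orbF.
rewrite kt; apply/allP => i; rewrite mem_iota add0n /= => si; case: leqP => //= ik.
rewrite ltNge; apply/negP => it; have := kmin i; rewrite si it => /(_ isT); lia.
Qed.

(** * Correctness of the rescaled perceptron *)

Section Correctness.
Variables m' n' : nat.
Let m := m'.+1.
Let n := n'.+1.
Implicit Types H G N A : imat.

Definition mx H : 'M[rat]_(m, n) := \matrix_(i, j) (ent H i j)%:~R.
Definition mxs H : 'M[rat]_n := \matrix_(i, j) (ent H i j)%:~R.
Definition cv (y : seq int) : 'cV[rat]_m := \col_i (nth 0 y i)%:~R.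

Lemma ent_gram H (i j : 'I_n) : wf m n H ->
  (ent (gram H) i j)%:~R = ((mx H)^T *m mx H) i j :> rat.
Proof.
move=> wH; rewrite /gram (wf_head _ wH) // ent_mkM !ltn_ord /=.
case: wH => -> _; rewrite sum_iota rmorph_sum mxE; apply: eq_bigr => k _.
by rewrite !mxE rmorphM.
Qed.

Lemma size_gram H : wf m n H -> size (gram H) = n.
Proof. by move=> wH; rewrite size_mkM size_iota (wf_head _ wH). Qed.

Lemma flm_fl N : size N = n -> mxs (flm N) = fl (mxs N) n'.
Proof.
move=> sN; rewrite /flm sN size_behead sN /=.
suff H t : mxs (foldl (fl_step N) (mkM (iota 0 n) (iota 0 n)
    (fun i j => if i == j then 1 else 0)) (iota 0 t)) = fl (mxs N) t by exact: H.
elim: t => [|t IH].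
  apply/matrixP => i j; rewrite !mxE ent_mkM !ltn_ord /= -(inj_eq val_inj) /=.
  by case: eqP.
rewrite -{1}addn1 iotaD add0n foldl_cat /=; set M := foldl _ _ _ in IH *.
have E p s : (\sum_(l <- iota 0 n) ent N (p : 'I_n) l * ent M l (s : 'I_n))%:~R =
    (mxs N *m fl (mxs N) t) p s.
  rewrite -IH mxE sum_iota rmorph_sum; apply: eq_bigr => l _.
  by rewrite !mxE rmorphM.
apply/matrixP => i j; rewrite [LHS]mxE /fl_step sN ent_mkMT ?ltn_ord //.
transitivity (t.+1%:R * (mxs N *m fl (mxs N) t) i j - (\tr (mxs N *m fl (mxs N) t))%:M i j);
  last by rewrite !mxE.
rewrite rmorphB rmorphM -E; congr (_ * _ - _).
rewrite [_%:M _ _]mxE -(inj_eq val_inj); case: eqP => _ //; rewrite mulr1n /mxtrace.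
rewrite sum_iota rmorph_sum; apply: eq_bigr => p _; exact: E.
Qed.

Lemma slackE H A D y (k : 'I_m) : wf m n H ->
  (nth 0 (slack H A D y) k)%:~R =
  D%:~R * (mx H *m mxs A *m (mx H)^T *m cv y) k 0.
Proof.
move=> wH; rewrite /slack (wf_head _ wH) //; case: (wH) => sH _; rewrite sH.
rewrite (nth_map 0%N) ?size_iota // nth_iota // add0n rmorphM; congr (_ * _).
rewrite sum_iota rmorph_sum -!mulmxA mxE; apply: eq_bigr => j _.
rewrite rmorphM mxE; congr (_ * _).
rewrite /lp_vec (wf_head _ wH) // (nth_map 0%N) ?size_iota // nth_iota // add0n.
rewrite sum_iota rmorph_sum mxE; apply: eq_bigr => l _.
rewrite rmorphM mxE; congr (_ * _); rewrite sH sum_iota rmorph_sum mxE.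
by apply: eq_bigr => i _; rewrite !mxE rmorphM.
Qed.

Lemma size_slack H A D y : size (slack H A D y) = size H.
Proof. by rewrite size_map size_iota. Qed.

Section Round.
Variable H : imat.
Hypothesis wH : wf m n H.
Hypothesis injH : forall v : 'cV[rat]_n, mx H *m v = 0 -> v = 0.
Let A := flm (gram H).
Let c := lp_scale (gram H) A.

Lemma gramA : (mx H)^T *m mx H *m mxs A = (c%:~R)%:M.
Proof.
have EN : mxs (gram H) = (mx H)^T *m mx H.
  by apply/matrixP => i j; rewrite [LHS]mxE ent_gram.
rewrite -EN /A flm_fl ?size_gram // fl_inverse; congr _%:M.
have := congr1 (fun M : 'M_n => M 0 0) (fl_inverse (mxs (gram H))).
rewrite -flm_fl ?size_gram // [X in _ = X]mxE eqxx mulr1n => <-.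
rewrite /c /lp_scale size_gram // sum_iota rmorph_sum mxE.
by apply: eq_bigr => l _; rewrite !mxE rmorphM.
Qed.

Lemma c_neq0 : c%:~R != 0 :> rat.
Proof.
have EN : mxs (gram H) = (mx H)^T *m mx H.
  by apply/matrixP => i j; rewrite [LHS]mxE ent_gram.
have : (c%:~R)%:M = (- (n'`!)%:R * (char_poly (mxs (gram H)))`_0)%:M :> 'M[rat]_n.
  by rewrite -gramA -EN /A flm_fl ?size_gram // fl_inverse.
move=> /(congr1 (fun M : 'M_n => M 0 0)); rewrite !mxE !eqxx !mulr1n => ->.
rewrite char_poly0 EN mulf_neq0 // ?oppr_eq0 ?pnatr_eq0 -?lt0n ?fact_gt0 //.
by rewrite mulf_neq0 ?signr_eq0 // gram_unit.
Qed.

Let pr := proj (mx H) (mxs A) c%:~R.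

Lemma slack_proj y (k : 'I_m) : (nth 0 (slack H A c y) k)%:~R =
  c%:~R ^+ 2 * (pr *m cv y) k 0.
Proof.
rewrite slackE // /pr /proj -scalemxAl [X in _ = _ * X]mxE mulrA; congr (_ * _).
by rewrite expr2 mulfK // c_neq0.
Qed.

Lemma slack_le0 y (k : 'I_m) : (nth 0 (slack H A c y) k <= 0) = ((pr *m cv y) k 0 <= 0).
Proof.
rewrite -(ler_int rat) slack_proj pmulr_rle0 //.
by rewrite lt_def sqr_ge0 sqrf_eq0 c_neq0.
Qed.

(** Once all slacks are positive, [bump] changes nothing. Until then each step adds exactly one to
    the sum of [y] and at most one to its squared projected norm. *)
Lemma percep_inv (l : seq unit) :
  let y := foldl (fun y _ => bump H A c y) [seq 0 | k <- rI H] l in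
  all (fun z => 0 < z) (slack H A c y) \/
  \sum_(k < m) nth 0 y k = Posz (size l) /\ sqn (mx H) (mxs A) c%:~R (cv y) <= (size l)%:R.
Proof.
have [sH _] := wH.
elim/last_ind: l => [|l a].
  right; rewrite /=; have E : cv [seq 0 | k <- rI H] = 0.
    apply/matrixP => i j; rewrite !mxE /= (nth_map 0%N) // size_iota sH; exact: ltn_ord.
  split; last by rewrite E /sqn mulmx0 big1 // => i _; rewrite mxE expr0n.
  by rewrite big1 // => i _ /=; rewrite (nth_map 0%N) // size_iota sH; exact: ltn_ord.
rewrite foldl_rcons size_rcons; have [sy _] := percep_le H A c l 0.
set y := foldl _ _ _ in sy *; move=> IH; rewrite /=.
have [/allP pos|/allPn[z /(nthP 0) [k ks <-]]] := boolP (all (fun z => 0 < z) (slack H A c y)).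
  left; suff -> : bump H A c y = y by apply/allP.
  apply: (@eq_from_nth _ 0); rewrite /bump size_map size_iota ?sy // => i iH.
  rewrite (nth_map 0%N) ?size_iota // nth_iota // add0n /first_le leNgt pos ?addr0 //.
  by apply: mem_nth; rewrite size_slack.
rewrite -leNgt => k0; case: IH => [/allP pos|[sumy sqy]].
  by have := pos _ (mem_nth 0 ks); rewrite ltNge k0.
have [j js [j0 jP]] := first_leP (ex_intro2 _ _ k ks k0).
rewrite size_slack sH in js jP; pose j' : 'I_m := Ordinal js.
have Ey : cv (bump H A c y) = cv y + delta_mx j' 0.
  apply/matrixP => i q; rewrite ord1 !mxE /bump (nth_map 0%N) ?size_iota ?sH //.
  rewrite nth_iota // add0n jP // rmorphD /= -[(i == j')]/(val i == j) eqxx andbT.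
  by case: eqP.
right; split; last first.
  rewrite Ey -natr1; apply: le_trans (sqn_step gramA c_neq0 _) _.
    by rewrite -slack_le0.
  by rewrite lerD2r.
rewrite -addn1 PoszD -sumy.
have -> : \sum_(i < m) nth 0 (bump H A c y) i = \sum_(i < m) (nth 0 y i + (i == j')%:R).
  apply: eq_bigr => i _; rewrite /bump (nth_map 0%N) ?size_iota ?sH // nth_iota // add0n jP //.
  by rewrite -[(i == j')]/(val i == j); case: eqP.
rewrite big_split /=; congr (_ + _); rewrite (bigD1 j') //= eqxx big1 ?addr0 //.
by move=> i /negbTE ->.
Qed.

(** After [4 m^3] unsuccessful steps some [y_k] is at least [4 m^2] by averaging. For the slack
    [x_k] at [v], [sqn_bound] then gives [(4 m^2 x_k)^2 <= 4 m^4], that is [x_k <= 1/2]. *)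
Lemma round_progress (v : 'cV[rat]_n) : (forall k, 0 <= (mx H *m v) k 0 <= 1) ->
  (round H).1 \/ (exists2 k : 'I_m, (mx H *m v) k 0 <= 2%:R^-1 &
    wf m n (round H).2 /\ forall (i : 'I_m) (j : 'I_n), ent (round H).2 i j =
       (if i == k then 2 else 1) * ent H i j).
Proof.
move=> x01; rewrite /round /round4 /round3 /round2 -/A -/c /round1.
case: ifP => [|npos]; first by left.
right; have [sH rH] := wH.
have := percep_inv (steps H); rewrite -/(percep H A c) /= npos => -[//|].
set y := percep H A c; rewrite size_steps sH => -[sumy sqy].
have [sy _] := percep_le H A c (steps H) 0; rewrite -/(percep H A c) -/y sH in sy.
have y0 (i : nat) : 0 <= nth 0 y i.
  by have [_ /andP[]] := percep_le H A c (steps H) i.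
have [k0 k0P] : exists k : 'I_m, Posz (4 * m * m) <= nth 0 y k.
  apply: contrapT => /forallNP N.
  suff : \sum_(k < m) nth 0 y k < \sum_(k < m) Posz (4 * m * m).
    by rewrite sumy sumr_const card_ord; lia.
  apply: ltr_sum; last by move=> i _; rewrite ltNge; apply/negP/N.
  by apply/hasP; exists ord0; rewrite ?mem_index_enum.
have sny : size [seq - z | z <- y] = m by rewrite size_map.
have [|k] := @first_leP [seq - z | z <- y] (- Posz (4 * m * m)).
  by exists k0; rewrite ?sny // (nth_map 0) ?sy // lerN2.
rewrite sny => km [kP kU]; pose k' : 'I_m := Ordinal km.
rewrite (nth_map 0) ?sy // lerN2 in kP.
exists k'; last first.
  split=> /=.
    split; first by rewrite size_mkM size_iota.
    move=> i im; rewrite /mkM (nth_map 0%N) ?size_iota ?sH // size_map size_iota.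
    exact: (wf_head _ wH).
  move=> i j; rewrite /double_row (wf_head _ wH) // sH ent_mkM !ltn_ord /= kU //.
have B := sqn_bound gramA c_neq0 k' sqy _ x01.
have {}B := B (fun i => _); have : forall i, 0 <= cv y i 0.
  by move=> i; rewrite mxE ler0z.
move=> /B {B}; rewrite mxE /=; set x := (mx H *m v) k' 0.
have x0 : 0 <= x by case/andP: (x01 k').
have mR : (1 : rat) <= m%:R by rewrite ler1n.
have yk : (4 * m%:R * m%:R : rat) <= (nth 0 y k)%:~R.
  by have := kP; rewrite -(ler_int rat) -!pmulrn !natrM.
set q : rat := (nth 0 y k)%:~R in yk *.
rewrite !natrM => B.
have {}B : (4 * m%:R * m%:R * x) ^+ 2 <= 4 * (m%:R * (m%:R * m%:R)) * m%:R.
  apply: le_trans B; rewrite ler_pXn2r ?nnegrE ?ler_wpM2r ?mulr_ge0 //; try lra.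
  by apply: le_trans yk; nra.
rewrite leNgt; apply/negP => xh.
have M0 : 0 < (m%:R * m%:R) ^+ 2 :> rat by rewrite exprn_gt0 // mulr_gt0 //; lra.
have X : 2^-1 * 2^-1 < x ^+ 2 by rewrite expr2; nra.
have : (m%:R * m%:R) ^+ 2 * (2^-1 * 2^-1) < (m%:R * m%:R) ^+ 2 * x ^+ 2 by rewrite ltr_pM2l.
have -> : (m%:R * m%:R) ^+ 2 * x ^+ 2 = (4 * m%:R * m%:R * x) ^+ 2 / 16 by field.
have : (4 * m%:R * m%:R * x) ^+ 2 <= 4 * (m%:R * m%:R) ^+ 2.
  by apply: le_trans B _; rewrite le_eqVlt; apply/orP; left; apply/eqP; ring.
lra.
Qed.

End Round.

(** Potential argument: [d k] counts the doublings of row [k]. Only a row of slack at most 1/2 is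
    doubled, so slacks at [v] never exceed 1; starting from at least [2^-L], a row is doubled at
    most [L] times. *)
Lemma lp_solve_complete G (U : seq unit) (v : 'cV[rat]_n) L : wf m n G ->
  (forall v : 'cV[rat]_n, mx G *m v = 0 -> v = 0) ->
  (forall k, 2%:R^-L <= (mx G *m v) k 0 <= 1) -> (m * L < size U)%N -> lp_solve G U.
Proof.
move=> wG injG x01 LU; apply: contraT => nsol.
have I (l : seq unit) : let st := foldl (fun (st : bool * imat) _ =>
     if st.1 then st else round st.2) (false, G) l in
   st.1 \/ exists d : 'I_m -> nat, [/\ wf m n st.2, (\sum_k d k = size l)%N &
     (forall (i : 'I_m) (j : 'I_n), ent st.2 i j = 2 ^+ d i * ent G i j) /\
     forall k, 2%:R ^+ d k * (mx G *m v) k 0 <= 1].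
  elim/last_ind: l => [|l a].
    right; exists (fun=> 0%N); split=> //; first by rewrite big1.
    by split=> [i j|k]; rewrite expr0 mul1r //; case/andP: (x01 k).
  rewrite foldl_rcons size_rcons; case: (foldl _ _ _) => -[] H /=; first by left.
  case=> // -[d [wH sd [Hd dx]]].
  have mxH (u : 'cV[rat]_n) k : (mx H *m u) k 0 = 2%:R ^+ d k * (mx G *m u) k 0.
    rewrite !mxE mulr_sumr; apply: eq_bigr => j _.
    by rewrite !mxE Hd rmorphM rmorphXn mulrA.
  have injH (u : 'cV[rat]_n) : mx H *m u = 0 -> u = 0.
    move=> Hu; apply: injG; apply/matrixP => i j; rewrite ord1 [RHS]mxE.
    have := mxH u i; rewrite Hu mxE => /esym /eqP.
    by rewrite mulf_eq0 expf_eq0 pnatr_eq0 andbF /= => /eqP.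
  have G0 k : 0 <= (mx G *m v) k 0.
    by case/andP: (x01 k) => h _; apply: le_trans h; rewrite invr_ge0 exprn_ge0.
  have Hx k : 0 <= (mx H *m v) k 0 <= 1.
    by rewrite mxH dx andbT mulr_ge0 // exprn_ge0.
  have [->|[k xk [wH' Hk]]] := round_progress wH injH Hx; [by left|right].
  exists (fun i => d i + (i == k))%N; split=> //.
    by rewrite big_split /= sd (bigD1 k) //= eqxx big1 ?addn1 // => i /negbTE ->.
  split=> [i j|i].
    by rewrite Hk Hd mulrA; congr (_ * _); case: eqP => _; rewrite ?addn0 ?mul1r // addn1 exprS.
  case: eqP => [->|_]; last by rewrite addn0.
  by rewrite addn1 exprS -mulrA -mxH; lra.
have [//|[d [_ sd [_ dx]]]] := I U; first by rewrite -[X in is_true X]/(lp_solve G U) (negbTE nsol).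
suff : (\sum_k d k <= \sum_(k < m) L)%N.
  by rewrite sd sum_nat_const card_ord leqNgt LU.
apply: leq_sum => k _; rewrite leqNgt; apply/negP => Ld.
have := dx k; rewrite leNgt => /negP; apply.
have /andP[h _] := x01 k; apply: lt_le_trans (_ : 2%:R ^+ d k * 2%:R ^- L <= _).
  by rewrite ltr_pdivlMr ?exprn_gt0 // mul1r ltr_eXn2l // ltr1n.
by rewrite ler_pM2l // exprn_gt0.
Qed.

(** Every current row is a positive multiple of the original one, so a solution of the rescaled
    system solves the given system. *)
Lemma lp_solve_sound G (U : seq unit) : wf m n G -> lp_solve G U ->
  exists v : nat -> int, forall k, (k < m)%N -> 0 < \sum_(j < n) ent G k j * v j.
Proof.
move=> wG; rewrite /lp_solve.
suff I (l : seq unit) : let st := foldl (fun (st : bool * imat) _ =>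
     if st.1 then st else round st.2) (false, G) l in
   wf m n st.2 /\ (exists a : nat -> nat, (forall i, 0 < a i)%N /\
      forall i j, (i < m)%N -> (j < n)%N -> ent st.2 i j = Posz (a i) * ent G i j) /\
   (st.1 -> exists v : nat -> int, forall k, (k < m)%N -> 0 < \sum_(j < n) ent st.2 k j * v j).
  have [_ [[a [a0 aE]] H]] := I U => /H [v vP]; exists v => k km.
  have := vP k km; have -> : \sum_(j < n) ent (foldl (fun (st : bool * imat) _ =>
     if st.1 then st else round st.2) (false, G) U).2 k j * v j =
     Posz (a k) * \sum_(j < n) ent G k j * v j.
    by rewrite mulr_sumr; apply: eq_bigr => j _; rewrite aE // mulrA.
  by rewrite pmulr_rgt0 // ltz_nat a0.
elim/last_ind: l => [|l b].
  by split=> //; split=> //; exists (fun=> 1%N); split=> // i j _ _; rewrite mul1r.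
rewrite foldl_rcons; case: (foldl _ _ _) => -[] H /=; first by [].
move=> [wH [[a [a0 aE]] _]]; have [sH rH] := wH.
rewrite /round /round4 /round3 /round2 /round1; set A := flm _; set c := lp_scale _ _.
set y := percep H A c; case: ifP => [/allP pos|_] /=.
  split=> //; split; first by exists a.
  (* By its definition the slack vector is [H] applied to this integer vector. *)
  move=> _; exists (fun j => c * nth 0 (lp_vec H A y) j) => k km.
  have := pos (nth 0 (slack H A c y) k); rewrite mem_nth ?size_slack ?sH // => /(_ isT).
  rewrite /slack (nth_map 0%N) ?size_iota ?sH // nth_iota // add0n (wf_head _ wH) // sum_iota.
  by rewrite mulr_sumr; congr (_ < _); apply: eq_bigr => j _; ring.
split; first split.
- by rewrite size_mkM size_iota.
- move=> i im; rewrite /mkM (nth_map 0%N) ?size_iota ?sH // size_map size_iota.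
  exact: (wf_head _ wH).
split=> //; pose e i := first_le [seq - z | z <- y] (- Posz (4 * size H * size H)) i.
exists (fun i => (if e i then 2 else 1) * a i)%N; split=> [i|i j im jn].
  by case: (e i); have := a0 i; lia.
rewrite /double_row (wf_head _ wH) // sH ent_mkM im jn /= -sH -/(e i) PoszM -mulrA -aE //.
by case: (e i).
Qed.

End Correctness.

(** * Inhomogeneous systems with named unknowns *)

Section System.
Variables (X : eqType) (vars : seq X).
Hypothesis uvars : uniq vars.

(** The last entry is the constant term, that is the coefficient of an additional homogenising
    unknown. *)
Definition mkrow (f : X -> int) (t : int) : seq int := rcons [seq f x | x <- vars] t.

Lemma size_mkrow f t : size (mkrow f t) = (size vars).+1.
Proof. by rewrite size_rcons size_map. Qed.

Lemma dot_mkrow (K : pzRingType) f t (v : nat -> K) :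
  \sum_(j < (size vars).+1) (nth 0 (mkrow f t) j)%:~R * v j =
  \sum_(x <- vars) (f x)%:~R * v (index x vars) + t%:~R * v (size vars).
Proof.
rewrite big_ord_recr /= nth_rcons size_map ltnn eqxx; congr (_ + _).
case: (altP (size vars =P 0%N)) => [/size0nil ->|ne]; first by rewrite big_ord0 big_nil.
have [x0 _] : exists x0 : X, true by case: (vars) ne => // x0 *; exists x0.
rewrite (big_nth x0) big_mkord; apply: eq_bigr => j _.
by rewrite nth_rcons size_map ltn_ord (nth_map x0) // index_uniq.
Qed.

Variables (G : imat) (U : seq unit).
Hypothesis rowsG : forall row, row \in G -> size row = (size vars).+1.

Lemma lp_wf : wf (size G) (size vars).+1 G.
Proof. by split=> // i iG; apply: rowsG; exact: mem_nth. Qed.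

Lemma lp_sound : lp_solve G U -> exists (v : X -> int) (t : int),
  forall f c, mkrow f c \in G -> 0 < \sum_(x <- vars) f x * v x + c * t.
Proof.
case: (posnP (size G)) => [/size0nil ->|G0]; first by exists (fun=> 0), 0.
have wG := lp_wf; rewrite -(prednK G0) in wG.
move=> /(lp_solve_sound wG)[v vP]; exists (fun x => v (index x vars)), (v (size vars)) => f c rG.
have iG : (index (mkrow f c) G < (size G).-1.+1)%N by rewrite prednK // index_mem.
have := vP _ iG; rewrite /ent nth_index //.
have := @dot_mkrow int f c v; under eq_bigr do rewrite intz.
by move=> ->; rewrite intz; under eq_bigr do rewrite intz.
Qed.

(** Extending [v] by 1 and scaling by [2^-L] brings all slacks into the interval from [2^-L] to 1.
    The unit rows and the row of the constant make the matrix injective, so that its Gram matrix is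
    invertible. *)
Lemma lp_complete (v : X -> rat) L :
  (forall x, x \in vars -> exists c, mkrow (fun y => (y == x)%:R) c \in G) ->
  mkrow (fun=> 0) 1 \in G ->
  (forall row, row \in G -> exists f c, row = mkrow f c /\
    1 <= \sum_(x <- vars) (f x)%:~R * v x + c%:~R <= 2 ^+ L) ->
  (size G * L < size U)%N -> lp_solve G U.
Proof.
move=> unitG oneG vP LU.
have G0 : (0 < size G)%N by case: (G) oneG.
have wG := lp_wf; rewrite -(prednK G0) in wG LU.
have dotE (u : 'cV[rat]_(size vars).+1) f c : mkrow f c \in G ->
    exists k : 'I_(size G).-1.+1, (mx (size G).-1 (size vars) G *m u) k 0 =
    \sum_(x <- vars) (f x)%:~R * u (inord (index x vars)) 0 + c%:~R * u ord_max 0.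
  move=> rG; have iG : (index (mkrow f c) G < (size G).-1.+1)%N by rewrite prednK // index_mem.
  exists (Ordinal iG); rewrite mxE.
  rewrite (_ : ord_max = inord (size vars)); last by apply: val_inj; rewrite /= inordK.
  rewrite -(@dot_mkrow rat f c (fun j => u (inord j) 0)); apply: eq_bigr => j _.
  by rewrite mxE /ent nth_index // inord_val.
pose u : 'cV[rat]_(size vars).+1 := \col_j (2%:R ^- L *
  (if (j < size vars)%N then nth 0 [seq v x | x <- vars] j else 1)).
apply: (lp_solve_complete (v := u) wG _ _ LU).
  move=> z z0; have t0 : z ord_max 0 = 0.
    have [k] := dotE z _ _ oneG; rewrite z0 mxE big1 ?add0r ?mul1r // => x _.
    by rewrite mul0r.
  apply/matrixP => j j'; rewrite [j']ord1 [RHS]mxE.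
  case: (ltnP j (size vars)) => jv; last first.
    by rewrite (_ : j = ord_max) //; apply: val_inj; have := ltn_ord j => /= jl; apply/eqP; rewrite eqn_leq jv -ltnS jl.
  have [x0 _] : exists x0 : X, true.
    by have := leq_ltn_trans (leq0n _) jv; case: (vars) => // x0 *; exists x0.
  have xv : nth x0 vars j \in vars by rewrite mem_nth.
  have [c cG] := unitG _ xv; have [k] := dotE z _ _ cG.
  rewrite z0 mxE t0 mulr0 addr0 (bigD1_seq (nth x0 vars j)) //= eqxx mul1r index_uniq // big1 ?addr0.
    by rewrite inord_val => <-.
  by move=> y /negbTE ->; rewrite mul0r.
move=> k; have kG : (k < size G)%N by rewrite -[X in (_ < X)%N](prednK G0).
have [f [c [rE /andP[lo hi]]]] := vP _ (mem_nth [::] kG).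
have -> : (mx (size G).-1 (size vars) G *m u) k 0 =
    2%:R ^- L * (\sum_(x <- vars) (f x)%:~R * v x + c%:~R).
  rewrite mxE; transitivity (2%:R ^- L * \sum_(j < (size vars).+1)
      (nth 0 (mkrow f c) j)%:~R * (if (j < size vars)%N then nth 0 [seq v x | x <- vars] j else 1)).
    by rewrite mulr_sumr; apply: eq_bigr => j _; rewrite !mxE /ent rE mulrCA.
  congr (_ * _); rewrite (dot_mkrow f c (fun j => if (j < size vars)%N
    then nth 0 [seq v x | x <- vars] j else 1)) ltnn mulr1; congr (_ + _).
  rewrite !big_seq; apply: eq_bigr => x xv; rewrite index_mem xv (nth_map x) ?index_mem //.
  by rewrite nth_index.
have p2 : (0 : rat) < 2%:R ^+ L by rewrite exprn_gt0.
rewrite ler_pMr ?invr_gt0 // lo mulrC ler_pdivrMr // mul1r; exact: hi.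
Qed.

End System.

(** * The algorithm on lists *)

(* A set of states is given by its characteristic bit string; [tr] lists, for
   every state, the rows of scaled transition probabilities of its actions. *)
Notation bmask := (seq bool).
Notation ttab := (seq (seq (seq int))).
Notation item := (int * (nat * (nat * seq bool)))%type.

(** A disabled action has a zero row, so the first conjunct tests that the action is enabled. *)
Definition stayb (row : seq int) (C : bmask) := has (fun z => z != 0) row &&
  all (fun j => (nth 0 row j == 0) || nth false C j) (iota 0 (size row)).
Definition actsb (rows : seq (seq int)) C := has (fun row => stayb row C) rows.
Definition edgeb (rows : seq (seq int)) C u :=
  has (fun row => stayb row C && (nth 0 row u != 0)) rows.
Definition edges (tr : ttab) C := [seq [seq nth false C t && edgeb (nth [::] tr t) C u
  | u <- iota 0 (size tr)] | t <- iota 0 (size tr)].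
Definition rstep (e : seq bmask) (A : bmask) := [seq nth false A u ||
  has (fun t => nth false A t && nth false (nth [::] e t) u) (iota 0 (size e))
  | u <- iota 0 (size e)].
Definition reachb (e : seq bmask) (x : nat) : bmask :=
  foldl (fun A _ => rstep e A) [seq u == x | u <- iota 0 (size e)] e.
Definition ecstepb (tr : ttab) s C e := [seq [&& nth false C t,
  actsb (nth [::] tr t) C, nth false (reachb e s) t & nth false (reachb e t) s]
  | t <- iota 0 (size tr)].
Definition ecofb (tr : ttab) (U : bmask) s : bmask :=
  foldl (fun C _ => ecstepb tr s C (edges tr C)) [seq ~~ nth false U t | t <- iota 0 (size tr)] tr.

Definition orb_mask (tr : ttab) (U V : bmask) :=
  [seq nth false U t || nth false V t | t <- iota 0 (size tr)].
(** The unions of at most [c] targets. Each level multiplies the length by the number of items plus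
    one, which is polynomial for fixed [c]. *)
Fixpoint family (c : nat) (tr : ttab) (items : seq item) : seq bmask :=
  if c is c'.+1 then family c' tr items ++
    flatten [seq [seq orb_mask tr U it.2.2.2 | it <- items] | U <- family c' tr items]
  else [:: [seq false | t <- iota 0 (size tr)]].

Definition valb (items : seq item) (k s : nat) (C : bmask) : int :=
  \sum_(it <- items) (if (it.2.2.1 == k) && ((it.2.1 == s) &&
    has (fun t => nth false C t && nth false it.2.2.2 t) (iota 0 (size C))) then it.1 else 0).

(** The unknown [(k, (s, t))] stands for the value at state [t] of the stopping problem that belongs
    to scheduler variable [k] and initial state [s]. *)
Definition lpvars (ks ss : seq nat) : seq (nat * (nat * nat)) :=
  flatten [seq flatten [seq [seq (k, (s, t)) | t <- ss] | s <- ss] | k <- ks].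

Notation var := (nat * (nat * nat))%type.
Section Rows.
Variables (vars : seq var) (beta den : nat).
(** The relaxed constraint [v(t) - sum_u P(t,a,u) v(u) + 1/beta > 0], multiplied by [beta * den] to
    become integral. *)
Definition row_step (x : var) (row : seq int) := mkrow vars (fun y : var =>
  if (y.1 == x.1) && (y.2.1 == x.2.1) then
    Posz beta * ((if y.2.2 == x.2.2 then Posz den else 0) + - nth 0 row y.2.2) else 0) (Posz den).
(** The relaxed constraint [v(t) - c + 1/beta > 0], multiplied by [beta]. *)
Definition row_stop (x : var) (c : int) := mkrow vars (fun y : var =>
  if (y.1 == x.1) && ((y.2.1 == x.2.1) && (y.2.2 == x.2.2)) then Posz beta else 0)
  (1 + - (Posz beta * c)).
(** The test selects the unknowns [(k, (s, s))], the values at the initial states; their sum has to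
    stay below [theta + 1/beta]. *)
Definition row_obj (theta : int) := mkrow vars (fun y : var =>
  if y.2.1 == y.2.2 then - Posz beta else 0) (Posz beta * theta + 1).
(** The constraint [v > - beta], true of the optimal values because [beta] exceeds their absolute
    values. It provides the unit rows that [lp_complete] asks for. *)
Definition row_var (x : var) := mkrow vars (fun y : var =>
  if (y.1 == x.1) && ((y.2.1 == x.2.1) && (y.2.2 == x.2.2)) then 1 else 0) (Posz beta).
Definition row_pos := mkrow vars (fun y : var => 0) 1.
Definition rows_at (tr : ttab) (items : seq item) (fam : seq bmask) (x : var) : imat :=
  row_var x :: ([seq row_step x row | row <- filter (fun row => has (fun z => z != 0) row) (nth [::] tr x.2.2)] ++
   [seq row_stop x (valb items x.1 x.2.1 C) |
      C <- filter (fun C => nth false C x.2.2) [seq ecofb tr U x.2.2 | U <- fam]]).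
Definition lpmx (tr : ttab) (items : seq item) (fam : seq bmask) (theta : int) : imat :=
  row_pos :: (row_obj theta :: flatten [seq rows_at tr items fam x | x <- vars]).
End Rows.

(** Equals [Kbd], a bound on the determinants of policy systems. Its power [kall], with one factor
    per group, bounds a common denominator of the sum over all groups. *)
Definition kbd (S : seq nat) den : nat := (\prod_(i <- S) (i.+1 * (2 * den)))%N.
Definition kall (ks S : seq nat) den : nat := (\prod_(k <- ks) \prod_(s <- S) kbd S den)%N.
Definition wsum (items : seq item) : nat := absz (\sum_(it <- items) Posz (absz it.1))%R.
(** With [K0] the value of [kall] and [T] the bound on expected stopping times, this is
    [K0 * (1 + n S (T + 1)) + W + 1]. The total effect of the relaxation,
    [(1 + n S (T + 1)) / beta], is thus less than [1 / K0], and [beta > W]. *)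
Definition betab (ks S : seq nat) den (W : nat) : nat :=
  (kall ks S den * (1 + size ks * size S * (size S * kbd S den * den + 1)) + W + 1)%N.
(** Dominates the value of every row at the optimal point; its bit length is the [L] of the
    solver. *)
Definition boundb (ks S : seq nat) den (W beta : nat) (theta : int) : nat :=
  (beta * (2 * den * W + 2 * W + `|theta| + size ks * size S * W + 1) + W + den + 1)%N.
Definition fuel (G : imat) (B : nat) : seq unit :=
  tt :: flatten [seq [seq tt | _ <- bits B] | _ <- G].

(** A solution certifies that the optimum is at most [theta], hence the negation. *)
Definition gt_test2 (G : imat) (B : nat) := ~~ lp_solve G (fuel G B).
Definition gt_test1 (tr : ttab) den (items : seq item) fam (ks : seq nat) (theta : int) W beta :=
  gt_test2 (lpmx (lpvars ks (iota 0 (size tr))) beta den tr items fam theta)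
    (boundb ks (iota 0 (size tr)) den W beta theta).
Definition gt_test (tr : ttab) den (items : seq item) fam (ks : seq nat) (theta : int) :=
  gt_test1 tr den items fam ks theta (wsum items)
    (betab ks (iota 0 (size tr)) den (wsum items)).
Definition scale_items (z : int) (items : seq item) : seq item :=
  [seq (z * it.1, it.2) | it <- items].
(** [K] bounds a denominator of the optimum, so an optimum below the integer [theta] is below it by
    at least [1 / K]. After scaling by [K], the optimum is at least [theta] iff the scaled one
    exceeds [K * theta - 1]. *)
Definition ge_test1 (tr : ttab) den (items : seq item) fam (ks : seq nat) (theta K : int) :=
  gt_test tr den (scale_items K items) fam ks (K * theta + - 1).
Definition ge_test (tr : ttab) den (items : seq item) fam (ks : seq nat) (theta : int) :=
  ge_test1 tr den items fam ks theta (Posz (kall ks (iota 0 (size tr)) den)).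

(** * Running time of the algorithm *)

Lemma esz_mask (s : seq bool) : (esz s <= 4 * size s + 1)%N.
Proof.
rewrite mulnC; apply: esz_seq_le => k a _.
by case: (nth a s k).
Qed.

Lemma P_stayb {X} {eX : Enc X} (a : X -> seq int) (b : X -> bmask) : P a -> P b ->
  P (fun x => stayb (a x) (b x)).
Proof.
move=> Pa Pb; apply: (P_comp (f := fun x => (a x, b x)) (g := fun p => stayb p.1 p.2)); last by P_auto.
by rewrite /stayb; P_auto.
Qed.

Lemma P_actsb {X} {eX : Enc X} (a : X -> seq (seq int)) (b : X -> bmask) : P a -> P b ->
  P (fun x => actsb (a x) (b x)).
Proof.
move=> Pa Pb; apply: (P_has (p := fun x row => stayb row (b x)) _ Pa).
by apply: P_stayb; P_auto; apply: (P_comp Pb); P_auto.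
Qed.

Lemma P_edges {X} {eX : Enc X} (a : X -> ttab) (b : X -> bmask) : P a -> P b ->
  P (fun x => edges (a x) (b x)).
Proof.
move=> Pa Pb; apply: (P_comp (f := fun x => (a x, b x)) (g := fun p => edges p.1 p.2)); last by P_auto.
rewrite /edges; apply: P_map; last by P_auto.
apply: P_map; last by P_auto.
apply: P_andb; first by P_auto.
rewrite /edgeb; apply: P_has; last by P_auto.
by apply: P_andb; [apply: P_stayb|]; P_auto.
Qed.

Lemma size_reachb e x n : size (foldl (fun A (_ : bmask) => rstep e A)
  [seq u == x | u <- iota 0 (size e)] (take n e)) = size e.
Proof.
by elim/last_ind: (take n e) => [|s a IH]; rewrite ?foldl_rcons /= size_map size_iota.
Qed.

Lemma P_reachb {X} {eX : Enc X} (a : X -> seq bmask) (b : X -> nat) : P a -> P b ->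
  P (fun x => reachb (a x) (b x)).
Proof.
move=> Pa Pb; apply: (P_comp (f := fun x => (a x, b x)) (g := fun p => reachb p.1 p.2)); last by P_auto.
apply: (P_foldl (f := fun p A _ => rstep p.1 A) (z := fun p : seq bmask * nat =>
  [seq u == p.2 | u <- iota 0 (size p.1)]) (l := fun p => p.1)).
- by rewrite /rstep; P_auto.
- by P_auto.
- by P_auto.
have [c [k cP]] : polyb (fun n => 4 * n + 1)%N by polyb_tac.
exists c, k => -[e x] n; apply: leq_trans (cP _); apply: leq_trans (esz_mask _) _.
rewrite leq_add2r leq_mul2l /= size_reachb esz_pair.
by pose proof (size_le_esz e); lia.
Qed.

Lemma size_ecofb tr U s n : size (foldl (fun C (_ : seq (seq int)) => ecstepb tr s C (edges tr C))
  [seq ~~ nth false U t | t <- iota 0 (size tr)] (take n tr)) = size tr.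
Proof.
by elim/last_ind: (take n tr) => [|l a IH]; rewrite ?foldl_rcons /= size_map size_iota.
Qed.

Lemma P_ecofb {X} {eX : Enc X} (a : X -> ttab) (b : X -> bmask) (d : X -> nat) :
  P a -> P b -> P d -> P (fun x => ecofb (a x) (b x) (d x)).
Proof.
move=> Pa Pb Pd.
apply: (P_comp (f := fun x => (a x, (b x, d x))) (g := fun p => ecofb p.1 p.2.1 p.2.2)); last by P_auto.
apply: (P_foldl (f := fun p C _ => ecstepb p.1 p.2.2 C (edges p.1 C))
  (z := fun p : ttab * (bmask * nat) => [seq ~~ nth false p.2.1 t | t <- iota 0 (size p.1)])
  (l := fun p => p.1)).
- apply: (P_comp (f := fun q : (ttab * (bmask * nat)) * (bmask * seq (seq int)) =>
    (q.1.1, (q.1.2.2, (q.2.1, edges q.1.1 q.2.1))))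
    (g := fun p => ecstepb p.1 p.2.1 p.2.2.1 p.2.2.2)); last first.
    by P_auto; apply: P_edges; P_auto.
  rewrite /ecstepb; apply: P_map; last by P_auto.
  by P_auto; [apply: P_actsb; P_auto|apply: P_reachb; P_auto|apply: P_reachb; P_auto].
- by P_auto.
- by P_auto.
have [c [k cP]] : polyb (fun n => 4 * n + 1)%N by polyb_tac.
exists c, k => -[tr [U s]] n; apply: leq_trans (cP _); apply: leq_trans (esz_mask _) _.
rewrite leq_add2r leq_mul2l /= size_ecofb esz_pair.
by pose proof (size_le_esz tr); lia.
Qed.

Lemma P_family c : P (fun p : ttab * seq item => family c p.1 p.2).
Proof.
elim: c => [|c IH] /=; first by P_auto.
apply: P_cat => //; apply: P_flatten; apply: (P_map _ IH).
by rewrite /orb_mask; P_auto.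
Qed.

Lemma P_valb {X} {eX : Enc X} (a : X -> seq item) (k s : X -> nat) (C : X -> bmask) :
  P a -> P k -> P s -> P C -> P (fun x => valb (a x) (k x) (s x) (C x)).
Proof.
move=> Pa Pk Ps PC; apply: (P_comp (f := fun x => (a x, (k x, (s x, C x))))
  (g := fun p => valb p.1 p.2.1 p.2.2.1 p.2.2.2)); last by P_auto.
by rewrite /valb; P_auto.
Qed.

Lemma P_mkrow {X A} {eX : Enc X} {eA : Enc A} (v : X -> seq A) (f : X -> A -> int) (t : X -> int) :
  P v -> P (fun p : X * A => f p.1 p.2) -> P t ->
  P (fun x => rcons [seq f x y | y <- v x] (t x)).
Proof.
move=> Pv Pf Pt; apply: (P_ext (f := fun x => [seq f x y | y <- v x] ++ [:: t x])).
  by move=> x; rewrite cats1.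
by P_auto.
Qed.

Lemma P_rows_at {X} {eX : Enc X} (v : X -> seq var) (beta den : X -> nat) (tr : X -> ttab)
    (it : X -> seq item) (fam : X -> seq bmask) (y : X -> var) :
  P v -> P beta -> P den -> P tr -> P it -> P fam -> P y ->
  P (fun x => rows_at (v x) (beta x) (den x) (tr x) (it x) (fam x) (y x)).
Proof.
move=> Pv Pb Pd Pt Pi Pf Py; apply: (P_comp
  (f := fun x => (v x, (beta x, (den x, (tr x, (it x, (fam x, y x)))))))
  (g := fun p => rows_at p.1 p.2.1 p.2.2.1 p.2.2.2.1 p.2.2.2.2.1 p.2.2.2.2.2.1 p.2.2.2.2.2.2));
  last by P_auto.
rewrite /rows_at; apply: P_cons; first by apply: P_mkrow; P_auto.
apply: P_cat; apply: P_map.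
- by apply: P_mkrow; P_auto.
- by P_auto.
- by apply: P_mkrow; P_auto; apply: P_valb; P_auto.
- apply: P_filter; first by P_auto.
  by apply: P_map; [apply: P_ecofb|]; P_auto.
Qed.

Lemma P_lpmx {X} {eX : Enc X} (v : X -> seq var) (beta den : X -> nat) (tr : X -> ttab)
    (it : X -> seq item) (fam : X -> seq bmask) (theta : X -> int) :
  P v -> P beta -> P den -> P tr -> P it -> P fam -> P theta ->
  P (fun x => lpmx (v x) (beta x) (den x) (tr x) (it x) (fam x) (theta x)).
Proof.
move=> Pv Pb Pd Pt Pi Pf Py; apply: (P_comp
  (f := fun x => (v x, (beta x, (den x, (tr x, (it x, (fam x, theta x)))))))
  (g := fun p => lpmx p.1 p.2.1 p.2.2.1 p.2.2.2.1 p.2.2.2.2.1 p.2.2.2.2.2.1 p.2.2.2.2.2.2));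
  last by P_auto.
rewrite /lpmx; apply: P_cons; first by apply: P_mkrow; P_auto.
apply: P_cons; first by apply: P_mkrow; P_auto.
apply: P_flatten; apply: P_map; last by P_auto.
by apply: P_rows_at; P_auto.
Qed.

Lemma P_lpvars {X} {eX : Enc X} (a b : X -> seq nat) : P a -> P b -> P (fun x => lpvars (a x) (b x)).
Proof.
move=> Pa Pb; apply: (P_comp (f := fun x => (a x, b x)) (g := fun p => lpvars p.1 p.2)); last by P_auto.
by rewrite /lpvars; P_auto.
Qed.

Lemma P_kbd {X} {eX : Enc X} (b : X -> seq nat) (d : X -> nat) : P b -> P d ->
  P (fun x => kbd (b x) (d x)).
Proof.
move=> Pb Pd; apply: (P_comp (f := fun x => (b x, d x)) (g := fun p => kbd p.1 p.2)); last by P_auto.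
by rewrite /kbd; P_auto.
Qed.

Lemma P_kall {X} {eX : Enc X} (a b : X -> seq nat) (d : X -> nat) : P a -> P b -> P d ->
  P (fun x => kall (a x) (b x) (d x)).
Proof.
move=> Pa Pb Pd; apply: (P_comp (f := fun x => (a x, (b x, d x)))
  (g := fun p => kall p.1 p.2.1 p.2.2)); last by P_auto.
by rewrite /kall; do 2![apply: P_prodn; last by P_auto]; apply: P_kbd; P_auto.
Qed.

Lemma P_gt_test : P (fun p : ttab * (nat * (seq item * (seq bmask * (seq nat * int)))) =>
  gt_test p.1 p.2.1 p.2.2.1 p.2.2.2.1 p.2.2.2.2.1 p.2.2.2.2.2).
Proof.
rewrite /gt_test; apply: (P_comp (f := fun p : ttab * (nat * (seq item * (seq bmask * (seq nat * int)))) =>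
  (p, wsum p.2.2.1)) (g := fun q => let p := q.1 in gt_test1 p.1 p.2.1 p.2.2.1 p.2.2.2.1
     p.2.2.2.2.1 p.2.2.2.2.2 q.2 (betab p.2.2.2.2.1 (iota 0 (size p.1)) p.2.1 q.2))); last first.
  by rewrite /wsum; P_auto; apply: P_absz; P_auto; apply: P_absz; P_auto.
apply: (P_comp (f := fun q : (ttab * (nat * (seq item * (seq bmask * (seq nat * int))))) * nat =>
  (q, betab q.1.2.2.2.2.1 (iota 0 (size q.1.1)) q.1.2.1 q.2))
  (g := fun q2 => let q := q2.1 in let p := q.1 in gt_test1 p.1 p.2.1 p.2.2.1 p.2.2.2.1
     p.2.2.2.2.1 p.2.2.2.2.2 q.2 q2.2)); last first.
  rewrite /betab; P_auto; [apply: P_kall; P_auto|apply: P_kbd; P_auto].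
rewrite /gt_test1 /=; apply: (P_comp (f := fun q : ((ttab * (nat * (seq item * (seq bmask * (seq nat * int))))) * nat) * nat =>
  (lpmx (lpvars q.1.1.2.2.2.2.1 (iota 0 (size q.1.1.1))) q.2 q.1.1.2.1 q.1.1.1
     q.1.1.2.2.1 q.1.1.2.2.2.1 q.1.1.2.2.2.2.2,
   boundb q.1.1.2.2.2.2.1 (iota 0 (size q.1.1.1)) q.1.1.2.1 q.1.2 q.2 q.1.1.2.2.2.2.2))
  (g := fun p => gt_test2 p.1 p.2)); last first.
  apply: P_pair; first by apply: P_lpmx; P_auto; apply: P_lpvars; P_auto.
  by rewrite /boundb; P_auto; apply: P_absz; P_auto.
rewrite /gt_test2; apply: P_negb.
apply: (P_comp P_lp_solve (f := fun p : imat * nat => (p.1, fuel p.1 p.2))); rewrite /fuel; P_auto.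
by apply: P_bits; P_auto.
Qed.

Lemma P_ge_test : P (fun p : ttab * (nat * (seq item * (seq bmask * (seq nat * int)))) =>
  ge_test p.1 p.2.1 p.2.2.1 p.2.2.2.1 p.2.2.2.2.1 p.2.2.2.2.2).
Proof.
rewrite /ge_test; apply: (P_comp (f := fun p : ttab * (nat * (seq item * (seq bmask * (seq nat * int)))) =>
  (p, Posz (kall p.2.2.2.2.1 (iota 0 (size p.1)) p.2.1)))
  (g := fun q => let p := q.1 in ge_test1 p.1 p.2.1 p.2.2.1 p.2.2.2.1
     p.2.2.2.2.1 p.2.2.2.2.2 q.2)); last first.
  by P_auto; apply: P_kall; P_auto.
rewrite /ge_test1 /=; apply: (P_comp P_gt_test (f := fun q : (ttab * (nat * (seq item * (seq bmask * (seq nat * int))))) * int =>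
  (q.1.1, (q.1.2.1, (scale_items q.2 q.1.2.2.1, (q.1.2.2.2.1, (q.1.2.2.2.2.1,
     q.2 * q.1.2.2.2.2.2 + - 1))))))).
by rewrite /scale_items; P_auto.
Qed.

(** * Reading an instance *)

Notation wordlist := (seq (seq bool)).
Notation frac := (int * nat)%type.

(** The bit strings between end marks. Bits that are not followed by a mark (signs, targets, the
    kind of comparison) become prefixes of the next word. *)
Definition words (w : seq sym) : wordlist := foldr (fun (o : sym) (acc : wordlist) =>
  match o with Some b => (b :: head [::] acc) :: behead acc | None => [::] :: acc end) [:: [::]] w.
Definition fracof (l : wordlist) : frac :=
  (mkint (head false (head [::] l)) (bval (behead (head [::] l))), bval (head [::] (behead l))).
(** Cuts loops off at the input length. Running time has to be polynomial on every word, including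
    words that encode no instance and from which huge numbers are decoded. *)
Definition upto (n : nat) (N : seq nat) := filter (fun i => (i < n)%N) N.
(** Numerators over the common denominator [dprod], found without division from the product of the
    other denominators. *)
Definition scalel (l : seq frac) : seq int := [seq (nth (0, 0%N) l i).1 *
  Posz (\prod_(j <- iota 0 (size l)) (if j == i then 1 else (nth (0%R, 0) l j).2))%N
  | i <- iota 0 (size l)].
Definition dprod (l : seq frac) : nat := (\prod_(x <- l) x.2)%N.

Arguments words : simpl never.

Section Parse.
Variables (ws : wordlist) (N : seq nat).
Definition rS := bval (nth [::] ws 0).
Definition rA := bval (nth [::] ws 1).
Definition rSl := upto rS N.
Definition rAl := upto rA N.
Definition tfracs := [seq fracof (drop (2 + 2 * i) ws) | i <- upto (rS * rA * rS) N].
Definition rtr : ttab := [seq [seq [seq nth 0 (scalel tfracs) ((s * rA + a) * rS + t)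
  | t <- rSl] | a <- rAl] | s <- rSl].
(** The index of the word that holds the number of items: two words for the cardinals, then two for
    every transition probability. *)
Definition rbase := (2 + 2 * (rS * rA * rS))%N.
Definition rm := bval (nth [::] ws rbase).
Definition rn := bval (nth [::] ws rbase.+1).
Definition rml := upto rm N.
(* The bits of a target set are not followed by an end mark, so they are a
   prefix of the next word; padding the first word makes this uniform. *)
Definition rwords : wordlist := ([seq false | _ <- rSl] ++ head [::] (drop rbase.+2 ws)) ::
  behead (drop rbase.+2 ws).
(** Removes the target bits that the preceding item left in front of the next word. *)
Definition unpad (l : wordlist) : wordlist := drop rS (head [::] l) :: behead l.
Definition rrest := unpad (drop (4 * rm) rwords).
Definition rcmp i := nth false (head [::] rrest) i.
Definition rtail : wordlist := drop 2 (head [::] rrest) :: behead rrest.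
Definition rbound := if rcmp 0 then fracof (drop 2 rtail) else fracof rtail.
Definition rceps : frac := if rcmp 0 then fracof rtail else (0, 1%N).
(** Coefficients, bound and epsilon are brought to one common denominator, so that comparing the
    integer multiples is equivalent. *)
Definition cfracs := [seq fracof (unpad (drop (4 * i) rwords)) | i <- rml] ++ [:: rbound; rceps].
Definition ritems : seq item := [seq (nth 0 (scalel cfracs) i,
  (bval (nth [::] rwords (4 * i + 2)), (bval (nth [::] rwords (4 * i + 3)),
    [seq nth false (nth [::] rwords (4 * i + 4)) t | t <- rSl]))) | i <- rml].
Definition rzb := nth 0 (scalel cfracs) rm.
Definition rze := nth 0 (scalel cfracs) rm.+1.
End Parse.

(** [c1] and [c2] are the two bits of the comparison. Two-sided conditions become one-sided tests
    for the weights and for their negatives: a disjunction for distance, a conjunction for closeness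
    because the achievable values form an interval. *)
Definition decide1 (c : nat) (tr : ttab) den (items : seq item) (ks : seq nat)
    (c1 c2 : bool) (zb ze : int) :=
  if c1 then
    if c2 then gt_test tr den items (family c tr items) ks (zb + ze) ||
               gt_test tr den (scale_items (-1) items) (family c tr items) ks (- zb + ze)
    else ge_test tr den items (family c tr items) ks (zb + - ze) &&
         ge_test tr den (scale_items (-1) items) (family c tr items) ks (- zb + - ze)
  else if c2 then ge_test tr den items (family c tr items) ks zb
  else gt_test tr den items (family c tr items) ks zb.

Definition decide2 (c : nat) (ws : wordlist) (N : seq nat) :=
  decide1 c (rtr ws N) (dprod (tfracs ws N)) (ritems ws N) (upto (rn ws) N)
    (rcmp ws N 0) (rcmp ws N 1) (rzb ws N) (rze ws N).
Definition decide c (w : seq sym) := decide2 c (words w) (iota 0 (size w)).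

Lemma esz_words (w : seq sym) : (esz (words w) <= 5 * size w + 5)%N.
Proof.
elim: w => [//|o w IH]; rewrite [size _]/=; have -> : words (o :: w) = match o with
  Some b => (b :: head [::] (words w)) :: behead (words w) | None => [::] :: words w end by [].
case: o => [b|]; last by rewrite esz_cons; have -> : (esz ([::] : seq bool) = 1)%N by []; lia.
have b3 : (esz b <= 3)%N by case: (b).
move: IH; case: (words w) => [|h t]; rewrite ?esz_cons /= ?esz_cons.
  by move=> IH; have -> : (esz ([::] : seq bool) = 1)%N by []; have -> : (esz ([::] : wordlist) = 1)%N by []; lia.
by lia.
Qed.

Lemma P_words : P words.
Proof.
apply: (P_foldr (f := fun (_ : seq sym) (o : sym) (acc : wordlist) =>
  match o with Some b => (b :: head [::] acc) :: behead acc | None => [::] :: acc end)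
  (z := fun=> [:: [::]]) (l := id)).
- by apply: P_symcase; P_auto.
- exact: P_cst.
- exact: P_id.
have [c [k cP]] : polyb (fun n => 5 * n + 5)%N by polyb_tac.
exists c, k => w n; apply: leq_trans (cP _); apply: leq_trans (esz_words _) _.
rewrite leq_add2r leq_mul2l /= size_drop; pose proof (size_le_esz w); lia.
Qed.

Lemma P_fracof {X} {eX : Enc X} (a : X -> wordlist) : P a -> P (fun x => fracof (a x)).
Proof. by move=> Pa; apply: (P_comp (g := fracof) _ Pa); rewrite /fracof; P_auto. Qed.

Lemma P_upto {X} {eX : Enc X} (a : X -> nat) (b : X -> seq nat) : P a -> P b ->
  P (fun x => upto (a x) (b x)).
Proof.
move=> Pa Pb; apply: (P_comp (f := fun x => (a x, b x)) (g := fun p => upto p.1 p.2)); last by P_auto.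
by rewrite /upto; P_auto.
Qed.

Lemma P_scalel {X} {eX : Enc X} (a : X -> seq frac) : P a -> P (fun x => scalel (a x)).
Proof. by move=> Pa; apply: (P_comp (g := scalel) _ Pa); rewrite /scalel; P_auto. Qed.

Lemma P_dprod {X} {eX : Enc X} (a : X -> seq frac) : P a -> P (fun x => dprod (a x)).
Proof. by move=> Pa; apply: (P_comp (g := dprod) _ Pa); rewrite /dprod; P_auto. Qed.

Section Polynomial.
Context {X : Type} {eX : Enc X}.
Variables (a : X -> wordlist) (b : X -> seq nat).
Hypotheses (Pa : P a) (Pb : P b).

Lemma P_rS : P (fun x => rS (a x)). Proof. by rewrite /rS; P_auto. Qed.
Lemma P_rA : P (fun x => rA (a x)). Proof. by rewrite /rA; P_auto. Qed.
Lemma P_rbase : P (fun x => rbase (a x)).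
Proof. have := P_rS; have := P_rA; rewrite /rbase => *; P_auto. Qed.
Lemma P_rm : P (fun x => rm (a x)). Proof. by have := P_rbase; rewrite /rm => *; P_auto. Qed.
Lemma P_rn : P (fun x => rn (a x)). Proof. by have := P_rbase; rewrite /rn => *; P_auto. Qed.
Lemma P_rSl : P (fun x => rSl (a x) (b x)).
Proof. by rewrite /rSl; apply: P_upto => //; exact: P_rS. Qed.
Lemma P_rAl : P (fun x => rAl (a x) (b x)).
Proof. by rewrite /rAl; apply: P_upto => //; exact: P_rA. Qed.
Lemma P_rml : P (fun x => rml (a x) (b x)).
Proof. by rewrite /rml; apply: P_upto => //; exact: P_rm. Qed.
End Polynomial.

Section Polynomial2.
Context {X : Type} {eX : Enc X}.
Variables (a : X -> wordlist) (b : X -> seq nat).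
Hypotheses (Pa : P a) (Pb : P b).

Lemma P_tfracs : P (fun x => tfracs (a x) (b x)).
Proof.
rewrite /tfracs; apply: P_map; last first.
  apply: P_upto => //; have := P_rS Pa; have := P_rA Pa => *; P_auto.
apply: P_fracof; apply: P_drop; last by P_auto.
by apply: (P_comp Pa); P_auto.
Qed.

Lemma P_rwords : P (fun x => rwords (a x) (b x)).
Proof.
have := P_rSl Pa Pb; have := P_rbase Pa => *; rewrite /rwords; P_auto.
Qed.
End Polynomial2.

Ltac P_ctx H := apply: (P_comp H); P_auto.

Section Polynomial3.
Context {X : Type} {eX : Enc X}.
Variables (a : X -> wordlist) (b : X -> seq nat).
Hypotheses (Pa : P a) (Pb : P b).

Lemma P_unpad {Y} {eY : Enc Y} (c : Y -> wordlist) (l : Y -> wordlist) : P c -> P l ->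
  P (fun x => unpad (c x) (l x)).
Proof. by move=> Pc Pl; have := P_rS Pc; rewrite /unpad => *; P_auto. Qed.

Lemma P_rrest : P (fun x => rrest (a x) (b x)).
Proof.
by rewrite /rrest; apply: P_unpad => //; have := P_rm Pa; have := P_rwords Pa Pb => *; P_auto.
Qed.

Lemma P_rcmp i : P (fun x => rcmp (a x) (b x) i).
Proof. by have := P_rrest; rewrite /rcmp => *; P_auto. Qed.

Lemma P_rtail : P (fun x => rtail (a x) (b x)).
Proof. by have := P_rrest; rewrite /rtail => *; P_auto. Qed.

Lemma P_rbound : P (fun x => rbound (a x) (b x)).
Proof.
have Pr := P_rtail; rewrite /rbound; apply: P_if; first exact: P_rcmp.
  by apply: P_fracof; P_auto.
exact: P_fracof.
Qed.

Lemma P_reps : P (fun x => rceps (a x) (b x)).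
Proof.
have Pr := P_rtail; rewrite /rceps; apply: P_if; first exact: P_rcmp.
  exact: P_fracof.
exact: P_cst.
Qed.

Lemma P_cfracs : P (fun x => cfracs (a x) (b x)).
Proof.
have P1 := P_rbound; have P2 := P_reps; rewrite /cfracs; apply: P_cat; last by P_auto.
apply: P_map; last exact: P_rml.
apply: P_fracof; apply: P_unpad; first by P_ctx Pa.
by apply: P_drop; [P_ctx (P_rwords Pa Pb)|P_auto].
Qed.

Lemma P_ritems : P (fun x => ritems (a x) (b x)).
Proof.
rewrite /ritems; apply: P_map; last exact: P_rml.
have Pw := P_rwords Pa Pb.
apply: P_pair; first by apply: P_nth; [P_ctx (P_scalel P_cfracs)|P_auto].
apply: P_pair; first by apply: P_bval; apply: P_nth; [P_ctx Pw|P_auto].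
apply: P_pair; first by apply: P_bval; apply: P_nth; [P_ctx Pw|P_auto].
apply: P_map; last by P_ctx (P_rSl Pa Pb).
apply: P_nth; last by P_auto.
apply: P_nth; last by P_auto.
apply: (P_comp Pw); P_auto.
Qed.

Lemma P_rtr : P (fun x => rtr (a x) (b x)).
Proof.
rewrite /rtr; apply: P_map; last exact: P_rSl.
apply: P_map; last by P_ctx (P_rAl Pa Pb).
apply: P_map; last by apply: (P_comp (P_rSl Pa Pb)); P_auto.
apply: P_nth; first by apply: (P_comp (P_scalel (P_tfracs Pa Pb))); P_auto.
have P1 : P (fun x : X * nat * nat * nat => rS (a x.1.1.1)) by apply: (P_comp (P_rS Pa)); P_auto.
have P2 : P (fun x : X * nat * nat * nat => rA (a x.1.1.1)) by apply: (P_comp (P_rA Pa)); P_auto.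
by P_auto.
Qed.
End Polynomial3.

Lemma P_scale_items {X} {eX : Enc X} (z : int) (a : X -> seq item) : P a ->
  P (fun x => scale_items z (a x)).
Proof. by move=> Pa; apply: (P_comp (g := scale_items z) _ Pa); rewrite /scale_items; P_auto. Qed.

Lemma P_decide1 c : P (fun p : ttab * (nat * (seq item * (seq nat * ((bool * bool) * (int * int))))) =>
  decide1 c p.1 p.2.1 p.2.2.1 p.2.2.2.1 p.2.2.2.2.1.1 p.2.2.2.2.1.2 p.2.2.2.2.2.1 p.2.2.2.2.2.2).
Proof.
pose Y := (ttab * (nat * (seq item * (seq nat * ((bool * bool) * (int * int))))))%type.
have Pg (it : Y -> seq item) (th : Y -> int) : P it -> P th ->
    P (fun p : Y => gt_test p.1 p.2.1 (it p) (family c p.1 p.2.2.1) p.2.2.2.1 (th p)).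
  move=> Pi Pt; apply: (P_comp P_gt_test (f := fun p : Y => (p.1, (p.2.1, (it p,
    (family c p.1 p.2.2.1, (p.2.2.2.1, th p))))))); P_auto.
  by apply: (P_comp (P_family c) (f := fun p : Y => (p.1, p.2.2.1))); P_auto.
have Pe (it : Y -> seq item) (th : Y -> int) : P it -> P th ->
    P (fun p : Y => ge_test p.1 p.2.1 (it p) (family c p.1 p.2.2.1) p.2.2.2.1 (th p)).
  move=> Pi Pt; apply: (P_comp P_ge_test (f := fun p : Y => (p.1, (p.2.1, (it p,
    (family c p.1 p.2.2.1, (p.2.2.2.1, th p))))))); P_auto.
  by apply: (P_comp (P_family c) (f := fun p : Y => (p.1, p.2.2.1))); P_auto.
rewrite /decide1; apply: P_if; first (by P_auto); apply: P_if; try (by P_auto).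
- apply: P_orb; apply: Pg; try (by P_auto); by apply: P_scale_items; P_auto.
- apply: P_andb; apply: Pe; try (by P_auto); by apply: P_scale_items; P_auto.
- by apply: Pe; P_auto.
- by apply: Pg; P_auto.
Qed.

Lemma P_decide c : P (decide c).
Proof.
apply: (P_comp (f := fun w : seq sym => (words w, iota 0 (size w)))
  (g := fun p => decide2 c p.1 p.2)); last first.
  by apply: P_pair; [exact: P_words|P_auto].
have P1 : P (fun p : wordlist * seq nat => p.1) by P_auto.
have P2 : P (fun p : wordlist * seq nat => p.2) by P_auto.
apply: (P_comp (P_decide1 c) (f := fun p => (rtr p.1 p.2, (dprod (tfracs p.1 p.2),
  (ritems p.1 p.2, (upto (rn p.1) p.2, ((rcmp p.1 p.2 0, rcmp p.1 p.2 1),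
    (rzb p.1 p.2, rze p.1 p.2)))))))).
have Pm := P_rm P1.
apply: P_pair; first exact: P_rtr.
apply: P_pair; first by apply: P_dprod; exact: P_tfracs.
apply: P_pair; first exact: P_ritems.
apply: P_pair; first by apply: P_upto => //; exact: P_rn.
apply: P_pair; first by apply: P_pair; exact: P_rcmp.
by apply: P_pair; apply: P_nth; try (by P_auto); apply: P_scalel; exact: P_cfracs.
Qed.

(** * Optimal stopping in a finite decision process *)

(** An average that reaches an upper bound of the averaged values puts no weight on smaller ones. *)
Lemma avg_max (X : finType) (q w : X -> rat) m z : (forall y, 0 <= q y) ->
  \sum_y q y = 1 -> (forall y, w y <= m) -> m <= \sum_y q y * w y -> 0 < q z -> w z = m.
Proof.
move=> q0 q1 wm mw qz; apply/eqP; rewrite eq_le wm /= leNgt; apply/negP => lt.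
move: mw; rewrite leNgt => /negP; apply.
rewrite -[m]mul1r -q1 mulr_suml (bigD1 z) //= [X in _ < X](bigD1 z) //=.
apply: ltr_leD; first by rewrite ltr_pM2l.
by apply: ler_sum => y _; apply: ler_wpM2l.
Qed.

Lemma det_le (n : nat) (B : 'M[rat]_n) (b : rat) : 0 <= b -> (forall i j, `|B i j| <= b) ->
  `|\det B| <= (n`!)%:R * b ^+ n.
Proof.
move=> b0 Bb; rewrite /determinant; apply: le_trans (ler_norm_sum _ _ _) _.
apply: (@le_trans _ _ (\sum_(s : 'S_n) b ^+ n)).
  apply: ler_sum => s _; rewrite normrM normrX normrN1 expr1n mul1r normr_prod.
  have -> : b ^+ n = \prod_(i < n) b by rewrite prodr_const card_ord.
  by apply: ler_prod => i _; rewrite normr_ge0 Bb.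
by rewrite sumr_const card_Sn mulr_natl.
Qed.

Section Stopping.
Variables (X A : finType) (p : X -> A -> X -> rat) (en : X -> A -> bool).
Variable r : X -> option rat.
Hypothesis p_ge0 : forall x a y, 0 <= p x a y.
Hypothesis p_sum : forall x a, en x a -> \sum_y p x a y = 1.

Notation policy := {ffun X -> option A}.
Implicit Types (pi : policy) (w b : X -> rat).

Definition pstep pi : rel X := fun x y => if pi x is Some a then 0 < p x a y else false.
Definition valid pi := [forall x, if pi x is Some a then en x a else r x != None].
(** Under the policy some stopping state is reachable from everywhere; in a finite process this
    means that it stops almost surely. *)
Definition proper pi := [forall x, exists y, connect (pstep pi) x y && (pi y == None)].
Definition okp pi := valid pi && proper pi.

(** If the maximum of [w] were positive, the states attaining it would be closed under the
    transitions of the policy and would contain a stopping state, where [w] is at most 0. *)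
Lemma max_principle pi w : okp pi ->
  (forall x, if pi x is Some a then w x <= \sum_y p x a y * w y else w x <= 0) ->
  forall x, w x <= 0.
Proof.
move=> /andP[/forallP vl /forallP pr] H x0; rewrite leNgt; apply/negP => w0.
pose x1 := [arg max_(x > x0) w x]%O.
have x1P y : w y <= w x1 by rewrite /x1; case: arg_maxP => // i _; apply.
have m0 : 0 < w x1 by exact: lt_le_trans (x1P x0).
have S y z : w y = w x1 -> pstep pi y z -> w z = w x1.
  rewrite /pstep => wy; have := H y; have := vl y; case: (pi y) => // a ea.
  by rewrite wy => le; apply: avg_max le => //; exact: p_sum.
have C y : connect (pstep pi) x1 y -> w y = w x1.
  move=> /connectP[s + ->]; elim/last_ind: s => //= s z IH.
  by rewrite rcons_path last_rcons => /andP[/IH wl]; exact: S.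
have /existsP[y /andP[/C wy /eqP py]] := pr x1.
by have := H y; rewrite py wy leNgt m0.
Qed.

Definition pmx pi : 'M[rat]_#|X| := \matrix_(i, j) ((i == j)%:R -
  (if pi (enum_val i) is Some a then p (enum_val i) a (enum_val j) else 0)).
(** The solution of [v = b + P_pi v], which for a proper policy is the expected total of [b] up to
    and including the stopping state. *)
Definition pval pi b (x : X) : rat :=
  (invmx (pmx pi) *m (\col_i b (enum_val i))) (enum_rank x) 0.

Lemma sum_enum_val (f : X -> rat) : \sum_(i < #|X|) f (enum_val i) = \sum_x f x.
Proof.
rewrite [RHS](reindex_onto (fun i : 'I_#|X| => enum_val i) enum_rank).
  by apply: eq_bigl => i; rewrite enum_valK eqxx.
by move=> i _; rewrite enum_rankK.
Qed.

Lemma pmx_mul pi (v : 'cV[rat]_#|X|) i : (pmx pi *m v) i 0 = v i 0 -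
  (if pi (enum_val i) is Some a then
    \sum_y p (enum_val i) a y * v (enum_rank y) 0 else 0).
Proof.
rewrite mxE; under eq_bigr do rewrite mxE mulrBl.
rewrite sumrB (bigD1 i) //= eqxx mul1r big1 ?addr0; last first.
  by move=> j ji; rewrite eq_sym (negbTE ji) mul0r.
congr (_ - _); case: (pi _) => [a|]; last by rewrite big1 // => j _; rewrite mul0r.
rewrite -(sum_enum_val (fun y => p (enum_val i) a y * v (enum_rank y) 0)).
by apply: eq_bigr => j _; rewrite enum_valK.
Qed.

(** The maximum principle for a kernel vector and for its negative. *)
Lemma pmx_unit pi : okp pi -> pmx pi \in unitmx.
Proof.
move=> ok; rewrite -unitmx_tr -row_free_unit -kermx_eq0.
apply/rowV0P => u /sub_kermxP uM.
have E : pmx pi *m u^T = 0 by have := congr1 trmx uM; rewrite trmx_mul trmxK trmx0.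
have Ei x : u 0 (enum_rank x) = if pi x is Some a then
    \sum_y p x a y * u 0 (enum_rank y) else 0.
  have := congr1 (fun M : 'cV_#|X| => M (enum_rank x) 0) E.
  rewrite pmx_mul enum_rankK !mxE => /eqP; rewrite subr_eq0 => /eqP ->.
  by case: (pi x) => // a; apply: eq_bigr => y _; rewrite mxE.
have le0 x : u 0 (enum_rank x) <= 0.
  apply: (max_principle (w := fun x => u 0 (enum_rank x)) ok) => z.
  by have := Ei z; case: (pi z) => [a|] ->.
have ge0 x : - u 0 (enum_rank x) <= 0.
  apply: (max_principle (w := fun x => - u 0 (enum_rank x)) ok) => z.
  have := Ei z; case: (pi z) => [a|] ->; rewrite ?oppr0 //.
  by rewrite -sumrN; apply: ler_sum => y _; rewrite mulrN.
apply/matrixP => i j; rewrite ord1 [RHS]mxE -(enum_valK j); apply/eqP.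
by rewrite eq_le le0 /=; have := ge0 (enum_val j); rewrite oppr_le0.
Qed.

Lemma pvalE pi b x : okp pi ->
  pval pi b x = b x + (if pi x is Some a then \sum_y p x a y * pval pi b y else 0).
Proof.
move=> ok; have := congr1 (fun M : 'cV_#|X| => M (enum_rank x) 0)
  (mulKVmx (pmx_unit ok) (\col_i b (enum_val i))).
rewrite pmx_mul [RHS]mxE enum_rankK => <-.
by rewrite subrK.
Qed.

Definition stopval pi := pval pi (fun x => if pi x is None then odflt 0 (r x) else 0).
Definition stoptime pi := pval pi (fun x => if pi x is None then 0 else 1).

Lemma stopvalE pi x : okp pi -> stopval pi x =
  if pi x is Some a then \sum_y p x a y * stopval pi y else odflt 0 (r x).
Proof.
by move=> ok; rewrite {1}/stopval pvalE //; case: (pi x) => [a|]; rewrite ?add0r ?addr0.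
Qed.

Lemma stoptimeE pi x : okp pi -> stoptime pi x =
  if pi x is Some a then 1 + \sum_y p x a y * stoptime pi y else 0.
Proof.
by move=> ok; rewrite {1}/stoptime pvalE //; case: (pi x) => [a|]; rewrite ?addr0.
Qed.

(** An error [d] per constraint accumulates over the expected number of steps, plus one for the
    final stop. *)
Lemma stopval_relax pi (v : X -> rat) d x : okp pi -> 0 <= d ->
  (forall x a, en x a -> \sum_y p x a y * v y - d <= v x) ->
  (forall x c, r x = Some c -> c - d <= v x) ->
  stopval pi x <= v x + d * (stoptime pi x + 1).
Proof.
move=> ok d0 H1 H2; rewrite -subr_le0.
apply: (max_principle (w := fun x => stopval pi x - (v x + d * (stoptime pi x + 1))) ok).
have /andP[/forallP vl _] := ok => {}x; have := vl x.
rewrite stopvalE // stoptimeE //; case E: (pi x) => [a|] h.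
  have Sp := p_sum h; have := H1 x a h.
  have -> : \sum_y p x a y * (stopval pi y - (v y + d * (stoptime pi y + 1))) =
     \sum_y p x a y * stopval pi y - \sum_y p x a y * v y -
     d * (\sum_y p x a y * stoptime pi y) - d * \sum_y p x a y.
    rewrite !mulr_sumr -!sumrB; apply: eq_bigr => y _; ring.
  rewrite Sp; set t := \sum_y p x a y * stoptime pi y; lra.
by have := H2 x; case: (r x) h => // c _ /(_ c erefl) /=; lra.
Qed.

(** Policy improvement at a single state. Once the new policy is known to be proper, the maximum
    principle for the difference of the two values shows that no value decreases, and the gain at
    [x] is strict. *)
Lemma improve pi x (o : option A) : okp pi ->
  (if o is Some a then en x a else r x != None) ->
  stopval pi x < (if o is Some a then \sum_y p x a y * stopval pi y else odflt 0 (r x)) ->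
  let pi' := [ffun z => if z == x then o else pi z] : policy in
  okp pi' /\ \sum_z stopval pi z < \sum_z stopval pi' z.
Proof.
move=> ok vo lt pi'; have /andP[/forallP vl /forallP pr] := ok.
set V := stopval pi in lt *.
have pi'x : pi' x = o by rewrite ffunE eqxx.
have pi'n z : z != x -> pi' z = pi z by move=> zx; rewrite ffunE (negbTE zx).
have vl' : valid pi'.
  by apply/forallP => z; rewrite ffunE; case: eqP => [->|_]; [exact: vo|exact: vl].
have sub z : if pi' z is Some a then V z <= \sum_y p z a y * V y /\
    (z = x -> V z < \sum_y p z a y * V y) else V z <= odflt 0 (r z).
  have [->|zx] := eqVneq z x.
    by rewrite pi'x; case: (o) lt => [a|] lt; [split=> //; exact: ltW|exact: ltW].
  rewrite pi'n //; have := stopvalE z ok; rewrite -/V; case: (pi z) => [a|] EV; last by rewrite EV.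
  by split=> [|zx']; [rewrite -EV|rewrite zx' eqxx in zx].
have ok' : okp pi'.
  (* Suppose that the new policy never stops from [y0]. Among the states it reaches, those of
     maximal value are closed under it and avoid [x], where the gain is strict. The old policy
     agrees with it there and would never stop either. *)
  rewrite /okp vl'; apply/forallP => y0; apply: contraT => /existsPn N.
  pose C := [pred y | connect (pstep pi') y0 y].
  have C0 : C y0 by exact: connect0.
  pose y1 := [arg max_(y > y0 | C y) V y]%O.
  have [C1 y1P] : C y1 /\ forall y, C y -> V y <= V y1.
    by rewrite /y1; case: arg_maxP => // i Ci Hi; split=> // y /Hi.
  have Cns y : C y -> exists a, pi' y = Some a.
    by move=> Cy; have := N y; rewrite (Cy : connect _ _ _) /=; case: (pi' y) => [a|] //; exists a.
  have S y : C y -> V y = V y1 -> y != x /\ forall z, pstep pi y z -> C z /\ V z = V y1.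
    move=> Cy Vy; have [a pa] := Cns y Cy; have := sub y; rewrite pa => -[le str].
    have ea : en y a by have := forallP vl' y; rewrite pa.
    have Cz z : 0 < p y a z -> C z.
      by move=> pz; apply: connect_trans Cy _; apply: connect1; rewrite /pstep pa.
    have max z : 0 < p y a z -> V z = V y1.
      move=> pz.
      have E : V y1 <= \sum_z p y a z * (if 0 < p y a z then V z else V y1).
        rewrite -{1}Vy; apply: le_trans le _; rewrite le_eqVlt; apply/orP; left.
        apply/eqP; apply: eq_bigr => t _; case: ifPn => // n0.
        have -> : p y a t = 0 by apply/eqP; rewrite eq_le p_ge0 leNgt n0.
        by rewrite !mul0r.
      have := avg_max (fun t => p_ge0 y a t) (p_sum ea) _ E pz; rewrite pz; apply.
      by move=> t; case: ifPn => // /Cz /y1P.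
    have yx : y != x.
      apply/eqP => yx; have := str yx; rewrite Vy ltNge => /negP; apply.
      have -> : V y1 = \sum_z p y a z * V y1 by rewrite -mulr_suml (p_sum ea) mul1r.
      apply: ler_sum => t _; have [/max ->//|n0] := boolP (0 < p y a t).
      have -> : p y a t = 0 by apply/eqP; rewrite eq_le p_ge0 leNgt n0.
      by rewrite !mul0r.
    split=> // z; rewrite /pstep -(pi'n y) // pa => pz.
    by split; [exact: Cz|exact: max].
  have K y : connect (pstep pi) y1 y -> C y /\ V y = V y1.
    move=> /connectP[s + ->]; elim/last_ind: s => //= s z IH.
    by rewrite rcons_path last_rcons => /andP[/IH [Cl Vl]]; have [_] := S _ Cl Vl; apply.
  have /existsP[y /andP[/K [Cy Vy] /eqP py]] := pr y1.
  have [yx _] := S y Cy Vy; have [a] := Cns y Cy.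
  by rewrite pi'n // py.
split=> //; set V' := stopval pi'.
have le z : V z <= V' z.
  rewrite -subr_le0; apply: (max_principle (w := fun z => V z - V' z) ok') => t.
  have := sub t; have := stopvalE t ok'; rewrite -/V'.
  case: (pi' t) => [a|] EV H; rewrite EV; last by rewrite subr_le0.
  have -> : \sum_y p t a y * (V y - V' y) =
      \sum_y p t a y * V y - \sum_y p t a y * V' y.
    by rewrite -sumrB; apply: eq_bigr => y _; rewrite mulrBr.
  by rewrite lerB //; case: H.
rewrite (bigD1 x) //= [X in _ < X](bigD1 x) //=; apply: ltr_leD; last first.
  by apply: ler_sum => z _; exact: le.
apply: lt_le_trans lt _; rewrite {1}/V' stopvalE // pi'x; case: (o) vo => [a|] // _.
by apply: ler_sum => y _; apply: ler_wpM2l.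
Qed.

(** Among the finitely many admissible policies take one that maximises the sum of its values; a
    violated inequality would allow [improve] to raise this sum. *)
Lemma best_policy : (exists pi, okp pi) -> exists pi, [/\ okp pi,
  forall x c, r x = Some c -> c <= stopval pi x &
  forall x a, en x a -> \sum_y p x a y * stopval pi y <= stopval pi x].
Proof.
move=> [pi0 ok0]; pose pi := [arg max_(q > pi0 | okp q) \sum_z stopval q z]%O.
have [ok best] : okp pi /\ forall q, okp q -> \sum_z stopval q z <= \sum_z stopval pi z.
  by rewrite /pi; case: arg_maxP => // q okq H; split=> // q' /H.
exists pi; split=> // [x c rc|x a ea]; rewrite leNgt; apply/negP => lt.
  have [] := improve (o := None) ok _ (_ : stopval pi x < _); rewrite ?rc //=.
  by move=> /best; rewrite leNgt => /negP.
have [] := improve (o := Some a) ok ea lt.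
by move=> /best; rewrite leNgt => /negP.
Qed.

Definition pgraph : rel X := fun x y => [exists a, en x a && (0 < p x a y)].

(** Stop where a reward is available, and otherwise move with positive probability to a state that
    is nearer to a reward. *)
Lemma okp_exists : (forall x, exists2 y, connect pgraph x y & r y != None) ->
  exists pi, okp pi.
Proof.
move=> reach.
pose L := fix L k x := (r x != None) ||
  (if k is k'.+1 then [exists a, [exists y, [&& en x a, 0 < p x a y & L k' y]]] else false).
have ex x : exists k, L k x.
  have [y /connectP[s + ->]] := reach x; elim: s x => [|z s IH] x /=.
    by move=> _ rx; exists 0%N; rewrite /= rx.
  move=> /andP[/existsP[a /andP[ea pz]] ps] rl; have [k Lk] := IH z ps rl.
  exists k.+1; rewrite /=; apply/orP; right; apply/existsP; exists a.
  by apply/existsP; exists z; rewrite ea pz Lk.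
pose rk x := ex_minn (ex x).
pose good x a := en x a && [exists y, (0 < p x a y) && (rk y < rk x)%N].
have goodP x : r x = None -> exists a, good x a.
  move=> rx; rewrite /good {2}/rk; case: ex_minnP => -[|k] /=; rewrite rx //=.
  move=> /existsP[a /existsP[y /and3P[ea py Ly]]] _; exists a; rewrite ea /=.
  apply/existsP; exists y; rewrite py ltnS /rk; case: ex_minnP => j _; exact.
pose pi : policy := [ffun x => if r x == None then [pick a | good x a] else None].
have piP x : if pi x is Some a then good x a else r x != None.
  rewrite ffunE; case: eqP => [rx|/eqP //]; case: pickP => // N.
  by have [a] := goodP x rx; rewrite N.
exists pi; apply/andP; split; apply/forallP => x.
  by have := piP x; case: (pi x) => // a /andP[].
move: {2}(rk x).+1 (ltnSn (rk x)) => n; elim: n x => // n IH x xn.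
have := piP x; case E: (pi x) => [a|] H; last first.
  by apply/existsP; exists x; rewrite connect0 E.
have /andP[_ /existsP[y /andP[py yx]]] := H.
have /existsP[z /andP[yz pz]] := IH y (leq_trans yx xn).
apply/existsP; exists z; rewrite pz andbT; apply: connect_trans yz.
by apply: connect1; rewrite /pstep E.
Qed.

(** * Bounds from Cramer's rule *)

Section Denominators.
Variable Den : nat.
Hypothesis Den_gt0 : (0 < Den)%N.
Hypothesis p_int : forall x a y, exists z : int, Den%:R * p x a y = z%:~R.
Hypothesis r_int : forall x c, r x = Some c -> exists z : int, c = z%:~R.

(** The Leibniz bound for a determinant of order [#|X|] with entries of absolute value at most
    [2 * Den]. *)
Definition Kbd := ((#|X|)`! * (2 * Den) ^ #|X|)%N.

Lemma imx_exists m n (B : 'M[rat]_(m, n)) : (forall i j, exists z : int, B i j = z%:~R) ->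
  exists C : 'M[int]_(m, n), B = map_mx intr C.
Proof.
move=> /= H; have H' (ij : 'I_m * 'I_n) : exists z : int, B ij.1 ij.2 = z%:~R by exact: H.
have [f fP] := choice H'; exists (\matrix_(i, j) f (i, j)).
by apply/matrixP => i j; rewrite !mxE -fP.
Qed.

(** [B = Den (I - P_pi)] is integral with entries of absolute value at most [2 * Den], so
    [K = |det B|] clears denominators. For the last bound, the cofactors obey the same estimate and
    [|det B|] is at least 1. *)
Lemma cramer pi b : okp pi -> (forall x, exists z : int, b x = z%:~R) ->
  exists K : nat, [/\ (0 < K)%N, (K <= Kbd)%N,
   forall x, exists z : int, K%:R * pval pi b x = z%:~R &
   forall x, (forall x, `|b x| <= 1) -> `|pval pi b x| <= (#|X| * Kbd * Den)%:R].
Proof.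
move=> ok bint; set n := #|X|.
have Dp : 0 < Den%:R :> rat by rewrite ltr0n.
have D1 : 1 <= Den%:R :> rat by rewrite ler1n.
pose B : 'M[rat]_n := Den%:R *: pmx pi.
have Bint i j : exists z : int, B i j = z%:~R.
  rewrite !mxE; case: (pi _) => [a|]; last first.
    by exists (Den%:Z * (i == j)%:R); rewrite subr0 rmorphM /= -!pmulrn; case: (i == j).
  have [z zP] := p_int (enum_val i) a (enum_val j).
  exists (Den%:Z * (i == j)%:R - z).
  by rewrite mulrBr zP rmorphB rmorphM /= -!pmulrn; case: (i == j).
have [C CE] := imx_exists Bint.
have p_le1 x a y : en x a -> p x a y <= 1.
  move=> ea; rewrite -(p_sum ea) (bigD1 y) //= lerDl; exact: sumr_ge0.
have Ble i j : `|B i j| <= (2 * Den)%:R.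
  rewrite !mxE natrM normrM (ger0_norm (ltW Dp)) mulrC ler_pM2r //.
  have /andP[/forallP vl _] := ok; have := vl (enum_val i).
  case: (pi _) => [a|] ea; last by rewrite subr0; case: (i == j); rewrite ?normr1 ?normr0.
  apply: le_trans (ler_normB _ _) _; rewrite (ger0_norm (p_ge0 _ _ _)).
  have := p_le1 _ _ (enum_val j) ea; case: (i == j); rewrite ?normr1 ?normr0; lra.
have detB : \det B = (\det C)%:~R by rewrite CE det_map_mx.
have uB : \det B != 0.
  rewrite detZ mulf_eq0 negb_or expf_eq0 negb_and (lt0r_neq0 Dp) orbT /=.
  by rewrite -unitfE -unitmxE pmx_unit.
pose K := `|\det C|%N.
have KE : K%:R = `|\det B| by rewrite detB /K natr_absz intr_norm.
have K0 : (0 < K)%N by rewrite -(ltr0n rat) KE normr_gt0.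
have KbdE : Kbd%:R = (n`!)%:R * (2 * Den)%:R ^+ n :> rat by rewrite /Kbd natrM natrX.
have adjE x : \det B * pval pi b x = \sum_j \adj B (enum_rank x) j * (Den%:R * b (enum_val j)).
  rewrite /pval; set v := \col_i b (enum_val i).
  have -> : \det B * (invmx (pmx pi) *m v) (enum_rank x) 0 =
      ((\det B)%:M *m (invmx (pmx pi) *m v)) (enum_rank x) 0.
    by rewrite mul_scalar_mx [RHS]mxE.
  rewrite -mul_adj_mx -!mulmxA {2}/B -scalemxAl mulKVmx ?pmx_unit // mxE.
  by apply: eq_bigr => j _; rewrite !mxE.
exists K; split=> //.
- rewrite -(ler_nat rat) KE KbdE; apply: det_le => //; exact: ler0n.
- move=> x; have : exists z : int, \det B * pval pi b x = z%:~R.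
    have [f fP] := choice bint.
    exists (\sum_j \adj C (enum_rank x) j * (Den%:Z * f (enum_val j))).
    rewrite adjE rmorph_sum; apply: eq_bigr => j _.
    have -> : \adj B (enum_rank x) j = (\adj C (enum_rank x) j)%:~R.
      by rewrite CE -map_mx_adj mxE.
    by rewrite !rmorphM /= -fP.
  move=> [z zE]; rewrite KE; case: (ger0P (\det B)) => _; first by exists z.
  by exists (- z); rewrite mulNr zE rmorphN.
move=> x b1; have [n0|n0] := posnP n.
  by have := enum_rank x; rewrite -/n n0 => -[].
have cof i j : `|\adj B i j| <= Kbd%:R.
  rewrite mxE /cofactor normrM normrX normrN1 expr1n mul1r.
  apply: (@le_trans _ _ ((n.-1)`!%:R * (2 * Den)%:R ^+ n.-1)).
    by apply: det_le => [|k l]; rewrite ?ler0n // !mxE; have := Ble (lift j k) (lift i l); rewrite !mxE.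
  rewrite KbdE; apply: ler_pM; rewrite ?exprn_ge0 ?ler0n //.
    rewrite ler_nat -{2}(prednK n0) factS leq_pmull //.
  by rewrite -{2}(prednK n0) exprS ler_peMl ?exprn_ge0 ?ler0n // ler1n muln_gt0.
have -> : pval pi b x = (\det B)^-1 * (\det B * pval pi b x) by rewrite mulKf.
rewrite normrM normfV -KE adjE.
apply: (@le_trans _ _ `|\sum_j \adj B (enum_rank x) j * (Den%:R * b (enum_val j))|).
  by rewrite ler_piMl // invf_le1 ?ltr0n // ler1n.
apply: le_trans (ler_norm_sum _ _ _) _.
have -> : (n * Kbd * Den)%:R = \sum_(j < n) Kbd%:R * Den%:R :> rat.
  by rewrite sumr_const card_ord -mulnA natrM natrM mulr_natl.
apply: ler_sum => j _; rewrite normrM ler_pM // normrM (ger0_norm (ltW Dp)).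
by rewrite ler_piMr // ltW.
Qed.

End Denominators.
End Stopping.

From mathcomp Require Import all_classical all_reals all_analysis.
Import Order.TTheory GRing.Theory Num.Theory.
Import numFieldNormedType.Exports.
Local Open Scope classical_set_scope.
Local Open Scope ring_scope.

(** * Almost sure behaviour of the paths of a decision process *)

Section FiniteValued.
Context d (T : measurableType d) (R : realType) (P : probability T R).

Definition mu (A : set T) : R := fine (P A).

Lemma muE A : measurable A -> P A = (mu A)%:E.
Proof. by move=> mA; rewrite /mu fineK // fin_num_measure. Qed.

Lemma mu_ge0 A : 0 <= mu A.
Proof. by rewrite /mu fine_ge0. Qed.

Lemma mu_le A B : measurable A -> measurable B -> A `<=` B -> mu A <= mu B.
Proof. by move=> mA mB AB; rewrite -lee_fin -!muE // le_measure ?inE. Qed.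

Lemma muU A B : measurable A -> measurable B -> A `&` B = set0 ->
  mu (A `|` B) = mu A + mu B.
Proof.
move=> mA mB AB; apply: EFin_inj; rewrite EFinD -!muE //; last exact: measurableU.
exact: measureU.
Qed.

Section Fibers.
Variables (I : finType) (Z : T -> I).
Hypothesis mZ : forall i, measurable [set w | Z w = i].

Lemma measurable_preim (Q : pred I) : measurable [set w | Q (Z w)].
Proof.
have -> : [set w | Q (Z w)] = \bigcup_(i in [set i | Q i]) [set w | Z w = i].
  apply/seteqP; split=> w /=; first by move=> Qw; exists (Z w).
  by move=> [i /= Qi Zi]; rewrite Zi.
by apply: fin_bigcup_measurable => //; exact: finite_finset.
Qed.

Lemma mu_partition B : measurable B -> mu B = \sum_i mu (B `&` [set w | Z w = i]).
Proof.
move=> mB.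
have S s : uniq s -> mu (B `&` [set w | Z w \in s]) = \sum_(i <- s) mu (B `&` [set w | Z w = i]).
  elim: s => [_|a s IH] /=.
    rewrite big_nil (_ : _ `&` _ = set0) /mu ?measure0 //.
    by apply/seteqP; split=> // w [].
  move=> /andP[as_ us]; rewrite big_cons -IH // -muU.
  - congr mu; apply/seteqP; split=> w /=.
      by move=> [Bw]; rewrite inE => /orP[/eqP|] h; [left|right].
    by move=> [[Bw ->]|[Bw h]]; split=> //; rewrite inE ?eqxx ?h ?orbT.
  - exact: measurableI.
  - by apply: measurableI => //; exact: (measurable_preim (mem s)).
  - by apply/seteqP; split=> // w /= [[_ Za] [_]]; rewrite Za (negbTE as_).
rewrite -big_enum -S ?enum_uniq //; congr mu; apply/seteqP; split=> w /= => [Bw|[]//].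
by split=> //; rewrite mem_enum.
Qed.

Lemma mu_pred (Q : pred I) : mu [set w | Q (Z w)] = \sum_(i | Q i) mu [set w | Z w = i].
Proof.
rewrite mu_partition; last exact: measurable_preim.
rewrite [RHS]big_mkcond /=; apply: eq_bigr => i _; case: ifPn => Qi.
  by congr mu; apply/seteqP; split=> w /= => [[]|Zi] //; split=> //; rewrite Zi.
rewrite (_ : _ `&` _ = set0) ?/mu ?measure0 //.
by apply/seteqP; split=> // w /= [+ Zi]; rewrite Zi (negbTE Qi).
Qed.
End Fibers.

(** The unions of the tails decrease to a null set; continuity from above. *)
Lemma mu_tail0 (B : nat -> set T) : (forall n, measurable (B n)) ->
  (\forall w \ae P, exists N, forall n, (N <= n)%N -> ~ B n w) ->
  forall e, 0 < e -> exists n, mu (B n) < e.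
Proof.
move=> mB ev e e0.
pose G n := \bigcup_(k in [set k | (n <= k)%N]) B k.
have mG n : measurable (G n) by apply: bigcup_measurable => k _.
have mI : measurable (\bigcap_n G n) by exact: bigcapT_measurable.
have G0 : P (\bigcap_n G n) = 0%E.
  apply: measure_negligible => //; apply: negligibleS ev => w Gw [N HN].
  by have [k Nk Bk] := Gw N I; exact: (HN k).
have cv : P \o G @ \oo --> P (\bigcap_n G n).
  apply: nonincreasing_cvg_mu => //; first by rewrite -ge0_fin_numE // fin_num_measure.
  by move=> m n mn; apply/subsetPset => w [k /= nk Bk]; exists k => //=; exact: leq_trans nk.
rewrite G0 in cv; have [N _ H] := cvgr_lt _ (fine_cvg cv) _ e0.
exists N; apply: le_lt_trans (H N (leqnn N)); apply: mu_le => //.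
by move=> w Bw; exists N => /=.
Qed.

(** Passage to the limit for finite-valued variables. The event where [f (Z w)] exceeds [g (Y n w)]
    has arbitrarily small probability for a suitable [n], and it contributes at most a constant
    times this probability. *)
Lemma limit_le (I J : finType) (Z : T -> I) (Y : nat -> T -> J) (f : I -> R) (g : J -> R) c :
  (forall i, measurable [set w | Z w = i]) ->
  (forall n j, measurable [set w | Y n w = j]) ->
  (forall n, \sum_j g j * mu [set w | Y n w = j] <= c) ->
  (\forall w \ae P, exists N, forall n, (N <= n)%N -> f (Z w) <= g (Y n w)) ->
  \sum_i f i * mu [set w | Z w = i] <= c.
Proof.
move=> mZ mY gc ev; apply/ler_addgt0Pr => e e0.
(* Bounds all differences [f i - g j]; the summand 1 makes it positive. *)
pose K := 1 + \sum_i `|f i| + \sum_j `|g j|.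
have K0 : 0 < K.
  by rewrite /K ltr_wpDr ?sumr_ge0 // ltr_wpDr ?sumr_ge0.
have fK i : f i <= 1 + \sum_i `|f i|.
  apply: le_trans (ler_norm _) _; rewrite (bigD1 i) //= addrCA lerDl.
  by rewrite addr_ge0 ?sumr_ge0.
have gK j : - g j <= \sum_j `|g j|.
  by apply: le_trans (ler_norm _) _; rewrite normrN (bigD1 j) //= lerDl sumr_ge0.
pose W n w := (Z w, Y n w).
have mW n ij : measurable [set w | W n w = ij].
  case: ij => i j; rewrite (_ : [set w | _] = [set w | Z w = i] `&` [set w | Y n w = j]).
    exact: measurableI.
  by rewrite /W; apply/seteqP; split=> w /=; [case=> <- <-|move=> [-> ->]].
pose bad (ij : I * J) := g ij.2 < f ij.1.
have mB n : measurable [set w | bad (W n w)] by exact: measurable_preim (mW n) bad.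
have [|n nB] := mu_tail0 mB _ (divr_gt0 e0 K0).
  apply: filterS ev => w [N HN]; exists N => n /HN; rewrite /bad /= ltNge => ->.
  by [].
have EZ i : mu [set w | Z w = i] = \sum_j mu [set w | W n w = (i, j)].
  rewrite (mu_partition (mY n)) //; apply: eq_bigr => j _; congr mu.
  by apply/seteqP; split=> w /=; [case=> <- <-|case].
have EY j : mu [set w | Y n w = j] = \sum_i mu [set w | W n w = (i, j)].
  rewrite (mu_partition mZ) //; apply: eq_bigr => i _; congr mu.
  by apply/seteqP; split=> w /=; [case=> <- <-|case].
apply: (@le_trans _ _ (\sum_j g j * mu [set w | Y n w = j] + K * mu [set w | bad (W n w)])).
  have -> : K * mu [set w | bad (W n w)] = \sum_i \sum_j
      (if bad (i, j) then K * mu [set w | W n w = (i, j)] else 0).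
    rewrite (mu_pred (mW n)) mulr_sumr big_mkcond pair_bigA.
    by apply: eq_bigr => -[i j] _.
  have -> : \sum_j g j * mu [set w | Y n w = j] =
     \sum_i \sum_j g j * mu [set w | W n w = (i, j)].
    rewrite exchange_big; apply: eq_bigr => j _; rewrite EY mulr_sumr //.
  rewrite -big_split; apply: ler_sum => i _; rewrite EZ mulr_sumr -big_split.
  apply: ler_sum => j _ /=; case: ifPn => [_|]; last first.
    by rewrite /bad /= -leNgt addr0 => fg; rewrite ler_wpM2r // mu_ge0.
  rewrite -mulrDl ler_wpM2r ?mu_ge0 //; have := fK i; have := gK j; rewrite /K; lra.
apply: lerD => //; rewrite mulrC -ler_pdivlMr //; exact: ltW.
Qed.

End FiniteValued.

(** * Expectations over finite words *)

Section Words.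
Variables (R : realType) (M : mdp) (sigma : scheduler R M) (s : state M).
Let X := (state M * action M)%type.
Implicit Types (h : seq X) (w : path_space M).
Notation ww := (word_weight sigma s).
Notation Ps := (Pr sigma s).
Notation pm := (mu Ps).

(** The expectation of [f] over the extensions of [h] by [n] letters, not normalised: the weight of
    [h] remains as a factor. *)
Fixpoint ex n h (f : seq X -> R) : R :=
  if n is n'.+1 then \sum_x ex n' (rcons h x) f else ww h * f h.

Lemma eq_ex n h f g : (forall h', size h' = (size h + n)%N -> f h' = g h') ->
  ex n h f = ex n h g.
Proof.
elim: n h => [|n IH] h fg /=; first by rewrite fg // addn0.
by apply: eq_bigr => x _; apply: IH => h' E; apply: fg; rewrite E size_rcons addSnnS.
Qed.

Lemma ex_le n h f g : (forall h', size h' = (size h + n)%N -> 0 < ww h' -> f h' <= g h') ->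
  ex n h f <= ex n h g.
Proof.
elim: n h => [|n IH] h fg /=.
  have [w0|w0] := ltP 0 (ww h); first by rewrite ler_pM2l // fg // addn0.
  by rewrite (_ : ww h = 0) ?mul0r //; apply/eqP; rewrite eq_le w0 word_weight_ge0.
by apply: ler_sum => x _; apply: IH => h' E; apply: fg; rewrite E size_rcons addSnnS.
Qed.

Lemma ex_scale n h f c : ex n h (fun h => c * f h) = c * ex n h f.
Proof.
elim: n h => [|n IH] h /=; first by rewrite mulrCA.
by rewrite mulr_sumr; apply: eq_bigr => x _; exact: IH.
Qed.

(** The one-step inequality is needed only on words of positive weight, since a zero weight is
    inherited by all extensions. *)
Lemma ex_step n h f g : (forall h', size h' = (size h + n)%N -> 0 < ww h' ->
    \sum_x ww (rcons h' x) * f (rcons h' x) <= ww h' * g h') ->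
  ex n.+1 h f <= ex n h g.
Proof.
elim: n h => [|n IH] h H.
  have [w0|w0] := ltP 0 (ww h); first by rewrite /=; apply: H => //; rewrite addn0.
  have {}w0 : ww h = 0 by apply/eqP; rewrite eq_le w0 word_weight_ge0.
  rewrite /= w0 mul0r big1 // => x _; suff -> : ww (rcons h x) = 0 by rewrite mul0r.
  have := sum_word_weight sigma s h; rewrite w0 => /psumr_eq0P; apply=> // y _.
  exact: word_weight_ge0.
rewrite [ex n.+1 h g]/= [ex n.+2 h f]/=; apply: ler_sum => x _.
by apply: IH => h' E; apply: H; rewrite E size_rcons addSnnS.
Qed.

Lemma ex1 n h : ex n h (fun=> 1) = ww h.
Proof.
elim: n h => [|n IH] h /=; first by rewrite mulr1.
by rewrite -[RHS]sum_word_weight; apply: eq_bigr => x _; exact: IH.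
Qed.

Lemma ex_sum (J : finType) n h (F : J -> seq X -> R) :
  ex n h (fun h => \sum_j F j h) = \sum_j ex n h (F j).
Proof.
elim: n h => [|n IH] h /=; first by rewrite mulr_sumr.
by rewrite exchange_big; apply: eq_bigr => x _; exact: IH.
Qed.

Definition on_word n (phi : pred (seq X)) : set (path_space M) :=
  [set w | phi (mkseq w n)].

Lemma on_word_cyl n phi : cylinder_sets (on_word n phi).
Proof.
exists n => w w' ww'; rewrite /on_word /= (_ : mkseq w' n = mkseq w n) //.
by apply/eq_in_map => i; rewrite mem_iota => /andP[_ /ww' ->].
Qed.

Lemma measurable_on_word n phi : measurable (on_word n phi).
Proof. by apply: sub_sigma_algebra; exact: on_word_cyl. Qed.

Lemma mu_on_word n phi : pm (on_word n phi) = ex n [::] (fun h => (phi h)%:R).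
Proof.
rewrite /mu /Pr /= path_measure_cyl; last exact: on_word_cyl.
have [N HN] := on_word_cyl n phi; rewrite /= (@cmassE _ _ _ _ n); last first.
  move=> w w' e; rewrite /on_word /= (_ : mkseq w' n = mkseq w n) //.
  by apply/eq_in_map => i; rewrite mem_iota => /andP[_ /e ->].
have E k h : mass sigma s k h (on_word n phi) = ex k h (fun h => (pad h \in on_word n phi)%:R).
  by elim: k h => //= k IH h; apply: eq_bigr.
rewrite E; apply: eq_ex => h sh; congr (_%:R); congr nat_of_bool.
rewrite add0n in sh; apply/idP/idP; rewrite in_setE /on_word /= -sh.
  by rewrite (_ : mkseq (pad h) (size h) = h) //; exact: mkseq_nth.
by rewrite (_ : mkseq (pad h) (size h) = h) //; exact: mkseq_nth.
Qed.

Lemma mu_ex (J : finType) (f : seq X -> J) (g : J -> R) n :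
  \sum_j g j * pm [set w | f (mkseq w n) = j] = ex n [::] (g \o f).
Proof.
have E j : pm [set w | f (mkseq w n) = j] = ex n [::] (fun h => (f h == j)%:R).
  rewrite -mu_on_word; congr mu; apply/seteqP; split=> w /=.
    by move=> fj; apply/eqP.
  by move=> /eqP.
under eq_bigr do rewrite E -ex_scale; rewrite -ex_sum; apply: eq_ex => h _ /=.
rewrite (bigD1 (f h)) //= eqxx mulr1 big1 ?addr0 // => j jf.
by rewrite eq_sym (negbTE jf) mulr0.
Qed.

Lemma measurable_word (J : finType) (f : seq X -> J) n j :
  measurable [set w : path_space M | f (mkseq w n) = j].
Proof.
rewrite (_ : [set w | _] = on_word n (fun h => f h == j)); first exact: measurable_on_word.
by apply/seteqP; split=> w /=; [move=> h; apply/eqP|move=> /eqP].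
Qed.

Lemma pos_ae : \forall w \ae Ps, forall n, 0 < ww (mkseq w n).
Proof.
apply: ae_foralln => n; apply: negligibleS (_ : Ps.-negligible (on_word n (fun h => ww h == 0))).
  move=> w /negP; rewrite -leNgt => w0; rewrite /on_word /=.
  by rewrite eq_le w0 word_weight_ge0.
apply/negligibleP; first exact: measurable_on_word.
apply: (etrans (muE Ps (measurable_on_word n (fun h => ww h == 0)))).
congr (_%:E); rewrite mu_on_word; apply/eqP; rewrite eq_le; apply/andP; split; last first.
  by rewrite -mu_on_word mu_ge0.
rewrite -[leRHS](mul0r (ex n [::] (fun=> 1))) -ex_scale; apply: ex_le => h _ w0.
by rewrite (gt_eqF w0) mul0r.
Qed.

(** * A conditional Borel-Cantelli lemma *)

Section BorelCantelli.
Variables (trig : pred (seq X)) (Y : pred X) (p : R).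
Hypothesis p0 : 0 < p.
Hypothesis trigY : forall h, 0 < ww h -> trig h ->
  p * ww h <= \sum_(x | Y x) ww (rcons h x).

(** The minimum with 1/2 keeps [q] positive, so that its negative powers make sense. *)
Let q := 1 - Num.min p 2^-1.
Let q0 : 0 < q. Proof. by rewrite /q subr_gt0 gt_min; apply/orP; right; lra. Qed.
Let q1 : q < 1. Proof. by rewrite /q gtrBl lt_min p0 /=; lra. Qed.

Let alive N h := all (predC Y) (drop N h).
Let cnt N h := count (fun i => trig (take i h)) (iota N (size h - N)).
(** A supermartingale: avoiding [Y] right after a trigger has conditional probability at most [q],
    which pays for the new factor [q^-1]. *)
Let psi N h := if alive N h then q ^- cnt N h else 0.

Let cntE N h x : (N <= size h)%N -> cnt N (rcons h x) = (cnt N h + trig h)%N.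
Proof.
move=> Nh; rewrite /cnt size_rcons subSn // -addn1 iotaD count_cat subnKC //=.
rewrite -cats1 take_size_cat // addn0; congr (_ + _)%N.
apply: eq_in_count => i; rewrite mem_iota subnKC // => /andP[_ ih].
by rewrite takel_cat // ltnW.
Qed.

Let psi_step N h : (N <= size h)%N -> 0 < ww h ->
  \sum_x ww (rcons h x) * psi N (rcons h x) <= ww h * psi N h.
Proof.
move=> Nh wh.
have aliveE x : alive N (rcons h x) = alive N h && ~~ Y x.
  by rewrite /alive drop_rcons // all_rcons andbC.
have [al|al] := boolP (alive N h); last first.
  rewrite big1; first by rewrite /psi (negbTE al) mulr0.
  by move=> x _; rewrite /psi aliveE (negbTE al) mulr0.
have -> : \sum_x ww (rcons h x) * psi N (rcons h x) =
    q ^- (cnt N h + trig h) * \sum_(x | ~~ Y x) ww (rcons h x).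
  rewrite mulr_sumr [RHS]big_mkcond; apply: eq_bigr => x _.
  by rewrite /psi aliveE al cntE //; case: (Y x); rewrite ?mulr0 // mulrC.
have S : \sum_(x | ~~ Y x) ww (rcons h x) = ww h - \sum_(x | Y x) ww (rcons h x).
  by rewrite -(sum_word_weight sigma s h) [\sum_x _](bigID Y) /= addrAC subrr add0r.
rewrite S /psi al exprD invfM; have qn : 0 < q ^- cnt N h by rewrite invr_gt0 exprn_gt0.
case: (boolP (trig h)) => tr /=; last first.
  rewrite expr0 invr1 mulr1 mulrC ler_pM2r // gerBl sumr_ge0 // => x _.
  exact: word_weight_ge0.
rewrite expr1 -mulrA [ww h * _]mulrC ler_pM2l // ler_pdivrMl //.
have := trigY wh tr; have : Num.min p 2^-1 <= p by rewrite ge_min lexx.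
by rewrite /q; nra.
Qed.

Let psi_le N j : ex (N + j) [::] (psi N) <= 1.
Proof.
elim: j => [|j IH].
  rewrite addn0 (_ : ex _ _ _ = ex N [::] (fun=> 1)); first by rewrite ex1.
  apply: eq_ex => h sh; rewrite /psi /alive /cnt sh add0n drop_oversize ?sh //=.
  by rewrite subnn /= expr0 invr1.
rewrite addnS; apply: le_trans IH; apply: ex_step => h sh; apply: psi_step.
by rewrite sh add0n leq_addr.
Qed.

(** By [psi_le], having met [k] triggers after time [N] without a letter of [Y] has probability at
    most [q^k]. A path with infinitely many triggers and no [Y] after [N] eventually stays in these
    events, for every [k]. *)
Lemma borel_cantelli : \forall w \ae Ps,
  (forall N, exists2 n, (N <= n)%N & trig (mkseq w n)) ->
  forall N, exists2 n, (N <= n)%N & Y (w n).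
Proof.
pose Bad N := [set w : path_space M | (forall N, exists2 n, (N <= n)%N & trig (mkseq w n)) /\
  forall n, (N <= n)%N -> ~~ Y (w n)].
suff nB N : Ps.-negligible (Bad N).
  apply: negligibleS (negligible_bigcup nB) => w /not_implyP[io] /existsNP[N HN].
  exists N => //; split=> // n Nn; apply/negP => Yn; apply: HN; by exists n.
pose E k n := on_word n (fun h => alive N h && (k <= cnt N h)%N).
pose D k n := \bigcap_(m in [set m | (n <= m)%N]) E k m.
have mE k n : measurable (E k n) by exact: measurable_on_word.
have mD k n : measurable (D k n) by apply: bigcap_measurable => //; exists n => /=.
have mU k : measurable (\bigcup_n D k n) by exact: bigcupT_measurable.
have BU k : Bad N `<=` \bigcup_n D k n.
  move=> w [io aw].
  have cS n : cnt N (mkseq w n.+1) = (cnt N (mkseq w n) + ((N <= n)%N && trig (mkseq w n)))%N.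
    rewrite mkseqS; case: (leqP N n) => Nn; first by rewrite cntE // size_mkseq.
    by rewrite /cnt size_rcons size_mkseq; do 2 rewrite (_ : (_ - N = 0)%N) ?addn0 //; lia.
  have cmono m n : (m <= n)%N -> (cnt N (mkseq w m) <= cnt N (mkseq w n))%N.
    by elim: n => [|n IH]; [rewrite leqn0 => /eqP ->|rewrite leq_eqVlt => /orP[/eqP ->//|/IH]; rewrite cS; lia].
  have [n0 n0P] : exists n0, (k <= cnt N (mkseq w n0))%N.
    elim: k => [|k [n0 n0P]]; first by exists 0%N.
    have [n1 n1P tr] := io (maxn n0 N).
    exists n1.+1; rewrite cS tr andbT; have := cmono n0 n1; lia.
  exists n0 => // n /= nn0; rewrite /E /on_word /= (leq_trans n0P (cmono _ _ nn0)) andbT.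
  rewrite /alive /mkseq -map_drop drop_iota all_map; apply/allP => i.
  by rewrite mem_iota add0n /= => /andP[/aw].
have Ek k n : (N <= n)%N -> mu Ps (E k n) <= q ^+ k.
  move=> Nn; rewrite mu_on_word -[leRHS]mulr1.
  have := psi_le N (n - N); rewrite subnKC // => le1.
  apply: le_trans (ler_wpM2l (exprn_ge0 _ (ltW q0)) le1); rewrite -ex_scale.
  apply: ex_le => h _ _; rewrite /psi; case: (alive N h) => /=; last by rewrite mulr0.
  case: (leqP k (cnt N h)) => kc; last by rewrite mulr_ge0 ?invr_ge0 ?exprn_ge0 // ltW.
  rewrite -[cnt N h](subnKC kc) exprD invfM mulrA divff ?mul1r; last by rewrite expf_neq0 // gt_eqF.
  by rewrite invf_ge1 ?exprn_gt0 // exprn_ile1 // ltW.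
have Uk k : mu Ps (\bigcup_n D k n) <= q ^+ k.
  rewrite leNgt; apply/negP => lt.
  have cv : Ps \o D k @ \oo --> Ps (\bigcup_n D k n).
    apply: nondecreasing_cvg_mu => //.
    by move=> m n mn; apply/subsetPset => w Dw i /= ni; apply: Dw => /=; exact: leq_trans ni.
  rewrite (muE Ps (mU k)) in cv; have [n0 _ H] := cvgr_gt _ (fine_cvg cv) _ lt.
  have := H (maxn n0 N); rewrite /= leq_maxl => /(_ isT); rewrite ltNge => /negP; apply.
  apply: le_trans (Ek k (maxn n0 N) (leq_maxr _ _)); apply: mu_le => //.
  by move=> w; apply => /=.
exists (\bigcap_k \bigcup_n D k n); split; first exact: bigcapT_measurable.
  have mI : measurable (\bigcap_k \bigcup_n D k n) by exact: bigcapT_measurable.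
  rewrite (muE Ps mI); congr (_%:E); apply/eqP; rewrite eq_le mu_ge0 andbT leNgt.
  apply/negP => lt; have qc : (fun k => q ^+ k) @ \oo --> (0 : R).
    by apply: cvg_expr; rewrite ger0_norm // ltW.
  have [k _ H] := cvgr_lt _ qc _ lt.
  have := H k (leqnn k); rewrite ltNge => /negP; apply; apply: le_trans (Uk k).
  by apply: mu_le => // w; apply.
by move=> w Bw k _; exact: BU.
Qed.

End BorelCantelli.
End Words.

(** * End components and the states visited infinitely often *)

Section EndComponents.
Variable M : mdp.
Implicit Types (C : {set state M}) (t u : state M) (a : action M).

Definition stays C t a := (a \in enabled t) && [forall u, (0 < trans t a u) ==> (u \in C)].
Definition ecgraph C : rel (state M) :=
  fun t u => (t \in C) && [exists a, stays C t a && (0 < trans t a u)].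
(** An end component is represented by its states alone, together with all the actions that stay
    among them. *)
Definition is_ec C := [&& C != finset.set0, [forall t in C, exists a, stays C t a] &
  [forall t in C, forall u in C, connect (ecgraph C) t u]].

Lemma is_ecP C : reflect [/\ exists t, t \in C, forall t, t \in C -> exists a, stays C t a &
  forall t u, t \in C -> u \in C -> connect (ecgraph C) t u] (is_ec C).
Proof.
apply: (iffP and3P) => -[H1 H2 H3]; split.
- by case/set0Pn: H1 => t; exists t.
- by move=> t tC; apply/existsP; exact: (forall_inP H2).
- by move=> t u tC uC; exact: (forall_inP (forall_inP H3 t tC)).
- by apply/set0Pn.
- by apply/forall_inP => t /H2 /existsP.
- by apply/forall_inP => t tC; apply/forall_inP => u uC; exact: H3.
Qed.

Definition io (I : Type) (w : nat -> I) (i : I) := forall N, exists2 n, (N <= n)%N & w n = i.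

Lemma io_eventually (I : finType) (w : nat -> I) : exists N, forall n, (N <= n)%N -> io w (w n).
Proof.
have H i : exists N, ~ io w i -> forall n, (N <= n)%N -> w n <> i.
  have [h|/existsNP[N HN]] := pselect (io w i); first by exists 0%N.
  by exists N => _ n Nn wn; apply: HN; exists n.
have [f fP] := choice H; exists (\max_i f i)%N => n nN.
apply: contrapT => N0; apply: (fP _ N0 n) => //; apply: leq_trans nN; exact: leq_bigmax.
Qed.

Lemma io_proj (I J : finType) (w : nat -> I) (f : I -> J) j :
  io (f \o w) j -> exists2 i, f i = j & io w i.
Proof.
move=> ioj; have [N HN] := io_eventually w; have [n Nn wn] := ioj N.
by exists (w n) => //; exact: HN.
Qed.

Definition Inf (w : path_space M) : {set state M} := [set t | `[< io (fun n => (w n).1) t >]]%SET.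

Lemma InfP w t : reflect (io (fun n => (w n).1) t) (t \in Inf w).
Proof. by rewrite inE; exact: asboolP. Qed.

Lemma measurable_Inf C : measurable [set w | Inf w = C].
Proof.
have -> : [set w | Inf w = C] = \bigcap_(t in [set t | true])
    (if t \in C then infinitely_often [set t]%SET else ~` infinitely_often [set t]%SET).
  have ioE w t : infinitely_often [set t]%SET w <-> t \in Inf w.
    by split=> [H|/InfP H]; [apply/InfP|] => N; have [n Nn] := H N; exists n => //;
      [apply/set1P|apply/set1P].
  apply/seteqP; split=> [w /= <- t _|w H].
    by case: ifPn => tI; [apply/ioE|move=> /ioE; apply/negP].
  apply/setP => t; have := H t isT; case: ifPn => tC; first by move=> /ioE.
  by move=> ni; apply/negP => /ioE.
apply: fin_bigcap_measurable => //; last first.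
  move=> t _; case: ifP => _; first exact: measurable_infinitely_often.
  by apply: measurableC; exact: measurable_infinitely_often.
Qed.

Lemma infinitely_often_Inf w (T : {set state M}) :
  infinitely_often T w <-> (Inf w :&: T)%SET != finset.set0.
Proof.
split=> [H|/set0Pn[t /setIP[/InfP H tT]] N]; last first.
  by have [n Nn wn] := H N; exists n => //; rewrite wn.
have [N HN] := io_eventually (fun n => (w n).1); have [n Nn wn] := H N.
by apply/set0Pn; exists (w n).1; rewrite inE wn andbT; apply/InfP; exact: HN.
Qed.

End EndComponents.

(** * Recurrence on almost every path, and the upper bound on values *)

Section Semantics.
Variables (R : realType) (M : mdp) (sigma : scheduler R M) (s : state M).
Let X := (state M * action M)%type.
Implicit Types (h : seq X) (w : path_space M).
Notation ww := (word_weight sigma s).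
Notation Ps := (Pr sigma s).

Lemma ae_imp (Q Q' : path_space M -> Prop) : (forall w, Q w -> Q' w) ->
  (\forall w \ae Ps, Q w) -> \forall w \ae Ps, Q' w.
Proof.
by move=> QQ; apply: negligibleS => w /= nQ Qw; apply: nQ; exact: QQ.
Qed.

Lemma ae_imp2 (Q1 Q2 Q' : path_space M -> Prop) : (forall w, Q1 w -> Q2 w -> Q' w) ->
  (\forall w \ae Ps, Q1 w) -> (\forall w \ae Ps, Q2 w) -> \forall w \ae Ps, Q' w.
Proof.
move=> QQ H1 H2; apply: negligibleS (negligibleU H1 H2) => w /= nQ.
by apply: contrapT => /not_orP[/contrapT q1 /contrapT q2]; apply: nQ; exact: QQ.
Qed.

Lemma ae_forall_fin (I : finType) (Q : I -> path_space M -> Prop) :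
  (forall i, \forall w \ae Ps, Q i w) -> \forall w \ae Ps, forall i, Q i w.
Proof.
move=> H; have : \forall w \ae Ps, forall n i, unpickle n = Some i -> Q i w.
  apply: ae_foralln => n; case E: (unpickle n) => [i|]; last by apply: aeW.
  by apply: filterS (H i) => w Qw j [<-].
by apply: filterS => w Hw i; apply: (Hw (pickle i)); rewrite pickleK.
Qed.

Lemma ww_rcons2 h v b u a : ww (rcons (rcons h (v, b)) (u, a)) =
  ww (rcons h (v, b)) * (ratr (trans v b u) * sigma (rcons h (v, b)) u a).
Proof. by rewrite [LHS]word_weight_rcons path_weight_rcons -mulrA. Qed.

Lemma ww_prefix h x : 0 < ww (rcons h x) -> 0 < ww h.
Proof.
move=> w0; rewrite lt_def word_weight_ge0 andbT; apply/eqP => h0.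
have := sum_word_weight sigma s h; rewrite h0 => /psumr_eq0P E.
by move: w0; rewrite E ?ltxx // => y _; exact: word_weight_ge0.
Qed.

Lemma ww_enabled h u a : 0 < ww (rcons h (u, a)) -> a \in enabled u.
Proof.
rewrite word_weight_rcons => w0; apply: (@sched_enabled _ _ sigma h).
by apply/eqP => s0; rewrite s0 mulr0 ltxx in w0.
Qed.

Lemma ww_sigma h u a : 0 < ww (rcons h (u, a)) -> 0 < sigma h u a.
Proof.
rewrite word_weight_rcons => w0; rewrite lt_def sched_ge0 andbT.
by apply/eqP => s0; rewrite s0 mulr0 ltxx in w0.
Qed.

Lemma ww_trans h v b u a : 0 < ww (rcons (rcons h (v, b)) (u, a)) -> 0 < trans v b u.
Proof.
rewrite ww_rcons2 => w0; rewrite lt_def; have /andP[-> _] := trans_itv v b u.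
by rewrite andbT; apply/eqP => t0; rewrite t0 rmorph0 mul0r mulr0 ltxx in w0.
Qed.

Lemma ww_head x : 0 < ww [:: x] -> x.1 = s.
Proof.
case: x => u a; rewrite (_ : [:: (u, a)] = rcons [::] (u, a)) // word_weight_rcons.
by rewrite /path_weight /=; case: eqP => // _; rewrite !mul0r ltxx.
Qed.

Section OnPath.
Variable w : path_space M.
Hypothesis wpos : forall n, 0 < ww (mkseq w n).

Lemma path_enabled n : (w n).2 \in enabled (w n).1.
Proof. by have := wpos n.+1; rewrite mkseqS [w n]surjective_pairing => /ww_enabled. Qed.

Lemma path_sigma n : 0 < sigma (mkseq w n) (w n).1 (w n).2.
Proof. by have := wpos n.+1; rewrite mkseqS [w n]surjective_pairing => /ww_sigma. Qed.

Lemma path_trans n : 0 < trans (w n).1 (w n).2 (w n.+1).1.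
Proof.
have := wpos n.+2; rewrite !mkseqS [w n]surjective_pairing [w n.+1]surjective_pairing.
exact: ww_trans.
Qed.

End OnPath.

(** The trigger is that the last letter is [(v, b)] and the history satisfies [extra]; the weight of
    the next letter then factors into a transition and a choice of the scheduler. *)
Lemma letter_bc (v : state M) (b : action M) (extra : pred (seq X)) (Y : pred X) (p : R) :
  0 < p -> (forall h, 0 < ww (rcons h (v, b)) -> extra (rcons h (v, b)) ->
    p <= \sum_(x | Y x) ratr (trans v b x.1) * sigma (rcons h (v, b)) x.1 x.2) ->
  \forall w \ae Ps,
    (forall N, exists2 n, (N <= n)%N & w n = (v, b) /\ extra (mkseq w n.+1)) ->
    forall N, exists2 n, (N <= n)%N & Y (w n).
Proof.
move=> p0 H; pose trig h := (ohead (rev h) == Some (v, b)) && extra h.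
have trigY h : 0 < ww h -> trig h -> p * ww h <= \sum_(x | Y x) ww (rcons h x).
  case/lastP: h => [|h [v' b']] w0 /andP[]; rewrite ?rev_rcons //= => /eqP[Ev Eb] eh.
  rewrite Ev Eb in w0 eh *.
  rewrite (eq_bigr (fun x => ww (rcons h (v, b)) * (ratr (trans v b x.1) *
    sigma (rcons h (v, b)) x.1 x.2))); last by move=> [u a] _; rewrite ww_rcons2.
  by rewrite -mulr_sumr mulrC ler_wpM2l ?word_weight_ge0 //; apply: H.
apply: (ae_imp _ (borel_cantelli p0 trigY)) => w Hw iow; apply: Hw => N.
have [n Nn [wn en]] := iow N; exists n.+1; first exact: leqW.
by rewrite /trig en andbT mkseqS rev_rcons /= wn.
Qed.

Lemma sum_state (u : state M) (F : X -> R) : \sum_(x | x.1 == u) F x = \sum_a F (u, a).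
Proof.
rewrite big_mkcond (eq_bigr (fun x => if x.1 == u then F (x.1, x.2) else 0)); last by case.
rewrite -(pair_bigA _ (fun y a => if y == u then F (y, a) else 0)) (bigD1 u) //=.
rewrite [X in _ + X]big1 ?addr0; first by apply: eq_bigr => a _; rewrite eqxx.
by move=> y /negbTE yu; rewrite big1 // => a _; rewrite yu.
Qed.

(** Each occurrence of the letter is followed by [u] with the same positive probability, whatever
    the scheduler does next. *)
Lemma letter_ae : \forall w \ae Ps, forall (x : X) (u : state M),
  0 < trans x.1 x.2 u -> io w x -> io (fun n => (w n).1) u.
Proof.
apply: ae_forall_fin => -[v b]; apply: ae_forall_fin => u.
have [p0|p0] := ltP 0 (trans v b u); last first.
  by apply: aeW.
have pR : 0 < ratr (trans v b u) :> R by rewrite ltr0q.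
have H h : 0 < ww (rcons h (v, b)) -> xpredT (rcons h (v, b)) -> ratr (trans v b u) <=
    \sum_(x : X | x.1 == u) ratr (trans v b x.1) * sigma (rcons h (v, b)) x.1 x.2.
  by move=> _ _; rewrite sum_state /= -mulr_sumr sched_sum mulr1.
apply: (ae_imp _ (letter_bc (extra := xpredT) (Y := fun x => x.1 == u) pR H)) => w Hw _ iow N.
have [|n Nn /eqP wn] := Hw _ N; last by exists n.
by move=> N'; have [n Nn wn] := iow N'; exists n.
Qed.

Lemma io_action (w : path_space M) t : io (fun n => (w n).1) t -> exists a, io w (t, a).
Proof.
move=> /(io_proj (w := w) (f := fst)) [[t' a] /= <- H]; by exists a.
Qed.

(** Letters that recur use staying actions, because all their successors recur by [letter_ae]. Once
    only recurrent letters are left, the path itself connects any two recurrent states. *)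
Lemma ec_ae : \forall w \ae Ps, is_ec (Inf w).
Proof.
apply: (ae_imp2 _ letter_ae (pos_ae sigma s)) => w cl wpos.
have stay t a : io w (t, a) -> stays (Inf w) t a.
  move=> iow; apply/andP; split.
    by have [n _ wn] := iow 0%N; have := path_enabled wpos n; rewrite wn.
  apply/forallP => u; apply/implyP => tu; apply/InfP; exact: (cl (t, a)).
have [N HN] := io_eventually w.
have inI n : (N <= n)%N -> (w n).1 \in Inf w.
  by move=> /HN iow; apply/InfP => K; have [k Kk wk] := iow K; exists k => //; rewrite wk.
apply/is_ecP; split.
- by exists (w N).1; exact: inI.
- by move=> t /InfP /io_action [a /stay ta]; exists a.
move=> t u /InfP iot /InfP iou.
have [n Nn wn] := iot N; have [k nk wk] := iou n.
rewrite -wn -wk -(subnKC nk); elim: (k - n)%N => [|j IH]; first by rewrite addn0 connect0.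
apply: connect_trans IH _; rewrite addnS; apply: connect1; rewrite /ecgraph inI ?(leq_trans Nn) ?leq_addr //.
apply/existsP; exists (w (n + j)%N).2; rewrite path_trans // andbT; apply: stay.
by rewrite -surjective_pairing; apply: HN; rewrite (leq_trans Nn) ?leq_addr.
Qed.

Definition lastst h := last s (unzip1 h).

Lemma lastst_rcons h x : lastst (rcons h x) = x.1.
Proof. by rewrite /lastst /unzip1 map_rcons last_rcons. Qed.

Lemma ww_markov h v b (F : state M -> R) :
  \sum_x ww (rcons (rcons h (v, b)) x) * F x.1 =
  ww (rcons h (v, b)) * \sum_u ratr (trans v b u) * F u.
Proof.
rewrite (eq_bigr (fun x => ww (rcons (rcons h (v, b)) (x.1, x.2)) * F x.1)); last by case.
rewrite -(pair_bigA _ (fun u a => ww (rcons (rcons h (v, b)) (u, a)) * F u)) mulr_sumr /=.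
apply: eq_bigr => u _; rewrite -mulr_suml mulrA; congr (_ * _).
under eq_bigr do rewrite ww_rcons2 mulrA.
by rewrite -mulr_sumr sched_sum mulr1.
Qed.

Lemma ww_headE x h : 0 < ww (x :: h) -> x.1 = s.
Proof.
elim/last_ind: h => [|h y IH]; first exact: ww_head.
by rewrite -rcons_cons => /ww_prefix.
Qed.

(* An optional-stopping bound: the potential of the current state decreases in
   mean and eventually dominates the value of the recurrent set. *)
Theorem value_upper (v : state M -> rat) (val : {set state M} -> rat) :
  (forall t a, a \in enabled t -> \sum_u trans t a u * v u <= v t) ->
  (forall C t, is_ec C -> t \in C -> val C <= v t) ->
  \sum_C ratr (val C) * mu Ps [set w | Inf w = C] <= ratr (v s).
Proof.
move=> sup dom.
apply: (@limit_le _ _ _ Ps _ _ (@Inf M) (fun n w => lastst (mkseq w n.+1))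
  (fun C => ratr (val C)) (fun t => ratr (v t))).
- exact: measurable_Inf.
- by move=> n j; exact: measurable_word.
- move=> n; rewrite (mu_ex sigma s lastst (fun t => ratr (v t))).
  elim: n => [|n IH].
    apply: (@le_trans _ _ (ex sigma s 1 [::] (fun h => ratr (v s) * 1))); last first.
      by rewrite ex_scale ex1 mulr1.
    apply: ex_le => -[|x [|//]] // _ /ww_headE xs.
    by rewrite mulr1 /= /lastst /= xs.
  apply: le_trans IH; apply: ex_step => h sh w0.
  case/lastP: h sh w0 => [//|h [t b]] _ w0.
  rewrite (eq_bigr (fun x => ww (rcons (rcons h (t, b)) x) * ratr (v x.1))); last first.
    by move=> x _; rewrite /= lastst_rcons.
  rewrite (ww_markov _ _ _ (fun t => ratr (v t))) /= lastst_rcons ler_pM2l //=.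
  under eq_bigr do rewrite -rmorphM.
  by rewrite -rmorph_sum ler_rat; apply: sup; exact: ww_enabled w0.
apply: (ae_imp _ ec_ae) => w ecw; have [N HN] := io_eventually (fun n => (w n).1).
exists N => n Nn; rewrite mkseqS lastst_rcons ler_rat; apply: dom => //.
by apply/InfP; exact: HN.
Qed.

Lemma sum_io (I : finType) (q : I -> rat) (T : I -> {set state M}) :
  \sum_i ratr (q i) * fine (Ps (infinitely_often (T i))) =
  \sum_C ratr (\sum_(i | (C :&: T i)%SET != finset.set0) q i) * mu Ps [set w | Inf w = C].
Proof.
have E i : fine (Ps (infinitely_often (T i))) =
    \sum_(C | (C :&: T i)%SET != finset.set0) mu Ps [set w | Inf w = C].
  rewrite -(mu_pred Ps (@measurable_Inf M) (fun C => (C :&: T i)%SET != finset.set0)).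
  rewrite /mu; congr (fine (Ps _)); apply/seteqP; split=> w /=.
    by move=> /infinitely_often_Inf.
  by move=> h; apply/infinitely_often_Inf.
under eq_bigr do rewrite E mulr_sumr.
rewrite (exchange_big_dep xpredT) //=; apply: eq_bigr => C _.
by rewrite rmorph_sum mulr_suml.
Qed.

End Semantics.

(** * A scheduler that attains the optimum *)

Section OptimalScheduler.
Variables (R : realType) (M : mdp).
Let X := (state M * action M)%type.
Implicit Types (h : seq X) (t : state M) (a : action M).
Variables (pol : state M -> state M -> option (action M)).
Variable D : state M -> state M -> {set state M}.

(* The policy [pol s0] is followed until it stops, where [s0] is the initial
   state; from the stopping state [z] on, actions are drawn uniformly from those
   that stay in [D s0 z]. *)
Definition stopst s0 h := ohead [seq z <- unzip1 h | pol s0 z == None].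

Definition plan h t : {set action M} :=
  let s0 := head t (unzip1 h) in
  match ohead [seq z <- rcons (unzip1 h) t | pol s0 z == None] with
  | Some z => [set a | stays (D s0 z) t a]%SET
  | None => if pol s0 t is Some b then [set b]%SET else finset.set0
  end.

(** On unintended histories the plan may be empty or contain disabled actions; falling back on all
    enabled actions makes [opt] a scheduler unconditionally. *)
Definition act_set h t := if (plan h t != finset.set0) && (plan h t \subset enabled t)
  then plan h t else enabled t.

Lemma act_set_sub h t : act_set h t \subset enabled t.
Proof. by rewrite /act_set; case: ifP => // /andP[]. Qed.

Lemma act_set_gt0 h t : (0 < #|act_set h t|)%N.
Proof.
rewrite card_gt0 /act_set; case: ifP => [/andP[]//|_].
by have [a Ea] := exists_enabled t; apply/set0Pn; exists a; rewrite inE; apply/eqP.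
Qed.

Definition opt_fun h t a : R := (a \in act_set h t)%:R / #|act_set h t|%:R.

Lemma opt_ge0 h t a : 0 <= opt_fun h t a.
Proof. by rewrite divr_ge0 // ler0n. Qed.

Lemma opt_sum h t : \sum_a opt_fun h t a = 1.
Proof.
rewrite -mulr_suml -natr_sum; set A := act_set h t.
have -> : (\sum_a (a \in A) = #|A|)%N.
  by rewrite -sum1_card [RHS]big_mkcond; apply: eq_bigr => a _; case: (a \in A).
by rewrite divff // pnatr_eq0 -lt0n act_set_gt0.
Qed.

Lemma opt_act h t a : opt_fun h t a != 0 -> a \in act_set h t.
Proof. by rewrite /opt_fun; case: (a \in _); rewrite ?mul0r ?eqxx. Qed.

Lemma opt_enabled h t a : opt_fun h t a != 0 -> a \in enabled t.
Proof. by move=> /opt_act; apply/(fintype.subsetP (act_set_sub h t)). Qed.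

Definition opt : scheduler R M := Scheduler opt_ge0 opt_sum opt_enabled.

Variables (s : state M) (V : state M -> rat) (val : {set state M} -> rat).
Let pi := pol s.
Hypothesis pi_enabled : forall t b, pi t = Some b -> b \in enabled t.
Hypothesis pi_proper : forall t, exists2 y,
  connect (fun t u => if pi t is Some b then 0 < trans t b u else false) t y & pi y = None.
Hypothesis pi_stop : forall z, pi z = None -> [/\ is_ec (D s z), z \in D s z & V z <= val (D s z)].
Hypothesis pi_step : forall t b, pi t = Some b -> V t <= \sum_u trans t b u * V u.

Notation ww := (word_weight opt s).
Notation Ps := (Pr opt s).

Lemma stopst_rcons h x : stopst s (rcons h x) =
  if stopst s h is Some z then Some z else if pi x.1 == None then Some x.1 else None.
Proof.
rewrite /stopst /unzip1 map_rcons filter_rcons -/pi; case: ifP => _.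
  by case: (seq.filter _ _).
by case: (seq.filter _ _).
Qed.

Lemma planE h t a : head t (unzip1 h) = s -> plan h t =
  match stopst s (rcons h (t, a)) with
  | Some z => [set a | stays (D s z) t a]%SET
  | None => if pi t is Some b then [set b]%SET else finset.set0
  end.
Proof. by move=> hd; rewrite /plan hd /stopst /unzip1 map_rcons. Qed.

Lemma ww_hd h t a : 0 < ww (rcons h (t, a)) -> head t (unzip1 h) = s.
Proof. by case: h => [|x h]; [move=> /ww_headE|rewrite rcons_cons => /ww_headE]. Qed.

Lemma act_follow h t a : head t (unzip1 h) = s -> stopst s (rcons h (t, a)) = None ->
  exists2 b, pi t = Some b & act_set h t = [set b]%SET.
Proof.
move=> hd st; have := st; rewrite stopst_rcons; case: (stopst s h) => // /=.
case E: (pi t) => [b|] //= _; exists b => //.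
rewrite /act_set (planE a hd) st E finset.sub1set (pi_enabled E) andbT.
by rewrite ifT //; apply/set0Pn; exists b; rewrite inE.
Qed.

Lemma stopst_pi h z : stopst s h = Some z -> pi z = None.
Proof.
rewrite /stopst; case E: (seq.filter _ _) => [//|y l] [<-].
have : y \in [seq z <- unzip1 h | pol s z == None] by rewrite E mem_head.
by rewrite mem_filter => /andP[/eqP].
Qed.

Lemma act_stays h t a z : head t (unzip1 h) = s -> stopst s (rcons h (t, a)) = Some z ->
  t \in D s z -> act_set h t = [set a | stays (D s z) t a]%SET.
Proof.
move=> hd st tD; rewrite /act_set (planE a hd) st ifT //.
have [/is_ecP[_ H _] _ _] := pi_stop (stopst_pi st); have [c sc] := H t tD.
apply/andP; split; first by apply/set0Pn; exists c; rewrite inE.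
by apply/fintype.subsetP => c'; rewrite inE => /andP[].
Qed.

(** After stopping, the choice is uniform among at most [#|action M|] actions, so [(u, c)] follows
    [(v, b)] with probability at least [trans v b u / #|action M|]. *)
Lemma stay_bc z v b u c : 0 < trans v b u -> u \in D s z -> stays (D s z) u c ->
  \forall w \ae Ps,
    (forall N, exists2 n, (N <= n)%N & w n = (v, b) /\ stopst s (mkseq w n.+1) == Some z) ->
    io w (u, c).
Proof.
move=> p0 uD sc.
have pR : 0 < ratr (trans v b u) / #|action M|%:R :> R.
  by rewrite divr_gt0 ?ltr0q // ltr0n action_inh.
have H h : 0 < ww (rcons h (v, b)) -> stopst s (rcons h (v, b)) == Some z ->
   ratr (trans v b u) / #|action M|%:R <=
    \sum_(x | x == (u, c)) ratr (trans v b x.1) * opt (rcons h (v, b)) x.1 x.2.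
  move=> w0 /eqP st; rewrite big_pred1_eq /=.
  have hd : head u (unzip1 (rcons h (v, b))) = s.
    by have := ww_hd w0; rewrite /unzip1 map_rcons; case: (h).
  have st' : stopst s (rcons (rcons h (v, b)) (u, c)) = Some z by rewrite stopst_rcons st.
  rewrite ler_wpM2l ?ler0q //; first by have /andP[] := trans_itv v b u.
  rewrite /opt_fun (act_stays hd st' uD) inE sc div1r lef_pV2 ?posrE ?ltr0n ?action_inh //.
    by rewrite ler_nat max_card.
  by rewrite -(act_stays hd st' uD) act_set_gt0.
apply: (ae_imp _ (letter_bc (extra := fun h => stopst s h == Some z) (Y := fun x => x == (u, c)) pR H)) => w Hw iow N.
by have [n Nn /eqP] := Hw iow N; exists n.
Qed.

Lemma stay_ae : \forall w \ae Ps, forall (y : (state M * X) * X), let: (z, (v, b), (u, c)) := y in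
  0 < trans v b u -> u \in D s z -> stays (D s z) u c ->
  (forall N, exists2 n, (N <= n)%N & w n = (v, b) /\ stopst s (mkseq w n.+1) == Some z) ->
  io w (u, c).
Proof.
apply: ae_forall_fin => -[[z [v b]] [u c]].
have [[h1 h2 h3]|N] := pselect [/\ 0 < trans v b u, u \in D s z & stays (D s z) u c].
  by apply: (ae_imp _ (stay_bc h1 h2 h3)) => w H _ _ _.
by apply: aeW => w h1 h2 h3; case: N.
Qed.

Section Path.
Variable w : path_space M.
Hypothesis wpos : forall n, 0 < ww (mkseq w n).
Hypothesis wlet : forall (x : X) (u : state M),
  0 < trans x.1 x.2 u -> io w x -> io (fun n => (w n).1) u.
Hypothesis wstay : forall (y : (state M * X) * X), let: (z, (v, b), (u, c)) := y in
  0 < trans v b u -> u \in D s z -> stays (D s z) u c ->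
  (forall N, exists2 n, (N <= n)%N & w n = (v, b) /\ stopst s (mkseq w n.+1) == Some z) ->
  io w (u, c).

Lemma mkseq_pair n : mkseq w n.+1 = rcons (mkseq w n) ((w n).1, (w n).2).
Proof. by rewrite mkseqS -surjective_pairing. Qed.

Lemma path_hd n : head (w n).1 (unzip1 (mkseq w n)) = s.
Proof. by apply: (@ww_hd _ _ (w n).2); rewrite -mkseq_pair. Qed.

Lemma path_act n : (w n).2 \in act_set (mkseq w n) (w n).1.
Proof. by apply: opt_act; have := path_sigma wpos n; rewrite lt_def => /andP[]. Qed.

Lemma path_follow n : stopst s (mkseq w n.+1) = None -> pi (w n).1 = Some (w n).2.
Proof.
rewrite mkseq_pair => st; have [b E A] := act_follow (path_hd n) st.
by have := path_act n; rewrite A inE => /eqP ->.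
Qed.

(** A path that never stopped would follow [pi] forever. Recurrence would then spread along the
    edges of [pi] up to a stopping state, which properness provides. *)
Lemma path_stops : exists n, stopst s (mkseq w n) <> None.
Proof.
apply: contrapT => /forallNP N.
have fol n : pi (w n).1 = Some (w n).2 by apply: path_follow; apply: contrapT; exact: N.
have [n0 H0] := io_eventually (fun n => (w n).1).
have [y + py] := pi_proper (w n0).1; move=> /connectP[l pl El].
suff : io (fun n => (w n).1) y by move=> /(_ 0%N)[n _ wn]; have := fol n; rewrite wn py.
rewrite El; have := H0 n0 (leqnn _); move: (w n0).1 pl {El}; elim: l => //= u l IH t.
move=> /andP[tu pl] iot; apply: IH pl _; case E: (pi t) tu => [b|] // tu.
apply: (wlet (x := (t, b))) => //= K; have [n Kn wn] := iot K; exists n => //.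
by have := fol n; rewrite wn E => -[->]; rewrite -wn -surjective_pairing.
Qed.

(** From the stopping state [z] on, the path cannot leave [D s z]. Some letter recurs, recurrence
    passes to every staying letter at its successors, and connectedness carries it to all states of
    [D s z]. *)
Lemma path_end : exists z N, [/\ pi z = None, forall n, (N <= n)%N ->
  stopst s (mkseq w n) = Some z & Inf w = D s z].
Proof.
have ex : exists n, stopst s (mkseq w n) != None.
  by have [n /eqP] := path_stops; exists n.
case: (ex_minnP ex) => -[|k] //; rewrite mkseqS stopst_rcons => + kmin.
case E: (stopst s (mkseq w k)) => [z|]; first by have := kmin k; rewrite E ltnn => /(_ isT).
case: ifP => // /eqP pz _; set z := (w k).1 in pz.
have stE n : (k < n)%N -> stopst s (mkseq w n) = Some z.
  elim: n => // n IH; rewrite ltnS leq_eqVlt => /orP[/eqP <-|/IH e]; rewrite mkseqS stopst_rcons ?e //.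
  by rewrite E pz.
have [/is_ecP[_ Dact Dcon] zD _] := pi_stop pz.
have inD n : (k <= n)%N -> (w n).1 \in D s z /\ stays (D s z) (w n).1 (w n).2.
  move=> kn; have act m : (k <= m)%N -> (w m).1 \in D s z -> stays (D s z) (w m).1 (w m).2.
    move=> km mD; have := path_act m.
    have st := stE m.+1; rewrite mkseq_pair in st.
    by rewrite (act_stays (path_hd m) (st km) mD) inE.
  suff : (w n).1 \in D s z by move=> h; split=> //; exact: act.
  rewrite -(subnKC kn); elim: (n - k)%N => [|j IH]; first by rewrite addn0.
  have := act (k + j)%N (leq_addr _ _) IH => /andP[_ /forallP/(_ (w (k + j.+1)%N).1)].
  by rewrite addnS (path_trans wpos) implyTb.
exists z, k.+1; split=> //; apply/setP => y; apply/idP/idP.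
  by move=> /InfP /(_ k)[n kn <-]; have [] := inD n kn.
move=> yD; have [N HN] := io_eventually w.
pose x := w (maxn N k); have iox : io w x by apply: HN; exact: leq_maxl.
have [xD xs] := inD (maxn N k) (leq_maxr _ _); rewrite -/x in xD xs.
have prop v b : io w (v, b) -> forall u c, 0 < trans v b u -> u \in D s z ->
    stays (D s z) u c -> io w (u, c).
  move=> iov u c p0 uD uc; apply: (wstay ((z, (v, b)), (u, c))) => // K.
  have [n Kn wn] := iov (maxn K k); exists n; first by move: Kn; rewrite geq_max => /andP[].
  by split=> //; apply/eqP; apply: stE; rewrite ltnS; move: Kn; rewrite geq_max => /andP[].
have [u xu] : exists u, 0 < trans x.1 x.2 u.
  apply: contrapT => /forallNP Nu; have /andP[ex2 _] := xs.
  move: ex2; rewrite inE big1; first by rewrite eq_sym oner_eq0.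
  move=> u _; apply/eqP; rewrite eq_le.
  by have /andP[-> _] := trans_itv x.1 x.2 u; rewrite andbT leNgt; apply/negP/Nu.
have uD : u \in D s z by move: xs => /andP[_ /forallP/(_ u)]; rewrite xu.
have all_u c : stays (D s z) u c -> io w (u, c).
  by move=> uc; apply: (prop x.1 x.2) => //; rewrite -surjective_pairing.
have all_y : forall c, stays (D s z) y c -> io w (y, c).
  have := Dcon u y uD yD => /connectP[l pl ->].
  elim: l u pl all_u {uD xu} => //= v l IH u /andP[/andP[uD /existsP[b /andP[ub bv]]] pl] all_u.
  apply: IH pl _ => c vc; apply: (prop u b) => //; first exact: all_u.
  by move: ub => /andP[_ /forallP/(_ v)]; rewrite bv.
have [c yc] := Dact y yD; apply/InfP => K; have [n Kn wn] := all_y c yc K.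
by exists n => //; rewrite wn.
Qed.

End Path.

(** The current state of the process stopped when the policy stops. *)
Definition frozen h := odflt (lastst s h) (stopst s h).

Theorem opt_value : ratr (V s) <= \sum_C ratr (val C) * mu Ps [set w | Inf w = C].
Proof.
rewrite -lerN2 -sumrN; under eq_bigr do rewrite -mulNr.
apply: (@limit_le _ _ _ Ps _ _ (@Inf M) (fun n w => frozen (mkseq w n.+1))
  (fun C => - ratr (val C)) (fun t => - ratr (V t))).
- exact: measurable_Inf.
- by move=> n j; exact: measurable_word.
- move=> n; rewrite (mu_ex opt s frozen (fun t => - ratr (V t))).
  elim: n => [|n IH].
    apply: (@le_trans _ _ (ex opt s 1 [::] (fun h => - ratr (V s) * 1))); last first.
      by rewrite ex_scale ex1 mulr1.
    apply: ex_le => -[|x [|//]] // _ /ww_headE xs.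
    rewrite mulr1 /= /frozen (_ : [:: x] = rcons [::] x) // stopst_rcons lastst_rcons /=.
    by case: ifP => _ /=; rewrite xs.
  apply: le_trans IH; apply: ex_step => h sh w0.
  case/lastP: h sh w0 => [//|h [t b]] _ w0.
  case st: (stopst s (rcons h (t, b))) => [z|].
    rewrite (eq_bigr (fun x => ww (rcons (rcons h (t, b)) x) * - ratr (V z))); last first.
      by move=> x _; rewrite /= /frozen stopst_rcons st.
    by rewrite -mulr_suml sum_word_weight /= /frozen st.
  rewrite (eq_bigr (fun x => ww (rcons (rcons h (t, b)) x) * - ratr (V x.1))); last first.
    move=> x _; rewrite /= /frozen stopst_rcons st lastst_rcons; case: ifP => //.
  rewrite (ww_markov opt s h t b (fun t => - ratr (V t))) /= /frozen st /= lastst_rcons ler_pM2l //=.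
  have [c Ec A] := act_follow (ww_hd w0) st.
  have bc : b = c.
    have := ww_sigma w0 => /lt0r_neq0 /opt_act; rewrite A inE => /eqP //.
  under eq_bigr do rewrite mulrN -rmorphM.
  by rewrite sumrN lerN2 -rmorph_sum ler_rat bc; exact: pi_step.
apply: (ae_imp2 _ (pos_ae opt s) (ae_imp2 _ (@letter_ae _ _ opt s) stay_ae (Q' := fun w => _ /\ _))).
  move=> w wpos [wlet wstay]; have [z [N [pz stz ->]]] := path_end wpos wlet wstay.
  exists N => n Nn; rewrite /frozen stz ?leqW //= lerN2 ler_rat.
  by have [] := pi_stop pz.
by move=> w h1 h2; split; [exact: h1|exact: h2].
Qed.

End OptimalScheduler.

(** * Mixtures of schedulers *)

Section Mixture.
Variables (R : realType) (M : mdp).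
Let X := (state M * action M)%type.
Implicit Types (h : seq X) (sg : scheduler R M).

(** The weight of a path is the product of a factor that depends on the scheduler and a factor
    [tweight] that depends on the process. Mixing affects the former only. *)
Fixpoint sweight sg past h : R :=
  if h is (u, a) :: h' then sg past u a * sweight sg (rcons past (u, a)) h' else 1.

Fixpoint tweight h (t : state M) : R :=
  if h is (u, a) :: h' then ratr (trans u a (head t (unzip1 h'))) * tweight h' t else 1.

Lemma ext_weight_split sg past h t : ext_weight sg past h t = tweight h t * sweight sg past h.
Proof. by elim: h past => [|[u a] h IH] past /=; rewrite ?mulr1 // IH; ring. Qed.

Lemma sweight_rcons sg past h u a :
  sweight sg past (rcons h (u, a)) = sweight sg past h * sg (past ++ h) u a.
Proof.
elim: h past => [|[v b] h IH] past /=; first by rewrite cats0 mulr1 mul1r.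
by rewrite IH cat_rcons mulrA.
Qed.

Lemma sweight_ge0 sg past h : 0 <= sweight sg past h.
Proof. by elim: h past => [|[v b] h IH] past //=; rewrite mulr_ge0 ?sched_ge0. Qed.

Variables (sg1 sg2 : scheduler R M) (l : R).
Hypothesis l01 : 0 <= l <= 1.

Let l0 : 0 <= l. Proof. by case/andP: l01. Qed.
Let l1 : 0 <= 1 - l. Proof. by rewrite subr_ge0; case/andP: l01. Qed.

Definition mixw h := l * sweight sg1 [::] h + (1 - l) * sweight sg2 [::] h.

(* The Bayesian mixture: each scheduler is weighted by the posterior probability
   of having been chosen at the start, given the history. *)
Definition mix_fun h t a : R :=
  if mixw h == 0 then sg1 h t a else
  (l * sweight sg1 [::] h * sg1 h t a + (1 - l) * sweight sg2 [::] h * sg2 h t a) / mixw h.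

Lemma mixw_ge0 h : 0 <= mixw h.
Proof. by rewrite addr_ge0 // mulr_ge0 ?sweight_ge0. Qed.

Lemma mix_ge0 h t a : 0 <= mix_fun h t a.
Proof.
rewrite /mix_fun; case: ifP => _; first exact: sched_ge0.
by rewrite divr_ge0 ?mixw_ge0 // addr_ge0 // !mulr_ge0 ?sweight_ge0 ?sched_ge0.
Qed.

Lemma mix_sum h t : \sum_a mix_fun h t a = 1.
Proof.
rewrite /mix_fun; case W: (mixw h == 0); first exact: sched_sum.
by rewrite -mulr_suml big_split -!mulr_sumr !sched_sum !mulr1 divff // W.
Qed.

Lemma mix_enabled h t a : mix_fun h t a != 0 -> a \in enabled t.
Proof.
rewrite /mix_fun; case: ifP => W; first exact: sched_enabled.
case: (eqVneq (sg1 h t a) 0) => [->|/sched_enabled //].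
case: (eqVneq (sg2 h t a) 0) => [->|/sched_enabled //].
by rewrite !mulr0 addr0 mul0r eqxx.
Qed.

Definition mixture : scheduler R M := Scheduler mix_ge0 mix_sum mix_enabled.

(** The denominators of the posterior probabilities telescope along the history. *)
Lemma sweight_mixture h : sweight mixture [::] h = mixw h.
Proof.
elim/last_ind: h => [|h [u a] IH]; first by rewrite /mixw /= !mulr1 addrC subrK.
rewrite /mixw !sweight_rcons IH /= /mix_fun; case: eqP => [W|/eqP W].
  have /andP[/eqP a0 /eqP b0] : (l * sweight sg1 [::] h == 0) && ((1 - l) * sweight sg2 [::] h == 0).
    by rewrite -paddr_eq0 ?mulr_ge0 ?sweight_ge0 //; apply/eqP.
  by rewrite W !mulrA a0 b0 !mul0r addr0.
by rewrite mulrC divfK // !mulrA.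
Qed.

Lemma path_weight_split sg s h t :
  path_weight sg s h t = (head t (unzip1 h) == s)%:R * tweight h t * sweight sg [::] h.
Proof. by rewrite /path_weight ext_weight_split mulrA. Qed.

Lemma word_weight_mixture s h :
  word_weight mixture s h = l * word_weight sg1 s h + (1 - l) * word_weight sg2 s h.
Proof.
case/lastP: h => [|h [u a]]; first by rewrite /word_weight /= !mulr1 addrC subrK.
rewrite !word_weight_rcons !path_weight_split -!mulrA.
have E sg : sweight sg [::] h * sg h u a = sweight sg [::] (rcons h (u, a)).
  by rewrite sweight_rcons.
by rewrite !E sweight_mixture /mixw; ring.
Qed.

Lemma mass_mixture s n h A :
  mass mixture s n h A = l * mass sg1 s n h A + (1 - l) * mass sg2 s n h A.
Proof.
elim: n h => [|n IH] h /=; first by rewrite word_weight_mixture; ring.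
by rewrite !mulr_sumr -big_split; apply: eq_bigr.
Qed.

(** Both sides are finite measures that agree on events of finite horizon; these generate the
    sigma-algebra and are stable under intersection. *)
Theorem mixture_value s (A : set (path_space M)) : measurable A ->
  fine (Pr mixture s A) = l * fine (Pr sg1 s A) + (1 - l) * fine (Pr sg2 s A).
Proof.
move=> mA; pose c1 := NngNum l0; pose c2 := NngNum l1.
pose m2 := measure_add (mscale c1 (Pr sg1 s)) (mscale c2 (Pr sg2 s)).
have m2E B : m2 B = (l%:E * Pr sg1 s B + (1 - l)%:E * Pr sg2 s B)%E.
  by rewrite /m2 measure_addE.
suff -> : Pr mixture s A = m2 A.
  rewrite m2E -(@fineK _ (Pr sg1 s A)) ?fin_num_measure //.
  by rewrite -(@fineK _ (Pr sg2 s A)) ?fin_num_measure // -!EFinM -EFinD.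
rewrite /m2; apply: (@measure_unique _ R (path_space M) (@cylinder_sets M) (fun=> setT)) => //.
- by move=> B C mB mC; exact: (@measurableI cyl_display (ipath M)).
- by move=> _; exists 0%N.
- by rewrite bigcup_const //; exists 0%N.
- move=> B mB; rewrite [RHS]m2E [LHS](path_measure_cyl mixture s mB).
  rewrite (path_measure_cyl sg1 s mB : Pr sg1 s B = _) (path_measure_cyl sg2 s mB : Pr sg2 s B = _).
  by rewrite -!EFinM -EFinD /cmass mass_mixture.
- by move=> _; rewrite -ge0_fin_numE // fin_num_measure.
Qed.

End Mixture.

Local Close Scope classical_set_scope.

(** * End components and the optimal value of an instance *)

Section Reach.
Variables (T : finType) (e : rel T).

Definition reach_step (A : {set T}) := [set u | (u \in A) || [exists t, (t \in A) && e t u]]%SET.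
Definition reach x := iter #|T| reach_step [set x]%SET.

Lemma reach_mono n m x : (n <= m)%N ->
  iter n reach_step [set x]%SET \subset iter m reach_step [set x]%SET.
Proof.
move=> /subnK <-; elim: (m - n)%N => [|k IH]; first by rewrite add0n.
apply: fintype.subset_trans IH _; rewrite addSn iterS; apply/fintype.subsetP => u uA.
by rewrite inE uA.
Qed.

Lemma reachE x y : (y \in reach x) = connect e x y.
Proof.
apply/idP/idP.
  rewrite /reach; elim: #|T| y => [|n IH] y /=; first by rewrite inE => /eqP ->.
  rewrite inE => /orP[/IH //|/existsP[t /andP[/IH xt ty]]].
  exact: connect_trans xt (connect1 ty).
(* A path without repetitions has at most [#|T|] edges, so [#|T|] iterations suffice. *)
move=> /connectP[p + ->] => /shortenP[q xq uq _].
have sq : (size q <= #|T|)%N by have := max_card (mem (x :: q)); rewrite (card_uniqP uq) /=; lia.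
apply: (fintype.subsetP (reach_mono x sq)).
elim/last_ind: q {uq sq} xq => [|q z IH]; first by rewrite inE.
rewrite rcons_path last_rcons size_rcons => /andP[xq lz]; rewrite iterS inE.
by apply/orP; right; apply/existsP; exists (last x q); rewrite IH.
Qed.

End Reach.

Section EndComponents.
Variable M : mdp.
Implicit Types (C D U : {set state M}) (s t : state M).

Definition ecstep s C := [set t in C | [&& [exists a, stays C t a],
  t \in reach (ecgraph C) s & s \in reach (ecgraph C) t]]%SET.
(** A decreasing iteration that is stationary after [#|state M|] steps. If the limit contains [s],
    it is the largest end component around [s] that avoids [U]. *)
Definition ecof U s := iter #|state M| (ecstep s) (~: U)%SET.

Lemma ecstep_sub s C : ecstep s C \subset C.
Proof. by apply/fintype.subsetP => t; rewrite inE => /andP[]. Qed.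

(** A step that is not yet stationary loses an element. *)
Lemma iter_shrink (T : finType) (f : {set T} -> {set T}) (A : {set T}) :
  (forall B, f B \subset B) -> f (iter #|T| f A) = iter #|T| f A.
Proof.
move=> fsub.
suff H n : (f (iter n f A) == iter n f A) || (#|iter n f A| + n <= #|T|)%N.
  have /orP[/eqP //|] := H #|T|; rewrite -[leqRHS]add0n leq_add2r leqn0 cards_eq0 => /eqP E.
  by apply/eqP; rewrite finset.eqEsubset fsub /= E finset.sub0set.
elim: n => [|n /orP[/eqP E|H]]; first by rewrite /= addn0 max_card orbT.
  by rewrite iterS E E eqxx.
case: (altP (f (iter n f A) =P iter n f A)) => [E|ne]; first by rewrite iterS E E eqxx.
apply/orP; right; rewrite iterS; apply: leq_trans H; rewrite addnS -addSn leq_add2r.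
by apply: proper_card; rewrite finset.properEneq ne fsub.
Qed.

Lemma ecof_fix U s : ecstep s (ecof U s) = ecof U s.
Proof. by apply: iter_shrink; exact: ecstep_sub. Qed.

Lemma ecof_avoid U s t : t \in ecof U s -> t \notin U.
Proof.
suff: ecof U s \subset (~: U)%SET by move=> /fintype.subsetP H /H; rewrite inE.
rewrite /ecof; elim: #|state M| => //= n IH; exact: fintype.subset_trans (ecstep_sub _ _) IH.
Qed.

Lemma ecof_ec U s : s \in ecof U s -> is_ec (ecof U s).
Proof.
move=> sC; apply/is_ecP; split; first by exists s.
  by move=> t; rewrite -{1}ecof_fix inE => /and4P[_ /existsP].
move=> t u; rewrite -{1}ecof_fix inE => /and4P[_ _ _ ts].
rewrite -{1}ecof_fix inE => /and4P[_ _ su _]; rewrite !reachE in ts su.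
exact: connect_trans ts su.
Qed.

Lemma stays_sub C D t a : C \subset D -> stays C t a -> stays D t a.
Proof.
move=> /fintype.subsetP CD /andP[en /forallP H]; rewrite /stays en; apply/forallP => u.
by apply/implyP => p; apply: CD; apply: (implyP (H u)).
Qed.

Lemma ecgraph_sub C D : C \subset D -> subrel (ecgraph C) (ecgraph D).
Proof.
move=> CD t u /andP[tC /existsP[a /andP[sa p]]]; rewrite /ecgraph (fintype.subsetP CD) //=.
by apply/existsP; exists a; rewrite (stays_sub CD sa) p.
Qed.

(** [D] survives every step, because a larger set only offers more staying actions and more
    edges. *)
Lemma ecof_max U s D : is_ec D -> s \in D -> [disjoint D & U] -> D \subset ecof U s.
Proof.
move=> /is_ecP[_ act con] sD dis; rewrite /ecof; elim: #|state M| => [|n IH].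
  by apply/fintype.subsetP => t tD; rewrite inE (fintype.disjointFr dis tD).
rewrite iterS; set C := iter _ _ _ in IH *; apply/fintype.subsetP => t tD.
rewrite inE (fintype.subsetP IH) //= !reachE.
have [a /(stays_sub IH) sa] := act t tD.
apply/and3P; split; first by apply/existsP; exists a.
  exact: (connect_sub (fun x y xy => connect1 (ecgraph_sub IH xy))) (con _ _ sD tD).
exact: (connect_sub (fun x y xy => connect1 (ecgraph_sub IH xy))) (con _ _ tD sD).
Qed.

(** Take a reachable state from which the fewest states are reachable. Those states are mutually
    reachable and closed under all actions, hence they form an end component. *)
Lemma reaches_ec s : exists2 t, connect (pgraph (@trans M) (fun s a => a \in enabled s)) s t &
  exists2 C, is_ec C & t \in C.
Proof.
set g := pgraph _ _; pose N t := #|[set u | connect g t u]%SET|.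
pose t := [arg min_(t < s | connect g s t) N t]%N.
have [st tmin] : connect g s t /\ forall u, connect g s u -> (N t <= N u)%N.
  by rewrite /t; case: arg_minnP => //; exact: connect0.
exists t => //; exists [set u | connect g t u]%SET; last by rewrite inE connect0.
have back u : connect g t u -> connect g u t.
  move=> tu; have su := connect_trans st tu.
  have sub : [set v | connect g u v]%SET \subset [set v | connect g t v]%SET.
    by apply/fintype.subsetP => v; rewrite !inE; exact: connect_trans.
  have : [set v | connect g u v]%SET == [set v | connect g t v]%SET.
    by rewrite finset.eqEcard sub tmin.
  by move=> /eqP/setP /(_ t); rewrite !inE connect0.
have st_all u a : connect g t u -> a \in enabled u -> stays [set u | connect g t u]%SET u a.
  move=> tu ea; rewrite /stays ea; apply/forallP => v; apply/implyP => p; rewrite inE.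
  by apply: connect_trans tu (connect1 _); apply/existsP; exists a; rewrite ea p.
have enx (u : state M) : exists a, a \in enabled u.
  by have [a ea] := exists_enabled u; exists a; rewrite inE; apply/eqP.
apply/is_ecP; split; first by exists t; rewrite inE connect0.
  by move=> u; rewrite inE => tu; have [a ea] := enx u; exists a; exact: st_all.
move=> u v; rewrite !inE => tu tv.
have [p + ->] := connectP (connect_trans (back _ tu) tv).
elim: p u tu => [|x p IH] u tu /=; first by rewrite connect0.
move=> /andP[ux xp]; move: (ux) => /existsP[a /andP[ea pa]].
apply: (connect_trans (connect1 _) (IH _ (connect_trans tu (connect1 ux)) xp)).
by rewrite /ecgraph inE tu; apply/existsP; exists a; rewrite st_all.
Qed.

End EndComponents.

Lemma common_denominator (Y : finType) (x : Y -> rat) (B : nat) :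
  (forall y, exists K : nat, [/\ (0 < K)%N, (K <= B)%N & exists z : int, K%:R * x y = z%:~R]) ->
  exists K : nat, [/\ (0 < K)%N, (K <= B ^ #|Y|)%N & exists z : int, K%:R * \sum_y x y = z%:~R].
Proof.
move=> /choice[K KP]; exists (\prod_y K y)%N; split.
- by apply: prodn_gt0 => y; have [] := KP y.
- rewrite -prod_nat_const; apply: leq_prod => y _; by have [] := KP y.
have /choice[z zP] : forall y, exists z : int, (K y)%:R * x y = z%:~R by move=> y; have [] := KP y.
exists (\sum_y (Posz (\prod_(y' | y' != y) K y')%N * z y)).
rewrite mulr_sumr rmorph_sum; apply: eq_bigr => y _.
by rewrite (bigD1 y) //= natrM intrM -zP; ring.
Qed.

(** * The value of an instance as a sum of stopping problems *)

Section Values.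
Variables (R : realType) (M : mdp) (m n : nat).
Variables (init : 'I_m -> state M) (sched : 'I_m -> 'I_n) (target : 'I_m -> {set state M}).
Implicit Types (C D U : {set state M}) (s t : state M) (k : 'I_n) (w : 'I_m -> int).

Definition pr (sigma : 'I_n -> scheduler R M) (i : 'I_m) : R :=
  fine (Pr (sigma (sched i)) (init i) (infinitely_often (target i))).
Definition value w sigma := \sum_i (w i)%:~R * pr sigma i.

Definition hits C i := (C :&: target i)%SET != finset.set0.
Definition gval w k s C : rat :=
  \sum_(i | hits C i) (if (sched i == k) && (init i == s) then (w i)%:~R else 0).

(* Only the sets of [F] need to be avoided: an end component can be enlarged,
   avoiding some [U], without changing the targets of a group that it hits. *)
Definition dominating (F : seq {set state M}) := forall k s D, is_ec D ->
  exists2 U, U \in F & [disjoint D & U] /\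
    forall E, is_ec E -> D \subset E -> [disjoint E & U] ->
    forall i, sched i = k -> init i = s -> hits E i = hits D i.

Variable F : seq {set state M}.
Hypothesis F0 : finset.set0 \in F.
Hypothesis domF : dominating F.
Variable w : 'I_m -> int.

Definition cands k s t := [seq gval w k s (ecof U t) | U <- F & t \in ecof U t].
Definition reward k s t : option rat :=
  if cands k s t is c :: cs then Some (foldr Num.max c cs) else None.

Lemma foldr_max (c : rat) cs : foldr Num.max c cs \in c :: cs /\
  forall d, d \in c :: cs -> d <= foldr Num.max c cs.
Proof.
elim: cs => [|a cs [IH1 IH2]] /=; first by split=> [|d]; rewrite ?mem_head // inE => /eqP ->.
split=> [|d].
  case: (leP a (foldr Num.max c cs)) => _; last by rewrite !inE eqxx orbT.
  by move: IH1; rewrite !inE => /orP[->|->]; rewrite ?orbT.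
rewrite le_max !inE => /or3P[/eqP ->|/eqP ->|dc].
- by rewrite IH2 ?mem_head // orbT.
- by rewrite lexx.
- by rewrite (IH2 d) ?orbT // inE dc orbT.
Qed.

Lemma rewardP k s t c : reward k s t = Some c -> c \in cands k s t /\
  forall d, d \in cands k s t -> d <= c.
Proof. by rewrite /reward; case: (cands k s t) => // a cs [<-]; exact: foldr_max. Qed.

Lemma reward_cand k s t d : d \in cands k s t -> exists2 c, reward k s t = Some c & d <= c.
Proof.
rewrite /reward; case: (cands k s t) => // a cs dc; eexists; first by [].
by have [_] := foldr_max a cs; apply.
Qed.

Notation en := (fun t a => a \in enabled (M := M) t).
Notation okk k s := (okp (@trans M) en (reward k s)).
Notation sv k s := (stopval (@trans M) (reward k s)).

Lemma trans_ge0 (t : state M) a u : 0 <= trans t a u.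
Proof. by have /andP[] := trans_itv t a u. Qed.

Lemma trans_sum (t : state M) a : a \in enabled t -> \sum_u trans t a u = 1.
Proof. by rewrite inE => /eqP. Qed.

Lemma cand_ex k s t U : U \in F -> t \in ecof U t -> gval w k s (ecof U t) \in cands k s t.
Proof. by move=> UF tE; apply/mapP; exists U; rewrite // mem_filter tE. Qed.

Lemma best_exists : exists bp : 'I_n * state M -> {ffun state M -> option (action M)},
  forall ks, [/\ okk ks.1 ks.2 (bp ks),
   forall t c, c \in cands ks.1 ks.2 t -> c <= sv ks.1 ks.2 (bp ks) t &
   forall t a, a \in enabled t ->
     \sum_u trans t a u * sv ks.1 ks.2 (bp ks) u <= sv ks.1 ks.2 (bp ks) t].
Proof.
have H (ks : 'I_n * state M) : exists pi, [/\ okk ks.1 ks.2 pi,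
   forall t c, c \in cands ks.1 ks.2 t -> c <= sv ks.1 ks.2 pi t &
   forall t a, a \in enabled t ->
     \sum_u trans t a u * sv ks.1 ks.2 pi u <= sv ks.1 ks.2 pi t]; last first.
  by have [f fP] := choice H; exists f.
case: ks => k s /=.
have ex : exists pi, okk k s pi.
  apply: okp_exists => t.
  have [u tu [C Cec uC]] := reaches_ec t; exists u => //.
  have : u \in ecof finset.set0 u.
    apply: (fintype.subsetP (ecof_max Cec uC _)) => //.
    by rewrite -finset.setI_eq0 finset.setI0.
  by move=> /(cand_ex k s F0) /reward_cand[c ->].
have [pi [ok H1 H2]] := best_policy trans_ge0 trans_sum ex; exists pi; split=> // t c.
by move=> /reward_cand[d /H1 dv cd]; exact: le_trans cd dv.
Qed.

Definition bp := projT1 (cid best_exists).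
Lemma bpP : forall ks, [/\ okk ks.1 ks.2 (bp ks),
   forall t c, c \in cands ks.1 ks.2 t -> c <= sv ks.1 ks.2 (bp ks) t &
   forall t a, a \in enabled t ->
     \sum_u trans t a u * sv ks.1 ks.2 (bp ks) u <= sv ks.1 ks.2 (bp ks) t].
Proof. exact: (projT2 (cid best_exists)). Qed.

Definition best ks := sv ks.1 ks.2 (bp ks).
Definition vmax := \sum_ks best ks ks.2.

Lemma value_split sigma : value w sigma = \sum_(ks : 'I_n * state M)
  \sum_C ratr (gval w ks.1 ks.2 C) * mu (Pr (sigma ks.1) ks.2) [set p | Inf p = C]%classic.
Proof.
rewrite /value /gval.
under [RHS]eq_bigr => ks _ do rewrite -(sum_io (sigma ks.1) ks.2
  (fun i => if (sched i == ks.1) && (init i == ks.2) then (w i)%:~R else 0) target).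
rewrite exchange_big; apply: eq_bigr => i _; rewrite (bigD1 (sched i, init i)) //= !eqxx /=.
rewrite ratr_int big1 ?addr0 // => -[k s] /= ne; case: ifP => [/andP[/eqP e1 /eqP e2]|].
  by rewrite e1 e2 eqxx in ne.
by rewrite rmorph0 mul0r.
Qed.

(** [D] is enlarged to the maximal component that avoids the set [U] given by [dominating]; this
    does not change the targets of the group that are hit. *)
Lemma gval_dom k s D t : is_ec D -> t \in D -> gval w k s D <= best (k, s) t.
Proof.
move=> Dec tD; have [U UF [dis H]] := domF k s Dec.
have DE := ecof_max Dec tD dis; have tE := fintype.subsetP DE t tD.
have [_ + _] := bpP (k, s); move=> /(_ t _ (cand_ex k s UF tE)); apply: le_trans => /=.
rewrite /gval big_mkcond [leRHS]big_mkcond; apply: ler_sum => i _.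
case: (boolP ((sched i == k) && (init i == s))) => [/andP[/eqP e1 /eqP e2]|]; last by rewrite !if_same.
rewrite (H (ecof U t)) ?ecof_ec //.
by rewrite finset.disjoints_subset; apply/fintype.subsetP => u /ecof_avoid; rewrite inE.
Qed.

Lemma value_le_vmax sigma : value w sigma <= ratr vmax.
Proof.
rewrite value_split rmorph_sum; apply: ler_sum => -[k s] _ /=.
apply: (@value_upper _ _ _ _ (best (k, s))) => [t a|C t]; last exact: gval_dom.
by have [_ _] := bpP (k, s); apply.
Qed.

(** One scheduler per variable serves all initial states at once, since its plan reads the initial
    state off the history. *)
Lemma vmax_attained : exists sigma, value w sigma = ratr vmax.
Proof.
have ex (x : ('I_n * state M) * state M) : exists D, reward x.1.1 x.1.2 x.2 != None ->
   [/\ is_ec D, x.2 \in D & odflt 0 (reward x.1.1 x.1.2 x.2) <= gval w x.1.1 x.1.2 D].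
  case: x => -[k s] t /=; case E: (reward k s t) => [c|]; last by exists finset.set0.
  have [/mapP[U + cE] _] := rewardP E; rewrite mem_filter => /andP[tE UF].
  by exists (ecof U t) => _; split; rewrite ?ecof_ec // cE.
have [D DP] := choice ex.
exists (fun k => opt R (fun s t => bp (k, s) t) (fun s t => D ((k, s), t))).
apply/eqP; rewrite eq_le value_le_vmax /= value_split rmorph_sum; apply: ler_sum => -[k s] _ /=.
have [ok _ _] := bpP (k, s); have /andP[/forallP vl /forallP prp] := ok.
apply: (@opt_value R M _ _ s (best (k, s)) (gval w k s)) => [t b E|t|z E|t b E].
- by have := vl t; rewrite E.
- by have /existsP[y /andP[ty /eqP yN]] := prp t; exists y.
- have [|h1 h2 h3] := DP ((k, s), z); first by have := vl z; rewrite E.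
  by split=> //; rewrite /best (stopvalE trans_ge0 trans_sum z ok) E.
- by rewrite /best {1}(stopvalE trans_ge0 trans_sum t ok) E.
Qed.

Variable Den : nat.
Hypothesis Den_gt0 : (0 < Den)%N.
Hypothesis trans_int : forall (s : state M) a t, exists z : int, Den%:R * trans s a t = z%:~R.

Lemma gval_int k s C : exists z : int, gval w k s C = z%:~R.
Proof.
exists (\sum_(i | hits C i) (if (sched i == k) && (init i == s) then w i else 0)).
by rewrite rmorph_sum; apply: eq_bigr => i _; case: ifP.
Qed.

Lemma reward_int k s t c : reward k s t = Some c -> exists z : int, c = z%:~R.
Proof. by move=> /rewardP[/mapP[U _ ->] _]; exact: gval_int. Qed.

Lemma vmax_int : exists K : nat, [/\ (0 < K)%N,
  (K <= (Kbd (state M) Den) ^ (n * #|state M|))%N & exists z : int, K%:R * vmax = z%:~R].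
Proof.
rewrite -[X in (X * _)%N]card_ord -card_prod; apply: common_denominator => -[k s] /=.
have [ok _ _] := bpP (k, s).
have bint x : exists z : int,
    (if bp (k, s) x is None then odflt 0 (reward k s x) else 0) = z%:~R :> rat.
  case: (bp (k, s) x) => [_|]; first by exists 0.
  by case E: (reward k s x) => [c|]; [exact: reward_int E|exists 0].
have [K [K0 KB KZ _]] := cramer trans_ge0 trans_sum Den_gt0 trans_int ok bint.
by exists K; split=> //; exact: KZ.
Qed.

(** The bound of [cramer] for expected stopping times, where the accumulated cost per step is 1. *)
Definition tbound := (#|state M| * Kbd (state M) Den * Den)%N.

(** Each of the [n * #|state M|] groups loses at most [d] times its expected stopping time plus
    one. *)
Lemma best_relax (v : 'I_n * state M -> state M -> rat) d : 0 <= d ->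
  (forall ks t a, a \in enabled t -> \sum_u trans t a u * v ks u - d <= v ks t) ->
  (forall ks t c, c \in cands ks.1 ks.2 t -> c - d <= v ks t) ->
  vmax <= \sum_ks v ks ks.2 + (n * #|state M|)%:R * (d * (tbound%:R + 1)).
Proof.
move=> d0 H1 H2.
rewrite -[X in (X * _)%N]card_ord -card_prod mulr_natl -sumr_const -big_split.
apply: ler_sum => -[k s] _; have [ok _ _] := bpP (k, s).
apply: le_trans (stopval_relax trans_ge0 trans_sum s ok d0 (H1 (k, s)) _) _ => [t c|].
  by move=> /rewardP[/H2].
rewrite lerD2l ler_wpM2l // lerD2r.
have bint x : exists z : int, (if bp (k, s) x is None then 0 else 1) = z%:~R :> rat.
  by case: (bp (k, s) x) => [_|]; [exists 1|exists 0].
have [K [_ _ _ /(_ s) H]] := cramer trans_ge0 trans_sum Den_gt0 trans_int ok bint.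
apply: le_trans (ler_norm _) (H _) => x; case: (bp (k, s) x) => [_|]; by rewrite ?normr1 ?normr0.
Qed.

Lemma gval_bound k s C : `|gval w k s C| <= (\sum_i `|w i|)%:R.
Proof.
rewrite /gval big_mkcond; apply: le_trans (ler_norm_sum _ _ _) _.
rewrite natr_sum; apply: ler_sum => i _; case: ifP => _; last by rewrite normr0.
by case: ifP => _; rewrite ?normr0 // -intr_norm -abszE -pmulrn.
Qed.

(** The value is an average of rewards; formally, the maximum principle is applied to [best - W] and
    to [- W - best]. *)
Lemma best_bound ks t : `|best ks t| <= (\sum_i `|w i|)%:R.
Proof.
case: ks => k s; have [ok _ _] := bpP (k, s); set W : rat := _%:R.
have rb x : `|odflt 0 (reward k s x)| <= W.
  case E: (reward k s x) => [c|] /=; last by rewrite normr0 ler0n.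
  by have [/mapP[U _ ->] _] := rewardP E; exact: gval_bound.
have /andP[/forallP vl _] := ok.
have cst x a (f : state M -> rat) c : bp (k, s) x = Some a ->
    \sum_y trans x a y * (c + f y) = c + \sum_y trans x a y * f y.
  move=> E; under eq_bigr do rewrite mulrDr; rewrite big_split -mulr_suml trans_sum ?mul1r //.
  by have := vl x; rewrite E.
rewrite ler_norml -[X in X && _]subr_le0 -[X in _ && X]subr_le0; apply/andP; split.
  apply: (max_principle trans_ge0 trans_sum (w := fun x => - W - best (k, s) x) ok) => x.
  rewrite /best /= (stopvalE trans_ge0 trans_sum x ok); case E: (bp (k, s) x) => [a|].
    by rewrite (cst _ _ (fun y => - sv k s (bp (k, s)) y) _ E) lerD2l -sumrN; apply: ler_sum => y _; rewrite mulrN.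
  by rewrite subr_le0; have := rb x; rewrite ler_norml => /andP[].
apply: (max_principle trans_ge0 trans_sum (w := fun x => best (k, s) x - W) ok) => x.
rewrite /best /= (stopvalE trans_ge0 trans_sum x ok); case E: (bp (k, s) x) => [a|].
  under [leRHS]eq_bigr do rewrite addrC; by rewrite cst // addrC.
by rewrite subr_le0; have := rb x; rewrite ler_norml => /andP[].
Qed.

End Values.

(** * Correctness of the threshold tests *)

Section Ranks.
Variable T : finType.

Definition rk (x : T) : nat := enum_rank x.

Lemma rk_inj : injective rk.
Proof. by move=> x y /ord_inj /enum_rank_inj. Qed.

Lemma rk_lt x : (rk x < #|T|)%N. Proof. exact: ltn_ord. Qed.

Lemma iota_rk : iota 0 #|T| = [seq rk x | x <- enum T].
Proof.
apply: (@eq_from_nth _ 0%N) => [|i]; rewrite size_iota; first by rewrite size_map cardE.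
move=> iT.
rewrite nth_iota // add0n.
have [x0 _] : exists x0 : T, true by move: iT; case: (pickP T) => [x0 _|/eq_card0 ->]; [exists x0|].
have iE : (i < size (enum T))%N by rewrite -cardE.
rewrite (nth_map x0) //; apply/eqP.
by rewrite -(nth_uniq x0 iE _ (enum_uniq T)) ?nth_enum_rank // -cardE rk_lt.
Qed.

Lemma map_rk (Y : Type) (f : nat -> Y) : [seq f i | i <- iota 0 #|T|] = [seq f (rk x) | x <- enum T].
Proof. by rewrite iota_rk -map_comp. Qed.

Lemma has_enum (f : pred T) : has f (enum T) = [exists x, f x].
Proof.
apply/hasP/existsP => [[x _ fx]|[x fx]]; exists x => //; by rewrite mem_enum.
Qed.

Lemma all_enum (f : pred T) : all f (enum T) = [forall x, f x].
Proof.
apply/allP/forallP => [H x|H x _] //; apply: H; by rewrite mem_enum.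
Qed.

Lemma has_rk f : has f (iota 0 #|T|) = [exists x, f (rk x)].
Proof. by rewrite iota_rk has_map has_enum. Qed.

Lemma all_rk f : all f (iota 0 #|T|) = [forall x, f (rk x)].
Proof. by rewrite iota_rk all_map all_enum. Qed.

Lemma nth_rk (Y : Type) (d : Y) (f : T -> Y) x : nth d [seq f y | y <- enum T] (rk x) = f x.
Proof. by rewrite (nth_map x) ?nth_enum_rank // -cardE rk_lt. Qed.

Definition mask (C : {set T}) : seq bool := [seq x \in C | x <- enum T].

Lemma size_mask C : size (mask C) = #|T|.
Proof. by rewrite size_map cardE. Qed.

Lemma nth_mask (C : {set T}) x : nth false (mask C) (rk x) = (x \in C).
Proof. exact: nth_rk. Qed.

Lemma maskE (f : nat -> bool) (C : {set T}) : (forall x, f (rk x) = (x \in C)) ->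
  [seq f i | i <- iota 0 #|T|] = mask C.
Proof. by move=> H; rewrite map_rk; apply: eq_map. Qed.

Definition rel_mask (e : rel T) := [seq [seq e t u | u <- enum T] | t <- enum T].

Lemma size_rel_mask e : size (rel_mask e) = #|T|.
Proof. by rewrite size_map cardE. Qed.

Lemma foldl_iter (A B : Type) (g : A -> A) z (l : seq B) :
  foldl (fun a _ => g a) z l = iter (size l) g z.
Proof. by elim: l z => //= b l IH z; rewrite IH -iterSr. Qed.

Lemma rstepE e A : rstep (rel_mask e) (mask A) = mask (reach_step e A).
Proof.
rewrite /rstep size_rel_mask; apply: maskE => u; rewrite inE nth_mask has_rk; congr (_ || _).
by apply: eq_existsb => t; rewrite nth_mask nth_rk nth_rk.
Qed.

Lemma reachbE e x : reachb (rel_mask e) (rk x) = mask (reach e x).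
Proof.
rewrite /reachb foldl_iter size_rel_mask /reach (maskE (C := [set x]%SET)); last first.
  by move=> u; rewrite inE (inj_eq rk_inj).
by elim: #|T| => //= k ->; rewrite rstepE.
Qed.

End Ranks.

Lemma size_fuel (G : imat) B : size (fuel G B) = (size G * size (bits B)).+1.
Proof.
by rewrite /fuel /=; congr _.+1; elim: G => //= r G IH; rewrite size_cat size_map IH mulSn.
Qed.

(** * The list algorithm computes the mathematical objects *)

Section Instance.
Variables (M : mdp) (m n : nat).
Variables (init : 'I_m -> state M) (sched : 'I_m -> 'I_n) (target : 'I_m -> {set state M}).
Implicit Types (C D U : {set state M}) (s t : state M) (k : 'I_n) (w : 'I_m -> int).
Variables (Den : nat) (zP : state M -> action M -> state M -> int).
Hypothesis Den_gt0 : (0 < Den)%N.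
Hypothesis zPE : forall s a t, (zP s a t)%:~R = Den%:R * trans s a t.
Let S := #|state M|.

Definition rowz s a := [seq zP s a t | t <- enum (state M)].
Definition trz := [seq [seq rowz s a | a <- enum (action M)] | s <- enum (state M)].
Definition itemz w := [seq (w i, (rk (init i), (nat_of_ord (sched i), mask (target i)))) | i <- enum 'I_m].

Lemma size_trz : size trz = S. Proof. by rewrite size_map /S cardE. Qed.

Lemma zP_eq0 s a t : (zP s a t == 0) = ~~ (0 < trans s a t).
Proof.
rewrite lt_def trans_ge0 andbT negbK -(eqr_int rat) zPE mulf_eq0 pnatr_eq0.
by rewrite -[Den == 0%N]negbK -lt0n Den_gt0.
Qed.

Lemma enabledE s a : has (fun z => z != 0) (rowz s a) = (a \in enabled s).
Proof.
rewrite has_map has_enum inE; apply/existsP/eqP => [[t /=]|E].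
  rewrite zP_eq0 negbK => p; case: (pselect (\sum_t trans s a t = 1)) => // /trans_disabled.
  by move=> /psumr_eq0P -/(_ (fun u _ => trans_ge0 s a u) t isT) E; rewrite E ltxx in p.
apply: contrapT => /forallNP H; have := oner_neq0 rat; rewrite -E big1 ?eqxx // => t _.
by apply/eqP; apply: contraT => ne; case: (H t); rewrite /= zP_eq0 negbK lt_def trans_ge0 ne.
Qed.

Lemma staybE C s a : stayb (rowz s a) (mask C) = stays C s a.
Proof.
rewrite /stayb enabledE /stays size_map -cardE all_rk; congr (_ && _); apply: eq_forallb => t.
by rewrite nth_rk nth_mask zP_eq0 -implybE.
Qed.

Lemma nth_trz s : nth [::] trz (rk s) = [seq rowz s a | a <- enum (action M)].
Proof. exact: nth_rk. Qed.

Lemma edgesE C : edges trz (mask C) = rel_mask (ecgraph C).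
Proof.
rewrite /edges size_trz map_rk; apply: eq_map => t; rewrite map_rk; apply: eq_map => u.
rewrite nth_mask nth_trz /edgeb has_map has_enum; congr (_ && _); apply: eq_existsb => a /=.
by rewrite staybE nth_rk zP_eq0 negbK.
Qed.

Lemma ecstepbE s C : ecstepb trz (rk s) (mask C) (edges trz (mask C)) = mask (ecstep s C).
Proof.
rewrite edgesE /ecstepb size_trz; apply: maskE => t; rewrite !reachbE !nth_mask nth_trz inE.
rewrite /actsb has_map has_enum; congr [&& _, _, _ & _].
by apply: eq_existsb => a; rewrite /= staybE.
Qed.

Lemma ecofbE U s : ecofb trz (mask U) (rk s) = mask (ecof U s).
Proof.
rewrite /ecofb (foldl_iter (fun C : bmask => ecstepb trz (rk s) C (edges trz C))) size_trz /ecof.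
rewrite (maskE (C := (~: U)%SET)); last by move=> t; rewrite nth_mask inE.
by rewrite /S; elim: #|state M| => //= k ->; rewrite ecstepbE.
Qed.

Fixpoint unions c : seq {set state M} := if c is c'.+1 then unions c' ++
  flatten [seq [seq (U :|: target i)%SET | i <- enum 'I_m] | U <- unions c'] else [:: finset.set0].

Lemma familyE c w : family c trz (itemz w) = [seq mask U | U <- unions c].
Proof.
elim: c => [|c IH] /=.
  by rewrite size_trz (maskE (C := finset.set0)) // => x; rewrite inE.
rewrite IH map_cat map_flatten -!map_comp; congr (_ ++ flatten _); apply: eq_map => U /=.
rewrite -!map_comp; apply: eq_map => i /=; rewrite /orb_mask size_trz; apply: maskE => x.
by rewrite !nth_mask inE.
Qed.

Lemma unions0 c : finset.set0 \in unions c.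
Proof. by elim: c => [|c IH] /=; rewrite ?mem_head // mem_cat IH. Qed.

Lemma valbE w k s C : (valb (itemz w) k (rk s) (mask C))%:~R = gval init sched target w k s C.
Proof.
rewrite /valb /gval big_map big_enum rmorph_sum [RHS]big_mkcond; apply: eq_bigr => i _ /=.
rewrite (inj_eq val_inj) (inj_eq (@rk_inj _)) size_mask has_rk /hits.
have -> : [exists x : state M, nth false (mask C) (rk x) && nth false (mask (target i)) (rk x)] =
   ((C :&: target i)%SET != finset.set0).
  apply/existsP/set0Pn => -[x]; rewrite ?inE ?nth_mask => xC; exists x; by rewrite ?inE ?nth_mask.
by case: (sched i == k); case: (init i == s); case: (_ != finset.set0).
Qed.

Lemma wsumE w : wsum (itemz w) = (\sum_i `|w i|)%N.
Proof.
rewrite /wsum big_map big_enum /=; have -> : \sum_i Posz `|w i| = Posz (\sum_i `|w i|)%N :> int.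
  by elim/big_rec2: _ => // i a b _ ->.
by [].
Qed.

Lemma kbdE : kbd (iota 0 S) Den = Kbd (state M) Den.
Proof.
rewrite /kbd /Kbd big_split big_const_seq count_predT size_iota iter_muln_1; congr (_ * _)%N.
by rewrite fact_prod big_add1 /= /index_iota subn0.
Qed.

Lemma kallE : kall (iota 0 n) (iota 0 S) Den = (Kbd (state M) Den ^ (n * S))%N.
Proof.
rewrite /kall kbdE !big_const_seq !count_predT !size_iota !iter_muln_1.
by rewrite -expnM mulnC.
Qed.

Definition vx (ks : 'I_n * state M) t : var := (nat_of_ord ks.1, (rk ks.2, rk t)).
Definition vars := lpvars (iota 0 n) (iota 0 S).

Lemma sum_vars (K : nmodType) (f : var -> K) :
  \sum_(x <- vars) f x = \sum_ks \sum_t f (vx ks t).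
Proof.
rewrite /vars /lpvars big_flatten big_map -val_enum_ord big_map big_enum /=.
rewrite -(pair_bigA _ (fun k s => \sum_t f (vx (k, s) t))) /=; apply: eq_bigr => k _.
rewrite big_flatten big_map /S iota_rk big_map big_enum /=; apply: eq_bigr => s _.
by rewrite big_map big_map big_enum.
Qed.

Lemma uniq_flatten_map (A : eqType) (B : eqType) (f : A -> seq B) (g : B -> A) (l : seq A) :
  uniq l -> (forall a, uniq (f a)) -> (forall a b, b \in f a -> g b = a) ->
  uniq (flatten [seq f a | a <- l]).
Proof.
move=> ul uf gf; elim: l ul => //= a l IH /andP[al ul]; rewrite cat_uniq uf IH //= andbT.
apply/hasPn => b /flatten_mapP[a' a'l /gf e]; apply/negP => /gf e'.
by move: al; rewrite -e' e a'l.
Qed.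

Lemma uniq_vars : uniq vars.
Proof.
apply: (uniq_flatten_map (g := fst)) => [|k|k b]; first exact: iota_uniq.
  apply: (uniq_flatten_map (g := fun b => b.2.1)) => [|s|s b]; first exact: iota_uniq.
    by rewrite map_inj_uniq ?iota_uniq // => x y [].
  by move=> /mapP[t _ ->].
by move=> /flatten_mapP[s _ /mapP[t _ ->]].
Qed.

Lemma vars_vx ks t : vx ks t \in vars.
Proof.
case: ks => k s; apply/flatten_mapP; exists (nat_of_ord k); first by rewrite mem_iota /=.
apply/flatten_mapP; exists (rk s); first by rewrite mem_iota /= rk_lt.
by apply/mapP; exists (rk t) => //; rewrite mem_iota /= rk_lt.
Qed.

Lemma varsP x : x \in vars -> exists ks t, x = vx ks t.
Proof.
move=> /flatten_mapP[k]; rewrite mem_iota add0n /= => kn /flatten_mapP[s + /mapP[t + ->]].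
rewrite /S !iota_rk => /mapP[s' _ ->] /mapP[t' _ ->].
by exists (Ordinal kn, s'), t'.
Qed.

Lemma vx_inj ks ks' t t' : vx ks t = vx ks' t' -> ks = ks' /\ t = t'.
Proof.
case: ks ks' => k s [k' s'] [/ord_inj -> e1 e2].
by rewrite (rk_inj e1) (rk_inj e2).
Qed.

Lemma sum_group (K : nmodType) (ks : 'I_n * state M) (f : var -> K) :
  \sum_(x <- vars) (if (x.1 == ks.1) && (x.2.1 == rk ks.2) then f x else 0) = \sum_t f (vx ks t).
Proof.
rewrite sum_vars (bigD1 ks) //= [X in _ + X]big1 ?addr0.
  by apply: eq_bigr => t _; rewrite !eqxx.
move=> ks' ne; rewrite big1 // => t _; case: ifP => // /andP[/eqP e1 /eqP e2].
by move: ne; rewrite (surjective_pairing ks) (surjective_pairing ks') (ord_inj e1) (rk_inj e2) eqxx.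
Qed.

Lemma sum_single (K : nmodType) (ks : 'I_n * state M) t (f : var -> K) :
  \sum_(x <- vars) (if (x.1 == ks.1) && ((x.2.1 == rk ks.2) && (x.2.2 == rk t)) then f x else 0)
  = f (vx ks t).
Proof.
transitivity (\sum_(x <- vars) (if (x.1 == ks.1) && (x.2.1 == rk ks.2) then
    (if x.2.2 == rk t then f x else 0) else 0)).
  by apply: eq_bigr => x _; rewrite andbA; case: (_ && (_ == rk ks.2)).
rewrite (sum_group ks (fun x => if x.2.2 == rk t then f x else 0)) (bigD1 t) //= eqxx.
rewrite big1 ?addr0 // => u ut; case: eqP => // /rk_inj e; by rewrite e eqxx in ut.
Qed.

Section Test.
Variables (w : 'I_m -> int) (F : seq {set state M}) (F0 : finset.set0 \in F) (theta : int).
Notation items := (itemz w).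
Notation fam := [seq mask U | U <- F].
Notation vmx := (vmax init sched target F0 w).
Notation bst := (best init sched target F0 w).
Let W := (\sum_i `|w i|)%N.
Let beta := betab (iota 0 n) (iota 0 S) Den W.
Let G := lpmx vars beta Den trz items fam theta.
Let B := boundb (iota 0 n) (iota 0 S) Den W beta theta.
Let b : rat := beta%:R.
Let K0 := (Kbd (state M) Den ^ (n * S))%N.

Lemma rows_atE ks t : rows_at vars beta Den trz items fam (vx ks t) =
  row_var vars beta (vx ks t) ::
   ([seq row_step vars beta Den (vx ks t) (rowz t a) | a <- enum (action M) & a \in enabled t] ++
    [seq row_stop vars beta (vx ks t) (valb items ks.1 (rk ks.2) (mask (ecof U t))) |
      U <- F & t \in ecof U t]).
Proof.
rewrite /rows_at /= nth_trz; congr (_ :: (_ ++ _)).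
  by rewrite filter_map -map_comp; congr map; apply: eq_filter => a /=; rewrite enabledE.
have -> : [seq ecofb trz x (rk t) | x <- fam] = [seq mask (ecof U t) | U <- F].
  by rewrite -map_comp; apply: eq_map => U /=; rewrite ecofbE.
rewrite filter_map -map_comp; congr map; apply: eq_filter => U /=; by rewrite nth_mask.
Qed.

Lemma GP row : row \in G -> [\/ row = row_pos vars, row = row_obj vars beta theta |
  exists ks t, [\/ row = row_var vars beta (vx ks t),
    exists2 a, a \in enabled t & row = row_step vars beta Den (vx ks t) (rowz t a) |
    exists2 U, (U \in F) && (t \in ecof U t) &
      row = row_stop vars beta (vx ks t) (valb items ks.1 (rk ks.2) (mask (ecof U t)))]].
Proof.
rewrite !inE => /or3P[/eqP ->|/eqP ->|H]; [by constructor 1|by constructor 2|constructor 3].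
move: H => /flatten_mapP[x /varsP[ks [t ->]]]; rewrite rows_atE inE mem_cat.
move=> H; exists ks, t; move: H => /or3P[/eqP ->|/mapP[a]|/mapP[U]]; first by constructor 1.
  by rewrite mem_filter => /andP[ea _] ->; constructor 2; exists a.
by rewrite mem_filter andbC => h ->; constructor 3; exists U.
Qed.

Lemma G_at row ks t : row \in rows_at vars beta Den trz items fam (vx ks t) -> row \in G.
Proof.
move=> h; rewrite /G /lpmx !inE; apply/orP; right; apply/orP; right.
by apply/flatten_mapP; exists (vx ks t) => //; exact: vars_vx.
Qed.

Lemma G_var ks t : row_var vars beta (vx ks t) \in G.
Proof. by apply: (@G_at _ ks t); rewrite rows_atE mem_head. Qed.

Lemma G_step ks t a : a \in enabled t -> row_step vars beta Den (vx ks t) (rowz t a) \in G.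
Proof.
move=> ea; apply: (@G_at _ ks t); rewrite rows_atE inE mem_cat; apply/orP; right; apply/orP; left.
by apply/mapP; exists a; rewrite // mem_filter ea mem_enum.
Qed.

Lemma G_stop ks t U : U \in F -> t \in ecof U t ->
  row_stop vars beta (vx ks t) (valb items ks.1 (rk ks.2) (mask (ecof U t))) \in G.
Proof.
move=> UF tE; apply: (@G_at _ ks t); rewrite rows_atE inE mem_cat; apply/orP; right; apply/orP; right.
by apply/mapP; exists U; rewrite // mem_filter tE.
Qed.

Lemma G_size row : row \in G -> size row = (size vars).+1.
Proof.
move=> /GP[->|->|[ks [t [->|[a _ ->]|[U _ ->]]]]]; exact: size_mkrow.
Qed.

Lemma dot_step (u : var -> rat) ks t a : \sum_(x <- vars)
   (if (x.1 == (vx ks t).1) && (x.2.1 == (vx ks t).2.1) then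
    Posz beta * ((if x.2.2 == (vx ks t).2.2 then Posz Den else 0) + - nth 0 (rowz t a) x.2.2)
     else 0)%:~R * u x =
  b * Den%:R * (u (vx ks t) - \sum_y trans t a y * u (vx ks y)).
Proof.
under eq_bigr => x _ do rewrite (fun_if intr) rmorph0 (fun_if (fun z => z * u x)) mul0r.
rewrite /= (sum_group ks (fun x => (Posz beta * ((if x.2.2 == rk t then Posz Den else 0) +
  - nth 0 (rowz t a) x.2.2))%:~R * u x)).
rewrite (eq_bigr (fun y => b * ((if y == t then Den%:R else 0) * u (vx ks y) -
  Den%:R * (trans t a y * u (vx ks y))))) => [|y _]; last first.
  rewrite /= /rowz nth_rk (inj_eq (@rk_inj _)) intrM intrD rmorphN /= zPE -pmulrn -/b.
  by case: (y == t); rewrite -?pmulrn ?rmorph0; ring.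
rewrite -mulr_sumr sumrB -[RHS]mulrA [Den%:R * (_ - _)]mulrBr [X in _ = _ * (_ - X)]mulr_sumr.
congr (_ * (_ - _)).
rewrite (bigD1 t) //= eqxx big1 ?addr0 // => y /negbTE ->; by rewrite mul0r.
Qed.

Lemma dot_single (u : var -> rat) (c : int) ks t : \sum_(x <- vars)
   (if (x.1 == (vx ks t).1) && ((x.2.1 == (vx ks t).2.1) && (x.2.2 == (vx ks t).2.2))
    then c else 0)%:~R * u x = c%:~R * u (vx ks t).
Proof.
under eq_bigr => x _ do rewrite (fun_if intr) rmorph0 (fun_if (fun z => z * u x)) mul0r.
by rewrite /= (sum_single ks t (fun x => c%:~R * u x)).
Qed.

Lemma dot_obj (u : var -> rat) : \sum_(x <- vars) (if x.2.1 == x.2.2 then - Posz beta else 0)%:~R * u x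
  = - (b * \sum_ks u (vx ks ks.2)).
Proof.
rewrite sum_vars mulr_sumr -sumrN; apply: eq_bigr => ks _; rewrite (bigD1 ks.2) //= eqxx.
rewrite big1 ?addr0; first by rewrite rmorphN mulNr.
move=> t ne; case: eqP => [/rk_inj e|]; last by rewrite rmorph0 mul0r.
by rewrite e eqxx in ne.
Qed.

Lemma Kbd_gt0 : (0 < Kbd (state M) Den)%N.
Proof. by rewrite /Kbd muln_gt0 fact_gt0 expn_gt0 muln_gt0 Den_gt0. Qed.

Lemma betaE : beta = (K0 * (1 + n * S * (tbound M Den + 1)) + W + 1)%N.
Proof. by rewrite /beta /betab !size_iota kallE kbdE. Qed.

Lemma beta_gt0 : 0 < b.
Proof. by rewrite ltr0n betaE addn1. Qed.

Lemma trans_int (s : state M) a t : exists z : int, Den%:R * trans s a t = z%:~R.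
Proof. by exists (zP s a t). Qed.

(** Dividing by the homogenising unknown gives a solution with every constraint relaxed by
    [1 / beta]. By the choice of [beta], the integer [K * vmax] is then less than [K * theta + 1],
    hence at most [K * theta]. *)
Lemma test_sound : lp_solve G (fuel G B) -> vmx <= theta%:~R.
Proof.
move=> /(lp_sound uniq_vars G_size)[v [t H]].
have {}H f c : mkrow vars f c \in G -> (0 : rat) < \sum_(x <- vars) (f x)%:~R * (v x)%:~R + c%:~R * t%:~R.
  move=> /H; rewrite -(ltr_int rat) rmorphD rmorph_sum rmorphM /=.
  by under eq_bigr do rewrite rmorphM.
set tq : rat := t%:~R in H.
have t0 : 0 < tq.
  have := H _ _ (_ : row_pos vars \in G); rewrite mem_head => /(_ isT).
  by rewrite big1 ?add0r ?mul1r // => x _; rewrite mul0r.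
have b0 := beta_gt0; have D0 : (0 : rat) < Den%:R by rewrite ltr0n.
pose v' ks u := (v (vx ks u))%:~R / tq.
have vE ks u : (v (vx ks u))%:~R = v' ks u * tq by rewrite /v' divfK // gt_eqF.
have hb x : 0 < tq * (b * x + 1) -> 0 < x + b^-1.
  rewrite pmulr_rgt0 // (_ : b * x + 1 = b * (x + b^-1)) ?pmulr_rgt0 //.
  by rewrite mulrDr divff // gt_eqF.
have H1 ks u a : a \in enabled u -> \sum_y trans u a y * v' ks y - b^-1 <= v' ks u.
  move=> /(G_step ks) /H; rewrite (dot_step (fun x => (v x)%:~R)) vE -pmulrn.
  have -> : \sum_y trans u a y * (v (vx ks y))%:~R = (\sum_y trans u a y * v' ks y) * tq.
    by rewrite mulr_suml; apply: eq_bigr => y _; rewrite vE mulrA.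
  set A := \sum_y _; rewrite (_ : _ + _ = Den%:R * (tq * (b * (v' ks u - A) + 1))); last by ring.
  rewrite pmulr_rgt0 // => /hb; lra.
have H2 ks u c : c \in cands init sched target F w ks.1 ks.2 u -> c - b^-1 <= v' ks u.
  move=> /mapP[U]; rewrite mem_filter => /andP[uE UF] ->.
  have := H _ _ (G_stop ks UF uE); rewrite (dot_single (fun x => (v x)%:~R)) vE.
  rewrite rmorphB rmorph1 rmorphM /= valbE -!pmulrn -/b; set c' := gval _ _ _ _ _ _ _.
  rewrite (_ : _ + _ = tq * (b * (v' ks u - c') + 1)); last by ring.
  by move=> /hb; lra.
have H3 : \sum_ks v' ks ks.2 < theta%:~R + b^-1.
  have := H _ _ (_ : row_obj vars beta theta \in G); rewrite !inE eqxx orbT => /(_ isT).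
  rewrite (dot_obj (fun x => (v x)%:~R)); under eq_bigr do rewrite vE.
  rewrite -mulr_suml intrD intrM /= -pmulrn -/b; set A := \sum_ks _.
  rewrite (_ : _ + _ = tq * (b * (theta%:~R - A) + 1)); last by ring.
  by move=> /hb; lra.
have bi0 : 0 <= b^-1 by rewrite invr_ge0 ltW.
have := best_relax F0 Den_gt0 trans_int bi0 H1 H2; rewrite -/S.
have [K [Kp KK [z zE]]] := vmax_int init sched target F0 w Den_gt0 trans_int.
move=> le; have K0p : (0 : rat) < K%:R by rewrite ltr0n.
have : z%:~R < (Posz K * theta)%:~R + 1 :> rat.
  rewrite -zE intrM -pmulrn; apply: (@lt_le_trans _ _ (K%:R * (theta%:~R + b^-1 + (n * S)%:R * (b^-1 * ((tbound M Den)%:R + 1))))).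
    by rewrite ltr_pM2l //; apply: le_lt_trans le _; rewrite ltrD2r.
  rewrite -addrA mulrDr lerD2l.
  rewrite (_ : b^-1 + _ = (1 + n * S * (tbound M Den + 1))%:R / b); last first.
    by generalize b => bb; rewrite natrD [(n * S * _)%:R]natrM natrD; ring.
  rewrite mulrA ler_pdivrMr // mul1r -natrM ler_nat betaE -addnA; apply: leq_trans (leq_addr _ _).
  by rewrite leq_mul2r KK orbT.
rewrite -[1]/(1%:~R) -intrD ltr_int ltzD1 -(ler_int rat) -zE intrM -pmulrn.
by rewrite ler_pM2l.
Qed.

(** The optimal values satisfy the constraints without relaxation, so every row is at least 1 at
    this point; the bounds on optimal values and weights keep it below [B]. *)
Lemma test_complete : vmx <= theta%:~R -> lp_solve G (fuel G B).
Proof.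
move=> le.
pose u (x : var) : rat := if [pick y : ('I_n * state M) * state M | vx y.1 y.2 == x] is Some y
  then bst y.1 y.2 else 0.
have uE ks t : u (vx ks t) = bst ks t.
  rewrite /u; case: pickP => [[ks' t'] /eqP /vx_inj[-> ->] //|/(_ (ks, t))].
  by rewrite eqxx.
have b0 := beta_gt0; have D1 : (1 : rat) <= Den%:R by rewrite ler1n.
have bW : W%:R + 1 <= b by rewrite /b natr1 ler_nat betaE; lia.
have ub ks t : - W%:R <= bst ks t <= W%:R by rewrite -ler_norml; exact: best_bound.
have W0 : (0 : rat) <= W%:R by rewrite ler0n.
have BE : B%:R = b * (2 * Den%:R * W%:R + 2 * W%:R + `|theta|%N%:R + (n * S)%:R * W%:R + 1)
    + W%:R + Den%:R + 1 :> rat.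
  by rewrite /B /boundb !size_iota /b; generalize beta => bb; rewrite !natrD !natrM; ring.
have th : theta%:~R <= `|theta|%N%:R :> rat.
  by rewrite pmulrn abszE ler_int ler_norm.
have B2 : B%:R <= 2 ^+ size (bits B) :> rat.
  by rewrite -natrX ler_nat ltnW // -{1}(bitsK B) bval_lt.
have nn1 : 0 <= b * (Den%:R * W%:R) by rewrite !mulr_ge0 // ltW.
have nn2 : 0 <= b * W%:R by rewrite mulr_ge0 // ltW.
have nn3 : 0 <= b * ((n * S)%:R * W%:R) by rewrite !mulr_ge0 // ltW.
have nn4 : 0 <= b * `|theta|%N%:R by rewrite mulr_ge0 // ltW.
apply: (lp_complete uniq_vars G_size (v := u) (L := size (bits B))).
- move=> x /varsP[ks [t ->]]; exists (Posz beta).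
  rewrite (_ : mkrow _ _ _ = row_var vars beta (vx ks t)) ?G_var //; congr rcons; apply: eq_map => y /=.
  by case: y => y1 [y2 y3]; rewrite /eq_op /=; case: (_ && _).
- exact: mem_head.
- move=> row /GP[->|->|[ks [t [->|[a ea ->]|[U /andP[UF tE] ->]]]]]; eexists; eexists; split=> //.
  + rewrite big1 ?add0r => [|x _]; last by rewrite mul0r.
    apply/andP; split=> //; apply: le_trans B2; rewrite BE; lra.
  + rewrite dot_obj; under eq_bigr do rewrite uE; rewrite -/vmx intrD intrM /=.
    have h1 : b * (theta%:~R - vmx) >= 0 by rewrite mulr_ge0 ?subr_ge0 // ltW.
    have h2 : - vmx <= (n * S)%:R * W%:R.
      rewrite -sumrN -[X in (X * _)%N]card_ord -card_prod mulr_natl -sumr_const.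
      by apply: ler_sum => ks _; have := ub ks ks.2; lra.
    have h3 : b * (theta%:~R - vmx) <= b * (`|theta|%N%:R + (n * S)%:R * W%:R).
      by rewrite ler_pM2l //; lra.
    rewrite -/b; apply/andP; split; first by lra.
    apply: le_trans B2; rewrite BE; lra.
  + rewrite dot_single uE -/b; have := ub ks t => h; apply/andP; split; first by rewrite -[Posz beta]/(beta%:Z) -pmulrn -/b; lra.
    apply: le_trans B2; rewrite BE -pmulrn -/b; lra.
  + rewrite dot_step uE; under eq_bigr do rewrite uE.
    have [_ _ /(_ t a ea)] := bpP init sched target F0 w ks; rewrite -/bst => sup.
    have lo : - W%:R <= \sum_y trans t a y * bst ks y.
      have -> : - W%:R = \sum_y trans t a y * - W%:R by rewrite -mulr_suml (trans_sum ea) mul1r.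
      apply: ler_sum => y _.
      by rewrite ler_wpM2l ?trans_ge0 //; case/andP: (ub ks y).
    have := ub ks t => h; set A := bst ks t - _.
    have A0 : 0 <= A by rewrite subr_ge0; exact: sup.
    have A1 : b * Den%:R * A <= b * Den%:R * (2 * W%:R).
      have bD : 0 < b * Den%:R by apply: mulr_gt0 => //; rewrite ltr0n.
      rewrite (ler_pM2l bD) mulr_natl mulr2n; case/andP: h => _ h2.
      by apply: lerD => //; rewrite lerNl.
    have A2 : 0 <= b * Den%:R * A by rewrite !mulr_ge0 // ltW.
    rewrite -pmulrn; apply/andP; split; first by lra.
    apply: le_trans B2; rewrite BE; lra.
  + rewrite dot_single uE rmorphB rmorph1 rmorphM /= valbE -!pmulrn -/b; set c := gval _ _ _ _ _ _ _.
    have cin : c \in cands init sched target F w ks.1 ks.2 t by exact: cand_ex.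
    have [_ /(_ t c cin) + _] := bpP init sched target F0 w ks; rewrite -/bst => cb.
    have := gval_bound init sched target w ks.1 ks.2 (ecof U t); rewrite -/c -/W ler_norml => hc.
    have := ub ks t => h.
    have A0 : 0 <= b * (bst ks t - c) by rewrite mulr_ge0 ?subr_ge0 // ltW.
    have A1 : b * (bst ks t - c) <= b * (2 * W%:R) by rewrite ler_pM2l //; lra.
    apply/andP; split; first by lra.
    apply: le_trans B2; rewrite BE; lra.
by rewrite size_fuel.
Qed.

Theorem gt_testP : gt_test trz Den items fam (iota 0 n) theta = (theta%:~R < vmx).
Proof.
rewrite /gt_test wsumE size_trz /gt_test1 size_trz /gt_test2 -/vars -/W -/beta -/G -/B.
rewrite ltNge; congr (~~ _); apply/idP/idP; [exact: test_sound|exact: test_complete].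
Qed.

End Test.

End Instance.

(** * Reducing the special cases to few avoided sets *)

Section Domination.
Variables (M : mdp) (m n : nat).
Variables (init : 'I_m -> state M) (sched : 'I_m -> 'I_n) (target : 'I_m -> {set state M}).

Lemma cover_unions c (A : {set {set state M}}) :
  A \subset [set target i | i : 'I_m]%SET -> (#|A| <= c)%N -> finset.cover A \in unions target c.
Proof.
elim: c A => [|c IH] A sA.
  by rewrite leqn0 cards_eq0 => /eqP ->; rewrite /finset.cover big_set0 mem_head.
case: (finset.set_0Vmem A) => [-> _|[T TA] cA]; first by rewrite /finset.cover big_set0 unions0.
have sub : (A :\ T)%SET \subset [set target i | i : 'I_m]%SET.
  by apply: fintype.subset_trans sA; exact: finset.subD1set.
have H : finset.cover (A :\ T)%SET \in unions target c.
  by apply: IH sub _; move: cA; rewrite (cardsD1 T) TA add1n ltnS.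
have /imsetP[i _ Ti] := fintype.subsetP sA T TA.
rewrite /= mem_cat; apply/orP; right; apply/flatten_mapP; exists (finset.cover (A :\ T)%SET) => //.
apply/mapP; exists i; first by rewrite mem_enum.
rewrite /finset.cover (big_setD1 T) //= Ti finset.setUC; congr (_ :|: _)%SET.
Qed.

(** The set to avoid is the union of all targets that [D] misses: a larger component avoiding it
    hits exactly the targets that [D] hits. *)
Lemma dominating_few c : (#|[set target i | i : 'I_m]%SET| <= c)%N ->
  dominating init sched target (unions target c).
Proof.
move=> cm k s D Dec; pose A := [set T in [set target i | i : 'I_m] | [disjoint D & T]]%SET.
have sA : A \subset [set target i | i : 'I_m]%SET.
  by apply/fintype.subsetP => T; rewrite inE => /andP[].
have missE E (T : {set state M}) : (E :&: T == finset.set0)%SET = [disjoint E & T] by exact: finset.setI_eq0.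
exists (finset.cover A); first by apply: (cover_unions sA); exact: leq_trans (subset_leq_card sA) cm.
split=> [|E Eec DE dis i _ _].
  rewrite -finset.setI_eq0 /finset.cover big_distrr /=; apply/eqP/big1 => T.
  by rewrite inE => /andP[_]; rewrite -missE => /eqP.
rewrite /hits !missE; congr (~~ _); apply/idP/idP => [|h].
  by apply: fintype.disjointWl.
have TA : target i \in A by rewrite inE h imset_f.
by apply: fintype.disjointWr dis; rewrite /finset.cover (bigD1 (target i)) //= finset.subsetUl.
Qed.

Lemma set0_unions1 : finset.set0 \in unions target 1. Proof. exact: unions0. Qed.

Lemma disjoint_set0 (D : {set state M}) : [disjoint D & finset.set0].
Proof. by rewrite -finset.setI_eq0 finset.setI0. Qed.

(** An absorbing state has no edge to another state, so connectedness leaves room for nothing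
    else. *)
Lemma ec_absorbing (E : {set state M}) s : is_ec E -> s \in E -> absorbing s -> E = [set s]%SET.
Proof.
move=> /is_ecP[_ _ con] sE ab; apply/setP => t; rewrite inE; apply/idP/eqP => [tE|-> //].
have /connectP[p + ->] := con s t sE tE; elim: p => //= u p IH.
move=> /andP[/andP[_ /existsP[a /andP[/andP[ea _] pu]]]].
suff -> : u = s by [].
apply/eqP; apply: contraT => us; have := trans_sum ea; rewrite (bigD1 s) //= ab // (bigD1 u) //=.
have ge0 : 0 <= \sum_(v | (v != s) && (v != u)) trans s a v.
  by apply: sumr_ge0 => v _; exact: trans_ge0.
move=> /eqP; rewrite -[eqbRHS]addr0 (inj_eq (addrI _)) paddr_eq0 ?(ltW pu) // => /andP[/eqP z _].
by rewrite z ltxx in pu.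
Qed.

(** A component that hits an absorbing target is a singleton, hence equal to its part [D]. Nothing
    has to be avoided. *)
Lemma dominating_absorbing : (forall i, absorbing_set (target i)) ->
  dominating init sched target (unions target 1).
Proof.
move=> ab k s D Dec; exists finset.set0; first exact: set0_unions1.
split=> [|E Eec DE _ i _ _]; first exact: disjoint_set0.
have [[t tD] _ _] := is_ecP _ Dec.
rewrite /hits; apply/idP/idP => /set0Pn[u]; rewrite inE => /andP[uE uT]; last first.
  by apply/set0Pn; exists u; rewrite inE uT (fintype.subsetP DE).
have EE := ec_absorbing Eec uE (ab i u uT).
have := fintype.subsetP DE t tD; rewrite EE inE => /eqP tu.
by apply/set0Pn; exists u; rewrite inE uT -tu tD.
Qed.

(** All targets of a group coincide. If [D] hits this target, so does every larger set; otherwise it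
    is the set to avoid. *)
Lemma dominating_same : (forall i i', sched i = sched i' -> init i = init i' -> target i = target i') ->
  dominating init sched target (unions target 1).
Proof.
move=> same k s D Dec.
case: (pickP (fun i => (sched i == k) && (init i == s))) => [i /andP[/eqP ik /eqP is_]|none].
  case: (boolP (hits target D i)) => [hD|].
    exists finset.set0; first exact: set0_unions1.
    split=> [|E _ DE _ j jk js]; first exact: disjoint_set0.
    rewrite /hits (same j i) ?jk ?js // -/(hits target E i) -/(hits target D i) hD.
    move: hD => /set0Pn[u]; rewrite inE => /andP[uD uT]; apply/set0Pn; exists u.
    by rewrite inE uT (fintype.subsetP DE).
  rewrite /hits negbK => /eqP mis; exists (target i).
    rewrite /= cats0 inE; apply/orP; right; apply/mapP; exists i; rewrite ?mem_enum //.
    by rewrite finset.set0U.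
  split=> [|E _ DE dis j jk js]; first by rewrite -finset.setI_eq0 mis.
  rewrite /hits (same j i) ?jk ?js // mis eqxx.
  by move: dis; rewrite -finset.setI_eq0 => /eqP ->; rewrite eqxx.
exists finset.set0; first exact: set0_unions1.
split=> [|E _ DE _ j jk js]; first exact: disjoint_set0.
by have := none j; rewrite jk js !eqxx.
Qed.

End Domination.

(** * From thresholds on the optimum to the four comparisons *)

Section Decision.
Variables (R : realType) (M : mdp) (m n : nat).
Variables (init : 'I_m -> state M) (sched : 'I_m -> 'I_n) (target : 'I_m -> {set state M}).
Variables (Den : nat) (zP : state M -> action M -> state M -> int).
Hypothesis Den_gt0 : (0 < Den)%N.
Hypothesis zPE : forall s a t, (zP s a t)%:~R = Den%:R * trans s a t.
Variables (F : seq {set state M}) (F0 : finset.set0 \in F).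
Hypothesis domF : dominating init sched target F.
Implicit Type w : 'I_m -> int.
Notation vmx := (vmax init sched target F0).
Notation val := (@value R M m n init sched target).

Lemma exists_gt w (x : rat) : (exists sigma, ratr x < val w sigma) <-> x < vmx w.
Proof.
split=> [[sg h]|h].
  by rewrite -(ltr_rat R); apply: lt_le_trans h _; exact: value_le_vmax.
by have [sg E] := vmax_attained R F0 domF w; exists sg; rewrite E ltr_rat.
Qed.

Lemma exists_ge w (x : rat) : (exists sigma, ratr x <= val w sigma) <-> x <= vmx w.
Proof.
split=> [[sg h]|h].
  by rewrite -(ler_rat R); apply: le_trans h _; exact: value_le_vmax.
by have [sg E] := vmax_attained R F0 domF w; exists sg; rewrite E ler_rat.
Qed.

Lemma value_scale (z : int) w sg : val (fun i => z * w i) sg = z%:~R * val w sg.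
Proof. by rewrite /value mulr_sumr; apply: eq_bigr => i _; rewrite intrM mulrA. Qed.

(** Argued through the semantics: both optima are attained by schedulers, and values scale
    linearly. *)
Lemma vmax_scale (z : nat) w : (0 < z)%N -> vmx (fun i => Posz z * w i) = z%:R * vmx w.
Proof.
move=> z0; have zR : 0 < z%:R :> R by rewrite ltr0n.
apply/eqP; rewrite eq_le -!(ler_rat R) rmorphM /= ratr_nat; apply/andP; split.
  have [sg <-] := vmax_attained R F0 domF (fun i => Posz z * w i).
  by rewrite value_scale -pmulrn ler_pM2l //; exact: value_le_vmax.
have [sg <-] := vmax_attained R F0 domF w.
by rewrite [z%:R]pmulrn -value_scale; exact: value_le_vmax.
Qed.

Lemma ge_testP w theta : ge_test (trz zP) Den (itemz init sched target w) [seq mask U | U <- F]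
  (iota 0 n) theta = (theta%:~R <= vmx w).
Proof.
have -> : ge_test (trz zP) Den (itemz init sched target w) [seq mask U | U <- F] (iota 0 n) theta =
  gt_test (trz zP) Den (itemz init sched target
    (fun i => Posz (Kbd (state M) Den ^ (n * #|state M|)) * w i)) [seq mask U | U <- F]
  (iota 0 n) (Posz (Kbd (state M) Den ^ (n * #|state M|)) * theta + - 1).
  by rewrite /ge_test /ge_test1 size_trz kallE /scale_items /itemz -map_comp.
set K0 := (_ ^ _)%N; have K0p : (0 < K0)%N by rewrite expn_gt0 Kbd_gt0.
rewrite (gt_testP _ _ _ Den_gt0 zPE _ F0) vmax_scale // rmorphB rmorph1 rmorphM /= -pmulrn.
have K0q : 0 < K0%:R :> rat by rewrite ltr0n.
apply/idP/idP => h; last by rewrite ltrBlDr (le_lt_trans (y := K0%:R * vmx w)) ?ltrDl // ler_pM2l.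
rewrite leNgt; apply/negP => lt.
(* If the optimum is below [theta], the integer [K * vmax] is at most [K * theta - 1]. Since
   [K <= K0], the gap after scaling by [K0] is at least 1 as well. *)
have [K [Kp KK [z zE]]] := vmax_int init sched target F0 w Den_gt0 (trans_int zPE).
have Kq : 0 < K%:R :> rat by rewrite ltr0n.
have h1 : z + 1 <= Posz K * theta.
  by rewrite lezD1 -(ltr_int rat) -zE intrM -pmulrn ltr_pM2l.
have h2 : K%:R * (vmx w - theta%:~R) <= -1.
  by move: h1; rewrite -(ler_int rat) intrD intrM -zE -pmulrn; lra.
have h3 : K0%:R * (vmx w - theta%:~R) <= K%:R * (vmx w - theta%:~R).
  rewrite ler_wnM2r ?ler_nat // subr_le0 ltW //.
lra.
Qed.

Lemma value_mix w sg1 sg2 (l : R) : 0 <= l <= 1 ->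
  exists sg, val w sg = l * val w sg1 + (1 - l) * val w sg2.
Proof.
move=> l01; exists (fun k => mixture (sg1 k) (sg2 k) l01).
rewrite /value !mulr_sumr -big_split; apply: eq_bigr => i _.
rewrite /pr mixture_value; last exact: measurable_infinitely_often.
by rewrite mulrDr !(mulrCA _%:~R).
Qed.

Lemma value_opp w sg : val (fun i => -1 * w i) sg = - val w sg.
Proof. by rewrite value_scale rmorphN1 mulN1r. Qed.

Lemma exists_notapprox w (x e : rat) : (exists sigma, ratr e < `|val w sigma - ratr x|) <->
  (x + e < vmx w) \/ (- x + e < vmx (fun i => -1 * w i)).
Proof.
split=> [[sg]|[/exists_gt|/exists_gt] [sg h]].
- rewrite ltr_normr => /orP[h|h]; [left|right]; apply/exists_gt; exists sg.
    by rewrite rmorphD /= addrC -ltrBrDr.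
  by rewrite value_opp rmorphD rmorphN /=; lra.
- by exists sg; rewrite ltr_normr; move: h; rewrite rmorphD /= => h; apply/orP; left; lra.
- exists sg; rewrite ltr_normr; move: h; rewrite value_opp rmorphD rmorphN /= => h.
  by apply/orP; right; lra.
Qed.

Lemma exists_approx w (x e : rat) : 0 <= e -> (exists sigma, `|val w sigma - ratr x| <= ratr e) <->
  (x - e <= vmx w) /\ (- x - e <= vmx (fun i => -1 * w i)).
Proof.
move=> e0; have eR : 0 <= ratr e :> R by rewrite ler0q.
split=> [[sg]|[/exists_ge[sg1 h1] /exists_ge[sg2 h2]]].
  rewrite ler_norml => /andP[h1 h2]; split; apply/exists_ge; exists sg.
    by rewrite rmorphB /=; lra.
  by rewrite value_opp rmorphB rmorphN /=; lra.
move: h1 h2; rewrite value_opp !rmorphB rmorphN /= => h1 h2.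
have [g1|g1] := leP (val w sg1) (ratr x + ratr e).
  by exists sg1; rewrite ler_norml; apply/andP; split; lra.
have [g2|g2] := leP (ratr x - ratr e) (val w sg2).
  by exists sg2; rewrite ler_norml; apply/andP; split; lra.
(* The remaining case: one value lies above the interval and the other below it, so a mixture hits
   its centre exactly. *)
have d0 : 0 < val w sg1 - val w sg2 by lra.
have [|sg E] := value_mix w sg1 sg2 (l := (ratr x - val w sg2) / (val w sg1 - val w sg2)).
  apply/andP; split; first by rewrite divr_ge0 ?(ltW d0) // subr_ge0; lra.
  by rewrite ler_pdivrMr // mul1r; lra.
exists sg; rewrite E (_ : _ - _ = 0) ?normr0 //.
by field; rewrite gt_eqF.
Qed.

End Decision.

(** * Correctness of the decision procedure *)

Definition addp (p : seq bool) (W : wordlist) : wordlist := (p ++ head [::] W) :: behead W.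

Lemma words_cons (w : seq sym) : words w = head [::] (words w) :: behead (words w).
Proof. by case: w => [|[b|] w]. Qed.

Lemma words_some (b : seq bool) (w : seq sym) : words ([seq Some x | x <- b] ++ w) = addp b (words w).
Proof. by elim: b => [|x b IH]; [exact: words_cons|rewrite [LHS]/(addp [:: x] (words _)) IH]. Qed.

Definition nbits n := [seq odd (n %/ 2 ^ i) | i <- iota 0 (trunc_log 2 n).+1].

Lemma words_nat n (w : seq sym) : words (enc_nat n ++ w) = nbits n :: words w.
Proof.
rewrite /enc_nat -cats1 -catA map_comp words_some /addp /=.
by rewrite cats0.
Qed.

Lemma nbitsK n : bval (nbits n) = n.
Proof.
have : (n < 2 ^ (trunc_log 2 n).+1)%N by exact: trunc_log_ltn.
rewrite /nbits; move: (trunc_log 2 n).+1 => L; elim: L n => [|L IH] n nL.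
  by case: n nL.
rewrite [iota _ _]/= map_cons /= expn0 divn1 -[1%N]addn0 iotaDl -map_comp.
rewrite (eq_map (g := fun i => odd (n./2 %/ 2 ^ i))); last first.
  by move=> i /=; rewrite add1n expnS divnMA divn2.
by rewrite IH ?odd_double_half //; move: nL; rewrite expnS; lia.
Qed.

Arguments nbits : simpl never.
Arguments enc_rat : simpl never.
Arguments enc_nat : simpl never.

Definition frac_words (x : rat) : wordlist := [:: (x < 0) :: nbits `|numq x|; nbits `|denq x|].
Definition frac_of (x : rat) : frac := (numq x, `|denq x|%N).

Lemma words_rat x (w : seq sym) : words (enc_rat x ++ w) = frac_words x ++ words w.
Proof.
rewrite /enc_rat cat_cons -catA -[Some _ :: _]/([seq Some b | b <- [:: x < 0]] ++ _).
by rewrite words_some !words_nat.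
Qed.

Lemma fracofE (x : rat) l : fracof (frac_words x ++ l) = frac_of x.
Proof.
have -> : fracof (frac_words x ++ l) =
  (mkint (x < 0) (bval (nbits `|numq x|)), bval (nbits `|denq x|)) by [].
rewrite !nbitsK /frac_of; congr (_, _); rewrite -numq_lt0.
by rewrite /mkint; case: (numq x) => k //=; rewrite NegzE.
Qed.

Lemma words_rats (l : seq rat) (w : seq sym) : words (flatten [seq enc_rat x | x <- l] ++ w) =
  flatten [seq frac_words x | x <- l] ++ words w.
Proof. by elim: l => //= x l IH; rewrite -catA words_rat IH. Qed.

Lemma fracof_nth (l : seq rat) r i : (i < size l)%N ->
  fracof (drop (2 * i) (flatten [seq frac_words x | x <- l] ++ r)) = frac_of (nth 0 l i).
Proof.
elim: l i => // x l IH [|i] il; first by rewrite drop0 [flatten _]/= -(fracofE x (flatten [seq frac_words x | x <- l] ++ r)).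
by rewrite mulnS /= -IH.
Qed.

Lemma drop_rats (l : seq rat) r : drop (2 * size l) (flatten [seq frac_words x | x <- l] ++ r) = r.
Proof. by elim: l => [|x l IH]; rewrite ?drop0 // [size _]/= mulnS. Qed.

Lemma dprod_gt0 (l : seq rat) : (0 < dprod [seq frac_of x | x <- l])%N.
Proof.
rewrite /dprod big_map; elim: l => [|x l IH]; first by rewrite big_nil.
by rewrite big_cons muln_gt0 IH andbT /= absz_gt0 denq_neq0.
Qed.

Lemma scalelE (l : seq rat) i : (i < size l)%N ->
  (nth 0 (scalel [seq frac_of x | x <- l]) i)%:~R = (dprod [seq frac_of x | x <- l])%:R * nth 0 l i.
Proof.
move=> il; set L := [seq frac_of x | x <- l]; have sL : size L = size l by rewrite size_map.
rewrite /scalel (nth_map 0%N) ?size_iota ?sL // nth_iota // add0n /dprod.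
rewrite (big_nth (0, 0%N)) sL /index_iota subn0 (bigD1_seq i) ?iota_uniq ?mem_iota //=.
rewrite [in RHS](bigD1_seq i) ?iota_uniq ?mem_iota //= eqxx mul1n.
rewrite (eq_bigr (fun j => (nth (0, 0%N) L j).2)); last by move=> j /negbTE ->.
rewrite (nth_map 0) //= natrM intrM numqE -pmulrn.
set x := nth 0 l i; have -> : (denq x)%:~R = `|denq x|%N%:R :> rat by rewrite pmulrn absz_denq.
by ring.
Qed.

Lemma flatten_map_flatten (A B : Type) (f : A -> seq B) (L : seq (seq A)) :
  flatten [seq f x | x <- flatten L] = flatten [seq flatten [seq f x | x <- l] | l <- L].
Proof. by elim: L => //= l L IH; rewrite map_cat flatten_cat IH. Qed.

Lemma nth_flatten_const (A : Type) (d : A) k (L : seq (seq A)) i j :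
  all (fun l => size l == k) L -> (j < k)%N -> (i < size L)%N ->
  nth d (flatten L) (i * k + j) = nth d (nth [::] L i) j.
Proof.
elim: L i => //= l L IH [|i] /andP[/eqP sl sL] jk iL; rewrite nth_cat sl.
  by rewrite mul0n add0n jk.
rewrite mulSn -addnA -[X in (_ < X)%N]addn0 ltn_add2l ltn0 addKn; exact: IH.
Qed.

Lemma size_flatten_const (A : Type) k (L : seq (seq A)) :
  all (fun l => size l == k) L -> size (flatten L) = (size L * k)%N.
Proof. by elim: L => //= l L IH /andP[/eqP sl sL]; rewrite size_cat sl IH // mulSn. Qed.

Lemma uptoE n N : (n <= N)%N -> upto n (iota 0 N) = iota 0 n.
Proof. exact: (@filter_iota_ltn 0 N n). Qed.

Lemma size_enumT (T : finType) : size (enum T) = #|T|. Proof. by rewrite cardE. Qed.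

Section Items.
Variable k : nat.
Notation ritem := (rat * (nat * (nat * seq bool)))%type.
Definition enc_item (it : ritem) : seq sym :=
  enc_rat it.1 ++ enc_nat it.2.1 ++ enc_nat it.2.2.1 ++ [seq Some b | b <- it.2.2.2].

Definition cutp (l : wordlist) : wordlist := drop k (head [::] l) :: behead l.

Lemma cutp_addp p (w : seq sym) : size p = k -> cutp (addp p (words w)) = words w.
Proof. by move=> sp; rewrite /cutp /addp /= drop_size_cat // -words_cons. Qed.

Arguments enc_item : simpl never.

Lemma words_item it (w : seq sym) : words (enc_item it ++ w) = frac_words it.1 ++
  [:: nbits it.2.1, nbits it.2.2.1 & addp it.2.2.2 (words w)].
Proof. by rewrite /enc_item -!catA words_rat !words_nat words_some. Qed.

(** Each item leaves its target bits in front of the next word, so the induction runs over an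
    arbitrary pad [p] of length [k]; the pad put before the first item makes it no exception. *)
Lemma items_words (its : seq ritem) (d : ritem) p (r : seq sym) : size p = k ->
  all (fun it : ritem => size it.2.2.2 == k) its ->
  let W := addp p (words (flatten [seq enc_item it | it <- its] ++ r)) in
  (forall i, (i < size its)%N -> [/\ fracof (cutp (drop (4 * i) W)) = frac_of (nth d its i).1,
     bval (nth [::] W (4 * i + 2)) = (nth d its i).2.1,
     bval (nth [::] W (4 * i + 3)) = (nth d its i).2.2.1 &
     forall t, (t < k)%N -> nth false (nth [::] W (4 * i + 4)) t = nth false (nth d its i).2.2.2 t]) /\
  cutp (drop (4 * size its) W) = words r.
Proof.
elim: its p => [|it its IH] p sp; first by move=> _ W; split=> //; rewrite drop0 cutp_addp.
have -> : flatten [seq enc_item it | it <- it :: its] ++ r =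
  enc_item it ++ (flatten [seq enc_item it | it <- its] ++ r) by rewrite catA.
move=> /andP[/eqP sm sms]; rewrite words_item [size (_ :: _)]/=.
have [IH1 IH2] := IH _ sm sms; set W' := addp it.2.2.2 _ in IH1 IH2 *; set W := addp p _.
have WE j : drop (4 + j) W = drop j W' by [].
have nE j : nth [::] W (4 + j) = nth [::] W' j by [].
split; last by rewrite mulnS WE.
case=> [_|i il]; last first.
  case: (IH1 i il) => a1 a2 a3 a4; rewrite mulnS WE -[(4 + _ + 2)%N]addnA -[(4 + _ + 3)%N]addnA.
  by split; rewrite ?nE // => t tk; rewrite -addnA nE; exact: a4.
rewrite muln0 drop0 !add0n; split=> //; try exact: nbitsK.
  have -> : cutp W = frac_words it.1 ++ [:: nbits it.2.1, nbits it.2.2.1 & W'].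
    by rewrite /cutp /W /addp /= drop_size_cat.
  exact: fracofE.
by move=> t tk; rewrite -[4%N]addn0 nE /= nth_cat sm tk.
Qed.

End Items.

Section Instance.
Variable I : relbuechi.
Notation M := (rb_mdp I).
Notation m := (rb_m I).
Notation n := (rb_n I).
Notation S := #|state M|.
Notation A := #|action M|.

Definition tflat : seq rat := flatten [seq flatten [seq [seq trans s a t | t <- enum (state M)]
  | a <- enum (action M)] | s <- enum (state M)].

Lemma enc_mdpE : enc_mdp M = enc_nat S ++ enc_nat A ++ flatten [seq enc_rat x | x <- tflat].
Proof.
rewrite /enc_mdp; congr (_ ++ (_ ++ _)); rewrite /enc_all /tflat flatten_map_flatten -map_comp.
congr flatten; apply: eq_map => s /=; rewrite flatten_map_flatten -map_comp; congr flatten.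
by apply: eq_map => a /=; rewrite -map_comp.
Qed.

Lemma size_tflat : size tflat = (S * A * S)%N.
Proof.
rewrite (@size_flatten_const _ (A * S)); first by rewrite size_map size_enumT mulnA.
apply/allP => l /mapP[s _ ->]; rewrite (@size_flatten_const _ S).
  by rewrite size_map size_enumT.
by apply/allP => l' /mapP[a _ ->]; rewrite size_map size_enumT.
Qed.

Lemma nth_tflat (s : state M) (a : action M) (t : state M) :
  nth 0 tflat ((rk s * A + rk a) * S + rk t) = trans s a t.
Proof.
rewrite mulnDl -mulnA -addnA (@nth_flatten_const _ _ (A * S)).
- rewrite nth_rk (@nth_flatten_const _ _ S) ?rk_lt ?nth_rk //.
    by apply/allP => l' /mapP[b _ ->]; rewrite size_map size_enumT.
  by rewrite size_map size_enumT rk_lt.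
- apply/allP => l /mapP[u _ ->]; rewrite (@size_flatten_const _ S).
    by rewrite size_map size_enumT.
  by apply/allP => l' /mapP[b _ ->]; rewrite size_map size_enumT.
- by have := rk_lt a; have := rk_lt t; nia.
- by rewrite size_map size_enumT rk_lt.
Qed.

Definition enc_tail := enc_comparison (rb_cmp I) ++ enc_rat (rb_bound I).
Definition rits := [seq (rb_coef i, (rk (rb_init i), (nat_of_ord (rb_sched i), mask (rb_target i))))
  | i <- enum 'I_m].

Lemma encE : enc_relbuechi I = enc_nat S ++ enc_nat A ++ flatten [seq enc_rat x | x <- tflat] ++
  enc_nat m ++ enc_nat n ++ flatten [seq enc_item it | it <- rits] ++ enc_tail.
Proof.
rewrite /enc_relbuechi enc_mdpE -!catA; do 6!congr (_ ++ _).
rewrite /enc_all /rits -map_comp; congr flatten; apply: eq_map => i.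
rewrite /comp /enc_item; do 3![congr (_ ++ _)]; by rewrite /= /mask -map_comp.
Qed.

Let ws := words (enc_relbuechi I).
Let l := size (enc_relbuechi I).
Let N := iota 0 l.

Lemma wsE : ws = nbits S :: nbits A :: flatten [seq frac_words x | x <- tflat] ++
  nbits m :: nbits n :: words (flatten [seq enc_item it | it <- rits] ++ enc_tail).
Proof. by rewrite /ws encE !words_nat words_rats !words_nat. Qed.

Lemma size_flatten_ge (B C : Type) (f : B -> seq C) (L : seq B) :
  (forall b, 0 < size (f b))%N -> (size L <= size (flatten [seq f b | b <- L]))%N.
Proof. by move=> f0; elim: L => //= b L IH; rewrite size_cat; have := f0 b; lia. Qed.

Lemma flat_le : (S * A * S <= l)%N.
Proof.
rewrite /l encE !size_cat -size_tflat.
by have := @size_flatten_ge _ _ enc_rat tflat (fun=> isT); lia.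
Qed.

Lemma m_le : (m <= l)%N.
Proof.
rewrite /l encE !size_cat.
have := @size_flatten_ge _ _ enc_item rits (fun=> isT); rewrite size_map size_enumT card_ord; lia.
Qed.

(** The number of scheduler variables is written in binary, but each of them occurs in some item by
    [rb_schedP], so there are at most as many as items. *)
Lemma n_le : (n <= l)%N.
Proof.
apply: leq_trans m_le; rewrite -[X in (X <= _)%N]card_ord -[X in (_ <= X)%N]card_ord.
have [f fP] := choice (@rb_schedP I).
by apply: (leq_card f) => x y e; rewrite -(fP x) -(fP y) e.
Qed.

Lemma S_le : (S <= l)%N.
Proof.
apply: leq_trans flat_le; rewrite -mulnA; apply: leq_pmulr.
by rewrite muln_gt0 state_inh action_inh.
Qed.

Lemma A_le : (A <= l)%N.
Proof.
apply: leq_trans flat_le; rewrite -mulnA mulnCA; apply: leq_pmulr.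
by rewrite muln_gt0 !state_inh.
Qed.

Lemma rSE : rS ws = S. Proof. by rewrite /rS wsE; exact: nbitsK. Qed.
Lemma rAE : rA ws = A. Proof. by rewrite /rA wsE; exact: nbitsK. Qed.
Lemma rSlE : rSl ws N = iota 0 S. Proof. by rewrite /rSl rSE uptoE // S_le. Qed.
Lemma rAlE : rAl ws N = iota 0 A. Proof. by rewrite /rAl rAE uptoE // A_le. Qed.

Lemma tfracsE : tfracs ws N = [seq frac_of x | x <- tflat].
Proof.
rewrite /tfracs rSE rAE uptoE ?flat_le // -size_tflat.
apply: (@eq_from_nth _ (0, 0%N)) => [|i]; rewrite ?size_map ?size_iota // => il.
rewrite (nth_map 0%N) ?size_iota // nth_iota // add0n (nth_map 0) // wsE.
exact: fracof_nth.
Qed.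

Definition tden := dprod [seq frac_of x | x <- tflat].
Definition tz (s : state M) (a : action M) (t : state M) := nth 0 (scalel [seq frac_of x | x <- tflat]) ((rk s * A + rk a) * S + rk t).

Lemma tzE (s : state M) (a : action M) (t : state M) : (tz s a t)%:~R = tden%:R * trans s a t.
Proof.
rewrite /tz scalelE ?nth_tflat // size_tflat.
by have := rk_lt s; have := rk_lt a; have := rk_lt t; nia.
Qed.

Lemma rtrE : rtr ws N = trz tz.
Proof.
rewrite /rtr rSlE rAlE rSE rAE tfracsE /trz map_rk; apply: eq_map => s; rewrite map_rk.
by apply: eq_map => a; rewrite map_rk.
Qed.

Lemma drop_base : drop (rbase ws) ws =
  nbits m :: nbits n :: words (flatten [seq enc_item it | it <- rits] ++ enc_tail).
Proof.
rewrite /rbase rSE rAE wsE -size_tflat; exact: drop_rats.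
Qed.

Lemma rmE : rm ws = m.
Proof. by rewrite /rm -[rbase ws]addn0 -nth_drop drop_base; exact: nbitsK. Qed.
Lemma rnE : rn ws = n.
Proof. by rewrite /rn -addn1 -nth_drop drop_base; exact: nbitsK. Qed.
Lemma rmlE : rml ws N = iota 0 m. Proof. by rewrite /rml rmE uptoE // m_le. Qed.

Lemma rwordsE : rwords ws N = addp [seq false | _ <- iota 0 S]
  (words (flatten [seq enc_item it | it <- rits] ++ enc_tail)).
Proof.
by rewrite /rwords rSlE -[(rbase ws).+2]add2n -drop_drop drop_base /= drop0.
Qed.

Definition d0 : rat * (nat * (nat * seq bool)) := (0, (0%N, (0%N, [::]))).

Lemma itemsP : (forall i : 'I_m, [/\ fracof (unpad ws (drop (4 * i) (rwords ws N))) = frac_of (rb_coef i),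
     bval (nth [::] (rwords ws N) (4 * i + 2)) = rk (rb_init i),
     bval (nth [::] (rwords ws N) (4 * i + 3)) = rb_sched i &
     forall t, (t < S)%N -> nth false (nth [::] (rwords ws N) (4 * i + 4)) t =
       nth false (mask (rb_target i)) t]) /\
  rrest ws N = words enc_tail.
Proof.
have sm : all (fun it : rat * (nat * (nat * seq bool)) => size it.2.2.2 == S) rits.
  by apply/allP => it /mapP[i _ ->] /=; rewrite size_mask.
have sr : size rits = m by rewrite size_map size_enumT card_ord.
have sp : size [seq false | _ <- iota 0 S] = S by rewrite size_map size_iota.
have [H1 H2] := items_words d0 enc_tail sp sm.
rewrite /rrest /unpad rSE rmE rwordsE; split; last by move: H2; rewrite sr.
move=> i; have := H1 i; rewrite sr ltn_ord => /(_ isT).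
by rewrite (nth_map i) ?size_enumT ?card_ord ?ltn_ord // nth_ord_enum.
Qed.

Definition ceps : rat := match rb_cmp I with
  Approx e _ => e | NotApprox e _ => e | _ => 0 end.
Definition crats := [seq rb_coef i | i <- enum 'I_m] ++ [:: rb_bound I; ceps].
Definition cden := dprod [seq frac_of x | x <- crats].
Definition cz (i : nat) : int := nth 0 (scalel [seq frac_of x | x <- crats]) i.

Lemma size_crats : size crats = m.+2.
Proof. by rewrite size_cat size_map size_enumT card_ord addn2. Qed.

Lemma czE i : (i < m.+2)%N -> (cz i)%:~R = cden%:R * nth 0 crats i.
Proof. by move=> h; rewrite /cz scalelE // size_crats. Qed.

Lemma rcmpE : (rcmp ws N 0, rcmp ws N 1) = match rb_cmp I with
  Greater => (false, false) | GreaterEq => (false, true)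
  | Approx _ _ => (true, false) | NotApprox _ _ => (true, true) end.
Proof.
rewrite /rcmp; have [_ ->] := itemsP; rewrite /enc_tail.
by case: (rb_cmp I) => [||e he|e he]; rewrite /enc_comparison /=.
Qed.

Lemma tailE : rbound ws N = frac_of (rb_bound I) /\ rceps ws N = frac_of ceps.
Proof.
have [_ R] := itemsP; have C0 : rcmp ws N 0 = _ := congr1 fst rcmpE.
rewrite /rbound /rceps C0 /rtail R /enc_tail /ceps /frac_of.
case: (rb_cmp I) => [||e he|e he].
- split=> //; rewrite -[RHS](fracofE (rb_bound I) (words [::])) -words_rat cats0.
  by rewrite [in RHS]words_cons.
- split=> //; rewrite -[RHS](fracofE (rb_bound I) (words [::])) -words_rat cats0.
  by rewrite [in RHS]words_cons.
- split.
    rewrite -[RHS](fracofE (rb_bound I) (words [::])) -words_rat cats0.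
    have -> : words (enc_comparison (Approx he) ++ enc_rat (rb_bound I)) =
      addp [:: true; false] (frac_words e ++ words (enc_rat (rb_bound I))); last by [].
    by rewrite -words_rat -words_some.
  rewrite -[RHS](fracofE e (words (enc_rat (rb_bound I)))) -words_rat.
  by rewrite [in RHS]words_cons.
- split.
    rewrite -[RHS](fracofE (rb_bound I) (words [::])) -words_rat cats0.
    have -> : words (enc_comparison (NotApprox he) ++ enc_rat (rb_bound I)) =
      addp [:: true; true] (frac_words e ++ words (enc_rat (rb_bound I))); last by [].
    by rewrite -words_rat -words_some.
  rewrite -[RHS](fracofE e (words (enc_rat (rb_bound I)))) -words_rat.
  by rewrite [in RHS]words_cons.
Qed.

Lemma cfracsE : cfracs ws N = [seq frac_of x | x <- crats].
Proof.
have [H _] := itemsP.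
rewrite /cfracs; have [-> ->] := tailE.
rewrite /crats map_cat; congr (_ ++ _); rewrite rmlE -val_enum_ord -!map_comp.
by apply: eq_map => i /=; have [-> _ _ _] := H i.
Qed.

Lemma ritemsE : ritems ws N = itemz (@rb_init I) (@rb_sched I) (@rb_target I) (fun i : 'I_m => cz i).
Proof.
have [H _] := itemsP; rewrite /ritems cfracsE rmlE rSlE -[iota 0 m]val_enum_ord -map_comp /itemz.
apply: eq_map => i /=; have [_ -> -> T] := H i; congr (_, (_, (_, _))).
rewrite (maskE (C := rb_target i)) // => x; by rewrite T ?rk_lt // nth_mask.
Qed.

(** Multiplying all numbers by the positive integer [cden] changes no comparison and makes them
    integral; each of the four comparisons is then matched with its tests. *)
Theorem decideP (R : realType) c : dominating (@rb_init I) (@rb_sched I) (@rb_target I)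
    (unions (@rb_target I) c) -> (decide c (enc_relbuechi I) <-> rb_yes R I).
Proof.
move=> dom; pose w (i : 'I_m) := cz i.
have D0 : (0 < tden)%N by exact: dprod_gt0.
have F0 := unions0 (@rb_target I) c.
pose V := vmax (@rb_init I) (@rb_sched I) (@rb_target I) F0.
have gtP w' th := gt_testP (@rb_init I) (@rb_sched I) (@rb_target I) D0 tzE w' F0 th.
have geP w' th := ge_testP R D0 tzE F0 dom w' th.
have Q0 : 0 < cden%:R :> R by rewrite ltr0n; exact: dprod_gt0.
have zb : (cz m)%:~R = cden%:R * rb_bound I.
  by rewrite czE // /crats nth_cat size_map size_enumT card_ord ltnn subnn.
have ze : (cz m.+1)%:~R = cden%:R * ceps.
  by rewrite czE // /crats nth_cat size_map size_enumT card_ord ltnNge leqnSn /= subSnn.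
have valE (sg : 'I_n -> scheduler R M) : value (@rb_init I) (@rb_sched I) (@rb_target I) w sg = cden%:R *
   \sum_(i < m) ratr (rb_coef i) * fine (Pr (sg (rb_sched i)) (rb_init i)
                 (infinitely_often (rb_target i))).
  rewrite /value mulr_sumr; apply: eq_bigr => i _; rewrite mulrA; congr (_ * _).
  have im : (i < m.+2)%N by have := ltn_ord i; lia.
  rewrite -[LHS](ratr_int R) (czE im) rmorphM /= ratr_nat; congr (_ * ratr _).
  by rewrite /crats nth_cat size_map size_enumT card_ord ltn_ord (nth_map i) ?size_enumT ?card_ord // nth_ord_enum.
rewrite /decide /decide2 -/ws -/l -/N rtrE tfracsE ritemsE rnE (uptoE n_le) /rzb /rze cfracsE rmE -/(cz m) -/(cz m.+1).
have C0 : rcmp ws N 0 = _ := congr1 fst rcmpE.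
have C1 : rcmp ws N 1 = _ := congr1 snd rcmpE.
rewrite {}C0 {}C1.
rewrite /decide1 familyE -/w.
have scE : scale_items (-1) (itemz (@rb_init I) (@rb_sched I) (@rb_target I) w) =
    itemz (@rb_init I) (@rb_sched I) (@rb_target I) (fun i => -1 * w i).
  by rewrite /scale_items /itemz -map_comp.
rewrite scE /rb_yes; case E: (rb_cmp I) => [||e he|e he] /=; rewrite /ceps E in ze.
- rewrite gtP zb -(exists_gt R F0 dom) rmorphM /= ratr_nat.
  by split=> -[sg h]; exists sg; move: h; rewrite valE ltr_pM2l.
- rewrite geP zb -(exists_ge R F0 dom) rmorphM /= ratr_nat.
  by split=> -[sg h]; exists sg; move: h; rewrite valE ler_pM2l.
- have e0 : 0 <= cden%:R * e by rewrite mulr_ge0.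
  rewrite !geP !rmorphD !rmorphN /= zb ze; split=> [/andP/(exists_approx R F0 dom _ _ e0)|] [sg h].
    exists sg; move: h; rewrite valE !rmorphM /= ratr_nat -mulrBr normrM gtr0_norm //.
    by rewrite ler_pM2l.
  apply/andP/(exists_approx R F0 dom _ _ e0); exists sg; rewrite valE !rmorphM /= ratr_nat.
  by rewrite -mulrBr normrM gtr0_norm // ler_pM2l.
- rewrite !gtP !rmorphD !rmorphN /= zb ze; split=> [/orP/(exists_notapprox R F0 dom)|] [sg h].
    exists sg; move: h; rewrite valE !rmorphM /= ratr_nat -mulrBr normrM gtr0_norm //.
    by rewrite ltr_pM2l.
  apply/orP/(exists_notapprox R F0 dom); exists sg; rewrite valE !rmorphM /= ratr_nat.
  by rewrite -mulrBr normrM gtr0_norm // ltr_pM2l.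
Qed.

End Instance.

Lemma poly_time_dominating (R : realType) (c : nat) (special : relbuechi -> Prop) :
  (forall I, special I -> dominating (@rb_init I) (@rb_sched I) (@rb_target I)
     (unions (@rb_target I) c)) ->
  poly_time_solvable enc_relbuechi special (rb_yes R).
Proof.
move=> dom; have [N [a [b H]]] := P_decides (P_decide c).
exists N, a, b => I sI; exists (decide c (enc_relbuechi I)); first exact: H.
by apply: decideP; exact: dom.
Qed.

Theorem theorem6p21 (R : realType) :
  (forall c : nat,
     poly_time_solvable enc_relbuechi (at_most_targets c) (rb_yes R)) /\
  poly_time_solvable enc_relbuechi absorbing_targets (rb_yes R) /\
  poly_time_solvable enc_relbuechi same_targets (rb_yes R).
Proof.
split=> [c|]; last split.
- by apply: (@poly_time_dominating R c) => I; exact: dominating_few.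
(* Here and in the next case the avoided set is empty or a single target, so unions of at most one
   target suffice. *)
- by apply: (@poly_time_dominating R 1) => I; exact: dominating_absorbing.
- by apply: (@poly_time_dominating R 1) => I; exact: dominating_same.
Qed.
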